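(* Let $n,N\ge 1$ be fixed integers, and let $p,q,\alpha,\Omega_T,a,\mathcal{A},\nu,L,F$ be as described in the context. Assume that $u$ is a weak solution of $$u_t-\operatorname{div}\mathcal{A}(z,\nabla u)=-\operatorname{div}(|F|^{p-2}F+a(z)|F|^{q-2}F)\quad\text{in }\Omega_T .$$ Then there exists a constant $c=c(p,q,\nu,L)$ such that $$\sup_{t\in \ell_{S_1}(t_0)}\frac{1}{|B_{R_1}(x_0)|}\int_{B_{R_1}(x_0)}\frac{|u(x,t)-(u)_{Q_{R_1,S_1}(z_0)}|^2}{S_1}\,dx+\frac{1}{|Q_{R_1,S_1}(z_0)|}\iint_{Q_{R_1,S_1}(z_0)}H(z,|\nabla u|)\,dz$$ $$\le \frac{c}{|Q_{R_2,S_2}(z_0)|}\iint_{Q_{R_2,S_2}(z_0)}\left(H\left(z,\frac{|u-(u)_{Q_{R_2,S_2}(z_0)}|}{R_2-R_1}\right)+\frac{|u-(u)_{Q_{R_2,S_2}(z_0)}|^2}{S_2-S_1}+H(z,|F|)\right)dz$$ for every $Q_{R_2,S_2}(z_0)\subset\Omega_T$ with $R_2,S_2>0$, $R_1\in[R_2/2,R_2)$ and $S_1\in[S_2/2^2,S_2)$.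
   Context: Structural assumptions: $2\le p<q<\infty$, $\alpha\in(0,1]$, $q\le p+\frac{2\alpha}{n+2}$. $\Omega\subset\mathbb{R}^n$ is a bounded open set, $T>0$, $\Omega_T=\Omega\times(0,T)$. The function $a:\Omega_T\to[0,\infty)$ is bounded and there is a constant $[a]_\alpha>0$ with $|a(x,t)-a(y,t)|\le[a]_\alpha|x-y|^\alpha$ and $|a(x,t)-a(x,s)|\le[a]_\alpha|t-s|^{\alpha/2}$ for all $x,y\in\Omega$, $t,s\in(0,T)$. Write $H(z,s)=s^p+a(z)s^q$ for $s\ge0$. $\mathcal{A}:\Omega_T\times\mathbb{R}^{Nn}\to\mathbb{R}^{Nn}$ is a Carathéodory vector field with $\mathcal{A}(z,\xi)\cdot\xi\ge\nu(|\xi|^p+a(z)|\xi|^q)$ and $|\mathcal{A}(z,\xi)|\le L(|\xi|^{p-1}+a(z)|\xi|^{q-1})$ for a.e. $z\in\Omega_T$ and every $\xi\in\mathbb{R}^{Nn}$, where $0<\nu\le L<\infty$. $F:\Omega_T\to\mathbb{R}^{Nn}$ satisfies $\iint_{\Omega_T}H(z,|F|)\,dz<\infty$. Weak solution: a function $u\in C(0,T;L^2(\Omega,\mathbb{R}^N))\cap L^1(0,T;W^{1,1}(\Omega,\mathbb{R}^N))$ with $\iint_{\Omega_T}(H(z,|u|)+H(z,|\nabla u|))\,dz<\infty$ such that $$\iint_{\Omega_T}(-u\cdot\varphi_t+\mathcal{A}(z,\nabla u)\cdot\nabla\varphi)\,dz=\iint_{\Omega_T}(|F|^{p-2}F\cdot\nabla\varphi+a(z)|F|^{q-2}F\cdot\nabla\varphi)\,dz$$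 for every $\varphi\in C_0^\infty(\Omega_T,\mathbb{R}^N)$. Notation: $z=(x,t)$, $z_0=(x_0,t_0)$; $B_r(x_0)$ is the open ball; $\ell_s(t_0)=(t_0-s,t_0+s)$; $Q_{r,s}(z_0)=B_r(x_0)\times\ell_s(t_0)$; $(u)_E=\frac1{|E|}\iint_E u\,dz$. *)

(* Defs.v *)
From HB Require Import structures.
From mathcomp Require Import all_boot all_order all_algebra.
From mathcomp Require Import all_classical all_reals all_analysis.

Set Implicit Arguments.
Unset Strict Implicit.
Unset Printing Implicit Defensive.

Import Order.TTheory GRing.Theory Num.Theory.
Import numFieldNormedType.Exports.

Local Open Scope classical_set_scope.
Local Open Scope ring_scope.

(* R^n is 'rV[R]_n and R^(N x n) is 'M[R]_(N, n).  MathComp-Analysis puts the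
   sup norm on matrices: its topology is the usual one, but lengths below are
   measured with the Euclidean (Frobenius) norm [enorm]. *)

Definition edot {R : realType} {m n : nat} (A B : 'M[R]_(m, n)) : R :=
  \sum_i \sum_j A i j * B i j.

Definition enorm {R : realType} {m n : nat} (A : 'M[R]_(m, n)) : R :=
  Num.sqrt (edot A A).

Definition eball {R : realType} {n : nat} (x0 : 'rV[R]_n) (r : R) :
    set 'rV[R]_n :=
  [set x | enorm (x - x0) < r].

(* Matrices carry the sigma-algebra generated by the entries, which is the
   Borel one. *)

Fact matrix_display : measure_display.
Proof. exact: default_measure_display. Qed.

Section matrix_measurable.
Context (R : realType) (m n : nat).

Definition matrix_measurable : set (set 'M[R]_(m, n)) :=
  <<s [set X | exists i j, preimage_set_system setT
                 (fun M : 'M[R]_(m, n) => M i j) measurable X] >>.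

Let mx_measurable0 : matrix_measurable set0.
Proof. exact: sigma_algebra0. Qed.

Let mx_measurableC A : matrix_measurable A -> matrix_measurable (~` A).
Proof. exact: sigma_algebraC. Qed.

Let mx_measurable_bigcup (F : (set 'M[R]_(m, n))^nat) :
  (forall i, matrix_measurable (F i)) -> matrix_measurable (\bigcup_i (F i)).
Proof. exact: sigma_algebra_bigcup. Qed.

HB.instance Definition _ := @isMeasurable.Build matrix_display
  'M[R]_(m, n) matrix_measurable mx_measurable0 mx_measurableC
  mx_measurable_bigcup.

End matrix_measurable.

Lemma measurable_coord (R : realType) m n (i : 'I_m) (j : 'I_n) :
  measurable_fun [set: 'M[R]_(m, n)] (fun M : 'M[R]_(m, n) => M i j).
Proof.
move=> _ Y mY; apply: sub_sigma_algebra; exists i, j.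
by exists Y.
Qed.

Lemma measurable_fun_coordP d (T : measurableType d) (R : realType) m n
    (f : T -> 'M[R]_(m, n)) :
  (forall i j, measurable_fun setT (fun x => f x i j)) -> measurable_fun setT f.
Proof.
move=> mf _ Y mY; rewrite setTI.
suff : @matrix_measurable R m n `<=`
    [set Y : set 'M[R]_(m, n) | measurable (f @^-1` Y)] by apply.
apply: smallest_sub.
  split => [|A /= mA|F /= mF].
  - by rewrite /= preimage_set0.
  - by rewrite setTD preimage_setC; exact: measurableC.
  - by rewrite preimage_bigcup; exact: bigcup_measurable.
move=> X [i [j [B mB <-]]]; rewrite /= setTI.
by have := mf i j measurableT _ mB; rewrite setTI.
Qed.

(* Lebesgue measure on R^n, as the n-fold product of the one on R. *)

Section rV_lebesgue.
Context {R : realType}.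

Definition rV_cons (n : nat) (p : measurableTypeR R * 'rV[R]_n) : 'rV[R]_n.+1 :=
  row_mx (p.1 : R)%:M p.2.

Lemma rV_consE0 n (p : measurableTypeR R * 'rV[R]_n) : rV_cons p ord0 ord0 = p.1.
Proof.
have -> : ord0 = lshift n (@ord0 0) :> 'I_n.+1 by exact/val_inj.
by rewrite [LHS](row_mxEl (p.1 : R)%:M p.2) mxE eqxx mulr1n.
Qed.

Lemma rV_consES n (p : measurableTypeR R * 'rV[R]_n) (i : 'I_n) :
  rV_cons p ord0 (lift ord0 i) = p.2 ord0 i.
Proof.
have -> : lift ord0 i = rshift 1 i :> 'I_n.+1 by exact/val_inj.
by rewrite [LHS](row_mxEr (p.1 : R)%:M p.2).
Qed.

Lemma measurable_rV_cons n : measurable_fun setT (@rV_cons n).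
Proof.
apply: measurable_fun_coordP => i j; rewrite (ord1 i).
have [->|[k ->]] : j = ord0 \/ exists k, j = lift ord0 k.
  by case: (unliftP ord0 j) => [k|] ->; [right; exists k|left].
- under eq_fun do rewrite rV_consE0; exact: measurable_fst.
- under eq_fun do rewrite rV_consES.
  exact: (measurableT_comp (measurable_coord ord0 k) measurable_snd).
Qed.

Section step.
Context (n : nat) (mu : {sigma_finite_measure set 'rV[R]_n -> \bar R}).

Definition rV_lebesgueS : set 'rV[R]_n.+1 -> \bar R :=
  pushforward (lebesgue_measure \x mu)%E (@rV_cons n).


Let mpre A : measurable A -> measurable (@rV_cons n @^-1` A).
Proof.
by move=> mA; rewrite -[X in measurable X]setTI; exact: measurable_rV_cons.
Qed.

Let rV_lebesgueS0 : (rV_lebesgueS set0 = 0)%E.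
Proof. by rewrite /rV_lebesgueS /pushforward preimage_set0 measure0. Qed.

Let rV_lebesgueS_ge0 A : (0 <= rV_lebesgueS A)%E.
Proof. by rewrite /rV_lebesgueS /pushforward; apply: measure_ge0. Qed.

Let rV_lebesgueS_sigma_additive : semi_sigma_additive rV_lebesgueS.
Proof.
move=> F mF tF mUF; rewrite /rV_lebesgueS /pushforward preimage_bigcup.
apply: measure_semi_sigma_additive.
- by move=> k; exact: mpre.
- apply/trivIsetP => /= i j _ _ ij; rewrite -preimage_setI.
  by move/trivIsetP : tF => /(_ _ _ _ _ ij) ->//; rewrite preimage_set0.
- by rewrite -preimage_bigcup; exact: mpre.
Qed.

HB.instance Definition _ := isMeasure.Build _ _ _ rV_lebesgueS
  rV_lebesgueS0 rV_lebesgueS_ge0 rV_lebesgueS_sigma_additive.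

Let rV_lebesgueS_sigma_finite : sigma_finite setT rV_lebesgueS.
Proof.
have /sigma_finiteP[F [TF ndF Foo]] := sigma_finiteT (@lebesgue_measure R).
have /sigma_finiteP[G [TG ndG Goo]] := sigma_finiteT mu.
pose tl (v : 'rV[R]_n.+1) : 'rV[R]_n := \row_i v ord0 (lift ord0 i).
have tlK p : tl (@rV_cons n p) = p.2.
  by apply/rowP => i; rewrite mxE rV_consES.
have mtl : measurable_fun setT tl.
  apply: measurable_fun_coordP => i j.
  by under eq_fun do rewrite mxE; exact: measurable_coord.
pose hd (v : 'rV[R]_n.+1) : R := v ord0 ord0.
have mhd : measurable_fun setT hd by exact: measurable_coord.
exists (fun k => hd @^-1` F k `&` tl @^-1` G k).
  apply/seteqP; split => // v _ /=.
  have [i _ Fi] : (\bigcup_i F i) (hd v) by rewrite -TF.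
  have [j _ Gj] : (\bigcup_i G i) (tl v) by rewrite -TG.
  exists (maxn i j) => //; split.
  - by apply: (_ : F i `<=` F (maxn i j)) => //; exact/subsetPset/ndF/leq_maxl.
  - by apply: (_ : G j `<=` G (maxn i j)) => //; exact/subsetPset/ndG/leq_maxr.
move=> k; have [mF ?] := Foo k; have [mG ?] := Goo k; split.
  apply: measurableI; rewrite -[X in measurable X]setTI.
  - exact: mhd.
  - exact: mtl.
rewrite /rV_lebesgueS /pushforward (_ : _ @^-1` _ = F k `*` G k).
  by rewrite product_measure1E// lte_mul_pinfty// ge0_fin_numE.
by apply/seteqP; split => p; rewrite /= /hd rV_consE0 tlK.
Qed.

HB.instance Definition _ := Measure_isSigmaFinite.Build _ _ _ rV_lebesgueS
  rV_lebesgueS_sigma_finite.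

End step.

Fixpoint rV_lebesgue (n : nat) :
    {sigma_finite_measure set 'rV[R]_n -> \bar R} :=
  if n is n'.+1 then rV_lebesgueS (rV_lebesgue n') else \d_(0 : 'rV[R]_0).

Lemma rV_lebesgue_box (n : nat) (a b : 'I_n -> R) :
  (forall i, a i <= b i) ->
  (rV_lebesgue n [set x | forall i, (x ord0 i \in `]a i, b i[)%R] =
   (\prod_i (b i - a i))%:E)%E.
Proof.
elim: n a b => [|n IHn] a b ab.
  rewrite big_ord0 /= diracE mem_set//= => i; by case: i.
rewrite big_ord_recl EFinM -IHn; last by move=> i; exact: ab.
rewrite /= /rV_lebesgueS /pushforward.
have -> : @rV_cons n @^-1` [set x | forall i, x ord0 i \in `]a i, b i[] =
  (`]a ord0, b ord0[%classic : set (measurableTypeR R)) `*`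
    [set x : 'rV[R]_n | forall i : 'I_n, x ord0 i \in `]a (lift ord0 i), b (lift ord0 i)[].
  apply/seteqP; split => [[x y] /= H|[x y] /= [H1 H2] i].
    split; first by have := H ord0; rewrite rV_consE0.
    by move=> i; have := H (lift ord0 i); rewrite rV_consES.
  by case: (unliftP ord0 i) => [k|] ->; rewrite ?rV_consE0 ?rV_consES.
rewrite product_measure1E//.
- congr (_ * _)%E.
  rewrite [LHS](lebesgue_measure_itv `]a ord0, b ord0[)/= lte_fin EFinB.
  have := ab ord0; rewrite le_eqVlt => /orP[/eqP ->|->//].
  by rewrite ltxx subee.
rewrite (_ : mkset _ = \bigcap_(i in [set: 'I_n])
  ((fun x : 'rV[R]_n => x ord0 i) @^-1`
    `]a (lift ord0 i), b (lift ord0 i)[%classic)).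
  apply: fin_bigcap_measurable => // i _.
  by rewrite -[X in measurable X]setTI; apply: measurable_coord.
by apply/seteqP; split => x /= H i; [move=> _|]; exact: H.
Qed.

End rV_lebesgue.

Definition st_lebesgue {R : realType} (n : nat) :
    {measure set ('rV[R]_n * measurableTypeR R)%type -> \bar R} :=
  (rV_lebesgue n \x @lebesgue_measure R)%E.

Definition cylinder {R : realType} {n : nat}
    (x0 : 'rV[R]_n) (t0 r s : R) : set ('rV[R]_n * measurableTypeR R) :=
  eball x0 r `*` `]t0 - s, t0 + s[%classic.

Definition st_domain {R : realType} {n : nat} (Omega : set 'rV[R]_n) (T : R) :
    set ('rV[R]_n * measurableTypeR R) :=
  Omega `*` `]0, T[%classic.

(* The ambient sigma-algebras are Borel; a function is Lebesgue measurable iff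
   it agrees almost everywhere with a Borel function. *)
Definition lebesgue_measurable {R : realType} {d d'} {X : measurableType d}
    {Y : measurableType d'} (mu : {measure set X -> \bar R}) (D : set X)
    (f : X -> Y) : Prop :=
  exists2 g : X -> Y, measurable_fun D g & f = g %[ae mu in D].

Definition L1_fun {R : realType} {d} {X : measurableType d} {m k : nat}
    (mu : {measure set X -> \bar R}) (D : set X) (f : X -> 'M[R]_(m, k)) : Prop :=
  lebesgue_measurable mu D f /\
  (\int[mu]_(x in D) (enorm (f x))%:E < +oo)%E.

Definition mean {R : realType} {d} {X : measurableType d}
    (mu : {measure set X -> \bar R}) (E : set X) (f : X -> R) : \bar R :=
  ((fine (mu E))^-1%:E * \int[mu]_(x in E) (f x)%:E)%E.

Definition vmean {R : realType} {d} {X : measurableType d} {m : nat}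
    (mu : {measure set X -> \bar R}) (E : set X) (f : X -> 'rV[R]_m) : 'rV[R]_m :=
  \row_i ((fine (mu E))^-1 * \int[mu]_(x in E) f x ord0 i).

(* C^k through iterated directional derivatives; for the finite-dimensional [V]
   used here this is the usual notion. *)
Fixpoint C_k {R : realType} {V W : normedModType R} (k : nat) (f : V -> W) : Prop :=
  continuous f /\
  if k is k'.+1 then forall v, (forall x, derivable f x v) /\ C_k k' ('D_v f)
  else True.

Definition test_function {R : realType} {V W : normedModType R}
    (D : set V) (phi : V -> W) : Prop :=
  [/\ forall k, C_k k phi,
      compact (closure [set x | phi x != 0]) &
      closure [set x | phi x != 0] `<=` D].

Definition weak_gradient {R : realType} {n N : nat} (Omega : set 'rV[R]_n)
    (w : 'rV[R]_n -> 'rV[R]_N) (G : 'rV[R]_n -> 'M[R]_(N, n)) : Prop :=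
  forall psi : 'rV[R]_n -> R, test_function Omega psi ->
  forall (i : 'I_N) (j : 'I_n),
    \int[rV_lebesgue n]_(x in Omega) (w x ord0 i * 'D_(delta_mx ord0 j) psi x) =
    - \int[rV_lebesgue n]_(x in Omega) (G x i j * psi x).

Definition W11_fun {R : realType} {n N : nat} (Omega : set 'rV[R]_n)
    (w : 'rV[R]_n -> 'rV[R]_N) (G : 'rV[R]_n -> 'M[R]_(N, n)) : Prop :=
  [/\ L1_fun (rV_lebesgue n) Omega w, L1_fun (rV_lebesgue n) Omega G &
      weak_gradient Omega w G].

(* L^1(0, T; W^{1,1}(Omega, R^N)): the usual parabolic Sobolev space, with the
   Bochner space identified with jointly measurable functions whose slices lie
   in W^{1,1}.  The spatial weak gradient is only determined a.e., so it is
   carried along as a second function [Du]. *)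
Definition L1_W11_fun {R : realType} {n N : nat} (Omega : set 'rV[R]_n) (T : R)
    (u : 'rV[R]_n * R -> 'rV[R]_N) (Du : 'rV[R]_n * R -> 'M[R]_(N, n)) : Prop :=
  [/\ L1_fun (st_lebesgue n) (st_domain Omega T) u,
      L1_fun (st_lebesgue n) (st_domain Omega T) Du &
      {ae @lebesgue_measure R, forall t, t \in `]0, T[ ->
        W11_fun Omega (fun x => u (x, t)) (fun x => Du (x, t))}].

Definition L2_norm {R : realType} {n N : nat} (Omega : set 'rV[R]_n)
    (w : 'rV[R]_n -> 'rV[R]_N) : \bar R :=
  'N[rV_lebesgue n]_2%:E[(fun x => (enorm (w x))%:E) \_ Omega]%E.

(* C(0, T; L^2): continuity on the open interval only, which is implied by
   continuity on [0, T]. *)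
Definition C_L2_fun {R : realType} {n N : nat} (Omega : set 'rV[R]_n) (T : R)
    (u : 'rV[R]_n * R -> 'rV[R]_N) : Prop :=
  forall t, t \in `]0, T[ ->
    [/\ lebesgue_measurable (rV_lebesgue n) Omega (fun x => u (x, t)),
        (L2_norm Omega (fun x => u (x, t)%R) < +oo)%E &
        L2_norm Omega (fun x => u (x, s) - u (x, t)) @[s --> t] --> 0%E].

Definition dt {R : realType} {n N : nat} (phi : 'rV[R]_n * R -> 'rV[R]_N)
    (z : 'rV[R]_n * R) : 'rV[R]_N :=
  'D_((0, 1) : 'rV[R]_n * R) phi z.

Definition grad {R : realType} {n N : nat} (phi : 'rV[R]_n * R -> 'rV[R]_N)
    (z : 'rV[R]_n * R) : 'M[R]_(N, n) :=
  \matrix_(i, j) ('D_((delta_mx ord0 j, 0) : 'rV[R]_n * R) phi z) ord0 i.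

Definition Hfun {R : realType} {X : Type} (p q : R) (a : X -> R) (z : X) (s : R) : R :=
  s `^ p + a z * s `^ q.

Definition holder_coefficient {R : realType} {n : nat} (alpha : R)
    (Omega : set 'rV[R]_n) (T : R) (a : 'rV[R]_n * R -> R) : Prop :=
  [/\ forall z, st_domain Omega T z -> 0 <= a z,
      exists M : R, forall z, st_domain Omega T z -> a z <= M &
      exists2 K : R, 0 < K &
        (forall x y t, Omega x -> Omega y -> t \in `]0, T[ ->
           `|a (x, t) - a (y, t)| <= K * enorm (x - y) `^ alpha) /\
        (forall x t s, Omega x -> t \in `]0, T[ -> s \in `]0, T[ ->
           `|a (x, t) - a (x, s)| <= K * `|t - s| `^ (alpha / 2))].

Definition double_phase_field {R : realType} {n N : nat} (p q nu L : R)
    (Omega : set 'rV[R]_n) (T : R) (a : 'rV[R]_n * R -> R)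
    (A : 'rV[R]_n * R -> 'M[R]_(N, n) -> 'M[R]_(N, n)) : Prop :=
  [/\ forall xi, lebesgue_measurable (st_lebesgue n) (st_domain Omega T) (A ^~ xi),
      {ae st_lebesgue n, forall z, st_domain Omega T z -> continuous (A z)} &
      {ae st_lebesgue n, forall z, st_domain Omega T z -> forall xi,
         nu * (enorm xi `^ p + a z * enorm xi `^ q) <= edot (A z xi) xi /\
         enorm (A z xi) <=
           L * (enorm xi `^ (p - 1) + a z * enorm xi `^ (q - 1))}].

Definition double_phase_source {R : realType} {n N : nat} (p q : R)
    (Omega : set 'rV[R]_n) (T : R) (a : 'rV[R]_n * R -> R)
    (F : 'rV[R]_n * R -> 'M[R]_(N, n)) : Prop :=
  lebesgue_measurable (st_lebesgue n) (st_domain Omega T) F /\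
  (\int[st_lebesgue n]_(z in st_domain Omega T)
     (Hfun p q a z (enorm (F z)))%:E < +oo)%E.

(* [u] is a weak solution of
     u_t - div A(z, Du) = - div (|F|^(p-2) F + a |F|^(q-2) F)
   in Omega x (0, T), with spatial gradient [Du]. *)
Definition weak_solution {R : realType} {n N : nat} (p q : R)
    (Omega : set 'rV[R]_n) (T : R) (a : 'rV[R]_n * R -> R)
    (A : 'rV[R]_n * R -> 'M[R]_(N, n) -> 'M[R]_(N, n))
    (F : 'rV[R]_n * R -> 'M[R]_(N, n))
    (u : 'rV[R]_n * R -> 'rV[R]_N) (Du : 'rV[R]_n * R -> 'M[R]_(N, n)) : Prop :=
  [/\ C_L2_fun Omega T u,
      L1_W11_fun Omega T u Du,
      (\int[st_lebesgue n]_(z in st_domain Omega T)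
         (Hfun p q a z (enorm (u z)) + Hfun p q a z (enorm (Du z)))%:E < +oo)%E &
      forall phi : 'rV[R]_n * R -> 'rV[R]_N,
        test_function (st_domain Omega T) phi ->
        \int[st_lebesgue n]_(z in st_domain Omega T)
          (- edot (u z) (dt phi z) + edot (A z (Du z)) (grad phi z)) =
        \int[st_lebesgue n]_(z in st_domain Omega T)
          (edot (enorm (F z) `^ (p - 2) *: F z) (grad phi z) +
           a z * edot (enorm (F z) `^ (q - 2) *: F z) (grad phi z))].

(* Main.v *)
(* The equation is tested with phi = eta (rho_k * (eta v)), where v = u - const, eta is a
   smooth cut-off and rho_k an even smooth kernel at the parabolic scale (1/k, 1/k^2).
   Since rho_k is even, its time derivative is odd, so the term pairing eta v with
   d_t (rho_k * (eta v)) vanishes and no Steklov average is needed.  The growth conditions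
   bound the fluxes only by |.|^(p-1) + a |.|^(q-1); the passage to the limit k -> oo works
   because, a being Hoelder continuous, a(z) exceeds its values within the support of the
   kernel by at most C k^(-alpha), while |rho_k * W|^p <= C k^(n+2) for W in L^p, so that
   (n+2)(q-p) <= 2 alpha <= alpha p controls a |rho_k * W|^q by the mollification of
   |W|^p + a |W|^q.  The limit is the identity
     int |v|^2 eta d_t eta = int G : (eta^2 Du + 2 eta v (x) grad eta),
   G being the total flux, from which Young's inequality gives a Caccioppoli inequality with
   the cut-off eta = zeta(x)^m rise(t) fall(t), 2 m >= q.  Letting [fall] drop on
   (tau, tau + delta) bounds the L^2 norm of a slice u(., t) for some t in (tau, tau + delta),
   and continuity in L^2 transfers the bound to every tau. *)

From HB Require Import structures.
From mathcomp Require Import all_boot all_order all_algebra.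
From mathcomp Require Import all_classical all_reals all_analysis.
From mathcomp Require Import measurable_realfun lebesgue_integral_under.
From mathcomp Require Import ring lra.
Require Import Defs.

Set Implicit Arguments.
Unset Strict Implicit.
Unset Printing Implicit Defensive.

Import Order.TTheory GRing.Theory Num.Theory.
Import numFieldNormedType.Exports.

Local Open Scope classical_set_scope.
Local Open Scope ring_scope.

(** * Smooth functions in the sense of C_k *)

(** The functions u, Du, F and A(z, Du) are only determined up to null sets, so they are replaced by
    Borel functions that vanish off a part of full measure of the cylinder, and the analysis is
    carried out for these. Mollification acts on space and time together. Its convergence in L^1
    rests on a sigma-algebra argument: the sets whose indicator is asymptotically unchanged by the
    kernel form a sigma-algebra, and half-spaces belong to it. The products B (rho_k * W) of a flux
    and a mollification are treated by levels of the flux: on |B| <= N convergence of rho_k * W in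
    L^1 is enough, and on |B| > N the products are dominated by mollifications of one fixed
    integrable function. Every constant in the absorption depends on p, q, nu, L and the dimensions
    only, because the radii enter through R2 - R1 and S2 - S1 alone. The excess is centred at the
    mean over the small cylinder and the right-hand side at the mean over the large one; Jensen's
    inequality bounds the difference of the two means by the right-hand side. An infinite right-hand
    side is settled separately. *)

Section smooth.
Context {R : realType}.
Implicit Types V W : normedModType R.

Definition smooth {V W} (f : V -> W) := forall k, C_k k f.

Lemma C_kW V W k (f : V -> W) : C_k k.+1 f -> C_k k f.
Proof.
elim: k f => [|k IH] f [cf Hf]; first by split.
split=> // v; have [df ck] := Hf v; split => //.
exact: IH.
Qed.

Lemma C_k_continuous V W k (f : V -> W) : C_k k f -> continuous f.
Proof. by case: k => [|k] []. Qed.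

Lemma C_k_cst V W k (c : W) : C_k k (cst c : V -> W).
Proof.
elim: k c => [|k IH] c; split => //; try exact: cst_continuous.
move=> v; split=> [x|]; first exact: derivable_cst.
rewrite (_ : 'D_v _ = cst 0); first exact: IH.
by apply/funext => x; rewrite derive_cst.
Qed.

Lemma C_kD V W k (f g : V -> W) : C_k k f -> C_k k g -> C_k k (f + g).
Proof.
elim: k f g => [|k IH] f g [cf Hf] [cg Hg].
  by split=> // x; apply: continuousD; [exact: cf|exact: cg].
split; first by move=> x; apply: continuousD; [exact: cf|exact: cg].
move=> v; have [df Cf] := Hf v; have [dg Cg] := Hg v.
split; first by move=> x; exact: derivableD.
rewrite (_ : 'D_v _ = 'D_v f + 'D_v g); first exact: IH.
by apply/funext => x; rewrite deriveD.
Qed.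

Lemma C_kM V k (f g : V -> R) : C_k k f -> C_k k g -> C_k k (f * g).
Proof.
elim: k f g => [|k IH] f g Ckf Ckg.
  by split=> // x; apply: continuousM; [exact: C_k_continuous Ckf _|exact: C_k_continuous Ckg _].
have [cf Hf] := Ckf; have [cg Hg] := Ckg.
split; first by move=> x; apply: continuousM; [exact: cf|exact: cg].
move=> v; have [df Cf] := Hf v; have [dg Cg] := Hg v.
split; first by move=> x; exact: derivableM.
rewrite (_ : 'D_v _ = f * 'D_v g + g * 'D_v f); last first.
  by apply/funext => x; rewrite deriveM.
by apply: C_kD; apply: IH => //; exact: C_kW.
Qed.

Lemma is_derive_scaler V W (f : V -> R) (w : W) x v : derivable f x v ->
  is_derive x v (fun z => f z *: w) ('D_v f x *: w).
Proof.
move=> df.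
have H : (fun h : R => h^-1 *: (((fun z => f z *: w) \o shift x) (h *: v) - f x *: w)) @ 0^'
    --> 'D_v f x *: w.
  under eq_fun => h do rewrite /= -scalerBl scalerA.
  by apply: cvgZr_tmp; exact: df.
by apply: DeriveDef; [apply/cvg_ex; eexists; exact: H|exact: cvg_lim H].
Qed.

Lemma C_kZ V W k (f : V -> R) (w : W) : C_k k f -> C_k k (fun z => f z *: w).
Proof.
elim: k f => [|k IH] f [cf Hf].
  by split=> // x; apply: continuousZr_tmp; exact: cf.
split; first by move=> x; apply: continuousZr_tmp; exact: cf.
move=> v; have [df Cf] := Hf v.
split; first by move=> x; case: (is_derive_scaler w (df x)).
rewrite (_ : 'D_v _ = fun z => 'D_v f z *: w); first exact: IH.
by apply/funext => x; case: (is_derive_scaler w (df x)).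
Qed.

(** The derivative of 1/f is written as a product of 1/f, 1/f and the derivative of f, so that the
    induction on k closes through [C_kM]. *)
Lemma C_kV V k (f : V -> R) : (forall x, f x != 0) -> C_k k f ->
  C_k k (fun x => (f x)^-1).
Proof.
move=> f0; elim: k => [|k IH] Ckf.
  by split=> // x; apply: continuousV => //; exact: C_k_continuous Ckf _.
have [cf Hf] := Ckf.
split; first by move=> x; apply: continuousV => //; exact: cf.
move=> v; have [df Cf] := Hf v.
split; first by move=> x; exact: derivableV.
rewrite (_ : 'D_v _ = cst (-1) * ((fun x => (f x)^-1) * (fun x => (f x)^-1) * 'D_v f)).
  apply: C_kM; first exact: C_k_cst.
  by apply: C_kM => //; apply: C_kM; apply: IH; exact: C_kW.
apply/funext => x; rewrite deriveV//.
rewrite -[RHS]/(-1 * ((f x)^-1 * (f x)^-1 * 'D_v f x)).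
by rewrite -[LHS]/(- (f x) ^- 2 * 'D_v f x) mulN1r -expr2 exprVn mulNr.
Qed.

(** Only directional derivatives of f are available, so the chain rule is reduced to functions of
    one real variable by restricting f to the line h -> h v + x. *)
Lemma is_derive_comp1 V (s : R -> R) (f : V -> R) x v :
  derivable s (f x) 1 -> derivable f x v ->
  is_derive x v (s \o f) ('D_1 s (f x) * 'D_v f x).
Proof.
move=> ds df.
pose g := fun h : R => f (h *: v + x).
have dg : derivable g 0 1 by apply/(derivable1P f x v).
have g0 : g 0 = f x by rewrite /g scale0r add0r.
have Dg : 'D_1 g 0 = 'D_v f x.
  rewrite /derive (_ : (fun h => h^-1 *: ((g \o shift 0) (h *: 1) - g 0)) =
    (fun h => h^-1 *: ((f \o shift x) (h *: v) - f x)))//.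
  by apply/funext => h; rewrite /= /g scale0r add0r addr0 [_%:A]mulr1.
have ds' : derivable s (g 0) 1 by rewrite g0.
have [E D] : is_derive (0 : R) 1 (s \o g) ('D_1 s (g 0) * 'D_1 g 0).
  apply: is_derive_eq.
    by apply: is_derive1_comp; exact: derivableP.
  by [].
apply: DeriveDef; first by apply/derivable1P.
rewrite g0 Dg in D; rewrite -D.
rewrite /derive (_ : (fun h => h^-1 *: (((s \o g) \o shift 0) (h *: 1) - (s \o g) 0)) =
    (fun h => h^-1 *: (((s \o f) \o shift x) (h *: v) - (s \o f) x)))//.
by apply/funext => h; rewrite /= /g scale0r add0r addr0 [_%:A]mulr1.
Qed.

Lemma C_k_comp V k (s : R -> R) (f : V -> R) : C_k k s -> C_k k f -> C_k k (s \o f).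
Proof.
elim: k s => [|k IH] s Cs Cf.
  split=> // x; apply: continuous_comp; [exact: C_k_continuous Cf _|exact: C_k_continuous Cs _].
split.
  move=> x; apply: continuous_comp; [exact: C_k_continuous Cf _|exact: C_k_continuous Cs _].
move=> v; have [ds Cs'] := (Cs.2 1); have [df Cf'] := (Cf.2 v).
split; first by move=> x; case: (is_derive_comp1 (ds (f x)) (df x)).
rewrite (_ : 'D_v _ = ('D_1 s \o f) * 'D_v f).
  by apply: C_kM => //; apply: IH => //; exact: C_kW.
by apply/funext => x; case: (is_derive_comp1 (ds (f x)) (df x)).
Qed.

Lemma is_derive_linear V W (l : V -> W) x v : linear l ->
  is_derive x v l (l v).
Proof.
move=> ll.
have H : (fun h => h^-1 *: ((l \o shift x) (h *: v) - l x)) @ 0^' --> l v.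
  apply: cvg_near_cst.
  have : \forall h \near 0^', h != 0 :> R by exact: nbhs_dnbhs_neq.
  apply: filterS => h h0.
  rewrite -[LHS]/(h^-1 *: (l (h *: v + x) - l x)).
  have Hl : l (h *: v + x) = h *: l v + l x by exact: ll.
  rewrite Hl addrK scalerA mulVf//.
  by rewrite scale1r.
apply: DeriveDef; first by apply/cvg_ex; exists (l v).
exact: cvg_lim.
Qed.

Lemma C_k_linear V W k (l : V -> W) : linear l -> continuous l -> C_k k l.
Proof.
case: k => [|k] ll cl; split => // v.
split; first by move=> x; case: (is_derive_linear x v ll).
rewrite (_ : 'D_v _ = cst (l v)); first exact: C_k_cst.
by apply/funext => x; case: (is_derive_linear x v ll).
Qed.

Lemma C_k_sum V W k (I : finType) (f : I -> V -> W) :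
  (forall i, C_k k (f i)) -> C_k k (fun x => \sum_i f i x).
Proof.
move=> Hf; rewrite (_ : (fun _ => _) = \sum_i f i).
  elim/big_ind : _ => [|g h|i _]; [exact: C_k_cst|exact: C_kD|exact: Hf].
by apply/funext => x; rewrite fct_sumE.
Qed.

Lemma C_k_row V k N (f : 'I_N -> V -> R) :
  (forall i, C_k k (f i)) -> C_k k (fun z => \row_i f i z).
Proof.
move=> Hf.
rewrite (_ : (fun _ => _) = fun z => \sum_i (f i z *: delta_mx ord0 i)).
  apply: C_k_sum => i; exact: C_kZ.
apply/funext => z; rewrite [LHS]row_sum_delta.
by apply: eq_bigr => i _; rewrite mxE.
Qed.

Lemma derive_row V N (f : 'I_N -> V -> R) x v :
  (forall i, derivable (f i) x v) ->
  'D_v (fun z => \row_i f i z) x = \row_i 'D_v (f i) x.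
Proof.
move=> Hf.
rewrite (_ : (fun _ => _) = \sum_i (fun z => f i z *: delta_mx ord0 i)); last first.
  apply/funext => z; rewrite fct_sumE [LHS]row_sum_delta.
  by apply: eq_bigr => i _; rewrite mxE.
rewrite derive_sum; last by move=> i; case: (is_derive_scaler (delta_mx ord0 i : 'rV[R]_N) (Hf i)).
rewrite [RHS]row_sum_delta; apply: eq_bigr => i _; rewrite mxE.
by case: (is_derive_scaler (delta_mx ord0 i : 'rV[R]_N) (Hf i)).
Qed.

Lemma smooth_D V W (f : V -> W) v : smooth f -> smooth ('D_v f).
Proof. by move=> sf k; case: ((sf k.+1).2 v). Qed.

Lemma smooth_derivable V W (f : V -> W) x v : smooth f -> derivable f x v.
Proof. by move=> sf; case: ((sf 1%N).2 v). Qed.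

Lemma smooth_continuous V W (f : V -> W) : smooth f -> continuous f.
Proof. by move=> /(_ 0%N)[]. Qed.

Lemma smoothM V (f g : V -> R) : smooth f -> smooth g -> smooth (fun x => f x * g x).
Proof. by move=> sf sg k; exact: (@C_kM _ k f g). Qed.

Lemma smoothDf V W (f g : V -> W) : smooth f -> smooth g -> smooth (fun x => f x + g x).
Proof. by move=> sf sg k; exact: (@C_kD _ _ k f g). Qed.

Lemma smooth_cst V W (c : W) : smooth (fun _ : V => c).
Proof. by move=> k; exact: C_k_cst. Qed.

Lemma smoothX V (f : V -> R) m : smooth f -> smooth (fun x => f x ^+ m).
Proof.
move=> sf; elim: m => [|m IH]; first exact: smooth_cst.
rewrite (_ : (fun x => _) = fun x => f x * f x ^+ m); first exact: smoothM.
by apply/funext => x; rewrite exprS.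
Qed.

Lemma smooth_comp V (s : R -> R) (f : V -> R) : smooth s -> smooth f -> smooth (fun x => s (f x)).
Proof. by move=> ss sf k; exact: (@C_k_comp _ k s f). Qed.

(** By linearity of l the two difference quotients are the same function of h, hence have the same
    limit. *)
Lemma is_derive_comp_affine (U V W : normedModType R) (l : U -> V) (c : V) (f : V -> W) x v :
  linear l -> derivable f (l x + c) (l v) ->
  is_derive x v (fun x => f (l x + c)) ('D_(l v) f (l x + c)).
Proof.
move=> ll df.
have E : (fun h : R => h^-1 *: (((fun x => f (l x + c)) \o shift x) (h *: v) - f (l x + c))) =
    (fun h : R => h^-1 *: ((f \o shift (l x + c)) (h *: l v) - f (l x + c))).
  apply/funext => h /=.
  have -> : l (h *: v + x) = h *: l v + l x by exact: ll.
  by rewrite addrA.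
by apply: DeriveDef; rewrite /derivable /derive E.
Qed.

Lemma smooth_comp_affine (U V W : normedModType R) (l : U -> V) (c : V) (f : V -> W) :
  linear l -> continuous l -> smooth f -> smooth (fun x => f (l x + c)).
Proof.
move=> ll cl sf k; elim: k f sf => [|k IH] f sf.
  split=> // x; apply: (@continuous_comp _ _ _ (fun x => l x + c) f); last exact: smooth_continuous.
  by apply: continuousD; [exact: cl|exact: cst_continuous].
split.
  move=> x; apply: (@continuous_comp _ _ _ (fun x => l x + c) f); last exact: smooth_continuous.
  by apply: continuousD; [exact: cl|exact: cst_continuous].
move=> v; have H x := is_derive_comp_affine ll (@smooth_derivable _ _ f (l x + c) (l v) sf).
split; first by move=> x; case: (H x).
rewrite (_ : 'D_v _ = fun x => 'D_(l v) f (l x + c)); first by apply: (IH ('D_(l v) f)); exact: smooth_D.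
by apply/funext => x; case: (H x).
Qed.

Lemma smooth_comp_linear (U V W : normedModType R) (l : U -> V) (f : V -> W) :
  linear l -> continuous l -> smooth f -> smooth (fun x => f (l x)).
Proof.
move=> ll cl sf; have := @smooth_comp_affine U V W l 0 f ll cl sf.
by congr smooth; apply/funext => x; rewrite addr0.
Qed.

End smooth.

(** * A smooth step built from exp(-1/x) *)

Section step.
Context {R : realType}.

Lemma expR_exp_bound (i : nat) (y : R) : 0 <= y -> y ^+ i * expR (- y) <= i`!%:R.
Proof.
move=> y0; case: i => [|i].
  by rewrite mul1r expR_le1 oppr_le0.
rewrite expRN ler_pdivrMr ?expR_gt0//.
rewrite -ler_pdivrMl ?ltr0n ?fact_gt0// mulrC.
by apply: le_trans (expR_ge1Dxn i y0); rewrite lerDr.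
Qed.

(** This bound is what makes the functions [flat] vanish to first order at 0: there y stands for
    1/x. *)
Lemma poly_exp_bound (r : {poly R}) :
  exists C : R, forall y, 0 <= y -> `|r.[y]| * expR (- y) <= C.
Proof.
exists (\sum_(i < size r) `|r`_i| * i`!%:R) => y y0.
rewrite horner_coef (le_trans (ler_wpM2r (expR_ge0 _) (ler_norm_sum _ _ _)))//.
rewrite mulr_suml; apply: ler_sum => i _.
rewrite normrM -mulrA ler_wpM2l// ger0_norm ?exprn_ge0//.
exact: expR_exp_bound.
Qed.

(* This class of functions is closed under differentiation, hence consists of smooth functions. *)
Definition flat (p : {poly R}) (x : R) : R :=
  if 0 < x then p.[x^-1] * expR (- x^-1) else 0.

(** With y = 1/x one has dy/dx = - y^2, so differentiating p(y) exp(-y) in x gives y^2 (p(y) -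
    p'(y)) exp(-y), which is again of the same form. *)
Definition dflat (p : {poly R}) : {poly R} := 'X^2 * (p - p^`()).

Lemma is_derive_horner (p : {poly R}) (x : R) : is_derive x 1 (horner p) (p^`()).[x].
Proof.
elim/poly_ind : p => [|p c IH].
  rewrite deriv0 (_ : horner 0 = cst 0); last by apply/funext => y; rewrite horner0.
  exact: is_derive_cst.
rewrite (_ : horner _ = horner p * id + cst c); last first.
  by apply/funext => y; rewrite !hornerE.
have D := is_deriveD (is_deriveM IH (is_derive_id x 1)) (is_derive_cst c x 1).
apply: (@is_derive_eq _ _ _ _ _ _ _ _ D); rewrite derivMXaddC !hornerE.
by rewrite -[LHS]/(p.[x] * 1 + x * (p^`()).[x]) mulr1 [x * _]mulrC.
Qed.

Lemma flat_is_derive (p : {poly R}) (x : R) : is_derive x 1 (flat p) (flat (dflat p) x).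
Proof.
have [x0|x0|<-] := ltrgtP 0 x.
- apply: (@near_eq_is_derive R R R (fun x : R => p.[x^-1] * expR (- x^-1))).
    have : \near x, 0 < x by exact: lt_nbhsr.
    by apply: filterS => y y0; rewrite /flat y0.
  have dV : is_derive x 1 (fun y : R => y^-1) (- x ^- 2).
    have xn : (id x : R) != 0 by rewrite gt_eqF.
    have := @is_deriveV R id x 1 1 xn (is_derive_id _ _).
    by rewrite [_ *: 1]mulr1.
  have d1 := @is_derive1_comp _ (horner p) _ x _ _ (is_derive_horner p _) dV.
  have d2 := @is_derive1_comp _ expR _ x _ _ (is_derive_expR _) (is_deriveN dV).
  have d3 := is_deriveM d1 d2.
  apply: (@is_derive_eq _ _ _ _ _ _ _ _ d3).
  rewrite /flat x0 /dflat !hornerE /= opprK.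
  rewrite -[LHS]/(p.[x^-1] * (expR (- x^-1) * (x ^- 2)) +
    expR (- x^-1) * ((p^`()).[x^-1] * - (x^- 2))).
  by rewrite exprVn; ring.
- apply: (@near_eq_is_derive R R R (cst 0)).
    have : \near x, x < 0 by exact: lt_nbhsl.
    by apply: filterS => y y0; rewrite /flat ltNge (ltW y0).
  by rewrite /flat ltNge (ltW x0); exact: is_derive_cst.
- rewrite [flat _ 0]/flat ltxx.
  (* At 0 the difference quotient is p(1/h)/h times exp(-1/h). The factor X^2 rewrites it as h times
     a bounded quantity, so it tends to 0. *)
  have [C HC] := poly_exp_bound ('X^2 * p).
  have C0 : 0 <= C by have := HC 0 (lexx _); rewrite !hornerE /= expr0n/= mul0r normr0 mul0r.
  suff H : (fun h : R => h^-1 *: ((flat p \o shift 0) (h *: 1) - flat p 0)) @ 0^' --> (0 : R).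
    by apply: DeriveDef; [apply/cvg_ex; eexists; exact: H|exact: cvg_lim H].
  apply/cvgr0Pnorm_le => e e0.
  have Ce : 0 < e / (C + 1) by rewrite divr_gt0// ltr_wpDl.
  near=> h.
  have hC : `|h| <= e / (C + 1).
    near: h. apply: dnbhs0_le => //.
  rewrite /= addr0 [_%:A]mulr1 /flat ltxx subr0.
  case: ifPn => h0; last by rewrite scaler0 normr0 ltW.
  rewrite -[X in `|X|]/(h^-1 * (p.[h^-1] * expR (- h^-1))).
  have -> : h^-1 * (p.[h^-1] * expR (- h^-1)) = h * (('X^2 * p).[h^-1] * expR (- h^-1)).
    by rewrite !hornerE /=; field; rewrite gt_eqF.
  rewrite normrM normrM (ger0_norm (expR_ge0 _)).
  have H1 : `|('X^2 * p).[h^-1]| * expR (- h^-1) <= C by apply: HC; rewrite invr_ge0 ltW.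
  apply: (@le_trans _ _ (e / (C + 1) * (C + 1))).
    apply: ler_pM => //.
    by rewrite (le_trans H1)// lerDl.
  by rewrite divfK// gt_eqF// ltr_wpDl.
Unshelve. all: by end_near. Qed.

(** [C_k] asks for all directions v, also on the real line, while the one-variable calculus delivers
    the direction 1. *)
Lemma is_derive1_scale (W : normedModType R) (f : R -> W) (x v : R) df :
  is_derive x 1 f df -> is_derive x v f (v *: df).
Proof.
move=> [d <-]; have dd : differentiable f x by apply/derivable1_diffP.
apply: DeriveDef; first exact: diff_derivable.
by rewrite !deriveE// -linearZ/= [v *: 1]mulr1.
Qed.

Lemma C_k_flat k p : C_k k (flat p).
Proof.
have c q : continuous (flat q).
  by move=> x; apply: differentiable_continuous; apply/derivable1_diffP; case: (flat_is_derive q x).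
elim: k p => [|k IH] p; split => // v.
have H x := is_derive1_scale v (flat_is_derive p x).
split; first by move=> x; case: (H x).
rewrite (_ : 'D_v _ = fun x => flat (dflat p) x *: v).
  exact: C_kZ.
by apply/funext => x; case: (H x) => _ ->; rewrite -[LHS]/(_ * _) mulrC.
Qed.

(** [flat 1] is exp(-1/x) extended by 0. The denominator is positive because x and 1 - x cannot both
    be nonpositive, and the quotient climbs from 0 to 1 between the points 0 and 1. *)
Definition sstep (x : R) : R := flat 1 x / (flat 1 x + flat 1 (1 - x)).

Lemma flat1_ge0 (x : R) : 0 <= flat 1 x.
Proof. by rewrite /flat; case: ifP => // _; rewrite hornerC mul1r expR_ge0. Qed.

Lemma flat1_gt0 (x : R) : 0 < x -> 0 < flat 1 x.
Proof. by move=> x0; rewrite /flat x0 hornerC mul1r expR_gt0. Qed.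

Lemma flat1_le (x y : R) : x <= y -> flat 1 x <= flat 1 y.
Proof.
move=> xy; have [x0|x0] := ltP 0 x; last first.
  by rewrite {1}/flat ltNge x0/= flat1_ge0.
rewrite /flat x0 (lt_le_trans x0 xy) !hornerC !mul1r ler_expR lerN2.
by rewrite lef_pV2 ?posrE// (lt_le_trans x0 xy).
Qed.

Lemma sstep_den_gt0 x : 0 < flat 1 x + flat 1 (1 - x).
Proof.
have [x0|x0] := ltP 0 x.
  by rewrite ltr_pwDl ?flat1_gt0 ?flat1_ge0.
by rewrite ltr_wpDl ?flat1_ge0// flat1_gt0//; lra.
Qed.

Lemma smooth_flat p : smooth (flat p).
Proof. by move=> k; exact: C_k_flat. Qed.

Lemma smooth_id : smooth (@id R).
Proof. by move=> k; apply: C_k_linear => // x; exact: cvg_id. Qed.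

Lemma smooth_sstep : smooth sstep.
Proof.
apply: smoothM; first exact: smooth_flat.
have H : smooth (fun x => flat 1 x + flat 1 (1 - x)).
  apply: smoothDf; first exact: smooth_flat.
  apply: smooth_comp; first exact: smooth_flat.
  rewrite (_ : (fun x => _) = fun x : R => 1 + (-1) * x); last first.
    by apply/funext => x; rewrite mulN1r.
  apply: smoothDf; first exact: smooth_cst.
  apply: smoothM; [exact: smooth_cst|exact: smooth_id].
move=> k; apply: C_kV; last exact: H.
by move=> x; rewrite gt_eqF// sstep_den_gt0.
Qed.

Lemma sstep_ge0 x : 0 <= sstep x.
Proof. by rewrite divr_ge0 ?flat1_ge0// ltW// sstep_den_gt0. Qed.

Lemma sstep_le1 x : sstep x <= 1.
Proof. by rewrite ler_pdivrMr ?sstep_den_gt0// mul1r lerDl flat1_ge0. Qed.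

Lemma sstep0 x : x <= 0 -> sstep x = 0.
Proof. by move=> x0; rewrite /sstep {1}/flat ltNge x0/= mul0r. Qed.

Lemma sstep1 x : 1 <= x -> sstep x = 1.
Proof.
move=> x1; rewrite /sstep {3}/flat ifF; last by apply/negbTE; rewrite -leNgt; lra.
by rewrite addr0 divff// gt_eqF// flat1_gt0//; lra.
Qed.

Lemma sstep_le x y : x <= y -> sstep x <= sstep y.
Proof.
move=> xy; rewrite /sstep ler_pdivrMr ?sstep_den_gt0//.
rewrite mulrAC ler_pdivlMr ?sstep_den_gt0//.
have H1 := flat1_le xy.
have H2 : flat 1 (1 - y) <= flat 1 (1 - x) by apply: flat1_le; lra.
have := ler_pM (flat1_ge0 _) (flat1_ge0 _) H1 H2.
by rewrite !mulrDr [flat 1 y * flat 1 x]mulrC => ?; lra.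
Qed.

Lemma derive1_ge0 (f : R -> R) (x : R) : derivable f x 1 ->
  (forall a b, a <= b -> f a <= f b) -> 0 <= 'D_1 f x.
Proof.
move=> df ndf; apply: limr_ge; first exact: df.
near=> h; have h0 : h != 0 by near: h; exact: nbhs_dnbhs_neq.
rewrite /= [_%:A]mulr1 -[leRHS]/(h^-1 * (f (h + x) - f x)).
have [h1|h1|] := ltrgtP 0 h; last by move/eqP; rewrite eq_sym (negbTE h0).
  by rewrite mulr_ge0 ?invr_ge0 ?subr_ge0 ?(ltW h1)// ndf// lerDr ltW.
by rewrite mulr_le0 ?invr_le0 ?subr_le0 ?(ltW h1)// ndf// gerDr ltW.
Unshelve. all: by end_near. Qed.

Lemma dsstep_ge0 (x : R) : 0 <= 'D_1 sstep x.
Proof.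
apply: derive1_ge0; first exact: smooth_derivable smooth_sstep.
exact: sstep_le.
Qed.

Lemma dsstep_out (x : R) : (x < 0) || (1 < x) -> 'D_1 sstep x = 0.
Proof.
move=> x01; suff [c Hc] : exists c : R, \forall y \near x, sstep y = (cst c) y.
  by rewrite (near_eq_derive _ Hc) derive_cst.
case/orP : x01 => x01; [exists 0|exists 1].
  have : \near x, x < 0 by exact: lt_nbhsl.
  by apply: filterS => y y0; rewrite sstep0// ltW.
have : \near x, 1 < x by exact: lt_nbhsr.
by apply: filterS => y y0; rewrite sstep1// ltW.
Qed.

Lemma dsstep_bound : exists2 C : R, 0 < C & forall x, 'D_1 sstep x <= C.
Proof.
have cD : {within `[0, 1], continuous ('D_1 sstep : R -> R)}.
  have H : continuous ('D_1 sstep : R -> R).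
    apply: (@smooth_continuous R R R); exact: smooth_D smooth_sstep.
  exact: continuous_subspaceT.
have [c _ Hc] := EVT_max ler01 cD.
(* The added 1 makes the bound strictly positive. *)
exists ('D_1 sstep c + 1); first by rewrite ltr_wpDl// dsstep_ge0.
move=> x; have [x01|] := boolP (x \in `[0, 1]%R).
  by rewrite (le_trans (Hc _ x01))// lerDl.
rewrite in_itv/= negb_and -!ltNge => x01; rewrite dsstep_out//.
by rewrite addr_ge0// dsstep_ge0.
Qed.

End step.

(** * Space-time Lebesgue measure *)

Section st_measure.
Context {R : realType} {n : nat}.
Local Notation V := ('rV[R]_n * measurableTypeR R)%type.
Local Notation mu := (@st_lebesgue R n).

Definition st_box (c : 'rV[R]_n * R) (e : R) : set V :=
  [set z : V | (forall i, `|z.1 ord0 i - c.1 ord0 i| < e) /\ `|(z.2 : R) - c.2| < e].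

Lemma measurable_st_box c e : measurable (st_box c e).
Proof.
rewrite (_ : st_box c e =
  (\bigcap_(i in [set: 'I_n]) ((fun z : V => z.1 ord0 i) @^-1` ball (c.1 ord0 i) e)) `&`
  ((fun z : V => z.2) @^-1` ball c.2 e)).
  apply: measurableI.
    apply: fin_bigcap_measurable => // i _.
    rewrite -[X in measurable X]setTI; apply: (measurableT_comp (measurable_coord ord0 i) measurable_fst) => //.
    by apply: open_measurable; exact: ball_open.
  rewrite -[X in measurable X]setTI; apply: measurable_snd => //.
  by apply: open_measurable; exact: ball_open.
apply/seteqP; split => z /= [H1 H2]; split => //.
- by move=> i _; rewrite /ball /= distrC; exact: H1.
- by rewrite /ball /= distrC.
- by move=> i; have := H1 i I; rewrite /ball /= distrC.
- by move: H2; rewrite /ball /= distrC.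
Qed.

Lemma nbhs_st_box (z : 'rV[R]_n * R) (U : set ('rV[R]_n * R)) :
  nbhs z U -> exists2 e, 0 < e & st_box z e `<=` U.
Proof.
move=> /nbhs_ballP[e /= e0 He]; exists e => // y [H1 H2]; apply: He; split.
  split => // i j; rewrite (ord1 i); have := H1 j; rewrite distrC; exact.
by rewrite /ball/= distrC; exact: H2.
Qed.

(** The sigma-algebra is generated by the coordinates and the topology by the sup norm. They are
    reconciled by second countability: an open set is a countable union of boxes with rational
    centres and sides 1/(k+1). *)
Lemma open_measurable_st (U : set ('rV[R]_n * R)) : open U -> measurable (U : set V).
Proof.
move=> oU.
pose c (k : 'rV[rat]_n * rat) : 'rV[R]_n * R := (map_mx ratr k.1, ratr k.2).
pose F (k : 'rV[rat]_n * rat * nat) : set V :=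
  if `[< st_box (c k.1) k.2.+1%:R^-1 `<=` U >] then st_box (c k.1) k.2.+1%:R^-1 else set0.
suff -> : U = \bigcup_k F k.
  apply: countable_bigcupT_measurable; first exact: countableP.
  move=> k; rewrite /F; case: ifP => // _; exact: measurable_st_box.
apply/seteqP; split => [z Uz|z [k _]]; last first.
  by rewrite /F; case: ifPn => // /asboolP H /H.
have [e e0 He] := nbhs_st_box (open_nbhs_nbhs (conj oU Uz)).
have [k Hk] : exists k, k.+1%:R^-1 < e / 2.
  (* Half of e: a point of the rational box is within d of its centre, which is within d of z, and 2
     d < e. *)
  have [k _ Hk] := near_infty_natSinv_lt (PosNum (divr_gt0 e0 (ltr0n _ 2))).
  by exists k; exact: Hk (leqnn k).
pose d : R := k.+1%:R^-1.
have d0 : 0 < d by rewrite invr_gt0 ltr0n.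
have /choice[q Hq] : forall i, exists q : rat, `|z.1 ord0 i - ratr q| < d.
  move=> i; have zd : z.1 ord0 i - d < z.1 ord0 i + d by lra.
  have [q] := rat_in_itvoo zd.
  by rewrite in_itv/= => /andP[? ?]; exists q; rewrite ltr_norml; apply/andP; split; lra.
have zd : (z.2 : R) - d < z.2 + d by lra.
have [q0] := rat_in_itvoo zd.
rewrite in_itv/= => /andP[q1 q2].
exists ((\row_i q i, q0), k) => //.
rewrite /F ifT /=.
  by split => /= [i|]; [rewrite !mxE; exact: Hq|rewrite ltr_norml; apply/andP; split; rewrite -/d; lra].
apply/asboolP => y [/= H1 H2]; apply: He; split => /= [i|].
  have := H1 i; have := Hq i; rewrite !mxE => A1 A2.
  rewrite (_ : _ - _ = (y.1 ord0 i - ratr (q i)) - (z.1 ord0 i - ratr (q i))); last by ring.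
  by apply: le_lt_trans (ler_normB _ _) _; rewrite -/d in A1 A2 Hk *; lra.
rewrite (_ : _ - _ = (y.2 - ratr q0) - (z.2 - ratr q0)); last by ring.
apply: le_lt_trans (ler_normB _ _) _.
have : `|z.2 - ratr q0| < d by rewrite ltr_norml; apply/andP; split; lra.
by move=> ?; rewrite -/d in H2 Hk *; lra.
Qed.

Lemma continuous_at_measurable_st (f : 'rV[R]_n * R -> R) (D : set V) :
  open (D : set ('rV[R]_n * R)) -> (forall z, D z -> {for z, continuous f}) ->
  measurable_fun D (f : V -> R).
Proof.
move=> oD cf mD; apply: (measurability _ (RGenOpens.measurableE R)) => //.
move=> _ [_ [a [b ->]] <-]; apply: open_measurable_st.
rewrite openE => z [Dz fz]; rewrite /interior.
apply: filterI; first exact: open_nbhs_nbhs.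
by apply: cf => //; apply: open_nbhs_nbhs; split => //; exact: interval_open.
Qed.

Lemma continuous_measurable_st (f : 'rV[R]_n * R -> R) (D : set V) :
  continuous f -> measurable D -> measurable_fun D (f : V -> R).
Proof.
move=> cf mD; apply: (@measurable_funS _ _ _ _ setT) => //.
by apply: continuous_at_measurable_st; [exact: openT|move=> z _; exact: cf].
Qed.

(** Obtained from the space-time statement, as the section at time 0 of the open set of all (x, t)
    with x in U. *)
Lemma open_measurable_rV (U : set 'rV[R]_n) : open U -> measurable U.
Proof.
move=> oU.
have oV : open ((fun z : 'rV[R]_n * R => z.1) @^-1` U).
  by apply: open_comp => // z _; exact: cvg_fst.
have := measurable_ysection (0 : R) (open_measurable_st oV).
by congr measurable; apply/seteqP; split => x; rewrite /ysection /= inE.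
Qed.

Lemma continuous_measurable_rV (f : 'rV[R]_n -> R) :
  continuous f -> measurable_fun setT f.
Proof.
move=> cf mD; apply: (measurability _ (RGenOpens.measurableE R)) => //.
move=> _ [_ [a [b ->]] <-]; rewrite setTI; apply: open_measurable_rV.
by apply: open_comp => [z _|]; [exact: cf|exact: interval_open].
Qed.

Lemma measurable_shift_rV (v : 'rV[R]_n) : measurable_fun setT (fun x : 'rV[R]_n => x + v).
Proof.
apply: measurable_fun_coordP => i j; under eq_fun do rewrite mxE.
by apply: measurable_funD => //; exact: measurable_coord.
Qed.

End st_measure.

(** * Translation invariance of the measures *)

Section translation.
Context {R : realType}.

Lemma lebesgue_measure_shift (v : R) (A : set R) : measurable A ->
  lebesgue_measure ((fun x : R => x + v) @^-1` A) = lebesgue_measure A.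
Proof.
have mf : measurable_fun setT (fun x : measurableTypeR R => x + v : measurableTypeR R).
  by apply: measurable_funD.
move=> mA; apply/esym.
apply: (@lebesgue_measure_unique _ (pushforward lebesgue_measure (fun x : measurableTypeR R => x + v : measurableTypeR R))) => //= _ [[a b]] _ <-.
rewrite /pushforward.
rewrite (_ : _ @^-1` _ = `]a - v, b - v]%classic); last first.
  by apply/seteqP; split => x /=; rewrite !in_itv/= => /andP[? ?]; apply/andP; split; lra.
rewrite !lebesgue_measure_itv/= !lte_fin ltrD2r.
by case: ifP => // _; rewrite -!EFinD; congr EFin; ring.
Qed.

Lemma product_measure_preserving d1 d2 (T1 : measurableType d1) (T2 : measurableType d2)
    (m1 : {sigma_finite_measure set T1 -> \bar R})
    (m2 : {sigma_finite_measure set T2 -> \bar R}) (f : T1 -> T1) (g : T2 -> T2) :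
  measurable_fun setT f -> measurable_fun setT g ->
  (forall A, measurable A -> m1 (f @^-1` A) = m1 A) ->
  (forall A, measurable A -> m2 (g @^-1` A) = m2 A) ->
  forall X, measurable X ->
    (m1 \x m2)%E ((fun z => (f z.1, g z.2)) @^-1` X) = (m1 \x m2)%E X.
Proof.
move=> mf mg fA gA X mX.
have mfg : measurable_fun setT (fun z : T1 * T2 => (f z.1, g z.2)).
  apply/measurable_fun_pairP; split => /=.
    exact: (measurableT_comp mf measurable_fst).
  exact: (measurableT_comp mg measurable_snd).
apply/esym.
apply: (@product_measure_unique _ _ _ _ _ m1 m2 (pushforward (m1 \x m2)%E
   (fun z : T1 * T2 => (f z.1, g z.2)))) => // A B mA mB.
rewrite /pushforward -fA// -gA// -product_measure1E//.
- by rewrite -[X in measurable X]setTI; exact: mf.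
- by rewrite -[X in measurable X]setTI; exact: mg.
Qed.

(** Induction on the dimension: [rV_cons] carries a product of two translations to a translation,
    and a product of measure-preserving maps preserves the product measure. *)
Lemma rV_lebesgue_shift n (v : 'rV[R]_n) A : measurable A ->
  rV_lebesgue n ((fun x => x + v) @^-1` A) = rV_lebesgue n A.
Proof.
elim: n v A => [|n IH] v A mA.
  congr (rV_lebesgue 0 _); apply/seteqP; split => x /=.
    by rewrite (_ : x + v = x)//; apply/rowP => -[].
  by rewrite (_ : x + v = x)//; apply/rowP => -[].
pose v0 : R := v ord0 ord0.
pose v' : 'rV[R]_n := \row_i v ord0 (lift ord0 i).
rewrite /= /rV_lebesgueS /pushforward.
have mf : measurable_fun setT (fun x : measurableTypeR R => x + v0 : measurableTypeR R).
  by apply: measurable_funD.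
rewrite -[RHS](@product_measure_preserving _ _ _ _ lebesgue_measure (rV_lebesgue n)
   (fun x : measurableTypeR R => x + v0 : measurableTypeR R) (fun x => x + v')) => //.
- congr (_ _); apply/seteqP; split => -[x y] /=.
    rewrite (_ : rV_cons (x, y) + v = rV_cons (x + v0, y + v'))//.
    apply/rowP => i; rewrite mxE; case: (unliftP ord0 i) => [k|] ->.
      by rewrite !rV_consES !mxE.
    by rewrite !rV_consE0.
  rewrite (_ : rV_cons (x, y) + v = rV_cons (x + v0, y + v'))//.
  apply/rowP => i; rewrite mxE; case: (unliftP ord0 i) => [k|] ->.
    by rewrite !rV_consES !mxE.
  by rewrite !rV_consE0.
- exact: measurable_shift_rV.
- by move=> B mB; exact: lebesgue_measure_shift.
- by move=> B mB; exact: IH.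
- by rewrite -[X in measurable X]setTI; exact: measurable_rV_cons.
Qed.

Context {n : nat}.
Local Notation V := ('rV[R]_n * measurableTypeR R)%type.
Local Notation mu := (@st_lebesgue R n).

Definition st_add (w : 'rV[R]_n * R) (z : V) : V := (z.1 + w.1, (z.2 : R) + w.2).

Lemma measurable_st_add w : measurable_fun setT (st_add w).
Proof.
apply/measurable_fun_pairP; split => /=.
  exact: (measurableT_comp (measurable_shift_rV w.1) measurable_fst).
by apply: measurable_funD.
Qed.

Lemma st_lebesgue_shift (w : 'rV[R]_n * R) A : measurable A ->
  mu (st_add w @^-1` A) = mu A.
Proof.
move=> mA; apply: (@product_measure_preserving _ _ _ _ (rV_lebesgue n) lebesgue_measure
  (fun x => x + w.1) (fun x : measurableTypeR R => (x : R) + w.2 : measurableTypeR R)) => //.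
- exact: measurable_shift_rV.
- by apply: measurable_funD.
- by move=> B mB; exact: rV_lebesgue_shift.
- by move=> B mB; exact: lebesgue_measure_shift.
Qed.

Lemma ge0_integral_st_shift (w : 'rV[R]_n * R) (f : V -> \bar R) :
  measurable_fun setT f -> (forall z, 0 <= f z)%E ->
  (\int[mu]_z f (st_add w z) = \int[mu]_z f z)%E.
Proof.
move=> mf f0; have m_w := measurable_st_add w.
have -> : (\int[mu]_z f z = \int[pushforward mu (st_add w)]_z f z)%E.
  by apply: eq_measure_integral => A mA _; rewrite -(st_lebesgue_shift w).
rewrite ge0_integral_pushforward//.
Qed.

End translation.

(** * Cubes and thin strips *)

Section cubes.
Context {R : realType} {n : nat}.
Local Notation V := ('rV[R]_n * measurableTypeR R)%type.
Local Notation mu := (@st_lebesgue R n).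

Definition st_cube (a b : R) : set V :=
  [set z : V | (forall i, `|z.1 ord0 i| < a) /\ `|(z.2 : R)| < b].

Lemma rV_lebesgue_cube (a : R) : 0 <= a ->
  rV_lebesgue n [set x : 'rV[R]_n | forall i, `|x ord0 i| < a] = ((a *+ 2) ^+ n)%:E.
Proof.
move=> a0; have := @rV_lebesgue_box R n (fun _ => - a) (fun _ => a).
rewrite big_const_ord iter_mulr_1 opprK -mulr2n => <-; last by move=> i; lra.
by congr (rV_lebesgue n _); apply/seteqP; split => x /= H i; have := H i;
  rewrite in_itv/= ltr_norml.
Qed.

Lemma measurable_rV_cube (a : R) : measurable [set x : 'rV[R]_n | forall i, `|x ord0 i| < a].
Proof.
rewrite (_ : mkset _ = \bigcap_(i in [set: 'I_n])
  ((fun x : 'rV[R]_n => x ord0 i) @^-1` ball 0 a)).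
  apply: fin_bigcap_measurable => // i _.
  rewrite -[X in measurable X]setTI; apply: (measurable_coord ord0 i) => //.
  by apply: open_measurable; exact: ball_open.
by apply/seteqP; split => x /= H i => [_|]; have := H i; rewrite /ball /= sub0r normrN//; exact.
Qed.

Lemma itv_oo_norm (b : R) : `]- b, b[%classic = [set s : R | `|s| < b].
Proof. by apply/seteqP; split => s /=; rewrite in_itv/= ltr_norml. Qed.

Lemma st_cubeE a b : st_cube a b =
  [set x : 'rV[R]_n | forall i, `|x ord0 i| < a] `*` `]- b, b[%classic.
Proof. by rewrite itv_oo_norm; apply/seteqP; split => z /=. Qed.

Lemma measurable_st_cube a b : measurable (st_cube a b).
Proof.
rewrite st_cubeE; apply: measurableX; first exact: measurable_rV_cube.
exact: measurable_itv.
Qed.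

Lemma lebesgue_itv_oo (a b : R) : a <= b ->
  lebesgue_measure (`]a, b[%classic : set R) = (b - a)%:E.
Proof.
move=> ab; rewrite lebesgue_measure_itv/= lte_fin EFinB.
by move: ab; rewrite le_eqVlt => /orP[/eqP ->|->//]; rewrite ltxx subee.
Qed.

Lemma st_lebesgue_cube a b : 0 <= a -> 0 <= b ->
  mu (st_cube a b) = ((a *+ 2) ^+ n * (b *+ 2))%:E.
Proof.
move=> a0 b0; rewrite st_cubeE [LHS]product_measure1E.
- rewrite EFinM -rV_lebesgue_cube//; congr (_ * _)%E.
  by rewrite [LHS]lebesgue_itv_oo ?opprK//; lra.
- exact: measurable_rV_cube.
- exact: measurable_itv.
Qed.

Lemma st_cube_sub a b a' b' : a <= a' -> b <= b' -> st_cube a b `<=` st_cube a' b'.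
Proof.
move=> aa' bb' z [H1 H2]; split; last exact: lt_le_trans bb'.
by move=> i; exact: lt_le_trans (H1 i) aa'.
Qed.

(** The strip lies in a box whose i-th side has length 2 e and whose other sides, time included,
    have length 2 M. There are n of these others, whence the power. The linear rate in e is what
    makes half-spaces have a vanishing L^1 modulus later on. *)
Lemma st_cube_strip_space (i : 'I_n) (M c e : R) : 0 <= M -> 0 <= e ->
  (mu [set z : V | st_cube M M z /\ (`|z.1 ord0 i - c| < e)%R] <=
   (e *+ 2 * (M *+ 2) ^+ n)%R%:E)%E.
Proof.
move=> M0 e0.
pose lo j := if j == i then c - e else - M.
pose hi j := if j == i then c + e else M.
pose B := [set x : 'rV[R]_n | forall j, x ord0 j \in `]lo j, hi j[%R].
have mB : measurable B.
  rewrite (_ : B = \bigcap_(j in [set: 'I_n])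
    ((fun x : 'rV[R]_n => x ord0 j) @^-1` `]lo j, hi j[%classic)).
    apply: fin_bigcap_measurable => // j _.
    by rewrite -[X in measurable X]setTI; apply: measurable_coord.
  by apply/seteqP; split => x /= H j; [move=> _|]; exact: H.
have mu_B : mu (B `*` `]- M, M[%classic) = (e *+ 2 * (M *+ 2) ^+ n)%:E.
  rewrite [LHS]product_measure1E//.
  rewrite [X in (X * _)%E]rV_lebesgue_box; last by move=> j; rewrite /lo /hi; case: ifP => _; lra.
  rewrite [X in (_ * X)%E]lebesgue_itv_oo; last by lra.
  rewrite -EFinM; congr EFin.
  rewrite (bigD1 i)//= /lo /hi eqxx.
  rewrite (eq_bigr (fun _ => M *+ 2)); last by move=> j /negbTE ->; ring.
  rewrite (eq_bigl (mem (predC1 i))); last by move=> j; rewrite !inE.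
  rewrite prodr_const cardC1 card_ord.
  have -> : (M *+ 2) ^+ n = (M *+ 2) ^+ n.-1 * (M *+ 2).
    by rewrite -exprSr prednK//; case: (n) (i) => // -[].
  ring.
rewrite -mu_B; apply: le_measure; rewrite ?inE.
- rewrite (_ : mkset _ = st_cube M M `&` (fun z : V => z.1 ord0 i) @^-1` ball c e).
    apply: measurableI; first exact: measurable_st_cube.
    rewrite -[X in measurable X]setTI.
    apply: (measurableT_comp (measurable_coord ord0 i) measurable_fst) => //.
    by apply: open_measurable; exact: ball_open.
  by apply/seteqP; split => z /= [H1 H2]; split => //; move: H2; rewrite /ball/= distrC.
- by apply: measurableX => //; exact: measurable_itv.
- move=> z [[H1 H2] H3]; split.
    move=> j; rewrite /lo /hi in_itv/=; case: eqP => [->|_].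
      by move: H3; rewrite ltr_norml => /andP[? ?]; apply/andP; split; lra.
    by have := H1 j; rewrite ltr_norml.
  by rewrite /= in_itv/= -ltr_norml.
Qed.

Lemma st_cube_strip_time (M c e : R) : 0 <= M -> 0 <= e ->
  (mu [set z : V | st_cube M M z /\ (`|(z.2 : R) - c| < e)%R] <=
   (e *+ 2 * (M *+ 2) ^+ n)%R%:E)%E.
Proof.
move=> M0 e0.
have mu_B : mu ([set x : 'rV[R]_n | forall i, `|x ord0 i| < M] `*` `](c - e), (c + e)[%classic)
   = (e *+ 2 * (M *+ 2) ^+ n)%:E.
  rewrite [LHS]product_measure1E//; last exact: measurable_rV_cube.
  rewrite [X in (X * _)%E]rV_lebesgue_cube// [X in (_ * X)%E]lebesgue_itv_oo; last by lra.
  by rewrite -EFinM; congr EFin; ring.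
rewrite -mu_B; apply: le_measure; rewrite ?inE.
- rewrite (_ : mkset _ = st_cube M M `&` (fun z : V => z.2) @^-1` ball c e).
    apply: measurableI; first exact: measurable_st_cube.
    rewrite -[X in measurable X]setTI.
    apply: measurable_snd => //.
    by apply: open_measurable; exact: ball_open.
  by apply/seteqP; split => z /= [H1 H2]; split => //; move: H2; rewrite /ball/= distrC.
- by apply: measurableX; [exact: measurable_rV_cube|exact: measurable_itv].
- move=> z [[H1 H2] H3]; split => //=.
  by move: H3; rewrite ltr_norml in_itv/= => /andP[? ?]; apply/andP; split; lra.
Qed.

End cubes.

(** * The parabolic mollifier *)

Section euclid.
Context {R : realType}.

Lemma edot_ge0 m n (A : 'M[R]_(m, n)) : 0 <= edot A A.
Proof. by apply: sumr_ge0 => i _; apply: sumr_ge0 => j _; rewrite -expr2 sqr_ge0. Qed.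

Lemma enorm_ge0 m n (A : 'M[R]_(m, n)) : 0 <= enorm A.
Proof. exact: sqrtr_ge0. Qed.

Lemma enorm_sqr m n (A : 'M[R]_(m, n)) : enorm A ^+ 2 = edot A A.
Proof. by rewrite sqr_sqrtr// edot_ge0. Qed.

Lemma coord_sqr_le m n (A : 'M[R]_(m, n)) i j : A i j ^+ 2 <= edot A A.
Proof.
rewrite /edot (bigD1 i)//= (bigD1 j)//= -expr2 -addrA lerDl addr_ge0//.
  by apply: sumr_ge0 => l _; rewrite -expr2 sqr_ge0.
by apply: sumr_ge0 => l _; apply: sumr_ge0 => l' _; rewrite -expr2 sqr_ge0.
Qed.

Lemma coord_le_enorm m n (A : 'M[R]_(m, n)) i j : `|A i j| <= enorm A.
Proof.
by rewrite -(@ler_pXn2r _ 2)// ?nnegrE ?normr_ge0 ?enorm_ge0// real_normK ?num_real// enorm_sqr coord_sqr_le.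
Qed.

Lemma edot_rV n (x : 'rV[R]_n) : edot x x = \sum_j x ord0 j ^+ 2.
Proof. by rewrite /edot big_ord1; apply: eq_bigr => j _; rewrite expr2. Qed.

Lemma edotN m n (A : 'M[R]_(m, n)) : edot (- A) (- A) = edot A A.
Proof. by apply: eq_bigr => i _; apply: eq_bigr => j _; rewrite !mxE mulrNN. Qed.

End euclid.

Section st_smooth.
Context {R : realType} {n : nat}.
Local Notation E := ('rV[R]_n * R)%type.

Lemma smooth_fst (W : normedModType R) (f : 'rV[R]_n -> W) :
  smooth f -> smooth (fun z : E => f z.1).
Proof.
move=> sf; apply: (@smooth_comp_linear R E 'rV[R]_n W (fun z => z.1)) => //.
by move=> z; exact: cvg_fst.
Qed.

Lemma smooth_snd (W : normedModType R) (f : R -> W) :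
  smooth f -> smooth (fun z : E => f z.2).
Proof.
move=> sf; apply: (@smooth_comp_linear R E R W (fun z => z.2)) => //.
by move=> z; exact: cvg_snd.
Qed.

Lemma smooth_coord (i : 'I_n) : smooth (fun x : 'rV[R]_n => x ord0 i).
Proof.
move=> k; apply: C_k_linear; first by move=> a x y; rewrite !mxE.
exact: coord_continuous.
Qed.

Lemma smooth_sqdist (x0 : 'rV[R]_n) : smooth (fun x : 'rV[R]_n => edot (x - x0) (x - x0)).
Proof.
rewrite (_ : (fun x => _) = fun x : 'rV[R]_n => \sum_j (x ord0 j + - x0 ord0 j) ^+ 2); last first.
  by apply/funext => x; rewrite edot_rV; apply: eq_bigr => j _; rewrite !mxE.
move=> k; apply: C_k_sum => j.
apply: smoothX; apply: smoothDf; [exact: smooth_coord|exact: smooth_cst].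
Qed.

End st_smooth.

Section kernel.
Context {R : realType} {n : nat}.
Local Notation V := ('rV[R]_n * measurableTypeR R)%type.
Local Notation E := ('rV[R]_n * R)%type.
Local Notation mu := (@st_lebesgue R n).
Implicit Type k : nat.

(** The squared Euclidean length of the rescaled point (lambda x, lambda^2 t) with lambda = k+1.
    Being a polynomial in squares, it gives a bump that is smooth and even. *)
Definition kquad k (z : E) : R :=
  k.+1%:R ^+ 2 * edot z.1 z.1 + k.+1%:R ^+ 4 * z.2 ^+ 2.

(* Bump at the parabolic scale 1/(k+1): length 1/(k+1) in space, 1/(k+1)^2 in time. *)
Definition kbump k (z : E) : R := sstep (2 - kquad k z).

Lemma smooth_kbump k : smooth (kbump k).
Proof.
apply: smooth_comp; first exact: smooth_sstep.
rewrite (_ : (fun x => _) = fun z => 2 + (- 1) * kquad k z); last first.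
  by apply/funext => z; rewrite mulN1r.
apply: smoothDf; first exact: smooth_cst.
apply: smoothM; first exact: smooth_cst.
apply: smoothDf.
  apply: smoothM; first exact: smooth_cst.
  apply: (@smooth_fst R n R (fun x => edot x x)).
  by have := @smooth_sqdist R n 0; congr smooth; apply/funext => x; rewrite subr0.
apply: smoothM; first exact: smooth_cst.
by apply: (@smooth_snd R n R (fun x => x ^+ 2)); apply: smoothX; exact: smooth_id.
Qed.

Lemma kbump_ge0 k z : 0 <= kbump k z. Proof. exact: sstep_ge0. Qed.
Lemma kbump_le1 k z : kbump k z <= 1. Proof. exact: sstep_le1. Qed.

Lemma kbumpN k z : kbump k (- z) = kbump k z.
Proof. by rewrite /kbump /kquad /= edotN sqrrN. Qed.

(** The bump lives where [kquad] is below 2, so the true constant is sqrt 2; it is rounded up to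
    2. *)
Lemma kbump_supp k z : kbump k z != 0 ->
  enorm z.1 < 2 / k.+1%:R /\ `|z.2| < 2 / k.+1%:R ^+ 2.
Proof.
have k0 : 0 < k.+1%:R :> R by rewrite ltr0n.
move=> H; have H2 : kquad k z < 2.
  by rewrite ltNge; apply: contra H => H; rewrite /kbump sstep0// subr_le0.
have e0 := edot_ge0 z.1; have s0 := sqr_ge0 z.2.
have A0 : 0 <= k.+1%:R ^+ 2 * edot z.1 z.1 by rewrite mulr_ge0// exprn_ge0// ltW.
have B0 : 0 <= k.+1%:R ^+ 4 * z.2 ^+ 2 by rewrite mulr_ge0// exprn_ge0// ltW.
rewrite /kquad in H2; split.
  rewrite -(@ltr_pXn2r _ 2)// ?nnegrE ?enorm_ge0 ?divr_ge0 ?(ltW k0)//.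
  rewrite enorm_sqr expr_div_n ltr_pdivlMr ?exprn_gt0// mulrC.
  by rewrite [2 ^+ 2]expr2; lra.
rewrite -(@ltr_pXn2r _ 2)// ?nnegrE ?divr_ge0 ?exprn_ge0 ?(ltW k0)//.
rewrite real_normK ?num_real// expr_div_n ltr_pdivlMr ?exprn_gt0// -exprM mulrC.
by rewrite [2 ^+ 2]expr2; lra.
Qed.

Lemma kbump_supp_cube k z : kbump k z != 0 ->
  st_cube (2 / k.+1%:R) (2 / k.+1%:R ^+ 2) z.
Proof.
move=> /kbump_supp[H1 H2]; split => // i.
by apply: le_lt_trans H1; exact: coord_le_enorm.
Qed.

(** On this smaller cube [kquad] is at most n/(n+1)^2 + 1/4, and the first summand is at most 1/4
    because (n - 1)^2 >= 0. The cube is needed for the lower bound on the mass. *)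
Lemma kbump1 k z : st_cube (k.+1%:R^-1 / n.+1%:R) (k.+1%:R^-1 ^+ 2 / 2) z -> kbump k z = 1.
Proof.
move=> [H1 H2]; rewrite /kbump sstep1//.
suff : kquad k z <= 1 by lra.
have k0 : 0 < k.+1%:R :> R by rewrite ltr0n.
have n0 : 0 < n.+1%:R :> R by rewrite ltr0n.
have sqle (u v : R) : `|u| < v -> u ^+ 2 <= v ^+ 2.
  move=> uv; have v0 : 0 <= v by rewrite (le_trans _ (ltW uv)).
  rewrite -real_normK ?num_real//; apply: lerXn2r; rewrite ?nnegrE//.
  exact: ltW.
have He : edot z.1 z.1 <= n%:R * (k.+1%:R^-1 / n.+1%:R) ^+ 2.
  rewrite edot_rV; apply: (@le_trans _ _ (\sum_(j < n) (k.+1%:R^-1 / n.+1%:R) ^+ 2)).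
    by apply: ler_sum => j _; exact: sqle.
  by rewrite sumr_const card_ord mulr_natl.
have Hs := sqle _ _ H2.
apply: (@le_trans _ _ (k.+1%:R ^+ 2 * (n%:R * (k.+1%:R^-1 / n.+1%:R) ^+ 2) +
   k.+1%:R ^+ 4 * ((k.+1%:R^-1 ^+ 2 / 2) ^+ 2))).
  by apply: lerD; rewrite ler_wpM2l// exprn_ge0// ltW.
have -> : k.+1%:R ^+ 2 * (n%:R * (k.+1%:R^-1 / n.+1%:R) ^+ 2) +
   k.+1%:R ^+ 4 * ((k.+1%:R^-1 ^+ 2 / 2) ^+ 2) = n%:R / n.+1%:R ^+ 2 + 4^-1 :> R.
  by field; rewrite !gt_eqF.
suff H : n%:R / n.+1%:R ^+ 2 <= 4^-1 :> R.
  by apply: le_trans (lerD H (lexx _)) _; lra.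
rewrite ler_pdivrMr ?exprn_gt0// -(@ler_pM2l _ 4)// mulrA divff// mul1r.
by rewrite -natr1; have := sqr_ge0 (n%:R - 1 : R); rewrite !expr2; lra.
Qed.

Lemma measurable_kbump k : measurable_fun setT (kbump k : V -> R).
Proof. by apply: continuous_measurable_st => //; exact/smooth_continuous/smooth_kbump. Qed.

Definition kmass k : R := fine (\int[mu]_z (kbump k z)%:E)%E.

Lemma kmassE k : (\int[mu]_z (kbump k z)%:E)%E = (kmass k)%:E.
Proof.
rewrite /kmass fineK// ge0_fin_numE; last by apply: integral_ge0 => z _; rewrite lee_fin kbump_ge0.
pose C := st_cube (2 / k.+1%:R) (2 / k.+1%:R ^+ 2) : set V.
apply: (@le_lt_trans _ _ (\int[mu]_z (\1_C z)%:E)%E).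
  apply: ge0_le_integral => //.
  - by move=> z _; rewrite lee_fin kbump_ge0.
  - by apply/measurable_EFinP; exact: measurable_kbump.
  - by apply/measurable_EFinP; apply: measurable_indic; exact: measurable_st_cube.
  - move=> z _; rewrite lee_fin; have [->|H] := eqVneq (kbump k z) 0; first by [].
    by rewrite indicE mem_set ?kbump_le1//; exact: kbump_supp_cube.
rewrite integral_indic// ?setIT; last exact: measurable_st_cube.
by rewrite st_lebesgue_cube ?ltry// divr_ge0// exprn_ge0.
Qed.

(** The left side is the volume of the cube on which the bump equals 1. The exponent n+2 is the
    parabolic dimension: n for space and 2 for time. Through [rho_le] it becomes the height of the
    normalised kernel. *)
Lemma kmass_ge k : (2 / n.+1%:R) ^+ n / k.+1%:R ^+ n.+2 <= kmass k.
Proof.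
have k0 : 0 < k.+1%:R :> R by rewrite ltr0n.
have n0 : 0 < n.+1%:R :> R by rewrite ltr0n.
rewrite -lee_fin -kmassE.
pose C := st_cube (k.+1%:R^-1 / n.+1%:R) (k.+1%:R^-1 ^+ 2 / 2) : set V.
apply: (@le_trans _ _ (\int[mu]_z (\1_C z)%:E)%E).
  rewrite integral_indic// ?setIT; last exact: measurable_st_cube.
  rewrite st_lebesgue_cube ?divr_ge0 ?exprn_ge0 ?invr_ge0 ?(ltW k0)// lee_fin.
  rewrite le_eqVlt; apply/orP; left; apply/eqP.
  rewrite -(addn2 n) exprD -(mulr_natl (_ / n.+1%:R)) -(mulr_natl (_ / 2)) !exprMn !exprVn.
  by field; rewrite !expf_neq0// gt_eqF.
apply: ge0_le_integral => //.
- by apply/measurable_EFinP; apply: measurable_indic; exact: measurable_st_cube.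
- by apply/measurable_EFinP; exact: measurable_kbump.
- move=> z _; rewrite lee_fin indicE; case: (boolP (z \in C)) => [|_]; last exact: kbump_ge0.
  by rewrite inE => /kbump1 ->.
Qed.

Lemma kmass_gt0 k : 0 < kmass k.
Proof. by apply: lt_le_trans (kmass_ge k); rewrite divr_gt0 ?exprn_gt0 ?divr_gt0. Qed.

Definition rho k (z : E) : R := (kmass k)^-1 * kbump k z.

Lemma smooth_rho k : smooth (rho k).
Proof. by apply: smoothM; [exact: smooth_cst|exact: smooth_kbump]. Qed.

Lemma measurable_rho k : measurable_fun setT (rho k : V -> R).
Proof. by apply: continuous_measurable_st => //; exact/smooth_continuous/smooth_rho. Qed.

Lemma rho_ge0 k z : 0 <= rho k z.
Proof. by rewrite mulr_ge0 ?kbump_ge0// invr_ge0 ltW// kmass_gt0. Qed.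

Lemma rhoN k z : rho k (- z) = rho k z.
Proof. by rewrite /rho kbumpN. Qed.

Lemma rho_le k z : rho k z <= (n.+1%:R / 2) ^+ n * k.+1%:R ^+ n.+2.
Proof.
have k0 : 0 < k.+1%:R :> R by rewrite ltr0n.
have n0 : 0 < n.+1%:R :> R by rewrite ltr0n.
apply: (@le_trans _ _ (kmass k)^-1).
  by rewrite ler_piMr ?kbump_le1// invr_ge0 ltW// kmass_gt0.
rewrite -[leRHS]invrK lef_pV2 ?posrE ?kmass_gt0//.
apply: le_trans (kmass_ge k).
by rewrite invfM -(exprVn (n.+1%:R / 2)) invf_div.
Qed.

Lemma rho_supp k z : rho k z != 0 ->
  enorm z.1 < 2 / k.+1%:R /\ `|z.2| < 2 / k.+1%:R ^+ 2.
Proof. by rewrite mulf_eq0 negb_or => /andP[_ /kbump_supp]. Qed.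

Lemma rho_supp_cube k z : rho k z != 0 ->
  st_cube (2 / k.+1%:R) (2 / k.+1%:R ^+ 2) z.
Proof. by rewrite mulf_eq0 negb_or => /andP[_ /kbump_supp_cube]. Qed.

Lemma integral_rho k : (\int[mu]_z (rho k z)%:E = 1)%E.
Proof.
under eq_integral do rewrite EFinM.
rewrite ge0_integralZl//.
- by rewrite kmassE -EFinM mulVf// gt_eqF// kmass_gt0.
- by apply/measurable_EFinP; exact: measurable_kbump.
- by move=> z _; rewrite lee_fin kbump_ge0.
- by rewrite lee_fin invr_ge0 ltW// kmass_gt0.
Qed.

Lemma integral_rho_sub_l k (z' : E) : (\int[mu]_z (rho k ((z : E) - z')%R)%:E = 1)%E.
Proof.
rewrite -(integral_rho k) -(@ge0_integral_st_shift _ _ (- z') (fun z => (rho k z)%:E)) //.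
- by apply/measurable_EFinP; exact: measurable_rho.
- by move=> z; rewrite lee_fin rho_ge0.
Qed.

Lemma integral_rho_sub_r k (z : E) : (\int[mu]_z' (rho k (z - (z' : E))%R)%:E = 1)%E.
Proof.
rewrite -(integral_rho_sub_l k z); apply: eq_integral => z' _.
by rewrite -rhoN opprB.
Qed.

End kernel.

Section ge0_real_integral.
Context d (T : measurableType d) (R : realType) (mu : {measure set T -> \bar R}).
Local Open Scope ereal_scope.

Lemma ge0_le_integralR (D : set T) (f g : T -> R) : measurable D ->
  measurable_fun D f -> measurable_fun D g -> (forall x, D x -> 0 <= f x <= g x)%R ->
  \int[mu]_(x in D) (f x)%:E <= \int[mu]_(x in D) (g x)%:E.
Proof.
move=> mD mf mg fg; apply: ge0_le_integral => //.
- by move=> x /fg /andP[? ?]; rewrite lee_fin.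
- by apply/measurable_EFinP.
- by apply/measurable_EFinP.
- by move=> x /fg /andP[? ?]; rewrite lee_fin.
Qed.

Lemma ge0_integralDR (D : set T) (f g : T -> R) : measurable D ->
  measurable_fun D f -> measurable_fun D g ->
  (forall x, D x -> 0 <= f x)%R -> (forall x, D x -> 0 <= g x)%R ->
  \int[mu]_(x in D) (f x + g x)%R%:E = \int[mu]_(x in D) (f x)%:E + \int[mu]_(x in D) (g x)%:E.
Proof.
move=> mD mf mg f0 g0; under eq_integral do rewrite EFinD.
apply: ge0_integralD => //; try (by apply/measurable_EFinP);
  by move=> x Dx; rewrite lee_fin ?f0 ?g0.
Qed.

Lemma ge0_integralZlR (D : set T) (f : T -> R) (c : R) : measurable D ->
  measurable_fun D f -> (forall x, D x -> 0 <= f x)%R -> (0 <= c)%R ->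
  \int[mu]_(x in D) (c * f x)%R%:E = c%:E * \int[mu]_(x in D) (f x)%:E.
Proof.
move=> mD mf f0 c0; under eq_integral do rewrite EFinM.
by apply: ge0_integralZl => //; apply/measurable_EFinP.
Qed.

Lemma integrableR (D : set T) (f g : T -> R) : measurable D -> measurable_fun D f ->
  measurable_fun D g -> (forall x, D x -> `|f x| <= g x)%R ->
  (\int[mu]_(x in D) (g x)%:E < +oo) -> mu.-integrable D (EFin \o f).
Proof.
move=> mD mf mg fg ig; apply/integrableP; split; first exact/measurable_EFinP.
apply: le_lt_trans ig; apply: ge0_le_integralR => //.
  by apply: measurableT_comp.
by move=> x /fg ->; rewrite normr_ge0.
Qed.

End ge0_real_integral.

(** * The L^1 modulus of continuity at the scale of the kernel *)

Section vanish.
Context {R : realType}.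

(** It is applied to nonnegative sequences, for which it is convergence to 0. Initial terms may be
    infinite, and domination, sums and multiples are immediate in this form. *)
Definition vanishes (u : nat -> \bar R) :=
  forall e : R, 0 < e -> exists N, forall k, (N <= k)%N -> (u k <= e%:E)%E.

Lemma vanishes_le u v : (forall k, (u k <= v k)%E) -> vanishes v -> vanishes u.
Proof. by move=> uv hv e /hv[N HN]; exists N => k /HN; exact: le_trans. Qed.

Lemma vanishes0 : vanishes (fun=> 0%E).
Proof. by move=> e e0; exists 0%N => k _; rewrite lee_fin ltW. Qed.

Lemma vanishesD u v : vanishes u -> vanishes v -> vanishes (fun k => u k + v k)%E.
Proof.
move=> hu hv e e0; have e2 : 0 < e / 2 by rewrite divr_gt0.
have [N HN] := hu _ e2; have [M HM] := hv _ e2.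
exists (maxn N M) => k; rewrite geq_max => /andP[/HN Hu /HM Hv].
by rewrite [e]splitr EFinD; exact: leeD.
Qed.

Lemma vanishesZ u (c : R) : 0 <= c -> vanishes u -> vanishes (fun k => c%:E * u k)%E.
Proof.
move=> c0 hu e e0; have ec : 0 < e / (c + 1) by rewrite divr_gt0// ltr_wpDl.
have [N HN] := hu _ ec; exists N => k /HN H.
apply: le_trans (lee_wpmul2l _ H) _; first by rewrite lee_fin.
rewrite -EFinM lee_fin mulrA ler_pdivrMr ?ltr_wpDl//.
by rewrite mulrC ler_wpM2l ?(ltW e0)// lerDl.
Qed.

Lemma vanishes_invn (c : R) : vanishes (fun k => (c / k.+1%:R)%:E).
Proof.
move=> e e0; have [N HN] : exists N : nat, `|c| / e <= N%:R.
  by exists (Num.bound (`|c| / e)); rewrite ltW// archi_boundP// divr_ge0// ltW.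
exists N => k Nk; rewrite lee_fin ler_pdivrMr// mulrC -ler_pdivrMr//.
apply: le_trans (ler_norm _) _; rewrite normrM normfV (gtr0_norm e0).
by apply: le_trans HN _; rewrite ler_nat ltnW.
Qed.

End vanish.

Section L1_modulus.
Context {R : realType} {n : nat}.
Local Notation V := ('rV[R]_n * measurableTypeR R)%type.
Local Notation E := ('rV[R]_n * R)%type.

(* [st_lebesgue], retyped so that its sigma-finiteness, which Fubini needs, can be declared. *)
Definition stm : set V -> \bar R := (rV_lebesgue n \x @lebesgue_measure R)%E.

HB.instance Definition _ := Measure.on stm.

Let stm_sigma_finite : sigma_finite setT stm.
Proof.
exists (fun k : nat => st_cube k%:R k%:R).
  apply/seteqP; split => // z _.
  have [N HN] : exists N : nat, (\sum_i `|z.1 ord0 i|) + `|z.2 : R| < N%:R.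
    by exists (Num.bound ((\sum_i `|z.1 ord0 i|) + `|z.2 : R|)); rewrite archi_boundP// addr_ge0// sumr_ge0.
  exists N => //; split.
    move=> i; apply: le_lt_trans HN; rewrite (bigD1 i)//= -addrA lerDl; apply: addr_ge0 => //; exact: sumr_ge0.
  by apply: le_lt_trans HN; rewrite lerDr sumr_ge0.
move=> k; split; first exact: measurable_st_cube.
by rewrite [X in (X < _)%E]st_lebesgue_cube// ltry.
Qed.

HB.instance Definition _ := Measure_isSigmaFinite.Build _ _ _ stm stm_sigma_finite.

Local Notation mu := (@st_lebesgue R n).
Local Notation mu2 := (stm \x stm)%E.
Implicit Types (K : set V) (W : V -> R) (k : nat) (c : R).

Definition st_sub (y : V * V) : V := ((y.1 : E) - (y.2 : E)).

Lemma measurable_st_sub : measurable_fun setT st_sub.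
Proof.
apply/measurable_fun_pairP; split => /=.
  apply: measurable_fun_coordP => i j; under eq_fun do rewrite !mxE.
  apply: measurable_funB.
    by apply: (measurableT_comp (measurable_coord i j)); exact: (measurableT_comp measurable_fst measurable_fst).
  by apply: (measurableT_comp (measurable_coord i j)); exact: (measurableT_comp measurable_fst measurable_snd).
apply: (@measurable_funB _ _ R).
  exact: (measurableT_comp measurable_snd measurable_fst).
exact: (measurableT_comp measurable_snd measurable_snd).
Qed.

Lemma measurable_rho2 k : measurable_fun setT (fun y : V * V => rho k (st_sub y)).
Proof. exact: (measurableT_comp (measurable_rho k) measurable_st_sub). Qed.

(** For each fixed first point the kernel has mass one in the second variable, which is integrated
    out. *)
Lemma tonelli_rho_l k (f : V -> R) : measurable_fun setT f -> (forall z, 0 <= f z) ->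
  (\int[mu2]_y (rho k (st_sub y) * f y.1)%:E = \int[mu]_z (f z)%:E)%E.
Proof.
move=> mf f0; rewrite fubini_tonelli1.
- rewrite /fubini_F; apply: eq_integral => z _ /=.
  under eq_integral do rewrite EFinM muleC.
  rewrite ge0_integralZl ?lee_fin//.
  + by rewrite [X in (_ * X)%E](integral_rho_sub_r k z) mule1.
  + apply/measurable_EFinP.
    exact: (measurableT_comp (measurable_rho2 k) (measurable_pair1 z)).
  + by move=> z' _; rewrite lee_fin rho_ge0.
- apply/measurable_EFinP; apply: measurable_funM; first exact: measurable_rho2.
  exact: (measurableT_comp mf measurable_fst).
- by move=> y; rewrite lee_fin mulr_ge0// rho_ge0.
Qed.

Lemma tonelli_rho_r k (f : V -> R) : measurable_fun setT f -> (forall z, 0 <= f z) ->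
  (\int[mu2]_y (rho k (st_sub y) * f y.2)%:E = \int[mu]_z (f z)%:E)%E.
Proof.
move=> mf f0; rewrite fubini_tonelli2.
- rewrite /fubini_G; apply: eq_integral => z _ /=.
  under eq_integral do rewrite EFinM muleC.
  rewrite ge0_integralZl ?lee_fin//.
  + by rewrite [X in (_ * X)%E](integral_rho_sub_l k z) mule1.
  + apply/measurable_EFinP.
    exact: (measurableT_comp (measurable_rho2 k) (measurable_pair2 z)).
  + by move=> z' _; rewrite lee_fin rho_ge0.
- apply/measurable_EFinP; apply: measurable_funM; first exact: measurable_rho2.
  exact: (measurableT_comp mf measurable_snd).
- by move=> y; rewrite lee_fin mulr_ge0// rho_ge0.
Qed.

(* The L^1 modulus of continuity of W at the scale of rho k. *)
Definition L1mod (K : set V) (W : V -> R) k : \bar R :=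
  (\int[mu2]_y (\1_K y.1 * (rho k (st_sub y) * `|W y.1 - W y.2|))%:E)%E.

Lemma measurable_L1mod K W k : measurable K -> measurable_fun setT W ->
  measurable_fun setT (fun y : V * V => \1_K y.1 * (rho k (st_sub y) * `|W y.1 - W y.2|)).
Proof.
move=> mK mW; apply: measurable_funM.
  by apply: (measurableT_comp _ measurable_fst); exact: measurable_indic.
apply: measurable_funM; first exact: measurable_rho2.
apply: measurableT_comp => //; apply: measurable_funB.
  exact: (measurableT_comp mW measurable_fst).
exact: (measurableT_comp mW measurable_snd).
Qed.

Lemma L1mod_integrand_ge0 K (W : V -> R) k y :
  0 <= \1_K y.1 * (rho k (st_sub y) * `|W y.1 - W y.2|).
Proof. by do 2?apply: mulr_ge0 => //; exact: rho_ge0. Qed.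

Lemma L1mod_leD K W W1 W2 k : measurable K -> measurable_fun setT W ->
  measurable_fun setT W1 -> measurable_fun setT W2 ->
  (forall z z', `|W z - W z'| <= `|W1 z - W1 z'| + `|W2 z - W2 z'|) ->
  (L1mod K W k <= L1mod K W1 k + L1mod K W2 k)%E.
Proof.
move=> mK mW mW1 mW2 HW; rewrite /L1mod -ge0_integralDR//;
  try by [exact: measurable_L1mod|move=> *; exact: L1mod_integrand_ge0].
apply: ge0_le_integralR => //; first exact: measurable_L1mod.
  by apply: measurable_funD; exact: measurable_L1mod.
move=> y _; rewrite L1mod_integrand_ge0 /= -!mulrDr.
by rewrite ler_wpM2l ?indicE// ler_wpM2l ?rho_ge0.
Qed.

Lemma eq_L1mod K W W1 k : (forall z z', `|W z - W z'| = `|W1 z - W1 z'|) ->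
  L1mod K W k = L1mod K W1 k.
Proof. by move=> HW; apply: eq_integral => y _; rewrite HW. Qed.

Lemma L1modZ K W c k : measurable K -> measurable_fun setT W ->
  L1mod K (fun z => c * W z) k = (`|c|%:E * L1mod K W k)%E.
Proof.
move=> mK mW; rewrite /L1mod -ge0_integralZlR//.
- by apply: eq_integral => y _; rewrite -mulrBr normrM; congr EFin; ring.
- exact: measurable_L1mod.
- by move=> *; exact: L1mod_integrand_ge0.
Qed.

(** The bound is uniform in k: replacing a function by one that is close in L^1 changes its modulus
    little at all scales at once. K' has to contain K and everything that the kernel reaches from
    K. *)
Lemma L1mod_bound K K' W k : measurable K -> measurable K' -> measurable_fun setT W ->
  K `<=` K' -> (forall z z', K z -> rho k ((z : E) - (z' : E)) != 0 -> K' z') ->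
  (L1mod K W k <= 2%:E * \int[mu]_z (\1_K' z * `|W z|)%:E)%E.
Proof.
move=> mK mK' mW KK' Hrho.
have mF : measurable_fun setT (fun z : V => \1_K' z * `|W z|).
  by apply: measurable_funM; [exact: measurable_indic|exact: measurableT_comp].
have F0 z : 0 <= \1_K' z * `|W z| by rewrite mulr_ge0// indicE.
have -> : (2%:E * \int[mu]_z (\1_K' z * `|W z|)%:E =
   \int[mu2]_y (rho k (st_sub y) * (\1_K' y.1 * `|W y.1|) +
      rho k (st_sub y) * (\1_K' y.2 * `|W y.2|))%:E)%E.
  rewrite ge0_integralDR//.
  - rewrite (tonelli_rho_l k mF F0) (tonelli_rho_r k mF F0).
    by rewrite -[2]/(1 + 1) EFinD ge0_muleDl// mul1e.
  - apply: measurable_funM; first exact: measurable_rho2.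
    exact: (measurableT_comp mF measurable_fst).
  - apply: measurable_funM; first exact: measurable_rho2.
    exact: (measurableT_comp mF measurable_snd).
  - by move=> y _; rewrite mulr_ge0// rho_ge0.
  - by move=> y _; rewrite mulr_ge0// rho_ge0.
apply: ge0_le_integralR => //.
- exact: measurable_L1mod.
- apply: measurable_funD; apply: measurable_funM; try exact: measurable_rho2.
    exact: (measurableT_comp mF measurable_fst).
  exact: (measurableT_comp mF measurable_snd).
- move=> y _; rewrite L1mod_integrand_ge0 /= -mulrDr mulrCA.
  have [r0|r0] := eqVneq (rho k (st_sub y)) 0; first by rewrite r0 !mul0r.
  rewrite ler_wpM2l ?rho_ge0// !indicE.
  have [/set_mem Ky|_] := boolP (y.1 \in K); last by rewrite mul0r addr_ge0// mulr_ge0.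
  rewrite !mem_set; [|exact: Hrho r0|exact: KK'].
  by rewrite !mul1r ler_normB.
Qed.

Lemma st_cube_rho k M z z' : st_cube M M z -> rho k ((z : E) - (z' : E)) != 0 ->
  st_cube (M + 2) (M + 2) z'.
Proof.
move=> [H1 H2] /rho_supp_cube[H3 H4].
have le2 : 2 / k.+1%:R <= 2 :> R by rewrite ler_pdivrMr// ler_peMr// ler1n.
have le2' : 2 / k.+1%:R ^+ 2 <= 2 :> R.
  by rewrite ler_pdivrMr ?exprn_gt0// ler_peMr// exprn_ege1// ler1n.
split => [i|].
  have := H3 i; rewrite /= !mxE => H.
  rewrite (_ : z'.1 ord0 i = z.1 ord0 i - (z.1 ord0 i - z'.1 ord0 i)); last by ring.
  by rewrite (le_lt_trans (ler_normB _ _))// ltrD// (lt_le_trans H).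
rewrite (_ : z'.2 = (z.2 : R) - ((z.2 : R) - z'.2)); last by ring.
by rewrite (le_lt_trans (ler_normB _ _))// ltrD// (lt_le_trans H4).
Qed.

Lemma L1mod_cube_bound M W k : measurable_fun setT W ->
  (L1mod (st_cube M M) W k <=
   2%:E * \int[mu]_z (\1_(st_cube (M + 2) (M + 2)) z * `|W z|)%:E)%E.
Proof.
move=> mW; apply: L1mod_bound => //; try exact: measurable_st_cube.
  by apply: st_cube_sub; rewrite lerDl.
by move=> z z' Kz rz; exact: st_cube_rho rz.
Qed.

(** These sets form a sigma-algebra that contains the coordinate half-spaces, hence every measurable
    set. This takes the place of the density of continuous functions in L^1. *)
Definition L1mod_sets M : set (set V) :=
  [set A | measurable A /\ vanishes (L1mod (st_cube M M) \1_A)].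

Lemma L1mod_setsC M A : L1mod_sets M A -> L1mod_sets M (~` A).
Proof.
move=> [mA vA]; split; first exact: measurableC.
apply: vanishes_le vA => k; rewrite le_eqVlt; apply/orP; left; apply/eqP.
apply: eq_L1mod => z z'; rewrite !indicE !in_setC.
by case: (z \in A); case: (z' \in A); rewrite /= ?subrr// ?subr0 ?sub0r ?normrN.
Qed.

Lemma L1mod_setsI M A B : L1mod_sets M A -> L1mod_sets M B -> L1mod_sets M (A `&` B).
Proof.
move=> [mA vA] [mB vB]; split; first exact: measurableI.
apply: vanishes_le (vanishesD vA vB) => k.
apply: L1mod_leD => //; first exact: measurable_st_cube.
  by apply: measurable_indic; exact: measurableI.
move=> z z'; rewrite !indicE !in_setI.
by case: (z \in A); case: (z' \in A); case: (z \in B); case: (z' \in B);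
  rewrite /= ?subrr ?normr0 ?subr0 ?sub0r ?normrN ?normr1 ?addr0 ?add0r ?addr_ge0// lerDl.
Qed.

Lemma L1mod_sets0 M : L1mod_sets M set0.
Proof.
split => //; apply: vanishes_le vanishes0 => k.
rewrite /L1mod integral0_eq// => y _.
by rewrite !indicE !in_set0 subrr normr0 !mulr0.
Qed.

Lemma L1mod_setsU M A B : L1mod_sets M A -> L1mod_sets M B -> L1mod_sets M (A `|` B).
Proof.
move=> hA hB; rewrite -(setCK (A `|` B)) setCU.
by apply: L1mod_setsC; apply: L1mod_setsI; exact: L1mod_setsC.
Qed.

(** A finite union [G N] exhausts the countable union U up to a set of small measure inside the
    enlarged cube. The remainder contributes at most twice this measure for all k, so N is fixed
    before k. *)
Lemma L1mod_sets_bigcup M (F : (set V)^nat) : (forall i, L1mod_sets M (F i)) ->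
  L1mod_sets M (\bigcup_i F i).
Proof.
move=> hF; have mF i : measurable (F i) by case: (hF i).
pose G N := \big[setU/set0]_(i < N) F i.
have hG N : L1mod_sets M (G N).
  by elim/big_ind : (G N) => [|A B|i _]; [exact: L1mod_sets0|exact: L1mod_setsU|exact: hF].
set U := \bigcup_i F i.
have mU : measurable U by exact: bigcup_measurable.
have mG N : measurable (G N) by case: (hG N).
split => // e e0.
pose Q := st_cube (M + 2) (M + 2) : set V.
have mQ : measurable Q by exact: measurable_st_cube.
pose B N := Q `&` (U `\` G N).
have mB N : measurable (B N) by apply: measurableI => //; exact: measurableD.
(* Continuity from above requires finite measure, which is the reason for intersecting with the
   bounded cube Q. *)
have Bcvg : mu \o B @ \oo --> mu (\bigcap_N B N).
  apply: nonincreasing_cvg_mu => //.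
  - rewrite (@le_lt_trans _ _ (mu Q))//; last first.
      have [M0|M0] := leP 0 (M + 2); first by rewrite st_lebesgue_cube ?ltry.
      suff -> : Q = set0 by rewrite measure0 ltry.
      rewrite -subset0 => z [_ H]; have := le_lt_trans (normr_ge0 _) H; lra.
    by apply: le_measure; rewrite ?inE//; exact: subIsetl.
  - exact: bigcapT_measurable.
  - move=> N N' NN'; apply/subsetPset; apply: setIS; apply: setDS.
    by apply: subset_bigsetU.
have B0 : \bigcap_N B N = set0.
  rewrite -subset0 => z Hz; have [_ [[i _ Fiz] _]] := Hz 0%N I.
  have [_ [_ ]] := Hz i.+1 I; apply.
  by rewrite /G big_ord_recr; right.
rewrite B0 measure0 in Bcvg.
have [N _ HN] : \forall N \near \oo, (mu (B N) < (e / 4)%:E)%E.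
  have /fine_cvgP[fB cB] := Bcvg.
  have e4 : 0 < e / 4 by rewrite divr_gt0.
  have /cvgr0Pnorm_lt/(_ _ e4) := cB.
  apply: filter_app; apply: filterS fB => N fN /=.
  by rewrite ger0_norm ?fine_ge0// -lte_fin fineK.
have {HN}HN := HN N (leqnn _).
have [N1 HN1] := (hG N).2 (e / 2) ltac:(by rewrite divr_gt0).
exists N1 => k /HN1 Hk.
have mD : measurable (U `\` G N) by exact: measurableD.
apply: (@le_trans _ _ (L1mod (st_cube M M) \1_(G N) k + L1mod (st_cube M M) \1_(U `\` G N) k)%E).
  apply: L1mod_leD; try exact: measurable_indic; first exact: measurable_st_cube.
  have GU z : z \in G N -> z \in U.
    by rewrite !inE => Gz; exact: (@bigsetU_bigcup _ F N).
  move=> z z'; rewrite !indicE !in_setD.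
  have := GU z; have := GU z'.
  case: (z \in U); case: (z' \in U); case: (z \in G N); case: (z' \in G N) => /= h1 h2;
    rewrite /= ?subrr ?normr0 ?subr0 ?sub0r ?normrN ?normr1 ?addr0 ?add0r ?addr_ge0//;
    try by [have := h1 isT|have := h2 isT].
rewrite [e]splitr EFinD; apply: leeD => //.
have mi : measurable_fun setT (\1_(U `\` G N) : V -> R) by exact: measurable_indic.
apply: (le_trans (L1mod_cube_bound M k mi)).
have -> : (\int[mu]_z (\1_(st_cube (M + 2) (M + 2)) z * `|\1_(U `\` G N) z|)%:E = mu (B N))%E.
  rewrite -[B N]setIT -integral_indic//.
  apply: eq_integral => z _; congr EFin; rewrite /B !indicE -/Q.
  by rewrite ger0_norm// -natrM mulnb -(in_setI z Q).
apply: (@le_trans _ _ (2%:E * (e / 4)%:E)%E); first by rewrite lee_wpmul2l// ltW.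
by rewrite -EFinM lee_fin; lra.
Qed.

(** The two indicator values differ only if the first point lies in S, and then by 1. Integrating
    the kernel in the second point leaves the measure of S. *)
Lemma L1mod_indic_bound K A S k : measurable K -> measurable A -> measurable S ->
  (forall z z', K z -> rho k ((z : E) - (z' : E)) != 0 -> \1_A z != \1_A z' :> R -> S z) ->
  (L1mod K \1_A k <= mu S)%E.
Proof.
move=> mK mA mS HS.
have mI : measurable_fun setT (\1_S : V -> R) by exact: measurable_indic.
have -> : mu S = (\int[mu2]_y (rho k (st_sub y) * \1_S y.1)%:E)%E.
  by rewrite (tonelli_rho_l k mI)// integral_indic// setIT.
apply: ge0_le_integralR => //.
- by apply: measurable_L1mod => //; exact: measurable_indic.
- apply: measurable_funM; first exact: measurable_rho2.
  exact: (measurableT_comp mI measurable_fst).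
- move=> y _; rewrite L1mod_integrand_ge0 /= mulrCA.
  have [r0|r0] := eqVneq (rho k (st_sub y)) 0; first by rewrite r0 !mul0r.
  rewrite ler_wpM2l ?rho_ge0//.
  have [->|A12] := eqVneq (\1_A y.1 : R) (\1_A y.2); first by rewrite subrr normr0 mulr0.
  have [/set_mem Ky|Ky] := boolP (y.1 \in K); last first.
    by rewrite [\1_K _]indicE (negbTE Ky) mul0r.
  rewrite [leRHS]indicE mem_set; last exact: HS r0 A12.
  rewrite !indicE mem_set// mul1r.
  by case: (_ \in A); case: (_ \in A); rewrite /= ?subrr ?subr0 ?sub0r ?normrN ?normr1 ?normr0.
Qed.

(** The kernel can cross the hyperplane only from points within 2/(k+1) of it, and this strip of the
    cube has volume O(1/k). *)
Lemma L1mod_sets_space M (i : 'I_n) (c : R) : 0 <= M ->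
  L1mod_sets M [set z : V | c < z.1 ord0 i].
Proof.
move=> M0.
have mA : measurable [set z : V | c < z.1 ord0 i].
  rewrite (_ : mkset _ = (fun z : V => z.1 ord0 i) @^-1` `]c, +oo[%classic).
    rewrite -[X in measurable X]setTI.
    by apply: (measurableT_comp (measurable_coord ord0 i) measurable_fst).
  by apply/seteqP; split => z /=; rewrite in_itv/= andbT.
split => //.
apply: vanishes_le (vanishes_invn (2 *+ 2 * (M *+ 2) ^+ n)) => k.
have -> : (2 *+ 2 * (M *+ 2) ^+ n) / k.+1%:R = (2 / k.+1%:R) *+ 2 * (M *+ 2) ^+ n :> R.
  by rewrite [LHS]mulrAC [X in X * _ = _]mulrnAl.
have d0 : 0 <= 2 / k.+1%:R :> R by rewrite divr_ge0.
apply: le_trans (st_cube_strip_space i c M0 d0).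
apply: L1mod_indic_bound => //; first exact: measurable_st_cube.
  rewrite (_ : mkset _ = st_cube M M `&` (fun z : V => z.1 ord0 i) @^-1` ball c (2 / k.+1%:R)).
    apply: measurableI; first exact: measurable_st_cube.
    rewrite -[X in measurable X]setTI.
    apply: (measurableT_comp (measurable_coord ord0 i) measurable_fst) => //.
    by apply: open_measurable; exact: ball_open.
  by apply/seteqP; split => z /= [H1 H2]; split => //; move: H2; rewrite /ball/= distrC.
move=> z z' Kz /rho_supp_cube[/(_ i) + _]; rewrite /= !mxE => H.
move=> HA; split => //; apply: le_lt_trans H.
have iE (w : V) : \1_[set z : V | c < z.1 ord0 i] w = ((c < w.1 ord0 i)%R)%:R :> R.
  by rewrite indicE; congr (nat_of_bool _)%:R; apply/idP/idP; rewrite inE.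
move: HA; rewrite !iE.
have [h|h] := ltP c (z.1 ord0 i); have [h'|h'] := ltP c (z'.1 ord0 i); rewrite ?eqxx// => _.
  by rewrite !ger0_norm; lra.
by rewrite !ler0_norm; lra.
Qed.

Lemma L1mod_sets_time M (c : R) : 0 <= M ->
  L1mod_sets M [set z : V | c < (z.2 : R)].
Proof.
move=> M0.
have mA : measurable [set z : V | c < (z.2 : R)].
  rewrite (_ : mkset _ = (fun z : V => z.2) @^-1` `]c, +oo[%classic).
    by rewrite -[X in measurable X]setTI; apply: measurable_snd.
  by apply/seteqP; split => z /=; rewrite in_itv/= andbT.
split => //.
apply: vanishes_le (vanishes_invn (2 *+ 2 * (M *+ 2) ^+ n)) => k.
have -> : (2 *+ 2 * (M *+ 2) ^+ n) / k.+1%:R = (2 / k.+1%:R) *+ 2 * (M *+ 2) ^+ n :> R.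
  by rewrite [LHS]mulrAC [X in X * _ = _]mulrnAl.
have d0 : 0 <= 2 / k.+1%:R :> R by rewrite divr_ge0.
apply: le_trans (st_cube_strip_time c M0 d0).
apply: L1mod_indic_bound => //; first exact: measurable_st_cube.
  rewrite (_ : mkset _ = st_cube M M `&` (fun z : V => z.2) @^-1` ball c (2 / k.+1%:R)).
    apply: measurableI; first exact: measurable_st_cube.
    rewrite -[X in measurable X]setTI; apply: measurable_snd => //.
    by apply: open_measurable; exact: ball_open.
  by apply/seteqP; split => z /= [H1 H2]; split => //; move: H2; rewrite /ball/= distrC.
move=> z z' Kz /rho_supp_cube[_]; rewrite /= => H.
(* In time the kernel reaches only 2/(k+1)^2. This is weakened to 2/(k+1) so that the rate is the
   one used for space. *)
have {}H : `|(z.2 : R) - z'.2| < 2 / k.+1%:R.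
  apply: lt_le_trans H _; rewrite ler_wpM2l// lef_pV2 ?posrE ?exprn_gt0//.
  by rewrite ler_eXnr// ler1n.
move=> HA; split => //; apply: le_lt_trans H.
have iE (w : V) : \1_[set z : V | c < (z.2 : R)] w = ((c < (w.2 : R))%R)%:R :> R.
  by rewrite indicE; congr (nat_of_bool _)%:R; apply/idP/idP; rewrite inE.
move: HA; rewrite !iE.
have [h|h] := ltP c z.2; have [h'|h'] := ltP c z'.2; rewrite ?eqxx// => _.
  by rewrite !ger0_norm; lra.
by rewrite !ler0_norm; lra.
Qed.

Lemma L1mod_sets_preimage d (T : measurableType d) M (f : V -> T) (G : set (set T)) :
  (forall B, G B -> L1mod_sets M (f @^-1` B)) ->
  forall B, <<s G >> B -> L1mod_sets M (f @^-1` B).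
Proof.
move=> HG B sB.
suff : <<s G >> `<=` [set B | L1mod_sets M (f @^-1` B)] by apply.
apply: smallest_sub => //; split => [|A HA|F HF].
- by rewrite /= preimage_set0; exact: L1mod_sets0.
- by rewrite /= setTD preimage_setC; exact: L1mod_setsC.
- by rewrite /= preimage_bigcup; exact: L1mod_sets_bigcup.
Qed.

Lemma L1mod_sets_coord M (i : 'I_n) (j : 'I_1) (B : set R) : 0 <= M -> measurable B ->
  L1mod_sets M ((fun z : V => z.1 j i) @^-1` B).
Proof.
move=> M0 mB; have {mB} : (@RGenOInfty.G R).-sigma.-measurable B.
  by rewrite -(RGenOInfty.measurableE R).
rewrite (ord1 j); move: B.
apply: (@L1mod_sets_preimage _ (measurableTypeR R)) => _ [c ->].
have := L1mod_sets_space i c M0; congr L1mod_sets.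
by apply/seteqP; split => z /=; rewrite in_itv/= andbT.
Qed.

(** The principle of good sets, used along the way the sigma-algebra is generated: rays for each
    coordinate and for time, then preimages, then rectangles. *)
Lemma L1mod_sets_measurable M A : 0 <= M -> measurable A -> L1mod_sets M A.
Proof.
move=> M0; rewrite measurable_prod_measurableType.
apply: (@L1mod_sets_preimage _ V M idfun) => _ [B mB [C mC <-]].
have -> : idfun @^-1` (B `*` C) = (fst @^-1` B) `&` (snd @^-1` C) :> set V.
  by apply/seteqP; split.
apply: L1mod_setsI.
  apply: (@L1mod_sets_preimage _ 'rV[R]_n M fst _ _ B mB) => _ [i [j [D mD <-]]].
  by rewrite setTI; exact: L1mod_sets_coord.
have {mC} : (@RGenOInfty.G R).-sigma.-measurable C.
  by rewrite -(RGenOInfty.measurableE R).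
move: C.
apply: (@L1mod_sets_preimage _ (measurableTypeR R)) => _ [c ->].
have := L1mod_sets_time c M0; congr L1mod_sets.
by apply/seteqP; split => z /=; rewrite in_itv/= andbT.
Qed.

End L1_modulus.

Import HBSimple.

(** * Convergence of mollifications in L^1 *)

Section mollify.
Context {R : realType} {n : nat}.
Local Notation V := ('rV[R]_n * measurableTypeR R)%type.
Local Notation E := ('rV[R]_n * R)%type.
Local Notation mu := (@st_lebesgue R n).
Local Notation mu2 := (@stm R n \x @stm R n)%E.
Implicit Types (K : set V) (W : V -> R) (k : nat) (c : R).

Lemma L1mod_vanish_sum K (I : finType) (c : I -> R) (A : I -> set V) :
  measurable K -> (forall i, measurable (A i)) ->
  (forall i, vanishes (L1mod K \1_(A i))) ->
  vanishes (L1mod K (fun z => \sum_i c i * \1_(A i) z)).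
Proof.
move=> mK mA vA.
have mF i : measurable_fun setT (fun z => c i * \1_(A i) z : R).
  by apply: measurable_funM => //; exact: measurable_indic.
elim: (index_enum I) => [|i s IH].
  apply: vanishes_le vanishes0 => k; rewrite /L1mod integral0_eq// => y _.
  by rewrite !big_nil subrr normr0 !mulr0.
have mS : measurable_fun setT (fun z => \sum_(j <- s) c j * \1_(A j) z : R).
  exact: measurable_sum.
apply: vanishes_le (vanishesD (vanishesZ (normr_ge0 (c i)) (vA i)) IH) => k.
have mAi : measurable_fun setT (\1_(A i) : V -> R) by exact: measurable_indic.
rewrite -L1modZ//.
apply: L1mod_leD => //.
  by under eq_fun do rewrite big_cons; exact: measurable_funD.
move=> z z'; rewrite !big_cons; apply: le_trans (ler_normD _ _).
by rewrite le_eqVlt; apply/orP; left; apply/eqP; congr (`| _ |); ring.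
Qed.

(** When the first point is outside the enlarged cube and the kernel is not zero, the second point
    is outside the support of W as well, so the integrand vanishes. *)
Lemma L1mod_supp M W k : measurable_fun setT W ->
  (forall z, ~ st_cube M M z -> W z = 0) ->
  (L1mod setT W k <= L1mod (st_cube (M + 2) (M + 2)) W k)%E.
Proof.
move=> mW W0; apply: ge0_le_integralR => //.
- exact: measurable_L1mod.
- by apply: measurable_L1mod => //; exact: measurable_st_cube.
move=> y _; rewrite L1mod_integrand_ge0 /=.
have [r0|r0] := eqVneq (rho k (st_sub y)) 0; first by rewrite r0 !mul0r !mulr0.
have [/set_mem Ky|Ky] := boolP (y.1 \in (st_cube (M + 2) (M + 2) : set V)).
  by rewrite !indicE !mem_set.
have y1 : W y.1 = 0.
  apply: W0 => Hy; move/negP: Ky; apply; rewrite inE.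
  by apply: st_cube_sub Hy; rewrite lerDl.
have y2 : W y.2 = 0.
  apply: W0 => Hy; move/negP: Ky; apply; rewrite inE.
  by apply: (@st_cube_rho _ _ k _ y.2) => //; rewrite -rhoN opprB.
by rewrite y1 y2 subrr normr0 !mulr0.
Qed.

Lemma L1mod_vanish M W : 0 <= M -> measurable_fun setT W ->
  (forall z, ~ st_cube M M z -> W z = 0) ->
  (\int[mu]_z `|W z|%:E < +oo)%E -> vanishes (L1mod setT W).
Proof.
move=> M0 mW W0 iW.
apply: (vanishes_le (v := L1mod (st_cube (M + 2) (M + 2)) W)); first by move=> k; exact: L1mod_supp.
set K : set V := st_cube (M + 2) (M + 2).
(* Two enlargements: one because [L1mod_supp] passes from the support to K, the other because
   [L1mod_bound] passes from K to K'. *)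
pose K' : set V := st_cube (M + 2 + 2) (M + 2 + 2).
have mK : measurable K by exact: measurable_st_cube.
have mK' : measurable K' by exact: measurable_st_cube.
have iWK : mu.-integrable K' (EFin \o W).
  apply: (integrableS measurableT) => //.
  by apply: (@integrableR _ _ _ _ _ W (fun z => `|W z|)) => //; exact: measurableT_comp.
have [g [ig _ cg]] := approximation_sfun_integrable mK' iWK.
move=> e e0.
have [N _ HN] : \forall N \near \oo, (\int[mu]_(z in K') `|(W z)%:E - (g N z)%:E| < (e / 4)%:E)%E.
  have /fine_cvgP[fB cB] := cg.
  have e4 : 0 < e / 4 by rewrite divr_gt0.
  have /cvgr0Pnorm_lt/(_ _ e4) := cB.
  apply: filter_app; apply: filterS fB => N fN /=.
  by rewrite ger0_norm ?fine_ge0 ?integral_ge0// -lte_fin fineK.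
have {HN}HN := HN N (leqnn _).
pose f := g N.
have mf : measurable_fun setT (f : V -> R) by exact: measurable_funP.
have vf : vanishes (L1mod K f).
  have -> := funext (fimfunEord f : forall x, (f : V -> R) x = _).
  have mA (r : R) : measurable (f @^-1` [set r]).
    by rewrite -[X in measurable X]setTI; exact: mf.
  apply: L1mod_vanish_sum => // i.
  by apply: (L1mod_sets_measurable _ (mA _)).2; rewrite addr_ge0.
have [N1 HN1] := vf (e / 2) ltac:(by rewrite divr_gt0).
exists N1 => k /HN1 Hk.
have mWf : measurable_fun setT (fun z => W z - f z) by exact: measurable_funB.
apply: (@le_trans _ _ (L1mod K f k + L1mod K (fun z => W z - f z)%R k)%E).
  apply: L1mod_leD => // z z'; apply: le_trans (ler_normD _ _).
  by rewrite le_eqVlt; apply/orP; left; apply/eqP; congr (`| _ |); ring.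
rewrite [e]splitr EFinD; apply: leeD => //.
apply: (le_trans (L1mod_cube_bound _ _ mWf)).
have -> : (\int[mu]_z (\1_(st_cube (M + 2 + 2) (M + 2 + 2)) z * `|W z - f z|)%:E =
   \int[mu]_(z in K') `|(W z)%:E - (f z)%:E|)%E.
  rewrite [RHS]integral_mkcond; apply: eq_integral => z _.
  rewrite patchE -/K' indicE; case: (z \in K') => /=; first by rewrite mul1r.
  by rewrite mul0r.
apply: (@le_trans _ _ (2%:E * (e / 4)%:E)%E); first by rewrite lee_wpmul2l// ltW.
by rewrite -EFinM lee_fin; lra.
Qed.

Definition conv (g : E -> R) W (z : E) : R := \int[mu]_z' (g (z - (z' : E)) * W z').

Lemma measurable_shifted (g : E -> R) (z : E) : continuous g ->
  measurable_fun setT (fun z' : V => g (z - (z' : E))).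
Proof.
move=> cg; have mg : measurable_fun setT (g : V -> R) by exact: continuous_measurable_st.
by apply: (measurableT_comp mg); exact: (measurableT_comp measurable_st_sub (measurable_pair1 z)).
Qed.

Lemma integrable_conv (g : E -> R) (C : R) W (z : E) : continuous g ->
  (forall y, `|g y| <= C) -> measurable_fun setT W ->
  (\int[mu]_z `|W z|%:E < +oo)%E ->
  mu.-integrable setT (EFin \o (fun z' => g (z - (z' : E)) * W z')).
Proof.
move=> cg gC mW iW.
apply: (@integrableR _ _ _ _ _ _ (fun z' => C * `|W z'|)) => //.
- by apply: measurable_funM => //; exact: measurable_shifted.
- by apply: measurable_funM => //; exact: measurableT_comp.
- by move=> z' _; rewrite normrM ler_wpM2r.
- have C0 : 0 <= C by apply: le_trans (gC 0).
  rewrite ge0_integralZlR//; last exact: measurableT_comp.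
  by rewrite lte_mul_pinfty// lee_fin.
Qed.

Lemma rho_bounded k : exists C : R, forall y : E, `|rho k y| <= C.
Proof. by eexists => y; rewrite ger0_norm ?rho_ge0//; exact: rho_le. Qed.

Lemma continuous_rho k : continuous (rho k : E -> R).
Proof. exact/smooth_continuous/smooth_rho. Qed.

(** Since the kernel has mass one, W z is itself an average of the constant W z. Integrating the
    bound in z then compares mollification with the L^1 modulus. *)
Lemma conv_sub_le W k (z : E) : measurable_fun setT W ->
  (\int[mu]_z `|W z|%:E < +oo)%E ->
  (`|conv (rho k) W z - W z|%:E <=
   \int[mu]_z' (rho k (z - (z' : E))%R * `|W z - W z'|)%:E)%E.
Proof.
move=> mW iW.
have [C HC] := rho_bounded k.
have i1 := integrable_conv z (@continuous_rho k) HC mW iW.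
have mr := measurable_shifted z (@continuous_rho k).
have i2 : mu.-integrable setT (EFin \o (fun z' : V => rho k (z - (z' : E)) * W z)).
  apply: (@integrableR _ _ _ _ _ _ (fun z' : V => `|W z| * rho k (z - (z' : E)))) => //.
  - exact: measurable_funM.
  - exact: measurable_funM.
  - by move=> z' _; rewrite normrM mulrC (ger0_norm (rho_ge0 _ _)).
  - rewrite ge0_integralZlR//; last by move=> *; exact: rho_ge0.
    by rewrite integral_rho_sub_r mule1 ltry.
have -> : conv (rho k) W z - W z = \int[mu]_z' (rho k (z - (z' : E)) * W z' - rho k (z - (z' : E)) * W z).
  rewrite RintegralB//; congr (_ - _).
  rewrite RintegralZr//.
    by rewrite /Rintegral integral_rho_sub_r mul1r.
  apply: (@integrableR _ _ _ _ _ _ (fun z' : V => rho k (z - (z' : E)))) => //.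
  - by move=> z' _; rewrite ger0_norm ?rho_ge0.
  - by rewrite integral_rho_sub_r ltry.
have i3 : mu.-integrable setT (EFin \o (fun z' : V => rho k (z - (z' : E)) * W z' - rho k (z - (z' : E)) * W z)).
  by apply: (integrableB measurableT i1 i2).
rewrite EFin_normr_Rintegral//.
apply: le_trans (le_abse_integral _ _ _) _ => //; first by case/integrableP: i3.
apply: ge0_le_integralR => //.
- apply: measurableT_comp => //; apply: measurable_funB; exact: measurable_funM.
- by apply: measurable_funM => //; apply: measurableT_comp => //; exact: measurable_funB.
- move=> z' _; rewrite normr_ge0 /= -mulrBr normrM ger0_norm ?rho_ge0//.
  by rewrite distrC.
Qed.

Lemma conv_L1_le W k : measurable_fun setT (conv (rho k) W : V -> R) ->
  measurable_fun setT W -> (\int[mu]_z `|W z|%:E < +oo)%E ->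
  (\int[mu]_z `|conv (rho k) W z - W z|%:E <= L1mod setT W k)%E.
Proof.
move=> mc mW iW; rewrite /L1mod [leRHS]fubini_tonelli1.
- apply: (@ge0_le_integral _ _ _ (@stm R n)) => //.
  + by apply/measurable_EFinP; apply: measurableT_comp => //; exact: measurable_funB.
  + apply: (@measurable_fun_fubini_tonelli_F _ _ V V R (@stm R n)
      (fun y => (\1_setT y.1 * (rho k (st_sub y) * `|W y.1 - W y.2|))%:E)).
      by apply/measurable_EFinP; exact: measurable_L1mod.
    by move=> y; rewrite lee_fin L1mod_integrand_ge0.
  + move=> z _; apply: le_trans (conv_sub_le _ _ mW iW) _.
    rewrite le_eqVlt; apply/orP; left; apply/eqP; apply: eq_integral => z' _ /=.
    by rewrite indicE mem_set//= mul1r.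
- by apply/measurable_EFinP; exact: measurable_L1mod.
- by move=> y; rewrite lee_fin L1mod_integrand_ge0.
Qed.

End mollify.

(** * Smoothness of convolutions *)

Section conv_smooth.
Context {R : realType} {n : nat}.
Local Notation V := ('rV[R]_n * measurableTypeR R)%type.
Local Notation E := ('rV[R]_n * R)%type.
Local Notation mu := (@st_lebesgue R n).
Implicit Types (W : V -> R) (k : nat) (c M : R) (g : E -> R).

Definition st_box_closed M : set E :=
  [set z : E | (forall i, z.1 ord0 i \in `[- M, M]%R) /\ z.2 \in `[- M, M]%R].

Lemma compact_st_box_closed M : compact (st_box_closed M).
Proof.
have -> : st_box_closed M = [set x : 'rV[R]_n | forall i, `[- M, M]%classic (x ord0 i)] `*` `[- M, M]%classic.
  by apply/seteqP; split.
apply: compact_setX; last exact: segment_compact.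
by apply: (@rV_compact _ n (fun _ => `[- M, M]%classic)) => i; exact: segment_compact.
Qed.

Lemma st_cube_closed M (z : E) : st_cube M M z -> st_box_closed M z.
Proof.
by move=> [H1 H2]; split => [i|]; rewrite in_itv/= -ler_norml ltW//; exact: H1.
Qed.

Definition supp_in M g := forall z, g z != 0 -> st_cube M M z.

Lemma supp_in_bounded M g : continuous g -> supp_in M g ->
  exists2 C, 0 <= C & forall z, `|g z| <= C.
Proof.
move=> cg sg.
have [K0|K0] := pselect (st_box_closed M !=set0); last first.
  exists 0 => // z; have [->|/sg/st_cube_closed zK] := eqVneq (g z) 0; first by rewrite normr0.
  by exfalso; apply: K0; exists z.
have cn : {within st_box_closed M, continuous (fun z => `|g z|)}.
  apply: continuous_subspaceT => z.
  by apply: continuous_comp; [exact: cg|exact: norm_continuous].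
have [z0 _ H] := compact_EVT_max K0 (@compact_st_box_closed M) cn.
exists `|g z0| => // z.
have [->|/sg/st_cube_closed zK] := eqVneq (g z) 0; first by rewrite normr0.
by apply: H; rewrite inE.
Qed.

(** The cube is open, so at a point of its boundary g need not vanish in a neighbourhood. Outside
    the cube with one more unit it does, and the derivative is then 0. *)
Lemma supp_in_derive M g v : supp_in M g -> supp_in (M + 1) ('D_v g).
Proof.
move=> sg z H; apply: contrapT => Hz; move/eqP : H; apply.
suff Hn : \forall y \near z, g y = cst 0 y by rewrite (near_eq_derive _ Hn) derive_cst.
have Hc y : ~ st_cube M M y -> g y = 0 by move=> Hy; apply: contra_notP Hy => /eqP/sg.
suff : \forall y \near z, ~ st_cube M M y by apply: filterS => y /Hc.
apply: contrapT => Hnn; apply: Hz; split.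
  move=> i; rewrite ltNge; apply/negP => Hi; apply: Hnn.
  have : \forall y \near z, `|(y : E).1 ord0 i| > M.
    have c1 : {for z, continuous (fun y : E => `|y.1 ord0 i|)}.
      by apply: (@continuous_comp _ _ _ (fun y : E => y.1 ord0 i)); [exact: smooth_continuous (smooth_fst (smooth_coord i)) z|exact: norm_continuous].
    by apply: (c1 [set r : R | M < r]); apply: lt_nbhsr; rewrite (lt_le_trans _ Hi)// ltrDl.
  by apply: filterS => y My [/(_ i)]; rewrite ltNge (ltW My).
rewrite ltNge; apply/negP => Hi; apply: Hnn.
have : \forall y \near z, `|(y : E).2| > M.
  have c1 : {for z, continuous (fun y : E => `|y.2|)}.
    by apply: (@continuous_comp _ _ _ (fun y : E => y.2)); [exact: cvg_snd|exact: norm_continuous].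
  by apply: (c1 [set r : R | M < r]); apply: lt_nbhsr; rewrite (lt_le_trans _ Hi)// ltrDl.
by apply: filterS => y My [_]; rewrite ltNge (ltW My).
Qed.

Lemma st_cube1_near0 : \forall w \near (0 : E), st_cube 1 1 w.
Proof.
apply/nbhs_ballP; exists 1 => //= w [[_ H1] H2]; split.
  by move=> i; have := H1 ord0 i; rewrite /ball/= mxE sub0r normrN.
by move: H2; rewrite /ball/= sub0r normrN.
Qed.

(** Compactness of the closed box of half-side M + 1 makes the continuity uniform there. Outside it,
    and for w in the unit cube, both z and w + z miss the support. *)
Lemma supp_in_ucont M g : continuous g -> supp_in M g ->
  forall e, 0 < e -> \forall w \near (0 : E), forall z, `|g (w + z) - g z| <= e.
Proof.
move=> cg sg e e0.
have cov : \forall w \near (0 : E), forall z, st_box_closed (M + 1) z -> `|g (w + z) - g z| <= e.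
  have := @compact_st_box_closed (M + 1).
  move=> /compact_near_coveringP/(_ _ (nbhs (0 : E)) (fun w z => `|g (w + z) - g z| <= e)).
  apply => z _.
  have c1 : {for (z, 0 : E), continuous (fun y : E * E => g (y.2 + y.1) - g y.1)}.
    apply: continuousB.
      apply: (@continuous_comp _ _ _ (fun y : E * E => y.2 + y.1) g); last exact: cg.
      by apply: continuousD; [exact: cvg_snd|exact: cvg_fst].
    by apply: (@continuous_comp _ _ _ (fun y : E * E => y.1) g); [exact: cvg_fst|exact: cg].
  have := c1 [set r | `|r| < e]; rewrite /= add0r subrr.
  have H0 : nbhs 0 [set r : R | `|r| < e].
    by apply/nbhs_ballP; exists e => //= r; rewrite /ball/= sub0r normrN.
  move=> /(_ H0) [[A B] [/= Az B0] AB]; exists (A, B) => // -[y w] ABw.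
  by apply/ltW; exact: (AB (y, w) ABw).
near=> w => z.
have w1 : st_cube 1 1 w by near: w; exact: st_cube1_near0.
have [zK|zK] := pselect (st_box_closed (M + 1) z).
  by move: z zK; near: w.
have nz y : ~ st_box_closed M y -> g y = 0.
  by move=> Hy; apply: contra_notP Hy => /eqP/sg/st_cube_closed.
rewrite !nz ?subrr ?normr0 ?(ltW e0)//.
  move=> [H1 H2]; apply: zK; split.
    by move=> i; have := H1 i; rewrite !in_itv/= => /andP[? ?]; apply/andP; split; lra.
  by move: H2; rewrite !in_itv/= => /andP[? ?]; apply/andP; split; lra.
move=> [H1 H2]; apply: zK; case: w1 => w1 w2; split.
  move=> i; have := H1 i; have := w1 i; rewrite !in_itv/= mxE ltr_norml => /andP[? ?] /andP[? ?].
  by apply/andP; split; lra.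
by move: H2 w2; rewrite !in_itv/= ltr_norml => /andP[? ?] /andP[? ?]; apply/andP; split; lra.
Unshelve. all: by end_near. Qed.

Lemma continuous_conv M g W : continuous g -> supp_in M g -> measurable_fun setT W ->
  (\int[mu]_z `|W z|%:E < +oo)%E -> continuous (conv g W).
Proof.
move=> cg sg mW iW z0.
have [C C0 gC] := supp_in_bounded cg sg.
apply/cvgrPdist_le => e e0.
set I := fine (\int[mu]_z `|W z|%:E)%E.
have I0 : 0 <= I by apply: fine_ge0; apply: integral_ge0.
have IE : (\int[mu]_z `|W z|%:E)%E = I%:E.
  by rewrite /I fineK// ge0_fin_numE// integral_ge0.
have eI : 0 < e / (I + 1) by rewrite divr_gt0// ltr_wpDl.
have Hu := supp_in_ucont cg sg eI.
have : \forall z \near z0, forall y, `|g (z - z0 + y) - g y| <= e / (I + 1).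
  have : (fun z : E => z - z0) @ z0 --> (0 : E).
    by rewrite -[X in _ --> X](subrr z0); apply: cvgB; [exact: cvg_id|exact: cvg_cst].
  by move=> H; apply: H Hu.
apply: filterS => z Hz.
have i1 := integrable_conv z0 cg gC mW iW.
have i2 := integrable_conv z cg gC mW iW.
rewrite /conv -RintegralB//.
have i3 : mu.-integrable setT (EFin \o (fun z' : V => g (z0 - (z' : E)) * W z' - g (z - (z' : E)) * W z')).
  exact: (integrableB measurableT i1 i2).
rewrite -lee_fin EFin_normr_Rintegral//.
apply: le_trans (le_abse_integral _ _ _) _ => //; first by case/integrableP: i3.
apply: (@le_trans _ _ (\int[mu]_z' (e / (I + 1) * `|W z'|)%:E)%E).
  apply: ge0_le_integralR => //.
  - apply: measurableT_comp => //; apply: measurable_funB;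
      by apply: measurable_funM => //; exact: measurable_shifted.
  - by apply: measurable_funM => //; exact: measurableT_comp.
  - move=> z' _; rewrite normr_ge0 /= -mulrBl normrM ler_wpM2r// distrC.
    by have := Hz (z0 - (z' : E)); rewrite addrA subrK.
rewrite ge0_integralZlR//; [|exact: measurableT_comp|exact: ltW].
rewrite IE -EFinM lee_fin -mulrAC ler_pdivrMr ?ltr_wpDl//.
by rewrite ler_wpM2l ?(ltW e0)// lerDl.
Qed.

Lemma is_derive_line g (y v : E) (x : R) : derivable g (x *: v + y) v ->
  is_derive x 1 (fun h : R => g (h *: v + y)) ('D_v g (x *: v + y)).
Proof.
move=> dg.
have Q : (fun h : R => h^-1 *: (((fun h : R => g (h *: v + y)) \o shift x) (h *: 1) - g (x *: v + y))) =
   (fun h : R => h^-1 *: ((g \o shift (x *: v + y)) (h *: v) - g (x *: v + y))).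
  by apply/funext => h /=; rewrite [_%:A]mulr1 scalerDl addrA.
by apply: DeriveDef; rewrite /derivable /derive Q.
Qed.

(** Differentiation under the integral along the line through z in direction v. The derivative of
    the integrand is dominated by a bound for ['D_v g] times |W|. *)
Lemma conv_is_derive M g W (z v : E) : smooth g -> supp_in M g -> measurable_fun setT W ->
  (\int[mu]_z `|W z|%:E < +oo)%E -> is_derive z v (conv g W) (conv ('D_v g) W z).
Proof.
move=> smg sg mW iW.
have cg := smooth_continuous smg.
have [C C0 gC] := supp_in_bounded cg sg.
have cDg := smooth_continuous (smooth_D v smg).
have [C1 C10 DgC] := supp_in_bounded cDg (supp_in_derive (v := v) sg).
pose f (h : R) (z' : V) : R := g (h *: v + (z - (z' : E))) * W z'.
have df (h : R) (z' : V) : is_derive h 1 (f ^~ z') ('D_v g (h *: v + (z - (z' : E))) * W z').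
  have H := is_derive_line (@smooth_derivable _ _ _ g (h *: v + (z - (z' : E))) v smg).
  have := is_deriveM H (is_derive_cst (W z') h 1).
  rewrite scaler0 add0r => H2; apply: (@is_derive_eq _ _ _ _ _ _ _ _ H2).
  by rewrite -[LHS]/(W z' * _) mulrC.
have d1f (h : R) (z' : V) : partial1of2 f h z' = 'D_v g (h *: v + (z - (z' : E))) * W z'.
  by rewrite partial1of2E; case: (df h z').
have intf (x : R) : x \in `]-1, 1[%R -> mu.-integrable setT (EFin \o f x).
  move=> _; have := integrable_conv (x *: v + z) cg gC mW iW.
  by congr (_.-integrable _ _); apply/funext => z' /=; rewrite /f addrA.
have iG : mu.-integrable setT (EFin \o (fun z' => C1 * `|W z'|)).
  apply: (@integrableR _ _ _ _ _ _ (fun z' => C1 * `|W z'|)) => //.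
  - by apply: measurable_funM => //; exact: measurableT_comp.
  - by apply: measurable_funM => //; exact: measurableT_comp.
  - by move=> z' _; rewrite ger0_norm// mulr_ge0.
  - rewrite ge0_integralZlR//; last exact: measurableT_comp.
    by rewrite lte_mul_pinfty// lee_fin.
have I0 : (`](-1), 1[ : set R)%classic 0 by rewrite /= in_itv/=; apply/andP; split; lra.
have H := @cvg_differentiation_under_integral R _ V mu f setT measurableT 0 (-1) 1 I0
  intf (fun x y _ _ => @ex_derive _ _ _ _ _ _ _ (df x y)) (fun z' => C1 * `|W z'|)
  (fun z' => mulr_ge0 C10 (normr_ge0 _)) iG _.
have {}H := H ltac:(move=> x y _ _; rewrite d1f normrM ler_wpM2r//).
have Q : (fun h : R => h^-1 *: ((conv g W \o shift z) (h *: v) - conv g W z)) @ 0^' --> conv ('D_v g) W z.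
  move: H; rewrite /conv.
  rewrite (_ : \int[mu]_y partial1of2 f 0 y = \int[mu]_z' ('D_v g (z - (z' : E)) * W z')); last first.
    by apply: eq_Rintegral => z' _; rewrite d1f scale0r add0r.
  rewrite (_ : (fun h : R => _) = (fun h : R => h^-1 *: (\int[mu]_y f (h + 0) y - \int[mu]_y f 0 y)))//.
  apply/funext => h; rewrite /= addr0; congr (_ *: (_ - _)).
    by apply: eq_Rintegral => z' _; rewrite /f addrA.
  by apply: eq_Rintegral => z' _; rewrite /f scale0r add0r.
by apply: DeriveDef; [apply/cvg_ex; eexists; exact: Q|exact: cvg_lim Q].
Qed.

(** The induction is over all kernels and support sizes at once, since each derivative replaces g by
    ['D_v g] and M by M + 1. *)
Lemma smooth_conv M g W : smooth g -> supp_in M g -> measurable_fun setT W ->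
  (\int[mu]_z `|W z|%:E < +oo)%E -> smooth (conv g W).
Proof.
move=> smg sg mW iW k; elim: k M g smg sg => [|k IH] M g smg sg.
  by split => //; exact: continuous_conv (smooth_continuous smg) sg mW iW.
split; first exact: continuous_conv (smooth_continuous smg) sg mW iW.
move=> v; split.
  by move=> z; case: (conv_is_derive z v smg sg mW iW).
rewrite (_ : 'D_v _ = conv ('D_v g) W); last first.
  by apply/funext => z; case: (conv_is_derive z v smg sg mW iW).
by apply: IH (supp_in_derive (v := v) sg); exact: smooth_D.
Qed.

Lemma supp_in_rho k : supp_in 2 (@rho R n k).
Proof.
move=> z /rho_supp_cube; apply: st_cube_sub.
  by rewrite ler_pdivrMr// ler_peMr// ler1n.
by rewrite ler_pdivrMr ?exprn_gt0// ler_peMr// exprn_ege1// ler1n.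
Qed.

End conv_smooth.

(** * Mollification in the double phase class *)

Section powR_inequalities.
Context {R : realType}.
Implicit Types (x y r : R).

Lemma le_powR x y r : 0 <= r -> 0 <= x -> x <= y -> x `^ r <= y `^ r.
Proof.
by move=> r0 x0 xy; apply: ge0_ler_powR => //; rewrite nnegrE// (le_trans x0).
Qed.

(** No optimisation is involved: if y <= d x the first term alone dominates, otherwise x < y / d and
    the second one does. *)
Lemma young_eps (d x y r : R) : 0 < d -> 1 <= r -> 0 <= x -> 0 <= y ->
  x `^ (r - 1) * y <= d * x `^ r + d^-1 `^ (r - 1) * y `^ r.
Proof.
move=> d0 r1 x0 y0; have r0 : 0 < r by lra.
have r10 : 0 <= r - 1 by lra.
have [yx|xy] := leP y (d * x).
  rewrite (@le_trans _ _ (d * x `^ r))//; last by rewrite lerDl mulr_ge0// powR_ge0.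
  by rewrite -[x `^ r]mulr_powRB1// mulrA mulrC ler_wpM2r// powR_ge0.
rewrite (@le_trans _ _ (d^-1 `^ (r - 1) * y `^ r))//; last first.
  by rewrite lerDr mulr_ge0 ?powR_ge0// ltW.
rewrite -[y `^ r]mulr_powRB1// mulrCA mulrC ler_wpM2l//.
rewrite -powRM ?invr_ge0// ?(ltW d0)//; apply: le_powR => //.
by rewrite ler_pdivlMl// ltW.
Qed.

Lemma young1 x y r : 1 <= r -> 0 <= x -> 0 <= y -> x `^ (r - 1) * y <= x `^ r + y `^ r.
Proof.
move=> r1 x0 y0; have := young_eps ltr01 r1 x0 y0.
by rewrite invr1 powR1 !mul1r.
Qed.

Lemma le1_powR x r : 1 <= r -> 0 <= x -> x <= 1 + x `^ r.
Proof.
move=> r1 x0; have [x1|x1] := leP x 1; first by rewrite (le_trans x1)// lerDl powR_ge0.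
by rewrite (le_trans (le1r_powR (ltW x1) r1))// lerDr.
Qed.

End powR_inequalities.

Section conv_powR.
Context {R : realType} {n : nat}.
Local Notation V := ('rV[R]_n * measurableTypeR R)%type.
Local Notation E := ('rV[R]_n * R)%type.
Local Notation mu := (@st_lebesgue R n).
Implicit Types (W : V -> R) (k : nat).

Lemma conv_rho_ge0 k W z : (forall z, 0 <= W z) -> 0 <= conv (rho k) W z.
Proof. by move=> W0; apply: Rintegral_ge0 => z' _; rewrite mulr_ge0// rho_ge0. Qed.

(* Jensen's inequality up to a constant; the weight w dominates b near z. *)
Lemma conv_jensen k W (w : V -> R) (b r : R) (z : E) : 1 <= r -> 0 <= b ->
  measurable_fun setT W -> measurable_fun setT w ->
  (forall z', 0 <= W z') -> (forall z', 0 <= w z') ->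
  (\int[mu]_z `|W z|%:E < +oo)%E -> (\int[mu]_z (w z * W z `^ r)%:E < +oo)%E ->
  (forall z' : E, rho k (z - z') != 0 -> W z' != 0 -> b <= w z') ->
  b * conv (rho k) W z `^ r <= 2 `^ r * conv (rho k) (fun z' => w z' * W z' `^ r) z.
Proof.
move=> r1 b0 mW mw W0 w0 iW iwW Hb.
set m := conv (rho k) W z.
have m0 : 0 <= m by exact: conv_rho_ge0.
have r0 : 0 < r by lra.
have mwW : measurable_fun setT (fun z' => w z' * W z' `^ r).
  by apply: measurable_funM => //; exact: (measurableT_comp (measurable_powR r) mW).
have wW0 z' : 0 <= w z' * W z' `^ r by rewrite mulr_ge0// powR_ge0.
have [C HC] := @rho_bounded R n k.
have cr := @continuous_rho R n k.
have iwW' : (\int[mu]_z `|w z * W z `^ r|%:E < +oo)%E.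
  by under eq_integral do rewrite ger0_norm//.
have i1 := integrable_conv z cr HC mW iW.
have i2 := integrable_conv z cr HC mwW iwW'.
have i0 : mu.-integrable setT (EFin \o (fun z' : V => rho k (z - (z' : E)))).
  apply: (@integrableR _ _ _ _ _ _ (fun z' : V => rho k (z - (z' : E)))) => //.
  - exact: measurable_shifted.
  - exact: measurable_shifted.
  - by move=> z' _; rewrite ger0_norm ?rho_ge0.
  - by rewrite integral_rho_sub_r ltry.
(* Young's inequality with d = 1/2 is applied to the number m and the value W z', multiplied by b
   and by the kernel, and integrated. One half of b m^r returns on the right and is absorbed, which
   doubles 2^(r-1) to 2^r. *)
have key : b * m `^ (r - 1) * m <= \int[mu]_z' (2^-1 * b * m `^ r * rho k (z - (z' : E)) +
    2 `^ (r - 1) * (rho k (z - (z' : E)) * (w z' * W z' `^ r))).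
  rewrite -RintegralZl//; apply: le_Rintegral => //.
  - exact: (integrableZl measurableT _ i1).
  - apply: (integrableD measurableT (integrableZl measurableT _ i0) (integrableZl measurableT _ i2)).
  move=> z' _.
  have [r_0|rn0] := eqVneq (rho k (z - (z' : E))) 0; first by rewrite r_0 !(mul0r, mulr0) addr0.
  have rp : 0 <= rho k (z - (z' : E)) by exact: rho_ge0.
  (* The weight is known to dominate b only where W does not vanish; elsewhere the left side is
     0. *)
  have [W_0|Wn0] := eqVneq (W z') 0.
    by rewrite W_0 !mulr0; apply: addr_ge0; do ?apply: mulr_ge0 => //; rewrite ?powR_ge0 ?invr_ge0.
  have Y := @young_eps R 2^-1 m (W z') r ltac:(by rewrite invr_gt0) r1 m0 (W0 z').
  rewrite invrK in Y.
  have Y1 := ler_wpM2l rp (ler_wpM2l b0 Y).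
  apply: le_trans (_ : rho k (z - (z' : E)) * (b * (m `^ (r - 1) * W z')) <= _).
    by rewrite le_eqVlt; apply/orP; left; apply/eqP; ring.
  apply: le_trans Y1 _; rewrite mulrDr mulrDr; apply: lerD.
    by rewrite le_eqVlt; apply/orP; left; apply/eqP; ring.
  have -> : rho k (z - (z' : E)) * (b * (2 `^ (r - 1) * W z' `^ r)) =
    (2 `^ (r - 1) * (rho k (z - (z' : E)) * W z' `^ r)) * b by ring.
  have -> : 2 `^ (r - 1) * (rho k (z - (z' : E)) * (w z' * W z' `^ r)) =
    (2 `^ (r - 1) * (rho k (z - (z' : E)) * W z' `^ r)) * w z' by ring.
  apply: ler_wpM2l; last exact: Hb.
  by do ?apply: mulr_ge0 => //; exact: powR_ge0.
move: key; rewrite RintegralD//.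
- rewrite [X in _ <= _ + X]RintegralZl// [X in _ <= X + _]RintegralZl// -/(conv _ _ _).
  rewrite [X in _ * X + _ ](_ : _ = 1); last exact: (congr1 fine (integral_rho_sub_r k z)).
  rewrite -mulrA [m `^ _ * m]mulrC mulr_powRB1// mulr1 => key.
  have E2 : 2 `^ r = 2 * 2 `^ (r - 1) :> R by rewrite mulr_powRB1.
  rewrite E2; set c := conv _ _ _ in key *.
  rewrite -mulrA -[leLHS]mul1r.
  have : b * m `^ r <= 2^-1 * (b * m `^ r) + 2 `^ (r - 1) * c by rewrite mulrA.
  set X := b * _; set Y := _ * c; lra.
- exact: (integrableZl measurableT _ i0).
- exact: (integrableZl measurableT _ i2).
Qed.

(** The height of the kernel times the L^1 norm. This growth in k is what the Hoelder continuity of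
    the coefficient has to compensate. *)
Lemma conv_le_sup k W (z : E) I : measurable_fun setT W -> (forall z, 0 <= W z) ->
  (\int[mu]_z (W z)%:E <= I%:E)%E ->
  conv (rho k) W z <= (n.+1%:R / 2) ^+ n * k.+1%:R ^+ n.+2 * I.
Proof.
move=> mW W0 iW.
have iW' : (\int[mu]_z `|W z|%:E < +oo)%E.
  by under eq_integral do rewrite ger0_norm//; apply: le_lt_trans iW (ltry _).
have [C HC] := @rho_bounded R n k.
have i1 := integrable_conv z (@continuous_rho R n k) HC mW iW'.
have c0 : 0 <= (n.+1%:R / 2) ^+ n * k.+1%:R ^+ n.+2 :> R by rewrite mulr_ge0// exprn_ge0.
rewrite -lee_fin /conv /Rintegral fineK; last exact: integrable_fin_num i1.
rewrite EFinM; apply: le_trans (lee_wpmul2l _ iW); last by rewrite lee_fin.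
rewrite -ge0_integralZlR//.
apply: ge0_le_integralR => //.
- by apply: measurable_funM => //; apply: measurable_shifted; exact: continuous_rho.
- exact: measurable_funM.
- by move=> z' _; rewrite mulr_ge0 ?rho_ge0//= ler_wpM2r// rho_le.
Qed.

Lemma normr_conv_le k W (z : E) : measurable_fun setT W ->
  (\int[mu]_z `|W z|%:E < +oo)%E -> `|conv (rho k) W z| <= conv (rho k) (fun z => `|W z|) z.
Proof.
move=> mW iW; have [C HC] := @rho_bounded R n k.
have i1 := integrable_conv z (@continuous_rho R n k) HC mW iW.
apply: le_trans (le_normr_Rintegral _ i1) _ => //.
rewrite le_eqVlt; apply/orP; left; apply/eqP; apply: eq_Rintegral => z' _.
by rewrite normrM ger0_norm// rho_ge0.
Qed.

End conv_powR.

(** * Passage to the limit under double phase growth *)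

Section conv_limit.
Context {R : realType} {n : nat}.
Local Notation V := ('rV[R]_n * measurableTypeR R)%type.
Local Notation E := ('rV[R]_n * R)%type.
Local Notation mu := (@st_lebesgue R n).
Variables (p q alpha M Kc : R) (Q : set V) (b : V -> R).
Hypotheses (hp : 2 <= p) (hpq : p < q) (ha : 0 < alpha <= 1).
Hypothesis hpqa : (n%:R + 2) * (q - p) <= alpha * p.
Hypotheses (M0 : 0 <= M) (mQ : measurable Q) (QM : Q `<=` st_cube M M).
Hypotheses (mb : measurable_fun setT b) (b0 : forall z, 0 <= b z) (Kc0 : 0 <= Kc).
Hypothesis bK : forall z z' : V, Q z -> Q z' ->
  b z - b z' <= Kc * (enorm (z.1 - z'.1) `^ alpha + `|(z.2 : R) - z'.2| `^ (alpha / 2)).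

Implicit Types (W : V -> R) (k : nat).

Definition phase (W : V -> R) (z : V) : R := `|W z| `^ p + b z * `|W z| `^ q.

Lemma phase_ge0 W z : 0 <= phase W z.
Proof. by rewrite addr_ge0 ?powR_ge0// mulr_ge0// powR_ge0. Qed.

Lemma measurable_normr_powR (W : V -> R) r : measurable_fun setT W ->
  measurable_fun setT (fun z => `|W z| `^ r).
Proof.
move=> mW; apply: (measurableT_comp (measurable_powR r)).
exact: measurableT_comp.
Qed.

Lemma measurable_phase W : measurable_fun setT W -> measurable_fun setT (phase W).
Proof.
move=> mW; apply: measurable_funD; first exact: measurable_normr_powR.
by apply: measurable_funM => //; exact: measurable_normr_powR.
Qed.

Let mu_Q : (mu Q < +oo)%E.
Proof.
apply: (@le_lt_trans _ _ (mu (st_cube M M))).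
  by apply: le_measure; rewrite ?inE//; exact: measurable_st_cube.
by rewrite st_lebesgue_cube// ltry.
Qed.

Lemma phase_L1 W : measurable_fun setT W -> (forall z, ~ Q z -> W z = 0) ->
  (\int[mu]_z (phase W z)%:E < +oo)%E -> (\int[mu]_z `|W z|%:E < +oo)%E.
Proof.
move=> mW W0 iW.
apply: (@le_lt_trans _ _ (\int[mu]_z (\1_Q z + phase W z)%:E)%E).
  apply: ge0_le_integralR => //.
  - exact: measurableT_comp.
  - by apply: measurable_funD; [exact: measurable_indic|exact: measurable_phase].
  - move=> z _; rewrite normr_ge0 /=.
    have [Qz|nQz] := pselect (Q z); last first.
      by rewrite W0// normr0 addr_ge0 ?phase_ge0// indicE.
    have p1 : 1 <= p by have h := hp; lra.
    rewrite indicE mem_set//; apply: le_trans (le1_powR p1 (normr_ge0 (W z))) _.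
    by rewrite lerD2l lerDl mulr_ge0// powR_ge0.
rewrite ge0_integralDR//.
- by rewrite lte_add_pinfty// integral_indic// setIT.
- exact: measurable_phase.
- by move=> *; exact: phase_ge0.
Qed.

Lemma conv_rho_le k (W1 W2 : V -> R) (z : E) : measurable_fun setT W1 -> measurable_fun setT W2 ->
  (\int[mu]_z (W2 z)%:E < +oo)%E -> (forall z, 0 <= W1 z <= W2 z) ->
  conv (rho k) W1 z <= conv (rho k) W2 z.
Proof.
move=> m1 m2 i2 W12.
have [C HC] := @rho_bounded R n k.
have i2' : (\int[mu]_z `|W2 z|%:E < +oo)%E.
  under eq_integral => x _.
    have /andP[h1 h2] := W12 x; rewrite ger0_norm; last exact: le_trans h2.
    over.
  by [].
have i1' : (\int[mu]_z `|W1 z|%:E < +oo)%E.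
  apply: le_lt_trans i2'; apply: ge0_le_integralR => //; try exact: measurableT_comp.
  by move=> x _; have /andP[h1 h2] := W12 x; rewrite normr_ge0/= !ger0_norm// (le_trans h1).
apply: le_Rintegral => //.
- exact: (integrable_conv z (@continuous_rho R n k) HC m1 i1').
- exact: (integrable_conv z (@continuous_rho R n k) HC m2 i2').
- by move=> z' _; rewrite ler_wpM2l ?rho_ge0//; have /andP[] := W12 z'.
Qed.

(** The coefficient at z is split as be + de, where be bounds b from below on the part of the
    kernel's support where W lives, and de is the oscillation. The part with be obeys the weighted
    Jensen inequality; the part with de is reduced to the exponent p. *)
Lemma phase_conv_le W : measurable_fun setT W -> (forall z, ~ Q z -> W z = 0) ->
  (\int[mu]_z (phase W z)%:E < +oo)%E ->
  exists2 C, 0 <= C & forall k (z : V), Q z ->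
    phase (conv (rho k) W) z <= C * conv (rho k) (phase W) z.
Proof.
move=> mW W0 iW; have hp' := hp; have hpq' := hpq.
have iW1 := phase_L1 mW W0 iW.
have mphi := measurable_phase mW.
have mWp := @measurable_normr_powR W p mW.
have mWq : measurable_fun setT (fun z => b z * `|W z| `^ q).
  by apply: measurable_funM => //; exact: measurable_normr_powR.
have iWp : (\int[mu]_z (`|W z| `^ p)%:E < +oo)%E.
  apply: le_lt_trans iW; apply: ge0_le_integralR => // z _.
  by rewrite powR_ge0/= lerDl mulr_ge0// powR_ge0.
have iWq : (\int[mu]_z (b z * `|W z| `^ q)%:E < +oo)%E.
  apply: le_lt_trans iW; apply: ge0_le_integralR => // z _.
  by rewrite mulr_ge0 ?powR_ge0//= lerDr powR_ge0.
pose I := fine (\int[mu]_z (`|W z| `^ p)%:E)%E.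
have I0 : 0 <= I by apply: fine_ge0; apply: integral_ge0 => z _; rewrite lee_fin powR_ge0.
have IE : (\int[mu]_z (`|W z| `^ p)%:E = I%:E)%E.
  by rewrite fineK// ge0_fin_numE// integral_ge0// => z _; rewrite lee_fin powR_ge0.
pose cn : R := (n.+1%:R / 2) ^+ n.
have cn0 : 0 <= cn by rewrite exprn_ge0// divr_ge0.
(* It will bound de m^(q-p): 4 Kc comes from the oscillation of b, and the base of the power bounds
   m^p up to the factor ka^(n+2). *)
pose K2 := 4 * Kc * (2 `^ p * (cn * I)) `^ ((q - p) / p).
have K20 : 0 <= K2 by rewrite !mulr_ge0// powR_ge0.
exists (2 `^ p + K2 * 2 `^ p + 2 `^ q).
  by rewrite !addr_ge0 ?mulr_ge0 ?powR_ge0.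
move=> k z Qz.
pose ka : R := k.+1%:R.
have ka1 : 1 <= ka by rewrite ler1n.
have ka0 : 0 < ka by apply: lt_le_trans ka1.
have mnW : measurable_fun setT (fun z => `|W z|) by exact: measurableT_comp.
have inW : (\int[mu]_z `| `|W z| |%:E < +oo)%E by under eq_integral do rewrite normr_id.
pose m := conv (rho k) (fun z => `|W z|) z.
have m0 : 0 <= m by apply: conv_rho_ge0.
have Wm : `|conv (rho k) W z| <= m by exact: normr_conv_le.
pose cp := conv (rho k) (fun z => `|W z| `^ p) z.
pose cq := conv (rho k) (fun z => b z * `|W z| `^ q) z.
have p1 : 1 <= p by lra.
have q1 : 1 <= q by lra.
have cpH : cp <= conv (rho k) (phase W) z.
  apply: conv_rho_le => // y; rewrite powR_ge0/= lerDl mulr_ge0// powR_ge0//.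
have cqH : cq <= conv (rho k) (phase W) z.
  apply: conv_rho_le => // y; rewrite mulr_ge0 ?powR_ge0//= lerDr powR_ge0//.
have mp : m `^ p <= 2 `^ p * cp.
  have := @conv_jensen R n k (fun z => `|W z|) (cst 1) 1 p z p1 ler01 mnW.
  rewrite mul1r => H; apply: le_trans (H _ _ _ _ _ _) _ => //.
    by under eq_integral do rewrite mul1r.
  rewrite le_eqVlt; apply/orP; left; apply/eqP; congr (_ * _).
  by apply: eq_Rintegral => z' _; rewrite mul1r.
have cpI : cp <= cn * ka ^+ n.+2 * I.
  apply: conv_le_sup => //; last by rewrite IE.

(* Each of the two terms of the Hoelder estimate is at most 2 ka^(-alpha) on the support of the
   kernel, whence the 4. *)
pose de := Kc * (4 * ka `^ (- alpha)).
have de0 : 0 <= de by rewrite !mulr_ge0// powR_ge0.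
have al0 : 0 < alpha by case/andP: ha.
have al1 : alpha <= 1 by case/andP: ha.
(* Truncated at 0 because [conv_jensen] asks for a nonnegative constant; the weight b is nonnegative
   and so still dominates it. *)
pose be := Num.max 0 (b z - de).
have mq : be * m `^ q <= 2 `^ q * cq.
  apply: (@conv_jensen R n k (fun z => `|W z|) b be q z q1) => //.
    by rewrite le_max lexx.
  (* Where W does not vanish the point z' is in Q, and this is where the Hoelder estimate is
     available. *)
  move=> z' rn0; rewrite normr_eq0 => Wn0.
  have Qz' : Q z' by apply: contra_neqP Wn0 => /W0.
  rewrite ge_max b0/= lerBlDr -lerBlDl; apply: le_trans (bK Qz Qz') _.
  rewrite ler_wpM2l//.
  have [H1 H2] := rho_supp rn0.
  have A1 : enorm (z.1 - z'.1) `^ alpha <= 2 * ka `^ (- alpha).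
    apply: le_trans (_ : (2 / ka) `^ alpha <= _).
      by apply: le_powR; rewrite ?enorm_ge0 ?(ltW al0)// ltW.
    rewrite powRM ?invr_ge0 ?(ltW ka0)// -[ka^-1]powR_inv1 ?(ltW ka0)// -powRrM mulN1r.
    by rewrite ler_wpM2r ?powR_ge0// ler1_powR// ler1n.
  have A2 : `|(z.2 : R) - z'.2| `^ (alpha / 2) <= 2 * ka `^ (- alpha).
    apply: le_trans (_ : (2 / ka ^+ 2) `^ (alpha / 2) <= _).
      by apply: le_powR; [lra|exact: normr_ge0|exact: ltW].
    have -> : ka ^- 2 = ka `^ (- 2%:R) by rewrite powR_invn// ltW.
    rewrite powRM ?powR_ge0// -powRrM.
    have -> : - 2%:R * (alpha / 2) = - alpha by field.
    by rewrite ler_wpM2r ?powR_ge0// ler1_powR ?ler1n//; lra.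
  by have := lerD A1 A2; set X := ka `^ _ => ?; lra.
(* Written as (m^p)^((q-p)/p), the power of m is at most a constant times ka^((n+2)(q-p)/p). The gap
   condition bounds this by ka^alpha, which cancels the decay of de. *)
have dm : de * m `^ (q - p) <= K2.
  have th0 : 0 <= (q - p) / p by rewrite divr_ge0//; lra.
  have -> : m `^ (q - p) = (m `^ p) `^ ((q - p) / p).
    by rewrite -powRrM mulrC divfK// gt_eqF//; lra.
  apply: le_trans (_ : de * ((2 `^ p * (cn * I)) `^ ((q - p) / p) * ka `^ alpha) <= _).
    rewrite ler_wpM2l//.
    apply: le_trans (_ : (2 `^ p * (cn * I) * ka ^+ n.+2) `^ ((q - p) / p) <= _).
      apply: le_powR => //; first exact: powR_ge0.
      apply: le_trans mp _; rewrite -mulrA ler_wpM2l ?powR_ge0//.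
      by apply: le_trans cpI _; rewrite le_eqVlt; apply/orP; left; apply/eqP; ring.
    rewrite powRM ?exprn_ge0 ?(ltW ka0)// ?mulr_ge0 ?powR_ge0//.
    rewrite ler_wpM2l ?powR_ge0// -powR_mulrn ?(ltW ka0)// -powRrM ler_powR//.
    rewrite mulrA ler_pdivrMr; last by lra.
    by rewrite -addn2 natrD.
  rewrite /de /K2 -[X in _ <= X]mulr1.
  have -> : 1 = ka `^ (- alpha) * ka `^ alpha :> R.
    by rewrite -powRD ?addNr ?powRr0// ?eqxx gt_eqF.
  by rewrite le_eqVlt; apply/orP; left; apply/eqP; ring.
(* In the excess part m^q is factored as m^(q-p) m^p, so that only the Jensen bound for the exponent
   p is needed. *)
have bm : b z * m `^ q <= 2 `^ q * cq + K2 * (2 `^ p * cp).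
  have h1 : b z <= be + de by rewrite -lerBlDr le_max lexx orbT.
  apply: le_trans (ler_wpM2r (powR_ge0 _ _) h1) _; rewrite mulrDl; apply: lerD => //.
  have -> : m `^ q = m `^ (q - p) * m `^ p.
    have qn0 : q != 0 by rewrite gt_eqF//; lra.
    by rewrite -powRD subrK// (negbTE qn0).
  rewrite [leLHS]mulrA; apply: ler_pM => //; try exact: powR_ge0.
  by apply: mulr_ge0 => //; exact: powR_ge0.
have Hc0 : 0 <= conv (rho k) (phase W) z by apply: conv_rho_ge0 => *; exact: phase_ge0.
have h1 : `|conv (rho k) W z| `^ p <= 2 `^ p * conv (rho k) (phase W) z.
  apply: le_trans (_ : m `^ p <= _); first by apply: le_powR; rewrite ?normr_ge0//; lra.
  by apply: le_trans mp _; rewrite ler_wpM2l// powR_ge0.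
have h2 : b z * `|conv (rho k) W z| `^ q <= (K2 * 2 `^ p + 2 `^ q) * conv (rho k) (phase W) z.
  apply: le_trans (_ : b z * m `^ q <= _).
    by rewrite ler_wpM2l//; apply: le_powR; rewrite ?normr_ge0//; lra.
  apply: le_trans bm _; rewrite mulrDl addrC; apply: lerD.
    by rewrite mulrA ler_wpM2l// mulr_ge0// powR_ge0.
  by rewrite ler_wpM2l// powR_ge0.
by apply: le_trans (lerD h1 h2) _; rewrite le_eqVlt; apply/orP; left; apply/eqP; ring.
Qed.

(** Dominated convergence: B is finite everywhere, so each point leaves the set |B| > N once N is
    large. *)
Lemma integral_level_tail (B g : V -> R) : measurable_fun setT B -> measurable_fun setT g ->
  (forall z, 0 <= g z) -> (\int[mu]_z (g z)%:E < +oo)%E ->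
  forall e, 0 < e -> exists N : nat,
    (\int[mu]_z (\1_[set z | (N%:R < `|B z|)%R] z * g z)%:E <= e%:E)%E.
Proof.
move=> mB mg g0 ig e e0.
have mS (N : nat) : measurable [set z : V | N%:R < `|B z|].
  rewrite (_ : mkset _ = (fun z => `|B z|) @^-1` `]N%:R, +oo[%classic).
    rewrite -[X in measurable X]setTI.
    have mn : measurable_fun setT (fun z => `|B z|) by exact: measurableT_comp.
    exact: mn.
  by apply/seteqP; split => z /=; rewrite in_itv/= andbT.
pose f (N : nat) (z : V) : \bar R := (\1_[set z | (N%:R < `|B z|)%R] z * g z)%:E.
have mf N : measurable_fun setT (f N).
  by apply/measurable_EFinP; apply: measurable_funM => //; exact: measurable_indic.
have ig' : mu.-integrable setT (EFin \o g).
  apply: (@integrableR _ _ _ _ _ g g) => // z _; by rewrite ger0_norm.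
have [||//||_ _ cf] := @dominated_convergence _ _ _ mu setT measurableT f (cst 0%E) (EFin \o g) mf.
- exact: measurable_cst.
- apply: aeW => z _.
  apply: cvg_near_cst.
  near=> N; rewrite /f indicE memNset ?mul0r//=.
  apply/negP; rewrite -leNgt; near: N.
  exists (Num.bound `|B z|) => // N /= HN.
  by rewrite ltW// (lt_le_trans (archi_boundP _))// ler_nat.
- apply: aeW => z N _; rewrite /f /= lee_fin ger0_norm; last by rewrite mulr_ge0// indicE.
  by rewrite ler_piMl// indicE; case: (_ \in _).
rewrite integral0 in cf.
have [N _ HN] : \forall N \near \oo, (\int[mu]_z f N z < e%:E)%E.
  have /fine_cvgP[fB cB] := cf.
  have /cvgr0Pnorm_lt/(_ _ e0) := cB.
  apply: filter_app; apply: filterS fB => N fN /=.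
  rewrite ger0_norm ?fine_ge0 ?integral_ge0// -?lte_fin ?fineK//.
  by move=> z _; rewrite lee_fin mulr_ge0// indicE.
by exists N; apply/ltW; exact: (HN N (leqnn N)).
Unshelve. all: by end_near. Qed.

(** Where |B| <= N, L^1 convergence of the mollifications suffices. Where |B| > N, both products are
    bounded by phases, and the mollified phase is the phase plus an error tending to 0 in L^1. The
    tail is thus small uniformly in k, and N can be fixed first. *)
Lemma conv_limit (B W f : V -> R) (C0 : R) : 0 <= C0 ->
  measurable_fun setT B -> measurable_fun setT W -> measurable_fun setT f ->
  (forall z, 0 <= f z) -> (forall z, ~ Q z -> W z = 0) -> (forall z, ~ Q z -> B z = 0) ->
  (forall z, `|B z| <= C0 * (f z `^ (p - 1) + b z * f z `^ (q - 1))) ->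
  (\int[mu]_z (phase f z)%:E < +oo)%E -> (\int[mu]_z (phase W z)%:E < +oo)%E ->
  mu.-integrable setT (EFin \o (fun z => B z * W z)) /\
  (forall k, mu.-integrable setT (EFin \o (fun z : V => B z * conv (rho k) W z))) /\
  (fun k => \int[mu]_z (B z * conv (rho k) W z)) @ \oo --> \int[mu]_z (B z * W z).
Proof.
move=> C00 mB mW mf f0 W0 B0 BC i_f iW; have hp' := hp; have hpq' := hpq.
have iW1 := phase_L1 mW W0 iW.
have [C1 C10 HC1] := phase_conv_le mW W0 iW.
have mphW := measurable_phase mW; have mphf := measurable_phase mf.
have iphW : (\int[mu]_z `|phase W z|%:E < +oo)%E.
  by under eq_integral do rewrite ger0_norm ?phase_ge0//.
have crho k : continuous (conv (rho k) W).
  exact: continuous_conv (@continuous_rho R n k) (@supp_in_rho R n k) mW iW1.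
have mrho k : measurable_fun setT (conv (rho k) W : V -> R) by exact: continuous_measurable_st.
have chk k : continuous (conv (rho k) (phase W)).
  exact: continuous_conv (@continuous_rho R n k) (@supp_in_rho R n k) mphW iphW.
have mhk k : measurable_fun setT (conv (rho k) (phase W) : V -> R) by exact: continuous_measurable_st.
(* Pointwise Young inequality for each exponent, with the value y left free: it is applied both to W
   z and to its mollification. *)
have BY (z : V) y : `|B z * y| <= C0 * (phase f z + (`|y| `^ p + b z * `|y| `^ q)).
  rewrite normrM; apply: le_trans (ler_wpM2r (normr_ge0 _) (BC z)) _.
  rewrite -mulrA ler_wpM2l// mulrDl /phase (ger0_norm (f0 z)).
  have p1 : 1 <= p by lra. have q1 : 1 <= q by lra.
  have Y1 := young1 p1 (f0 z) (normr_ge0 y).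
  have Y2 := ler_wpM2l (b0 z) (young1 q1 (f0 z) (normr_ge0 y)).
  by rewrite mulrDr in Y2; rewrite -mulrA; lra.
have iBW : mu.-integrable setT (EFin \o (fun z => B z * W z)).
  have m1 : measurable_fun setT (fun z => B z * W z) by exact: measurable_funM.
  have m2 : measurable_fun setT (fun z => C0 * (phase f z + phase W z)).
    by apply: measurable_funM => //; exact: measurable_funD.
  apply: (integrableR measurableT m1 m2 (fun z _ => BY z (W z))).
  rewrite ge0_integralZlR//;
    try (exact: measurable_funD);
    try (by move=> z _; rewrite addr_ge0 ?phase_ge0).
    rewrite ge0_integralDR//; try by move=> *; exact: phase_ge0.
    apply: lte_mul_pinfty; [by rewrite lee_fin|by []|exact: lte_add_pinfty i_f iW].
have vW : vanishes (L1mod setT W).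
  by apply: (L1mod_vanish M0) => // z Hz; apply: W0 => /QM.
have vH : vanishes (L1mod setT (phase W)).
  apply: (L1mod_vanish M0) => // z Hz; rewrite /phase W0 ?normr0; last by move=> /QM.
  by rewrite !powR0 ?mulr0 ?addr0// gt_eqF//; lra.
have L1_hk k : (\int[mu]_z `|conv (rho k) (phase W) z|%:E < +oo)%E.
  apply: (@le_lt_trans _ _ (\int[mu]_z (`|conv (rho k) (phase W) z - phase W z| + `|phase W z|)%R%:E)%E).
    apply: ge0_le_integralR => //.
    - exact: measurableT_comp.
    - apply: measurable_funD; apply: measurableT_comp => //; exact: measurable_funB.
    - move=> z _; rewrite normr_ge0/=; apply: le_trans (ler_normD _ _).
      by rewrite subrK.
  rewrite ge0_integralDR//;
    try (by apply: measurableT_comp => //; exact: measurable_funB);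
    try (exact: measurableT_comp).
  rewrite lte_add_pinfty//.
  apply: le_lt_trans (conv_L1_le (mhk k) mphW iphW) _.
  apply: le_lt_trans (L1mod_bound measurableT measurableT mphW _ _) _ => //.
  rewrite lte_mul_pinfty ?lee_fin//.
  by under eq_integral do rewrite indicE mem_set// mul1r.
(* The comparison of [phase_conv_le] concerns points of Q; off Q the factor B vanishes. *)
have Bk k (z : V) : `|B z * conv (rho k) W z| <= C0 * (phase f z + C1 * conv (rho k) (phase W) z).
  have [Qz|nQz] := pselect (Q z).
    apply: le_trans (BY z _) _; rewrite ler_wpM2l// lerD2l.
    exact: HC1.
  rewrite B0// mul0r normr0 mulr_ge0// addr_ge0 ?phase_ge0// mulr_ge0//.
  by apply: conv_rho_ge0 => *; exact: phase_ge0.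
have mBk k : measurable_fun setT (fun z : V => B z * conv (rho k) W z) by exact: measurable_funM.
have iBk k : mu.-integrable setT (EFin \o (fun z : V => B z * conv (rho k) W z)).
  have m2 : measurable_fun setT (fun z : V => C0 * (phase f z + C1 * `|conv (rho k) (phase W) z|)).
    apply: measurable_funM => //; apply: measurable_funD => //.
    by apply: measurable_funM => //; exact: measurableT_comp.
  apply: (integrableR measurableT (mBk k) m2).
    move=> z _; apply: le_trans (Bk k z) _; rewrite ler_wpM2l// lerD2l ler_wpM2l//.
    exact: ler_norm.
  - have m1 : measurable_fun setT (fun z : V => C1 * `|conv (rho k) (phase W) z|).
      by apply: measurable_funM => //; exact: measurableT_comp.
    rewrite ge0_integralZlR//;
    try (exact: measurable_funD);
    try (by move=> z _; rewrite addr_ge0 ?phase_ge0// mulr_ge0).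
    rewrite ge0_integralDR//; [|by move=> *; exact: phase_ge0|by move=> *; exact: mulr_ge0].
    rewrite ge0_integralZlR//; last exact: measurableT_comp.
    apply: lte_mul_pinfty; [by rewrite lee_fin|by []|apply: (lte_add_pinfty i_f)].
    by apply: lte_mul_pinfty; [rewrite lee_fin|by []|exact: L1_hk].
split => //; split => //.
apply/cvgrPdist_le => e e0.
have e3 : 0 < e / 3 by rewrite divr_gt0.
(* The sum of the bounds for the two products, once the mollified phase is replaced by the phase;
   the error made in doing so is kept apart, with coefficient C0 C1. *)
pose g (z : V) := C0 * (2 * phase f z + (C1 + 1) * phase W z).
have mg : measurable_fun setT g.
  by apply: measurable_funM => //; apply: measurable_funD; exact: measurable_funM.
have g0 z : 0 <= g z.
  by rewrite mulr_ge0// addr_ge0// mulr_ge0 ?phase_ge0// addr_ge0.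
have ig : (\int[mu]_z (g z)%:E < +oo)%E.
  rewrite ge0_integralZlR//;
    try (by apply: measurable_funD; exact: measurable_funM);
    try (by move=> z _; rewrite addr_ge0// mulr_ge0 ?phase_ge0// addr_ge0).
  rewrite ge0_integralDR//; try exact: measurable_funM;
    try (by move=> z _; rewrite mulr_ge0 ?phase_ge0);
    try (by move=> z _; rewrite mulr_ge0 ?phase_ge0// addr_ge0).
  rewrite !ge0_integralZlR ?addr_ge0//; try by move=> *; exact: phase_ge0.
  apply: lte_mul_pinfty; [by rewrite lee_fin|by []|apply: lte_add_pinfty].
    by apply: lte_mul_pinfty; [rewrite lee_fin|by []|exact: i_f].
  by apply: lte_mul_pinfty; [rewrite lee_fin addr_ge0|by []|exact: iW].
have [N HN] := integral_level_tail mB mg g0 ig e3.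
have mS : measurable [set z : V | N%:R < `|B z|].
  rewrite (_ : mkset _ = (fun z => `|B z|) @^-1` `]N%:R, +oo[%classic).
    rewrite -[X in measurable X]setTI.
    have mn : measurable_fun setT (fun z => `|B z|) by exact: measurableT_comp.
    exact: mn.
  by apply/seteqP; split => z /=; rewrite in_itv/= andbT.
set S := [set z : V | N%:R < `|B z|] in HN mS *.
have [N1 HN1] := vanishesZ (ler0n R N) vW e3.
have CC0 : 0 <= C0 * C1 by exact: mulr_ge0.
have [N2 HN2] := vanishesZ CC0 vH e3.
exists (maxn N1 N2) => // k; rewrite /= geq_max => /andP[/HN1 H1 /HN2 H2].
rewrite -RintegralB//.
have i3 : mu.-integrable setT (EFin \o (fun z : V => B z * W z - B z * conv (rho k) W z)).
  exact: (integrableB measurableT iBW (iBk k)).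
rewrite -lee_fin EFin_normr_Rintegral//.
apply: le_trans (le_abse_integral _ _ _) _ => //; first by case/integrableP: i3.
have mD1 : measurable_fun setT (fun z : V => `|conv (rho k) W z - W z|).
  by apply: measurableT_comp => //; exact: measurable_funB.
have mD2 : measurable_fun setT (fun z : V => `|conv (rho k) (phase W) z - phase W z|).
  by apply: measurableT_comp => //; exact: measurable_funB.
have mSg : measurable_fun setT (fun z => \1_S z * g z).
  by apply: measurable_funM => //; exact: measurable_indic.
apply: (@le_trans _ _ (\int[mu]_z (N%:R * `|conv (rho k) W z - W z| + (\1_S z * g z +
    C0 * C1 * `|conv (rho k) (phase W) z - phase W z|))%R%:E)%E).
  apply: ge0_le_integralR => //.
  - apply: measurableT_comp => //; apply: measurable_funB => //; exact: measurable_funM.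
  - apply: measurable_funD; first exact: measurable_funM.
    by apply: measurable_funD => //; exact: measurable_funM.
  move=> z _; rewrite normr_ge0/= -mulrBr.
  have Sg0 : 0 <= \1_S z * g z by rewrite mulr_ge0// indicE.
  have hn0 : 0 <= C0 * C1 * `|conv (rho k) (phase W) z - phase W z| by rewrite mulr_ge0.
  have [Qz|nQz] := pselect (Q z); last first.
    by rewrite B0// mul0r normr0 !addr_ge0// mulr_ge0.
  have [BN|NB] := leP `|B z| N%:R.
    rewrite normrM distrC (@le_trans _ _ (N%:R * `|conv (rho k) W z - W z|))//.
      by rewrite ler_wpM2r.
    by rewrite lerDl addr_ge0.
  rewrite [\1_S z]indicE mem_set// mul1r mulrBr.
  apply: le_trans (ler_normB _ _) _.
  apply: (@le_trans _ _ (g z + C0 * C1 * `|conv (rho k) (phase W) z - phase W z|)); last first.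
    by rewrite lerDr mulr_ge0.
  have h1 := BY z (W z).
  have h2 := Bk k z.
  have h3 : conv (rho k) (phase W) z <= `|conv (rho k) (phase W) z - phase W z| + phase W z.
    by rewrite -lerBlDr ler_norm.
  have h4 := ler_wpM2l CC0 h3.
  rewrite -/(phase W z) in h1.
  apply: le_trans (lerD h1 h2) _; rewrite /g.
  apply: le_trans (_ : C0 * (phase f z + phase W z) + C0 * phase f z + C0 * C1 * conv (rho k) (phase W) z <= _).
    by rewrite le_eqVlt; apply/orP; left; apply/eqP; ring.
  apply: le_trans (lerD (lexx _) h4) _.
  by rewrite le_eqVlt; apply/orP; left; apply/eqP; ring.
rewrite ge0_integralDR//;
    try (exact: measurable_funM);
    try (by apply: measurable_funD => //; exact: measurable_funM);
    try (by move=> z _; rewrite mulr_ge0);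
    try (by move=> z _; rewrite addr_ge0// mulr_ge0// ?indicE).
rewrite ge0_integralDR//;
    try (exact: measurable_funM);
    try (by move=> z _; rewrite mulr_ge0// indicE);
    try (by move=> z _; rewrite mulr_ge0).
rewrite !ge0_integralZlR//.
have -> : e = e / 3 + (e / 3 + e / 3) by field.
rewrite !EFinD; apply: leeD; last apply: leeD => //.
- apply: le_trans H1; apply: lee_wpmul2l; first by rewrite lee_fin.
  exact: conv_L1_le.
- apply: le_trans H2; apply: lee_wpmul2l; first by rewrite lee_fin.
  exact: conv_L1_le.
Qed.

End conv_limit.

(** * Testing the equation with mollifications *)

Section test_functions.
Context {R : realType}.
Implicit Types V W : normedModType R.

Lemma closureS_compact (V : normedModType R) (A B : set V) :
  A `<=` B -> compact (closure B) -> compact (closure A).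
Proof.
by move=> AB cB; apply: (subclosed_compact _ cB); [exact: closed_closure|exact: closure_subset].
Qed.

Lemma test_functionS V W W' (D : set V) (f : V -> W) (g : V -> W') :
  test_function D f -> smooth g -> (forall z, g z != 0 -> f z != 0) -> test_function D g.
Proof.
move=> [sf cf fD] sg gf.
have S : [set z | g z != 0] `<=` [set z | f z != 0] by move=> z /gf.
split => //; first exact: closureS_compact cf.
exact: subset_trans (closure_subset S) fD.
Qed.

Lemma test_function_near0 V W (D : set V) (f : V -> W) z : test_function D f -> ~ D z ->
  \forall y \near z, f y = 0.
Proof.
move=> [_ _ fD] nDz.
have nz : ~ closure [set z | f z != 0] z by move=> /fD.
have oC : open (~` closure [set z | f z != 0]) by exact/closed_openC/closed_closure.
have : \forall y \near z, (~` closure [set z | f z != 0]) y.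
  by apply: open_nbhs_nbhs; split.
apply: filterS => y ny; apply: contra_notP ny => /eqP fy.
exact: subset_closure.
Qed.

Lemma test_function0 V W (D : set V) (f : V -> W) z : test_function D f -> ~ D z -> f z = 0.
Proof. by move=> tf nDz; exact: nbhs_singleton (test_function_near0 tf nDz). Qed.

Lemma test_function_derive0 V W (D : set V) (f : V -> W) z v :
  test_function D f -> ~ D z -> 'D_v f z = 0.
Proof.
move=> tf nDz; have H := test_function_near0 tf nDz.
have H' : \forall y \near z, f y = cst 0 y by [].
by rewrite (near_eq_derive _ H') derive_cst.
Qed.

End test_functions.

Section st_calculus.
Context {R : realType} {n : nat}.
Local Notation V := ('rV[R]_n * measurableTypeR R)%type.
Local Notation E := ('rV[R]_n * R)%type.
Local Notation mu := (@st_lebesgue R n).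
Implicit Types (W : V -> R) (k : nat) (M : R).

Lemma test_function_supp_in M (Q : set V) (f : E -> R) :
  Q `<=` st_cube M M -> test_function Q f -> supp_in M f.
Proof. by move=> QM [_ _ fQ] z fz; apply/QM/fQ; exact: subset_closure. Qed.

Lemma integrable_st_shift (w : E) W : measurable_fun setT W ->
  mu.-integrable setT (EFin \o W) -> mu.-integrable setT (EFin \o (fun z => W (st_add w z))).
Proof.
move=> mW /integrableP[_ iW]; apply/integrableP; split.
  by apply/measurable_EFinP; exact: (measurableT_comp mW (measurable_st_add w)).
rewrite [X in (X < _)%E](_ : _ = (\int[mu]_z `|(EFin \o W) z|)%E)//.
rewrite -[RHS](ge0_integral_st_shift w)//.
by apply: measurableT_comp => //; apply/measurable_EFinP.
Qed.

Lemma Rintegral_st_shift (w : E) W : measurable_fun setT W ->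
  mu.-integrable setT (EFin \o W) ->
  \int[mu]_z W (st_add w z) = \int[mu]_z W z.
Proof.
move=> mW iW; rewrite /Rintegral; congr fine.
have m_w := measurable_st_add w.
have -> : (\int[mu]_z (W z)%:E = \int[pushforward mu (st_add w)]_z (W z)%:E)%E.
  by apply: eq_measure_integral => A mA _; rewrite -(st_lebesgue_shift w).
rewrite integral_pushforward ?preimage_setT//.
- by apply/measurable_EFinP.
- exact: integrable_st_shift.
Qed.

Lemma integrable_supp_in M (f : E -> R) : continuous f -> supp_in M f ->
  mu.-integrable setT (EFin \o (f : V -> R)).
Proof.
move=> cf sf; have [C C0 HC] := supp_in_bounded cf sf.
have mC : measurable (st_cube M M : set V) by exact: measurable_st_cube.
have mI : measurable_fun setT (fun z : V => C * \1_(st_cube M M) z).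
  by apply: measurable_funM => //; exact: measurable_indic.
apply: (integrableR measurableT _ mI).
- exact: continuous_measurable_st.
- move=> z _; have [->|/sf fz] := eqVneq (f z) 0.
    by rewrite normr0 mulr_ge0// indicE.
  by rewrite indicE mem_set// mulr1.
- rewrite ge0_integralZlR//.
  rewrite integral_indic// setIT lte_mul_pinfty ?lee_fin//.
  have [M0|M0] := leP 0 M; first by rewrite st_lebesgue_cube ?ltry.
  suff -> : st_cube M M = set0 :> set V by rewrite measure0 ltry.
  by rewrite -subset0 => z [_ H]; have := le_lt_trans (normr_ge0 _) H; lra.
Qed.

(** The reflection g of f is convolved with the indicator of a large cube. Near 0 the result is
    constant, equal to the integral of f, so its derivative is 0; but this derivative is also the
    integral of ['D_v f]. The reflection turns the direction v into - v. *)
Lemma zero_int_derive M (f : E -> R) (v : E) : smooth f -> supp_in M f ->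
  \int[mu]_z 'D_v f z = 0.
Proof.
move=> sf sM.
pose g : E -> R := fun z => f (- z).
have lN : linear (fun z : E => - z) by move=> a x y; rewrite opprD scalerN.
have cN : continuous (fun z : E => - z) by move=> z; exact: opp_continuous.
have sg : smooth g by exact: smooth_comp_linear.
have sgM : supp_in M g.
  move=> z /sM[H1 H2]; split => [i|]; last by move: H2; rewrite normrN.
  by have := H1 i; rewrite mxE normrN.
have Dg (y : E) : 'D_(- v) g y = 'D_v f (- y).
  have df : derivable f (- y + 0) (- - v) by exact: smooth_derivable.
  have [_] := is_derive_comp_affine lN df.
  rewrite opprK addr0 => <-; congr ('D_(- v) _ y).
  by apply/funext => z; rewrite addr0.
pose C := st_cube (M + 2) (M + 2) : set V.
have mC : measurable C by exact: measurable_st_cube.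
have mI : measurable_fun setT (\1_C : V -> R) by exact: measurable_indic.
have iI : (\int[mu]_z `|\1_C z : R|%:E < +oo)%E.
  under eq_integral do rewrite ger0_norm//.
  rewrite integral_indic// setIT.
  have [M0|M0] := leP 0 (M + 2); first by rewrite st_lebesgue_cube ?ltry.
  suff -> : C = set0 by rewrite measure0 ltry.
  by rewrite -subset0 => z [_ H]; have := le_lt_trans (normr_ge0 _) H; lra.
(* For z in the unit cube the translate of the support of f stays inside C, so the indicator is
   invisible and translation invariance applies. *)
have Hconst : \forall z \near (0 : E), conv g \1_C z = cst (\int[mu]_z f z) z.
  have := @st_cube1_near0 R n; apply: filterS => z [z1 z2].
  have mf : measurable_fun setT (f : V -> R).
    by apply: continuous_measurable_st => //; exact: smooth_continuous.
  rewrite /= -(Rintegral_st_shift (- z) mf); last exact: integrable_supp_in (smooth_continuous sf) sM.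
  apply: eq_Rintegral => z' _; rewrite /g opprB.
  rewrite (_ : st_add (- z) z' = (z' : E) - z)//.
  have [->|fn0] := eqVneq (f ((z' : E) - z)) 0; first by rewrite mul0r.
  rewrite indicE mem_set ?mulr1//.
  have [H1 H2] := sM _ fn0; split => [i|].
    have := H1 i; have := z1 i; rewrite !mxE !ltr_norml => /andP[? ?] /andP[? ?].
    by apply/andP; split; lra.
  move: H2 z2; rewrite /= !ltr_norml => /andP[? ?] /andP[? ?].
  by apply/andP; split; lra.
have [_] := conv_is_derive 0 (- v) sg sgM mI iI.
rewrite (near_eq_derive _ Hconst) derive_cst => /esym <-.
apply: eq_Rintegral => z' _; rewrite Dg sub0r opprK.
have [->|fn0] := eqVneq ('D_v f z') 0; first by rewrite mul0r.
rewrite indicE mem_set ?mulr1//.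
by have := supp_in_derive sM fn0; apply: st_cube_sub; rewrite lerD2l ler1n.
Qed.

(** The integrand W(z) g(z - z') W(z') changes sign when z and z' are exchanged. Boundedness of g
    and integrability of W make it integrable on the product, so that Fubini's theorem allows the
    exchange. *)
Lemma odd_conv_int (g : E -> R) (C : R) W : continuous g -> (forall z, `|g z| <= C) ->
  (forall z, g (- z) = - g z) -> measurable_fun setT W ->
  (\int[mu]_z `|W z|%:E < +oo)%E -> \int[mu]_z (W z * conv g W z) = 0.
Proof.
move=> cg gC gN mW iW.
have C0 : 0 <= C by apply: le_trans (gC 0).
pose F (y : V * V) : R := W y.1 * (g (st_sub y) * W y.2).
have mg : measurable_fun setT (g : V -> R) by exact: continuous_measurable_st.
have mF : measurable_fun setT F.
  apply: measurable_funM; first exact: (measurableT_comp mW measurable_fst).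
  apply: measurable_funM; first exact: (measurableT_comp mg measurable_st_sub).
  exact: (measurableT_comp mW measurable_snd).
have FI (z : V) : (\int[@stm R n]_z' (F (z, z'))%:E = (W z * conv g W z)%:E)%E.
  have i1 := integrable_conv z cg gC mW iW.
  rewrite EFinM /conv /Rintegral fineK; last exact: integrable_fin_num i1.
  by rewrite -[RHS](integralZl measurableT i1).
have iF : (@stm R n \x @stm R n)%E.-integrable setT (EFin \o F).
  apply/integrable12ltyP; first exact/measurable_EFinP.
  apply: (@le_lt_trans _ _ (\int[mu]_z (fine (C%:E * \int[mu]_z `|W z|%:E) * `|W z|)%:E)%E).
    apply: (@ge0_le_integral _ _ _ (@stm R n)) => //.
    - by move=> z _; apply: integral_ge0 => z' _; rewrite abse_ge0.
    - apply: (@measurable_fun_fubini_tonelli_F _ _ V V R (@stm R n) (fun y => `|(F y)%:E|%E)) => //.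
      by apply: measurableT_comp => //; exact/measurable_EFinP.
    - apply/measurable_EFinP; apply: measurable_funM => //; exact: measurableT_comp.
    - move=> z _; rewrite EFinM fineK; last first.
        by rewrite ge0_fin_numE ?lte_mul_pinfty ?lee_fin// mule_ge0 ?lee_fin// integral_ge0.
      rewrite -ge0_integralZlR//; last exact: measurableT_comp.
      have mCW : measurable_fun setT (fun z' => C * `|W z'|).
        by apply: measurable_funM => //; exact: measurableT_comp.
      rewrite muleC -ge0_integralZlR//; last by move=> z' _; rewrite mulr_ge0.
      apply: (@ge0_le_integral _ _ _ (@stm R n)) => //.
      + apply: measurableT_comp => //; apply/measurable_EFinP.
        exact: (measurableT_comp mF (measurable_pair1 z)).
      + by apply/measurable_EFinP; exact: measurable_funM.
      + move=> z' _; rewrite /F /= lee_fin !normrM ler_wpM2l// ler_wpM2r//.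
  rewrite ge0_integralZlR//; last 2 first.
    exact: measurableT_comp.
    by rewrite fine_ge0// mule_ge0 ?lee_fin// integral_ge0.
  by rewrite lte_mul_pinfty// ?lee_fin ?fine_ge0// mule_ge0 ?lee_fin// integral_ge0.
have FB := Fubini iF.
have E1 : (\int[@stm R n]_z \int[@stm R n]_z' (EFin \o F) (z, z') =
   \int[mu]_z (W z * conv g W z)%:E)%E.
  by apply: eq_integral => z _; exact: FI.
have E2 : (\int[@stm R n]_z' \int[@stm R n]_z (EFin \o F) (z, z') =
   \int[mu]_z (- (W z * conv g W z))%:E)%E.
  apply: eq_integral => z' _; rewrite EFinN -FI -integralN; last first.
    have i1 := integrable_conv z' cg gC mW iW.
    have := integrable_add_def measurableT (integrableZl measurableT (W z') i1).
    by [].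
  apply: eq_integral => z _.
  rewrite -[RHS]/((- F (z', z))%:E); congr EFin.
  by rewrite /F /st_sub /= -opprB gN; ring.
have : \int[mu]_z (W z * conv g W z) = - \int[mu]_z (W z * conv g W z).
  rewrite {1}/Rintegral -E1 FB E2 -/(Rintegral _ _ _).
  have i0 : mu.-integrable setT (EFin \o (fun z : V => W z * conv g W z)).
    have := integrable_fubini_F iF; congr (_.-integrable _ _).
    by apply/funext => z; rewrite /= -FI.
  under eq_Rintegral do rewrite -mulN1r.
  by rewrite RintegralZl// mulN1r.
by lra.
Qed.

End st_calculus.

Section finite_sums.
Context {R : realType}.

Lemma integrable_fsum d (T : measurableType d) (mu : {measure set T -> \bar R}) (D : set T)
    (I : finType) (f : I -> T -> R) : measurable D ->
  (forall i, mu.-integrable D (EFin \o f i)) ->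
  mu.-integrable D (EFin \o (fun x => \sum_i f i x)).
Proof.
move=> mD fi; elim: (index_enum I) => [|i s IH].
  by under [X in EFin \o X]eq_fun do rewrite big_nil; exact: integrable0.
under [X in EFin \o X]eq_fun do rewrite big_cons.
exact: (integrableD mD (fi i) IH).
Qed.

Lemma Rintegral_fsum d (T : measurableType d) (mu : {measure set T -> \bar R}) (D : set T)
    (I : finType) (f : I -> T -> R) : measurable D ->
  (forall i, mu.-integrable D (EFin \o f i)) ->
  \int[mu]_(x in D) (\sum_i f i x) = \sum_i \int[mu]_(x in D) f i x.
Proof.
move=> mD fi; have sI s : mu.-integrable D (EFin \o (fun x => \sum_(i <- s) f i x)).
  elim: s => [|i s IH].
    by under [X in EFin \o X]eq_fun do rewrite big_nil; exact: integrable0.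
  under [X in EFin \o X]eq_fun do rewrite big_cons.
  exact: (integrableD mD (fi i) IH).
elim: (index_enum I) => [|i s IH].
  under eq_Rintegral do rewrite big_nil.
  by rewrite big_nil /Rintegral integral0.
by under eq_Rintegral do rewrite big_cons; rewrite RintegralD// IH big_cons.
Qed.

Lemma cvg_fsum (I : finType) (u : I -> nat -> R) (l : I -> R) :
  (forall i, u i @ \oo --> l i) -> (fun k => \sum_i u i k) @ \oo --> \sum_i l i.
Proof.
move=> ul; elim: (index_enum I) => [|i s IH].
  by under eq_fun do rewrite big_nil; rewrite big_nil; exact: cvg_cst.
by under eq_fun do rewrite big_cons; rewrite big_cons; apply: cvgD.
Qed.

Lemma deriveNv (V : normedModType R) (f : V -> R) (x v : V) : smooth f ->
  'D_(- v) f x = - 'D_v f x.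
Proof.
move=> sf.
have lin : linear (fun h : R => h *: v).
  by move=> a h h'; rewrite scalerDl -scalerA.
have D c : is_derive (0 : R) c (fun h : R => f (h *: v + x)) ('D_(c *: v) f ((0 : R) *: v + x)).
  by apply: (is_derive_comp_affine lin); exact: smooth_derivable.
have D1 := D 1; have [_] := is_derive1_scale (-1) D1.
have [_ ->] := D (-1).
by rewrite scale1r scale0r add0r scaleN1r -[RHS]/(-1 * _) => ->; rewrite -[LHS]/(-1 * _) mulN1r.
Qed.

End finite_sums.

(** * The energy identity *)

Section core.
Context {R : realType} {n N : nat}.
Local Notation V := ('rV[R]_n * measurableTypeR R)%type.
Local Notation E := ('rV[R]_n * R)%type.
Local Notation mu := (@st_lebesgue R n).
Variables (p q alpha M Kc : R) (Q : set V) (b : V -> R).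
Hypotheses (hp : 2 <= p) (hpq : p < q) (ha : 0 < alpha <= 1).
Hypothesis hpqa : (n%:R + 2) * (q - p) <= alpha * p.
Hypotheses (M0 : 0 <= M) (mQ : measurable Q) (QM : Q `<=` st_cube M M).
Hypotheses (mb : measurable_fun setT b) (b0 : forall z, 0 <= b z) (Kc0 : 0 <= Kc).
Hypothesis bK : forall z z' : V, Q z -> Q z' ->
  b z - b z' <= Kc * (enorm (z.1 - z'.1) `^ alpha + `|(z.2 : R) - z'.2| `^ (alpha / 2)).
Variable Mb : R.
Hypothesis bM : forall z, b z <= Mb.

(** The phase is doubling: |W| is at most 2 C times the larger of |W1| and |W2|, and both powers are
    then bounded by the factor K. It gives finiteness of the energy of sums, multiples and
    components. *)
Lemma phase_dom (W W1 W2 : V -> R) (C : R) : 0 <= C ->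
  measurable_fun setT W -> measurable_fun setT W1 -> measurable_fun setT W2 ->
  (forall z, `|W z| <= C * (`|W1 z| + `|W2 z|)) ->
  (\int[mu]_z (phase p q b W1 z)%:E < +oo)%E -> (\int[mu]_z (phase p q b W2 z)%:E < +oo)%E ->
  (\int[mu]_z (phase p q b W z)%:E < +oo)%E.
Proof.
move=> C0 mW mW1 mW2 HW i1 i2; have h1 := hp; have h2 := hpq.
pose K := (C * 2) `^ p + (C * 2) `^ q.
have K0 : 0 <= K by rewrite addr_ge0 ?powR_ge0.
have m1 := measurable_phase p q mb mW1; have m2 := measurable_phase p q mb mW2.
have p0 W' z : 0 <= phase p q b W' z by exact: phase_ge0.
apply: (@le_lt_trans _ _ (\int[mu]_z (K * (phase p q b W1 z + phase p q b W2 z))%R%:E)%E); last first.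
  rewrite ge0_integralZlR//; try exact: measurable_funD; last by move=> *; exact: addr_ge0.
  rewrite ge0_integralDR//; apply: lte_mul_pinfty; [by rewrite lee_fin|by []|].
  exact: lte_add_pinfty i1 i2.
apply: ge0_le_integralR => //.
- exact: measurable_phase.
- by apply: measurable_funM => //; exact: measurable_funD.
move=> z _; rewrite p0 /=.
have C20 : 0 <= C * 2 by rewrite mulr_ge0.
have key r : 0 <= r -> `|W z| `^ r <= (C * 2) `^ r * (`|W1 z| `^ r + `|W2 z| `^ r).
  move=> r0; apply: le_trans (_ : (C * 2 * Num.max `|W1 z| `|W2 z|) `^ r <= _).
    apply: le_powR => //; apply: le_trans (HW z) _; rewrite -mulrA ler_wpM2l//.
    by case: (leP `|W1 z| `|W2 z|); lra.
  rewrite powRM ?le_max ?normr_ge0// ler_wpM2l ?powR_ge0//.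
  by case: (leP `|W1 z| `|W2 z|) => _; rewrite ?lerDl ?lerDr powR_ge0.
have kp := key p ltac:(lra).
have kq := ler_wpM2l (b0 z) (key q ltac:(lra)).
rewrite /phase /K; set X1 := `|W1 z| `^ p in kp *; set X2 := `|W2 z| `^ p in kp *.
set Y1 := `|W1 z| `^ q in kq *; set Y2 := `|W2 z| `^ q in kq *.
have X0 : 0 <= X1 + X2 by rewrite addr_ge0 ?powR_ge0.
have Y0 : 0 <= b z * (Y1 + Y2) by rewrite mulr_ge0// addr_ge0 ?powR_ge0.
have P1 := mulr_ge0 (powR_ge0 (C * 2) q) X0.
have P2 := mulr_ge0 (powR_ge0 (C * 2) p) Y0.
apply: le_trans (lerD kp kq) _; rewrite -subr_ge0.
suff -> : ((C * 2) `^ p + (C * 2) `^ q) * (X1 + b z * Y1 + (X2 + b z * Y2)) -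
  ((C * 2) `^ p * (X1 + X2) + b z * ((C * 2) `^ q * (Y1 + Y2))) =
  (C * 2) `^ q * (X1 + X2) + (C * 2) `^ p * (b z * (Y1 + Y2)) by exact: addr_ge0.
ring.
Qed.

Lemma phase_indic : (\int[mu]_z (phase p q b (\1_Q : V -> R) z)%:E < +oo)%E.
Proof.
have h1 := hp; have h2 := hpq.
have Mb0 : 0 <= Mb by apply: le_trans (bM 0).
have mI : measurable_fun setT (\1_Q : V -> R) by exact: measurable_indic.
apply: (@le_lt_trans _ _ (\int[mu]_z ((1 + Mb) * \1_Q z)%:E)%E).
  apply: ge0_le_integralR => //.
  - exact: measurable_phase.
  - exact: measurable_funM.
  move=> z _; rewrite phase_ge0//= /phase indicE; case: (z \in Q) => /=.
    by rewrite normr1 !powR1 !mulr1 lerD2l.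
  by rewrite normr0 !powR0 ?mulr0 ?addr0// gt_eqF//; lra.
rewrite ge0_integralZlR// ?addr_ge0// integral_indic// setIT.
rewrite lte_mul_pinfty ?lee_fin ?addr_ge0//.
apply: (@le_lt_trans _ _ (mu (st_cube M M))).
  by apply: le_measure; rewrite ?inE//; exact: measurable_st_cube.
by rewrite st_lebesgue_cube// ltry.
Qed.

Variables (v : 'I_N -> V -> R) (Dv G : 'I_N -> 'I_n -> V -> R) (f : V -> R) (C0 : R).
Hypotheses (mv : forall i, measurable_fun setT (v i))
  (mDv : forall i j, measurable_fun setT (Dv i j))
  (mG : forall i j, measurable_fun setT (G i j)) (mf : measurable_fun setT f).
Hypotheses (v0 : forall i z, ~ Q z -> v i z = 0)
  (Dv0 : forall i j z, ~ Q z -> Dv i j z = 0) (G0 : forall i j z, ~ Q z -> G i j z = 0).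
Hypotheses (iv : forall i, (\int[mu]_z (phase p q b (v i) z)%:E < +oo)%E)
  (iDv : forall i j, (\int[mu]_z (phase p q b (Dv i j) z)%:E < +oo)%E)
  (i_f : (\int[mu]_z (phase p q b f z)%:E < +oo)%E).
Hypotheses (f0 : forall z, 0 <= f z) (C00 : 0 <= C0).
Hypothesis GC : forall i j z, `|G i j z| <= C0 * (f z `^ (p - 1) + b z * f z `^ (q - 1)).

Definition e_time : E := (0, 1).
Definition e_space (j : 'I_n) : E := (delta_mx ord0 j, 0).

Hypothesis Hgrad : forall psi : E -> R, test_function Q psi -> forall i j,
  \int[mu]_z (v i z * 'D_(e_space j) psi z + Dv i j z * psi z) = 0.
Hypothesis Hweak : forall phi : E -> 'rV[R]_N, test_function Q phi ->
  \int[mu]_z (- (\sum_i v i z * dt phi z ord0 i) +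
    \sum_i \sum_j G i j z * grad phi z i j) = 0.

Variable eta : E -> R.
Hypothesis teta : test_function Q eta.

Let W i (z : V) : R := eta z * v i z.
Let DW i j (z : V) : R := eta z * Dv i j z + v i z * 'D_(e_space j) eta z.

Let seta : smooth eta. Proof. by case: teta. Qed.
Let ceta : continuous eta. Proof. exact: smooth_continuous. Qed.
Let meta : measurable_fun setT (eta : V -> R).
Proof. exact: continuous_measurable_st. Qed.
Let mDeta w : measurable_fun setT ('D_w eta : V -> R).
Proof. by apply: continuous_measurable_st => //; exact/smooth_continuous/smooth_D. Qed.
Let etaM : supp_in M eta. Proof. exact: test_function_supp_in teta. Qed.

Let eta_bd : exists2 C, 0 <= C & forall z, `|eta z| <= C.
Proof. exact: supp_in_bounded etaM. Qed.
Let Deta_bd w : exists2 C, 0 <= C & forall z, `|'D_w eta z| <= C.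
Proof.
apply: (@supp_in_bounded _ _ (M + 1)); last exact: supp_in_derive.
exact/smooth_continuous/smooth_D.
Qed.

Let mW i : measurable_fun setT (W i). Proof. exact: measurable_funM. Qed.
Let mDW i j : measurable_fun setT (DW i j).
Proof. by apply: measurable_funD; exact: measurable_funM. Qed.
Let W0 i z : ~ Q z -> W i z = 0. Proof. by move=> nQ; rewrite /W v0// mulr0. Qed.
Let DW0 i j z : ~ Q z -> DW i j z = 0.
Proof. by move=> nQ; rewrite /DW v0// Dv0// mulr0 mul0r addr0. Qed.

Let iW i : (\int[mu]_z (phase p q b (W i) z)%:E < +oo)%E.
Proof.
have [C CC HC] := eta_bd.
apply: (phase_dom CC (mW i) (mv i) (mv i) _ (iv i) (iv i)) => z.
by rewrite /W normrM mulrDr ler_wpDr ?mulr_ge0// ler_wpM2r.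
Qed.

Let iDW i j : (\int[mu]_z (phase p q b (DW i j) z)%:E < +oo)%E.
Proof.
have [C CC HC] := eta_bd; have [C' CC' HC'] := Deta_bd (e_space j).
have CC2 : 0 <= C + C' by exact: addr_ge0.
apply: (phase_dom CC2 (mDW i j) (mDv i j) (mv i) _ (iDv i j) (iv i)) => z.
rewrite /DW; apply: le_trans (ler_normD _ _) _; rewrite mulrDr !normrM; apply: lerD.
  by rewrite ler_wpM2r//; apply: le_trans (HC z) _; rewrite lerDl.
by rewrite mulrC ler_wpM2r//; apply: le_trans (HC' z) _; rewrite lerDr.
Qed.

Let W_L1 i : (\int[mu]_z `|W i z|%:E < +oo)%E.
Proof. exact: (phase_L1 hp M0 mQ QM mb b0 (mW i) (@W0 i) (iW i)). Qed.
Let DW_L1 i j : (\int[mu]_z `|DW i j z|%:E < +oo)%E.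
Proof. exact: (phase_L1 hp M0 mQ QM mb b0 (mDW i j) (@DW0 i j) (iDW i j)). Qed.

(** The kernel is moved under the weak gradient by testing with rho(z - z') eta(z') as a function of
    z'. The factor eta makes this supported in Q for every z. The product rule for it yields [DW],
    the weak gradient of eta v. *)
Lemma conv_grad k i j (z : E) :
  'D_(e_space j) (conv (rho k) (W i)) z = conv (rho k) (DW i j) z.
Proof.
have sr := @smooth_rho R n k.
have [_ ->] := conv_is_derive z (e_space j) sr (@supp_in_rho R n k) (mW i) (W_L1 i).
pose psi (z' : E) : R := rho k (z - z') * eta z'.
have lN : linear (fun y : E => - y) by move=> a x y; rewrite opprD scalerN.
have cN : continuous (fun y : E => - y) by move=> y; exact: opp_continuous.
have srz : smooth (fun z' : E => rho k (z - z')).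
  have := smooth_comp_affine z lN cN sr.
  by congr smooth; apply/funext => z'; rewrite addrC.
have Drz (z' : E) : is_derive z' (e_space j) (fun z' : E => rho k (z - z')) (- 'D_(e_space j) (rho k) (z - z')).
  have := @is_derive_comp_affine R E E R (fun y : E => - y) z (rho k) z' (e_space j) lN (@smooth_derivable R E R (rho k) (- z' + z) (- e_space j) sr).
  rewrite (@deriveNv _ E (rho k) (- z' + z) (e_space j) sr) [- z' + z]addrC.
  by congr is_derive; apply/funext => y; rewrite addrC.
have tpsi : test_function Q psi.
  apply: (test_functionS teta); first exact: smoothM.
  by move=> y; rewrite mulf_eq0 negb_or => /andP[].
have Dpsi (z' : E) : 'D_(e_space j) psi z' =
    rho k (z - z') * 'D_(e_space j) eta z' - 'D_(e_space j) (rho k) (z - z') * eta z'.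
  have [_] := is_deriveM (Drz z') (derivableP (@smooth_derivable R E R eta z' (e_space j) seta)).
  rewrite -[X in _ = X -> _]/(rho k (z - z') * 'D_(e_space j) eta z' +
    eta z' * (- 'D_(e_space j) (rho k) (z - z'))) mulrN [eta _ * _]mulrC.
  exact.
have [C HC] := @rho_bounded R n k.
have [C1 C10 HC1] : exists2 C, 0 <= C & forall z, `|'D_(e_space j) (@rho R n k) z| <= C.
  apply: (@supp_in_bounded _ _ (2 + 1)); last exact: (supp_in_derive (@supp_in_rho R n k)).
  exact/smooth_continuous/smooth_D.
have i1 := integrable_conv z (smooth_continuous (smooth_D (e_space j) sr)) HC1 (mW i) (W_L1 i).
have i2 := integrable_conv z (@continuous_rho R n k) HC (mDW i j) (DW_L1 i j).
apply/esym/eqP; rewrite -subr_eq0 /conv -RintegralB//; apply/eqP.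
rewrite -[RHS](Hgrad tpsi i j); apply: eq_Rintegral => z' _.
by rewrite Dpsi /psi /W /DW; ring.
Qed.

Let time_term k i : \int[mu]_z (W i z * 'D_e_time (conv (rho k) (W i)) z) = 0.
Proof.
have sr := @smooth_rho R n k.
have [C1 C10 HC1] : exists2 C, 0 <= C & forall z, `|'D_e_time (@rho R n k) z| <= C.
  apply: (@supp_in_bounded _ _ (2 + 1)); last exact: (supp_in_derive (@supp_in_rho R n k)).
  exact/smooth_continuous/smooth_D.
rewrite -[RHS](odd_conv_int (smooth_continuous (smooth_D e_time sr)) HC1 _ (mW i) (W_L1 i)).
  apply: eq_Rintegral => z _.
  by have [_ ->] := conv_is_derive z e_time sr (@supp_in_rho R n k) (mW i) (W_L1 i).
move=> z.
have lN : linear (fun y : E => - y) by move=> a x y; rewrite opprD scalerN.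
have df : derivable (@rho R n k) (- z + 0) (- e_time) by exact: smooth_derivable.
have [_ H] := @is_derive_comp_affine R E E R (fun y => - y) 0 (@rho R n k) z e_time lN df.
have E1 : (fun y : E => rho k (- y + 0)) = rho k by apply/funext => y; rewrite addr0 rhoN.
have {}H : 'D_e_time (rho k) z = - 'D_e_time (rho k) (- z).
  by rewrite -{1}E1 H (@deriveNv _ E (rho k) (- z + 0) e_time sr) addr0.
by rewrite H opprK.
Qed.

Let B1 i (z : V) : R := v i z * 'D_e_time eta z.
Let B2 i j (z : V) : R := G i j z * eta z.
Let B3 i j (z : V) : R := G i j z * 'D_(e_space j) eta z.

Let lim1 i : mu.-integrable setT (EFin \o (fun z => B1 i z * W i z)) /\
  (forall k, mu.-integrable setT (EFin \o (fun z : V => B1 i z * conv (rho k) (W i) z))) /\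
  (fun k => \int[mu]_z (B1 i z * conv (rho k) (W i) z)) @ \oo --> \int[mu]_z (B1 i z * W i z).
Proof.
have h1 := hp; have h2 := hpq.
have [C CC HC] := Deta_bd e_time.
(* Adding the indicator makes g at least 1 on Q. As p - 1 >= 1, this gives |v| <= g <= g^(p-1), the
   growth that [conv_limit] asks for. *)
pose g (z : V) : R := \1_Q z + `|v i z|.
have mI : measurable_fun setT (\1_Q : V -> R) by exact: measurable_indic.
have mg : measurable_fun setT g by apply: measurable_funD => //; exact: measurableT_comp.
have g0 z : 0 <= g z by rewrite addr_ge0// indicE.
have ig : (\int[mu]_z (phase p q b g z)%:E < +oo)%E.
  apply: (phase_dom ler01 mg mI (mv i) _ phase_indic (iv i)) => z.
  by rewrite mul1r ger0_norm// /g lerD2r ler_norm.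
have mB1 : measurable_fun setT (B1 i) by exact: measurable_funM.
have BC z : `|B1 i z| <= C * (g z `^ (p - 1) + b z * g z `^ (q - 1)).
  have [Qz|nQz] := pselect (Q z); last first.
    by rewrite /B1 v0// mul0r normr0 mulr_ge0// addr_ge0 ?mulr_ge0 ?powR_ge0.
  rewrite /B1 normrM mulrC; apply: ler_pM => //.
  apply: (@le_trans _ _ (g z `^ (p - 1))); last by rewrite lerDl mulr_ge0// powR_ge0.
  have gE : g z = 1 + `|v i z| by rewrite /g indicE mem_set.
  apply: (@le_trans _ _ (g z)); first by rewrite gE lerDr.
  have g1 : 1 <= g z by rewrite gE lerDl.
  have p1 : 1 <= p - 1 by lra.
  exact: (le1r_powR g1 p1).
have B10 z : ~ Q z -> B1 i z = 0 by move=> nQ; rewrite /B1 v0// mul0r.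
exact: (conv_limit hp hpq ha hpqa M0 mQ QM mb b0 Kc0 bK CC mB1 (mW i) mg g0 (@W0 i) B10 BC ig (iW i)).
Qed.

Let growth (e : E -> R) (C : R) i j : 0 <= C -> (forall z, `|e z| <= C) ->
  forall z, `|G i j z * e z| <= C0 * C * (f z `^ (p - 1) + b z * f z `^ (q - 1)).
Proof.
move=> CC HC z; rewrite normrM mulrAC; apply: ler_pM => //; exact: GC.
Qed.

Let lim2 i j : mu.-integrable setT (EFin \o (fun z => B2 i j z * DW i j z)) /\
  (forall k, mu.-integrable setT (EFin \o (fun z : V => B2 i j z * conv (rho k) (DW i j) z))) /\
  (fun k => \int[mu]_z (B2 i j z * conv (rho k) (DW i j) z)) @ \oo -->
    \int[mu]_z (B2 i j z * DW i j z).
Proof.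
have [C CC HC] := eta_bd.
have mB : measurable_fun setT (B2 i j) by exact: measurable_funM.
have B0 z : ~ Q z -> B2 i j z = 0 by move=> nQ; rewrite /B2 G0// mul0r.
exact: (conv_limit hp hpq ha hpqa M0 mQ QM mb b0 Kc0 bK (mulr_ge0 C00 CC) mB (mDW i j) mf f0
  (@DW0 i j) B0 (growth i j CC HC) i_f (iDW i j)).
Qed.

Let lim3 i j : mu.-integrable setT (EFin \o (fun z => B3 i j z * W i z)) /\
  (forall k, mu.-integrable setT (EFin \o (fun z : V => B3 i j z * conv (rho k) (W i) z))) /\
  (fun k => \int[mu]_z (B3 i j z * conv (rho k) (W i) z)) @ \oo -->
    \int[mu]_z (B3 i j z * W i z).
Proof.
have [C CC HC] := Deta_bd (e_space j).
have mB : measurable_fun setT (B3 i j) by exact: measurable_funM.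
have B0 z : ~ Q z -> B3 i j z = 0 by move=> nQ; rewrite /B3 G0// mul0r.
exact: (conv_limit hp hpq ha hpqa M0 mQ QM mb b0 Kc0 bK (mulr_ge0 C00 CC) mB (mW i) mf f0
  (@W0 i) B0 (growth i j CC HC) i_f (iW i)).
Qed.

(** The time derivative falls on the kernel and is bounded by a supremum of the derivative of the
    kernel times the L^1 norm of W. *)
Let int_time k i :
  mu.-integrable setT (EFin \o (fun z : V => W i z * 'D_e_time (conv (rho k) (W i)) z)).
Proof.
have sr := @smooth_rho R n k.
have sc := smooth_conv sr (@supp_in_rho R n k) (mW i) (W_L1 i).
have [C1 C10 HC1] : exists2 C, 0 <= C & forall z, `|'D_e_time (@rho R n k) z| <= C.
  apply: (@supp_in_bounded _ _ (2 + 1)); last exact: (supp_in_derive (@supp_in_rho R n k)).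
  exact/smooth_continuous/smooth_D.
have I0 : (0 <= \int[mu]_z `|W i z|%:E)%E by exact: integral_ge0.
pose I := fine (\int[mu]_z `|W i z|%:E)%E.
have IE : (\int[mu]_z `|W i z|%:E = I%:E)%E by rewrite fineK// ge0_fin_numE// W_L1.
have mD : measurable_fun setT ('D_e_time (conv (rho k) (W i)) : V -> R).
  by apply: continuous_measurable_st => //; exact/smooth_continuous/smooth_D.
have m1 : measurable_fun setT (fun z : V => W i z * 'D_e_time (conv (rho k) (W i)) z).
  exact: measurable_funM.
have m2 : measurable_fun setT (fun z => (C1 * I) * `|W i z|).
  by apply: measurable_funM => //; exact: measurableT_comp.
have II : 0 <= I by rewrite fine_ge0.
apply: (integrableR measurableT m1 m2) => [z _|].
  rewrite normrM mulrC ler_wpM2r//.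
  have [_ ->] := conv_is_derive z e_time sr (@supp_in_rho R n k) (mW i) (W_L1 i).
  have i1 := integrable_conv z (smooth_continuous (smooth_D e_time sr)) HC1 (mW i) (W_L1 i).
  rewrite -lee_fin EFin_normr_Rintegral//.
  apply: le_trans (le_abse_integral _ _ _) _ => //; first by case/integrableP: i1.
  rewrite EFinM -IE -ge0_integralZlR//; last exact: measurableT_comp.
  apply: ge0_le_integralR => //.
  - by apply: measurableT_comp => //; case/integrableP: i1 => /measurable_EFinP.
  - by apply: measurable_funM => //; exact: measurableT_comp.
  - by move=> z' _; rewrite normr_ge0 /= normrM ler_wpM2r.
rewrite ge0_integralZlR//; [|exact: measurableT_comp|exact: mulr_ge0].
by apply: lte_mul_pinfty; [rewrite lee_fin mulr_ge0|by []|exact: W_L1].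
Qed.

Let weak_k k : - \sum_i \int[mu]_z (B1 i z * conv (rho k) (W i) z) +
  \sum_i \sum_j (\int[mu]_z (B2 i j z * conv (rho k) (DW i j) z) +
                 \int[mu]_z (B3 i j z * conv (rho k) (W i) z)) = 0.
Proof.
have sc i := smooth_conv (@smooth_rho R n k) (@supp_in_rho R n k) (mW i) (W_L1 i).
pose c i : E -> R := conv (rho k) (W i).
pose phi (z : E) : 'rV[R]_N := \row_i (eta z * c i z).
have tphi : test_function Q phi.
  apply: (test_functionS teta).
    by move=> l; apply: C_k_row => i; exact: (smoothM seta (sc i)).
  move=> z; apply: contra_neq => e0; rewrite /phi e0.
  by apply/rowP => i; rewrite !mxE mul0r.
have Dprod w i (z : E) : is_derive z w (fun z => eta z * c i z) (eta z * 'D_w (c i) z + c i z * 'D_w eta z).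
  have d1 := derivableP (@smooth_derivable R E R eta z w seta).
  have d2 := derivableP (@smooth_derivable R E R (c i) z w (sc i)).
  exact: (is_deriveM d1 d2).
have Dphi w (z : E) i : 'D_w phi z ord0 i = eta z * 'D_w (c i) z + c i z * 'D_w eta z.
  rewrite derive_row; last by move=> l; case: (Dprod w l z).
  by rewrite mxE; case: (Dprod w i z).
have H := Hweak tphi.
(* The product rule for eta c splits the time term into (eta v) times the derivative of c, which
   integrates to 0 by [time_term], and a term with the derivative of eta. In [g2] the gradient of c
   is already the mollified [DW]. *)
pose g1 i (z : V) := W i z * 'D_e_time (c i) z + B1 i z * c i z.
pose g2 i j (z : V) := B2 i j z * conv (rho k) (DW i j) z + B3 i j z * c i z.
have ig1 i : mu.-integrable setT (EFin \o g1 i).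
  exact: (integrableD measurableT (int_time k i) ((lim1 i).2.1 k)).
have ig2 i j : mu.-integrable setT (EFin \o g2 i j).
  exact: (integrableD measurableT ((lim2 i j).2.1 k) ((lim3 i j).2.1 k)).
have isg1 : mu.-integrable setT (EFin \o (fun z => \sum_i g1 i z)) by exact: integrable_fsum.
have isg2 i : mu.-integrable setT (EFin \o (fun z => \sum_j g2 i j z)) by exact: integrable_fsum.
have issg2 : mu.-integrable setT (EFin \o (fun z => \sum_i \sum_j g2 i j z)) by exact: integrable_fsum.
have E1 : \int[mu]_z (\sum_i \sum_j g2 i j z - \sum_i g1 i z) = 0.
  rewrite -[RHS]H; apply: eq_Rintegral => z _; rewrite addrC; congr (- _ + _).
    apply: eq_bigr => i _; rewrite /dt Dphi /g1 /W /B1 -/e_time; ring.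
  apply: eq_bigr => i _; apply: eq_bigr => j _; rewrite mxE Dphi /g2 /B2 /B3.
  by rewrite (conv_grad k i j z); ring.
have E2 : \sum_i \int[mu]_z (\sum_j g2 i j z) - \sum_i \int[mu]_z g1 i z = 0.
  by rewrite -[RHS]E1 RintegralB// !Rintegral_fsum.
rewrite -[RHS]E2 addrC; congr (_ - _).
  apply: eq_bigr => i _; rewrite Rintegral_fsum//; apply: eq_bigr => j _.
  by rewrite /g2 (RintegralD measurableT ((lim2 i j).2.1 k) ((lim3 i j).2.1 k)).
apply: eq_bigr => i _; rewrite /g1 (RintegralD measurableT (int_time k i) ((lim1 i).2.1 k)).
by rewrite time_term add0r.
Qed.

Lemma core_identity :
  [/\ forall i, mu.-integrable setT (EFin \o (fun z : V => v i z * 'D_e_time eta z * (eta z * v i z))),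
      forall i j, mu.-integrable setT (EFin \o (fun z : V => G i j z * eta z *
        (eta z * Dv i j z + v i z * 'D_(e_space j) eta z))),
      forall i j, mu.-integrable setT (EFin \o (fun z : V => G i j z * 'D_(e_space j) eta z * (eta z * v i z))) &
      \sum_i \int[mu]_z (v i z * 'D_e_time eta z * (eta z * v i z)) =
      \sum_i \sum_j (\int[mu]_z (G i j z * eta z * (eta z * Dv i j z + v i z * 'D_(e_space j) eta z)) +
        \int[mu]_z (G i j z * 'D_(e_space j) eta z * (eta z * v i z)))].
Proof.
split.
- by move=> i; case: (lim1 i).
- by move=> i j; case: (lim2 i j).
- by move=> i j; case: (lim3 i j).
have L : (fun k => - \sum_i \int[mu]_z (B1 i z * conv (rho k) (W i) z) +
  \sum_i \sum_j (\int[mu]_z (B2 i j z * conv (rho k) (DW i j) z) +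
                 \int[mu]_z (B3 i j z * conv (rho k) (W i) z))) @ \oo -->
  - \sum_i \int[mu]_z (B1 i z * W i z) +
  \sum_i \sum_j (\int[mu]_z (B2 i j z * DW i j z) + \int[mu]_z (B3 i j z * W i z)).
  apply: cvgD.
    by apply: cvgN; apply: cvg_fsum => i; case: (lim1 i) => _ [].
  apply: cvg_fsum => i; apply: cvg_fsum => j; apply: cvgD.
    by case: (lim2 i j) => _ [].
  by case: (lim3 i j) => _ [].
have L0 : (fun _ : nat => 0 : R) @ \oo --> (0 : R) by exact: cvg_cst.
rewrite (_ : (fun k => _) = fun=> 0) in L; last by apply/funext => k; exact: weak_k.
have E0 : - \sum_i \int[mu]_z (B1 i z * W i z) + \sum_i \sum_j (\int[mu]_z (B2 i j z * DW i j z) +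
  \int[mu]_z (B3 i j z * W i z)) = 0 by exact: (cvg_unique (@norm_hausdorff _ R^o) L L0).
by move/eqP: E0; rewrite addrC subr_eq0 => /eqP <-.
Qed.

End core.

(** * Cut-off functions *)

Section cutoff_space.
Context {R : realType} {n : nat}.

(** A universal number: it depends on the step function alone, so it may enter the constant of the
    final inequality. *)
Definition sstep_lip : R := sval (cid2 (@dsstep_bound R)).

Lemma sstep_lip_gt0 : 0 < sstep_lip.
Proof. by rewrite /sstep_lip; case: cid2. Qed.

Lemma dsstep_le x : 'D_1 (@sstep R) x <= sstep_lip.
Proof. by rewrite /sstep_lip; case: cid2. Qed.

Lemma is_derive_sqdist (x0 x : 'rV[R]_n) (j : 'I_n) :
  is_derive x (delta_mx ord0 j) (fun x => edot (x - x0) (x - x0)) (2 * (x - x0) ord0 j).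
Proof.
have d := @smooth_derivable R _ _ _ x (delta_mx ord0 j) (smooth_sqdist x0).
apply: DeriveDef => //.
rewrite /derive; apply/cvg_lim => //.
apply: (@cvg_trans _ ((fun h : R => 2 * (x - x0) ord0 j + h) @ 0^')); last first.
  have : (fun h : R => 2 * (x - x0) ord0 j + h) @ 0^' --> 2 * (x - x0) ord0 j + 0.
    by apply: cvgD; [exact: cvg_cst|exact: nbhs_dnbhs].
  by rewrite addr0.
apply: near_eq_cvg; near=> h.
have h0 : h != 0 by near: h; exact: nbhs_dnbhs_neq.
have key : edot (h *: delta_mx ord0 j + x - x0) (h *: delta_mx ord0 j + x - x0) =
    edot (x - x0) (x - x0) + h * (2 * (x - x0) ord0 j + h).
  rewrite !edot_rV (bigD1 j)//= [in RHS](bigD1 j)//= [RHS]addrAC; congr (_ + _).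
    by rewrite !mxE !eqxx /= mulr1; ring.
  by apply: eq_bigr => k kj; rewrite !mxE (negbTE kj) andbF mulr0 add0r.
have Q : h^-1 *: (edot (h *: delta_mx ord0 j + x - x0) (h *: delta_mx ord0 j + x - x0) -
    edot (x - x0) (x - x0)) = 2 * (x - x0) ord0 j + h.
  by rewrite key addrC addKr -[_ *: _]/(_ * _) mulKf.
by first [exact: Q|exact: (esym Q)].
Unshelve. all: by end_near. Qed.

Lemma eball_measurable (x0 : 'rV[R]_n) r : measurable (eball x0 r).
Proof.
have m : measurable_fun setT (fun x : 'rV[R]_n => edot (x - x0) (x - x0)).
  exact: (continuous_measurable_rV (smooth_continuous (@smooth_sqdist R n x0))).
rewrite (_ : eball x0 r = (fun x => Num.sqrt (edot (x - x0) (x - x0))) @^-1` `]-oo, r[%classic).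
  rewrite -[X in measurable X]setTI.
  by apply: (measurableT_comp (continuous_measurable_fun (@sqrt_continuous R)) m).
by apply/seteqP; split => x /=; rewrite in_itv.
Qed.

Variables (x0 : 'rV[R]_n) (R1 R2 : R).
Hypotheses (R10 : 0 < R1) (R12 : R1 < R2).
Let r2 := (R1 + R2) / 2.
Let den := r2 ^+ 2 - R1 ^+ 2.
Let denE : den = (R2 - R1) / 2 * (r2 + R1). Proof. by rewrite /den /r2; field. Qed.
Let den0 : 0 < den.
Proof. have h := R10; have h' := R12; rewrite denE /r2; apply: mulr_gt0; lra. Qed.

Let arg (x : 'rV[R]_n) : R := (r2 ^+ 2 - edot (x - x0) (x - x0)) / den.

(** Using the squared distance keeps the function smooth at the centre. The transition takes place
    between R1 and the midpoint [r2] of R1 and R2, which leaves room for a compact support in the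
    ball of radius R2. *)
Definition cut_space (x : 'rV[R]_n) : R := sstep (arg x).

Let smooth_arg : smooth arg.
Proof.
rewrite (_ : arg = fun x => r2 ^+ 2 / den + - den^-1 * edot (x - x0) (x - x0)).
  apply: smoothDf; first exact: smooth_cst.
  by apply: smoothM; [exact: smooth_cst|exact: smooth_sqdist].
by apply/funext => x; rewrite /arg mulrBl mulNr [den^-1 * _]mulrC.
Qed.

Lemma smooth_cut_space : smooth cut_space.
Proof. by apply: smooth_comp => //; exact: smooth_sstep. Qed.

Lemma cut_space_ge0 x : 0 <= cut_space x. Proof. exact: sstep_ge0. Qed.
Lemma cut_space_le1 x : cut_space x <= 1. Proof. exact: sstep_le1. Qed.

Lemma cut_space1 x : eball x0 R1 x -> cut_space x = 1.
Proof.
move=> /ltW xR; apply: sstep1; rewrite /arg ler_pdivlMr// mul1r lerD2l lerN2 -enorm_sqr.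
by rewrite lerXn2r// nnegrE ?enorm_ge0// ltW.
Qed.

Lemma cut_space_supp x : cut_space x != 0 -> enorm (x - x0) <= (R1 + R2) / 2.
Proof.
move=> c0; rewrite leNgt; apply: contra_neqN c0 => xR; apply: sstep0.
rewrite /arg -enorm_sqr ler_pdivrMr// mul0r subr_le0.
by rewrite lerXn2r// ?nnegrE ?enorm_ge0 ?(ltW xR)//; have h := R10; have h' := R12; rewrite /r2; lra.
Qed.

(** The derivative is that of the step times - 2 (x - x0)_j / den. With [den] factored as (R2 -
    R1)/2 times r2 + R1, and |(x - x0)_j| <= r2, the ratio r2 / (r2 + R1) <= 1 remains, so only R2 -
    R1 survives. *)
Lemma dcut_space_le x j : `|'D_(delta_mx ord0 j) cut_space x| <= 4 * sstep_lip / (R2 - R1).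
Proof.
have h := R10; have h' := R12; have L0 := sstep_lip_gt0.
have d1 := @smooth_derivable R _ _ _ (arg x) 1 (@smooth_sstep R).
have d2 := @smooth_derivable R _ _ _ x (delta_mx ord0 j) smooth_arg.
have [_ ->] := is_derive_comp1 d1 d2.
(* Where the argument of the step leaves [0, 1] the derivative is 0; where it is nonnegative the
   point is within [r2] of the centre. *)
have [out|] := boolP ((arg x < 0) || (1 < arg x)).
  by rewrite dsstep_out// mul0r normr0 divr_ge0//; [rewrite mulr_ge0// ltW|lra].
rewrite negb_or -!leNgt => /andP[a0 a1].
have Da : is_derive x (delta_mx ord0 j) arg (- den^-1 * (2 * (x - x0) ord0 j)).
  rewrite (_ : arg = fun x => r2 ^+ 2 / den + - den^-1 * edot (x - x0) (x - x0)); last first.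
    by apply/funext => y; rewrite /arg mulrBl mulNr [den^-1 * _]mulrC.
  have D1 := is_deriveM (is_derive_cst (- den^-1) x (delta_mx ord0 j)) (is_derive_sqdist x0 x j).
  have D2 := is_deriveD (is_derive_cst (r2 ^+ 2 / den) x (delta_mx ord0 j)) D1.
  apply: (@is_derive_eq _ _ _ _ _ _ _ _ D2).
  by rewrite add0r -[_ *: _]/(_ * _) -[X in _ + X]/(_ * 0) mulr0 addr0.
have [_ ->] := Da.
have xr : `|(x - x0) ord0 j| <= r2.
  apply: le_trans (coord_le_enorm (x - x0) ord0 j) _.
  rewrite -(@ler_pXn2r _ 2)// ?nnegrE ?enorm_ge0//; last by rewrite /r2; lra.
  rewrite enorm_sqr -subr_ge0; move: a0; rewrite /arg pmulr_lge0// invr_gt0//.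
rewrite normrM (ger0_norm (dsstep_ge0 _)) mulrC normrM normrN normfV (gtr0_norm den0).
rewrite normrM (ger0_norm (ler0n _ 2)).
apply: (@le_trans _ _ (den^-1 * (2 * r2) * sstep_lip)).
  apply: ler_pM => //; rewrite ?dsstep_ge0 ?dsstep_le// ?mulr_ge0// ?invr_ge0 ?(ltW den0)//.
  by rewrite ler_wpM2l ?invr_ge0 ?(ltW den0)// ler_wpM2l.
rewrite denE; set e := r2 + R1.
have e0 : 0 < e by rewrite /e /r2; lra.
have re : r2 <= e by rewrite /e; lra.
have d0 : 0 < R2 - R1 by lra.
have -> : ((R2 - R1) / 2 * e)^-1 * (2 * r2) * sstep_lip = (r2 / e) * (4 * sstep_lip / (R2 - R1)).
  by rewrite !invfM invrK; ring.
rewrite ler_piMl//; first by rewrite divr_ge0//; [rewrite mulr_ge0// ltW|exact: ltW].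
by rewrite ler_pdivrMr// mul1r.
Qed.

End cutoff_space.

Section cutoff_time.
Context {R : realType}.

Lemma is_derive_sstep_affine (a b t : R) :
  is_derive t 1 (fun t => sstep (a * t + b)) (a * 'D_1 sstep (a * t + b)).
Proof.
have d := @smooth_derivable R _ _ _ (a * t + b) 1 (@smooth_sstep R).
have D : is_derive t 1 (fun t : R => a * t + b) a.
  have D1 := is_deriveD (is_deriveZ a (is_derive_id t (1 : R))) (is_derive_cst b t (1 : R)).
  by apply: (@is_derive_eq _ _ _ _ _ _ _ _ D1); rewrite addr0 -[_ *: _]/(_ * _) mulr1.
have := @is_derive_comp1 R R (@sstep R) (fun t : R => a * t + b) t 1 d (@ex_derive _ _ _ _ _ _ _ D).
by have [_ ->] := D; rewrite mulrC.
Qed.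

Lemma smooth_sstep_affine (a b : R) : smooth (fun t : R => sstep (a * t + b)).
Proof.
apply: (smooth_comp (@smooth_sstep R)); apply: smoothDf; last exact: smooth_cst.
by apply: smoothM; [exact: smooth_cst|exact: smooth_id].
Qed.

Variables (t0 S1 S2 tau delta : R).
Hypotheses (S12 : S1 < S2) (d0 : 0 < delta).
Let S3 := (S1 + S2) / 2.

(** It climbs on [t0 - S3, t0 - S1] with S3 the midpoint of S1 and S2, so it vanishes near the
    bottom of the large cylinder and is 1 from the bottom of the small one onwards. *)
Definition rise (t : R) : R := sstep ((S3 - S1)^-1 * t + (S3 - t0) / (S3 - S1)).
Definition fall (t : R) : R := sstep (- delta^-1 * t + (tau + delta) / delta).

Let riseE t : rise t = sstep ((t - (t0 - S3)) / (S3 - S1)).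
Proof. by rewrite /rise; congr sstep; ring. Qed.
Let fallE t : fall t = sstep ((tau + delta - t) / delta).
Proof. by rewrite /fall; congr sstep; ring. Qed.
Let S310 : 0 < S3 - S1. Proof. have h := S12; rewrite /S3; lra. Qed.

Lemma smooth_rise : smooth rise. Proof. exact: smooth_sstep_affine. Qed.
Lemma smooth_fall : smooth fall. Proof. exact: smooth_sstep_affine. Qed.

Lemma rise_ge0 t : 0 <= rise t. Proof. exact: sstep_ge0. Qed.
Lemma rise_le1 t : rise t <= 1. Proof. exact: sstep_le1. Qed.
Lemma fall_ge0 t : 0 <= fall t. Proof. exact: sstep_ge0. Qed.
Lemma fall_le1 t : fall t <= 1. Proof. exact: sstep_le1. Qed.

Lemma rise1 t : t0 - S1 <= t -> rise t = 1.
Proof. by move=> h; rewrite riseE sstep1// ler_pdivlMr//; lra. Qed.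
Lemma rise0 t : t <= t0 - S3 -> rise t = 0.
Proof. by move=> h; rewrite riseE sstep0// ler_pdivrMr//; lra. Qed.
Lemma fall1 t : t <= tau -> fall t = 1.
Proof. by move=> h; have := d0; rewrite fallE => h'; rewrite sstep1// ler_pdivlMr//; lra. Qed.
Lemma fall0 t : tau + delta <= t -> fall t = 0.
Proof. by move=> h; have := d0; rewrite fallE => h'; rewrite sstep0// ler_pdivrMr//; lra. Qed.

Lemma drise_ge0 t : 0 <= 'D_(1 : R) rise t.
Proof.
have [_ ->] := is_derive_sstep_affine (S3 - S1)^-1 ((S3 - t0) / (S3 - S1)) t.
by rewrite mulr_ge0 ?dsstep_ge0// invr_ge0 ltW.
Qed.

Lemma drise_le t : 'D_1 rise t <= 2 * sstep_lip / (S2 - S1).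
Proof.
have h := S12; have [_ ->] := is_derive_sstep_affine (S3 - S1)^-1 ((S3 - t0) / (S3 - S1)) t.
rewrite (_ : S3 - S1 = (S2 - S1) / 2); last by rewrite /S3; field.
rewrite invf_div mulrAC ler_pM2r ?invr_gt0; last lra.
by rewrite ler_pM2l// dsstep_le.
Qed.

Lemma dfall_le0 t : 'D_1 fall t <= 0.
Proof.
have [_ ->] := is_derive_sstep_affine (- delta^-1) ((tau + delta) / delta) t.
by rewrite mulNr oppr_le0 mulr_ge0 ?dsstep_ge0// invr_ge0 ltW.
Qed.

Lemma is_derive_fall_sqr (t : R) :
  is_derive t (1 : R) (fun t : R => - (fall t ^+ 2 / 2)) (- (fall t * 'D_1 fall t)).
Proof.
have D := derivableP (@smooth_derivable R _ _ _ t 1 smooth_fall).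
have D2 := is_deriveN (is_deriveZ (2^-1 : R) (is_deriveX 2 D)).
rewrite (_ : (fun t => - (fall t ^+ 2 / 2)) = - (2^-1 \*: fall ^+ 2)); last first.
  by apply/funext => y; rewrite /= mulrC.
apply: (@is_derive_eq _ _ _ _ _ _ _ _ D2).
by rewrite -![_ *: _]/(_ * _) expr1 -mulr_natl; congr (- _); field.
Qed.

(** The weight is the derivative of - fall^2 / 2. It is nonnegative with mass 1/2 whatever delta is,
    so letting delta shrink concentrates it at tau without loss. *)
Lemma integral_fall :
  (\int[@lebesgue_measure R]_(t in `[tau, (tau + delta)%R]%classic)
    (- (fall t * 'D_(1%R : R) fall t))%R%:E = (2^-1 : R)%:E)%E.
Proof.
have h := d0.
have cf : continuous (fun t => - (fall t ^+ 2 / 2)).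
  rewrite (_ : (fun t => _) = fun t => - 2^-1 * fall t ^+ 2).
    apply: (@smooth_continuous R R R); apply: smoothM; first exact: smooth_cst.
    exact: (smoothX 2 smooth_fall).
  by apply/funext => t; rewrite mulNr mulrC.
rewrite (@continuous_FTC2 _ _ (fun t => - (fall t ^+ 2 / 2)))//.
- rewrite fall0// fall1// expr1n expr0n/= mul0r oppr0 -EFinB; congr EFin; ring.
- by rewrite ltrDl.
- apply: continuous_subspaceT => t; apply: cvgN; apply: cvgM.
    exact: smooth_continuous smooth_fall t.
  exact: (@smooth_continuous R R R _ (@smooth_D R R R _ 1 smooth_fall) t).
- split=> [t _||].
  + exact: (@ex_derive _ _ _ _ _ _ _ (is_derive_fall_sqr t)).
  + by apply: cvg_at_right_filter; exact: cf.
  + by apply: cvg_at_left_filter; exact: cf.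
- by move=> t _; rewrite derive1E; have [_ ->] := is_derive_fall_sqr t.
Qed.

End cutoff_time.

Section cutoff.
Context {R : realType} {n : nat}.
Local Notation V := ('rV[R]_n * measurableTypeR R)%type.
Local Notation E := ('rV[R]_n * R)%type.
Variables (x0 : 'rV[R]_n) (t0 R1 R2 S1 S2 tau delta : R) (m : nat).
Hypotheses (R10 : 0 < R1) (R12 : R1 < R2) (S12 : S1 < S2) (d0 : 0 < delta).
Hypothesis tau_lt : tau + delta < t0 + S2.
Local Notation zeta := (cut_space x0 R1 R2).
Local Notation r := (rise t0 S1 S2).
Local Notation s := (fall tau delta).

(** The square of this function carries zeta^(2m+2), and its spatial derivative zeta^(2m+1). With q
    <= 2m+2 this loss of one power is harmless in [absorb_gradient]. *)
Definition cutoff (z : E) : R := zeta z.1 ^+ m.+1 * (r z.2 * s z.2).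

Lemma smooth_cutoff : smooth cutoff.
Proof.
apply: smoothM.
  by apply: smoothX; apply: (@smooth_fst R n R zeta); exact: smooth_cut_space.
by apply: smoothM; apply: smooth_snd; [exact: smooth_rise|exact: smooth_fall].
Qed.

Lemma cutoff_supp z : cutoff z != 0 ->
  [/\ enorm (z.1 - x0) <= (R1 + R2) / 2, t0 - (S1 + S2) / 2 <= z.2 & z.2 <= tau + delta].
Proof.
rewrite /cutoff mulf_eq0 negb_or mulf_eq0 negb_or expf_eq0/= => /andP[z0 /andP[r0 s0]]; split.
- exact: (cut_space_supp R10 R12 z0).
- by rewrite leNgt; apply: contra_neqN r0 => h; rewrite rise0// ltW.
- by rewrite leNgt; apply: contra_neqN s0 => h; rewrite fall0// ltW.
Qed.

Lemma test_function_cutoff : test_function (cylinder x0 t0 R2 S2) cutoff.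
Proof.
pose K := [set z : E | [/\ enorm (z.1 - x0) <= (R1 + R2) / 2,
  t0 - (S1 + S2) / 2 <= z.2 & z.2 <= tau + delta]].
have c1 : continuous (fun z : E => enorm (z.1 - x0)).
  move=> z; apply: (@continuous_comp _ _ _ (fun z : E => edot (z.1 - x0) (z.1 - x0))); last exact: sqrt_continuous.
  exact: (@smooth_continuous R E R _ (@smooth_fst R n R _ (@smooth_sqdist R n x0)) z).
have c2 : continuous (fun z : E => z.2) by move=> z; exact: cvg_snd.
have cK : closed K.
  rewrite (_ : K = (fun z : E => enorm (z.1 - x0)) @^-1` [set r | r <= (R1 + R2) / 2] `&`
    ((fun z : E => z.2) @^-1` [set t | t0 - (S1 + S2) / 2 <= t] `&`
     (fun z : E => z.2) @^-1` [set t | t <= tau + delta])); last first.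
    by apply/seteqP; split => z /= [] // a [].
  apply: closedI; first by apply: closed_comp => [z _|]; [exact: c1|exact: closed_le].
  apply: closedI; apply: closed_comp => [z _|]; rewrite ?/ge; try exact: c2.
    exact: closed_ge.
  exact: closed_le.
have sK : closure [set z | cutoff z != 0] `<=` K.
  rewrite [X in _ `<=` X]((closure_id K).1 cK).
  by apply: closure_subset => z; exact: cutoff_supp.
split; first exact: smooth_cutoff.
  (* A generous half-side: sums of absolute values of all the data bound each coordinate and the
     time. *)
  have KM : K `<=` st_box_closed (enorm x0 + R2 + `|t0| + `|t0 - S1| + `|t0 - S2| + `|t0 + S2|).
    have h := R10; have h' := R12; have h2 := S12; have h3 := tau_lt.
    move=> z [H1 H2 H3]; split => [i|] /=; rewrite in_itv/= -ler_norml.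
      apply: (@le_trans _ _ (enorm (z.1 - x0) + enorm x0)).
        rewrite -[z.1 in leLHS](subrK x0) mxE; apply: le_trans (ler_normD _ _) _.
        by apply: lerD; exact: coord_le_enorm.
      rewrite addrC -!addrA lerD2l; apply: (@le_trans _ _ R2); first lra.
      by rewrite lerDl !addr_ge0.
    have e0 := enorm_ge0 x0; have R0 : 0 <= R2 by lra.
    have n1 := normr_ge0 t0; have n2 := ler_norm (t0 + S2); have n3 := ler_norm (- (t0 - S2)).
    have n4 := ler_norm (- (t0 - S1)).
    have n5 := normr_ge0 (t0 - S1); have n6 := normr_ge0 (t0 - S2); have n7 := normr_ge0 (t0 + S2).
    rewrite normrN in n3; rewrite normrN in n4.
    rewrite ler_norml; apply/andP; split; lra.
  apply: (@subclosed_compact E _ _ (@closed_closure _ _) (@compact_st_box_closed R n _)).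
  exact: subset_trans sK KM.
apply: subset_trans sK _ => z [H1 H2 H3]; split => /=.
  by apply: le_lt_trans H1 _; have h := R12; lra.
by rewrite in_itv/=; have h := S12; have h' := tau_lt; apply/andP; split; lra.
Qed.

Lemma cutoff_derive_space (z : E) j : 'D_((delta_mx ord0 j, 0) : E) cutoff z =
  m.+1%:R * zeta z.1 ^+ m * 'D_(delta_mx ord0 j) zeta z.1 * (r z.2 * s z.2).
Proof.
have sz := smooth_cut_space x0 R1 R2.
have Dz : is_derive z ((delta_mx ord0 j, 0) : E) (fun z : E => zeta z.1) ('D_(delta_mx ord0 j) zeta z.1).
  have := @is_derive_comp_affine R E 'rV[R]_n R (fun z => z.1) 0 zeta z (delta_mx ord0 j, 0) _
     (@smooth_derivable R _ _ _ _ _ sz).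
  rewrite /= addr0 => H.
  by rewrite -[X in is_derive _ _ X _]/(fun z : E => zeta z.1)
   (_ : (fun z : E => zeta z.1) = fun z => zeta (z.1 + 0)); [exact: H|apply/funext => y; rewrite addr0].
have st : smooth (fun t => r t * s t) by apply: smoothM; [exact: smooth_rise|exact: smooth_fall].
have Dt : is_derive z ((delta_mx ord0 j, 0) : E) (fun z : E => r z.2 * s z.2) 0.
  have D := @is_derive_comp_affine R E R R (fun z => z.2) 0 (fun t => r t * s t) z (delta_mx ord0 j, 0)
    (fun _ _ _ => erefl) (@smooth_derivable R _ _ _ _ _ st).
  rewrite (_ : (fun z : E => r z.2 * s z.2) = fun z => r (z.2 + 0) * s (z.2 + 0)); last first.
    by apply/funext => y; rewrite addr0.
  apply: (@is_derive_eq _ _ _ _ _ _ _ _ D).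
  have := @derive0 R R R (fun t => r t * s t) (z.2 + 0); exact.
have Dzm : is_derive z ((delta_mx ord0 j, 0) : E) (fun z : E => zeta z.1 ^+ m.+1)
    (m.+1%:R * zeta z.1 ^+ m * 'D_(delta_mx ord0 j) zeta z.1).
  rewrite (_ : (fun z : E => zeta z.1 ^+ m.+1) = (fun z : E => zeta z.1) ^+ m.+1); last first.
    by apply/funext => y; elim: (m.+1) => [|k IH]; rewrite ?expr0// !exprS IH.
  apply: (@is_derive_eq _ _ _ _ _ _ _ _ (is_deriveX m.+1 Dz)).
  by rewrite -[_ *: _]/(_ * _) -mulr_natl.
have [_] := is_deriveM Dzm Dt.
rewrite -[X in X = _ -> _]/('D_((delta_mx ord0 j, 0) : E) cutoff z) => ->.
by rewrite -![_ *: _]/(_ * _) mulr0 add0r mulrC.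
Qed.

Lemma cutoff_derive_time (z : E) : 'D_((0, 1) : E) cutoff z =
  zeta z.1 ^+ m.+1 * ('D_1 r z.2 * s z.2 + r z.2 * 'D_1 s z.2).
Proof.
have sz := smoothX m.+1 (smooth_cut_space x0 R1 R2).
have sr := smooth_rise t0 S1 S2; have ss := smooth_fall tau delta.
have Dz : is_derive z ((0, 1) : E) (fun z : E => zeta z.1 ^+ m.+1) 0.
  have D := @is_derive_comp_affine R E 'rV[R]_n R (fun z => z.1) 0 (fun x => zeta x ^+ m.+1) z (0, 1)
    (fun _ _ _ => erefl) (@smooth_derivable R _ _ _ _ _ sz).
  rewrite (_ : (fun z : E => zeta z.1 ^+ m.+1) = fun z => zeta (z.1 + 0) ^+ m.+1); last first.
    by apply/funext => y; rewrite addr0.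
  apply: (@is_derive_eq _ _ _ _ _ _ _ _ D).
  have := @derive0 R 'rV[R]_n R (fun x => zeta x ^+ m.+1) (z.1 + 0); exact.
have Dt : is_derive z ((0, 1) : E) (fun z : E => r z.2 * s z.2) (r z.2 * 'D_1 s z.2 + s z.2 * 'D_1 r z.2).
  have D1 := is_deriveM (derivableP (@smooth_derivable R R R r (z.2 + 0) 1 sr)) (derivableP (@smooth_derivable R R R s (z.2 + 0) 1 ss)).
  have D := @is_derive_comp_affine R E R R (fun z => z.2) 0 (r * s) z (0, 1)
    (fun _ _ _ => erefl) (@ex_derive _ _ _ _ _ _ _ D1).
  rewrite (_ : (fun z : E => r z.2 * s z.2) = fun z => (r * s) (z.2 + 0)); last first.
    by apply/funext => y; rewrite addr0.
  apply: (@is_derive_eq _ _ _ _ _ _ _ _ D); case: D1 => _ ->.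
  by rewrite addr0.
have [_] := is_deriveM Dz Dt.
rewrite -[X in X = _ -> _]/('D_((0, 1) : E) cutoff z) => ->.
rewrite -![_ *: _]/(_ * _) mulr0 addr0 /=; ring.
Qed.

End cutoff.

(** * The Caccioppoli inequality for Borel data *)

Section absorption.
Context {R : realType}.
Implicit Types p q r M D L nu b z c s f y C : R.

(** If s <= M f the second term suffices. Otherwise f < s / M, and the factor M^(1-r) that appears
    is at most 1/M because r >= 2 and M >= 1. *)
Lemma absorb_source M f s r : 1 <= M -> 2 <= r -> 0 <= f -> 0 <= s ->
  f `^ (r - 1) * s <= M^-1 * s `^ r + M * f `^ r.
Proof.
move=> M1 r2 f0 s0; have M0 : 0 < M by lra.
have r1 : 0 <= r - 1 by lra.
have r0 : 0 < r by lra.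
have [sf|fs] := leP s (M * f).
  apply: (@le_trans _ _ (M * f `^ r)); last first.
    by rewrite lerDr mulr_ge0 ?powR_ge0// invr_ge0 ltW.
  by rewrite -(mulr_powRB1 f0 r0) mulrA [X in _ <= X]mulrC ler_wpM2l ?powR_ge0.
apply: (@le_trans _ _ (M^-1 * s `^ r)); last by rewrite lerDl mulr_ge0 ?powR_ge0// ltW.
have fs' : f <= s / M by rewrite ler_pdivlMr// mulrC ltW.
apply: (@le_trans _ _ ((s / M) `^ (r - 1) * s)); first by rewrite ler_wpM2r// le_powR.
rewrite powRM// ?invr_ge0 ?(ltW M0)// -(mulr_powRB1 s0 r0).
rewrite (_ : s `^ (r - 1) * M^-1 `^ (r - 1) * s = M^-1 `^ (r - 1) * (s * s `^ (r - 1))); last ring.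
rewrite ler_wpM2r ?mulr_ge0 ?powR_ge0//.
rewrite -[X in _ <= X]powRr1 ?invr_ge0 ?(ltW M0)//.
by apply: ger_powR; [rewrite invr_gt0 M0 invf_le1|lra].
Qed.

(** The comparison is between y and z s / M rather than s / M, so that the absorbed term carries the
    full weight z^(k+1). In the other case z^k s^(r-1) is bounded by (z s)^(r-1). The constant M^q
    serves both exponents r = p and r = q. *)
Lemma absorb_gradient M z s y r q k : 1 <= M -> 2 <= r -> r <= q -> r <= k.+1%:R ->
  0 <= z -> z <= 1 -> 0 <= s -> 0 <= y ->
  z ^+ k * (s `^ (r - 1) * y) <= M^-1 * (z ^+ k.+1 * s `^ r) + M `^ q * y `^ r.
Proof.
move=> M1 r2 rq rk z0 z1 s0 y0; have M0 : 0 < M by lra.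
have r1 : 0 <= r - 1 by lra.
have r0 : 0 < r by lra.
have Mi : 0 <= M^-1 by rewrite invr_ge0 ltW.
have [ys|sy] := leP y (M^-1 * (z * s)).
  apply: (@le_trans _ _ (M^-1 * (z ^+ k.+1 * s `^ r))); last by rewrite lerDl mulr_ge0 ?powR_ge0.
  rewrite -(mulr_powRB1 s0 r0) exprSr.
  rewrite (_ : M^-1 * _ = z ^+ k * (s `^ (r - 1) * (M^-1 * (z * s)))); last ring.
  by rewrite ler_wpM2l ?exprn_ge0// ler_wpM2l ?powR_ge0.
apply: (@le_trans _ _ (M `^ q * y `^ r)); last first.
  by rewrite lerDr mulr_ge0// mulr_ge0 ?exprn_ge0 ?powR_ge0.
have zs : z * s <= M * y.
  by rewrite ltW// -ltr_pdivrMl.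
(* For z in [0, 1] the larger exponent gives the smaller power, and r - 1 <= k. At z = 0 one needs
   0^k = 0, that is k >= 1, which holds since r >= 2. *)
have zk : z ^+ k <= z `^ (r - 1).
  move: z0; rewrite le_eqVlt => /orP[/eqP <-|z0].
    by rewrite powR0 ?expr0n; [case: k rk => //= ?; lra|lra].
  by rewrite -powR_mulrn ?(ltW z0)//; apply: ger_powR; [rewrite z0|rewrite -natr1 in rk; lra].
rewrite mulrA.
apply: (@le_trans _ _ ((z * s) `^ (r - 1) * y)).
  by rewrite ler_wpM2r// powRM// ler_wpM2r ?powR_ge0.
apply: (@le_trans _ _ ((M * y) `^ (r - 1) * y)).
  by rewrite ler_wpM2r// le_powR// mulr_ge0.
rewrite powRM// ?(ltW M0)// -(mulr_powRB1 y0 r0) -mulrA [y `^ _ * y]mulrC.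
by rewrite ler_wpM2r ?mulr_ge0 ?powR_ge0// ler_powR//; lra.
Qed.

(** M is chosen so that the gradient terms, which come with total coefficient (D + k1 L) / M, amount
    to at most nu / 2: half of the coercivity is left over. D stands for the entry count of the
    source term, k1 for the constant of the cut-off, y for |v| / (R2 - R1). *)
Lemma absorb_phase p q nu L D (k1 : R) M b z c s f y C k : 2 <= p -> p < q -> q <= k.+1%:R ->
  0 < nu -> 0 <= L -> 0 <= D -> 0 <= k1 -> M = 1 + 2 * (D + k1 * L) / nu ->
  D * M + k1 * L * M `^ q + k1 <= C -> 0 <= b ->
  0 <= z -> z <= 1 -> 0 <= c -> c <= 1 -> 0 <= s -> 0 <= f -> 0 <= y ->
  D * (z ^+ k.+1 * c * (f `^ (p - 1) * s + b * (f `^ (q - 1) * s))) +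
  k1 * (z ^+ k * c * ((L * (s `^ (p - 1) + b * s `^ (q - 1)) +
                       (f `^ (p - 1) + b * f `^ (q - 1))) * y)) <=
  nu / 2 * (z ^+ k.+1 * c * (s `^ p + b * s `^ q)) +
  C * ((y `^ p + b * y `^ q) + (f `^ p + b * f `^ q)).
Proof.
move=> p2 pq qk nu0 L0 D0 k0 ME CE b0 z0 z1 c0 c1 s0 f0 y0.
have kL : 0 <= k1 * L by rewrite mulr_ge0.
have M1 : 1 <= M by rewrite ME lerDl; apply: divr_ge0; [apply: mulr_ge0 => //; exact: addr_ge0|exact: ltW].
have M0 : 0 < M by lra.
have zk1 : 0 <= z ^+ k.+1 <= 1 by rewrite exprn_ge0//= exprn_ile1.
have zk : 0 <= z ^+ k <= 1 by rewrite exprn_ge0//= exprn_ile1.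
have [zk10 zk11] := andP zk1; have [zk0 zk01] := andP zk.
have e0 : 0 <= z ^+ k.+1 * c by rewrite mulr_ge0.
have e1 : z ^+ k.+1 * c <= 1 by rewrite mulr_ile1.
have g0 : 0 <= z ^+ k * c by rewrite mulr_ge0.
have g1 : z ^+ k * c <= 1 by rewrite mulr_ile1.
have T1 r : 2 <= r -> z ^+ k.+1 * c * (f `^ (r - 1) * s) <=
    M^-1 * (z ^+ k.+1 * c * s `^ r) + M * f `^ r.
  move=> r2; apply: (le_trans (ler_wpM2l e0 (absorb_source M1 r2 f0 s0))).
  by rewrite mulrDr [in X in X + _ <= _]mulrCA lerD2l; apply: ler_piMl => //; rewrite mulr_ge0 ?powR_ge0// ltW.
have T2 r : 2 <= r -> r <= q -> z ^+ k * c * (s `^ (r - 1) * y) <=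
    M^-1 * (z ^+ k.+1 * c * s `^ r) + M `^ q * y `^ r.
  move=> r2 rq; have rk : r <= k.+1%:R by lra.
  have h := ler_wpM2l c0 (absorb_gradient M1 r2 rq rk z0 z1 s0 y0).
  rewrite mulrAC mulrC; apply: (le_trans h).
  rewrite mulrDr; apply: lerD; first by rewrite le_eqVlt; apply/orP; left; apply/eqP; ring.
  by rewrite ler_piMl// mulr_ge0 ?powR_ge0.
have T3 r : 2 <= r -> z ^+ k * c * (f `^ (r - 1) * y) <= f `^ r + y `^ r.
  move=> r2; have r1 : 1 <= r by lra.
  apply: le_trans (young1 r1 f0 y0); by rewrite ler_piMl// mulr_ge0 ?powR_ge0.
have q2 : 2 <= q by lra.
set e := z ^+ k.+1 * c in e0 e1 T1 T2 *; set g := z ^+ k * c in g0 g1 T2 T3 *.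
have A1 := lerD (T1 p p2) (ler_wpM2l b0 (T1 q q2)).
have A2 := lerD (T2 p p2 (ltW pq)) (ler_wpM2l b0 (T2 q q2 (lexx q))).
have A3 := lerD (T3 p p2) (ler_wpM2l b0 (T3 q q2)).
pose Hs := s `^ p + b * s `^ q; pose Hf := f `^ p + b * f `^ q; pose Hy := y `^ p + b * y `^ q.
have Hs0 : 0 <= Hs by rewrite addr_ge0 ?mulr_ge0 ?powR_ge0.
have Hf0 : 0 <= Hf by rewrite addr_ge0 ?mulr_ge0 ?powR_ge0.
have Hy0 : 0 <= Hy by rewrite addr_ge0 ?mulr_ge0 ?powR_ge0.
have B1 : D * (e * (f `^ (p - 1) * s + b * (f `^ (q - 1) * s))) <= D * (M^-1 * (e * Hs) + M * Hf).
  by rewrite ler_wpM2l//; rewrite /Hs /Hf; lra.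
have B2 : k1 * L * (g * ((s `^ (p - 1) + b * s `^ (q - 1)) * y)) <=
    k1 * L * (M^-1 * (e * Hs) + M `^ q * Hy).
  by rewrite ler_wpM2l//; rewrite /Hs /Hy; lra.
have B3 : k1 * (g * ((f `^ (p - 1) + b * f `^ (q - 1)) * y)) <= k1 * (Hf + Hy).
  by rewrite ler_wpM2l//; rewrite /Hf /Hy; lra.
have nuM : (D + k1 * L) / M <= nu / 2.
  rewrite ler_pdivrMr// ME mulrDr mulr1.
  rewrite (_ : nu / 2 * (2 * (D + k1 * L) / nu) = D + k1 * L); last by field; rewrite gt_eqF.
  by rewrite lerDr; lra.
have B4 : (D + k1 * L) / M * (e * Hs) <= nu / 2 * (e * Hs) by rewrite ler_wpM2r// mulr_ge0.
have Mq : 0 <= k1 * L * M `^ q by rewrite mulr_ge0 ?powR_ge0.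
have DM : 0 <= D * M by rewrite mulr_ge0// ltW.
have B5 : (k1 * L * M `^ q + k1) * Hy <= C * Hy by rewrite ler_wpM2r//; lra.
have B6 : (D * M + k1) * Hf <= C * Hf by rewrite ler_wpM2r//; lra.
rewrite -/Hs -/Hf -/Hy; lra.
Qed.

(** Scalar products are estimated entry by entry; the factor m n is the price and puts the
    dimensions into the constant. *)
Lemma double_sum_le m n (g : 'I_m -> 'I_n -> R) C : (forall i j, `|g i j| <= C) ->
  `|\sum_i \sum_j g i j| <= (m * n)%:R * C.
Proof.
move=> gC; apply: le_trans (ler_norm_sum _ _ _) _.
apply: (@le_trans _ _ (\sum_(i < m) (n%:R * C))); last first.
  by rewrite sumr_const card_ord -[X in X <= _]mulr_natl natrM mulrA.
apply: ler_sum => i _; apply: le_trans (ler_norm_sum _ _ _) _.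
apply: (@le_trans _ _ (\sum_(j < n) C)); first exact: ler_sum.
by rewrite sumr_const card_ord -[X in X <= _]mulr_natl.
Qed.

End absorption.

(** * Energy estimate with a fixed cut-off *)

Section caccioppoli.
Context {R : realType} {n N : nat}.
Local Notation V := ('rV[R]_n * measurableTypeR R)%type.
Local Notation E := ('rV[R]_n * R)%type.
Local Notation mu := (@st_lebesgue R n).
Variables (p q nu L alpha M Kc Mb : R) (b : V -> R).
Variables (x0 : 'rV[R]_n) (t0 R1 R2 S1 S2 : R).
Local Notation Q := (cylinder x0 t0 R2 S2).
Hypotheses (hp : 2 <= p) (hpq : p < q) (ha : 0 < alpha <= 1) (hnu : 0 < nu) (hL : 0 <= L).
Hypothesis hpqa : (n%:R + 2) * (q - p) <= alpha * p.
Hypotheses (R10 : 0 < R1) (R12 : R1 < R2) (S12 : S1 < S2).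
Hypotheses (M0 : 0 <= M) (mQ : measurable Q) (QM : Q `<=` st_cube M M).
Hypotheses (mb : measurable_fun setT b) (b0 : forall z, 0 <= b z) (Kc0 : 0 <= Kc).
Hypothesis bK : forall z z' : V, Q z -> Q z' ->
  b z - b z' <= Kc * (enorm (z.1 - z'.1) `^ alpha + `|(z.2 : R) - z'.2| `^ (alpha / 2)).
Hypothesis bM : forall z, b z <= Mb.
Variables (v : V -> 'rV[R]_N) (Dv A F : V -> 'M[R]_(N, n)).
Hypotheses (mv : forall i, measurable_fun setT (fun z => v z ord0 i))
  (mDv : forall i j, measurable_fun setT (fun z => Dv z i j))
  (mA : forall i j, measurable_fun setT (fun z => A z i j))
  (mF : forall i j, measurable_fun setT (fun z => F z i j)).
Hypotheses (v0 : forall z, ~ Q z -> v z = 0) (Dv0 : forall z, ~ Q z -> Dv z = 0)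
  (A0 : forall z, ~ Q z -> A z = 0) (F0 : forall z, ~ Q z -> F z = 0).
Local Notation ev := (fun z => enorm (v z)).
Local Notation eDv := (fun z => enorm (Dv z)).
Local Notation eF := (fun z => enorm (F z)).
Hypotheses (iv : (\int[mu]_z (phase p q b ev z)%:E < +oo)%E)
  (iDv : (\int[mu]_z (phase p q b eDv z)%:E < +oo)%E)
  (iF : (\int[mu]_z (phase p q b eF z)%:E < +oo)%E).
Hypothesis coercive : forall z, nu * phase p q b eDv z <= edot (A z) (Dv z).
Hypothesis growthA : forall z,
  enorm (A z) <= L * (eDv z `^ (p - 1) + b z * eDv z `^ (q - 1)).

Definition source z : 'M[R]_(N, n) := (eF z `^ (p - 2)) *: F z + (b z * eF z `^ (q - 2)) *: F z.
Local Notation G := (fun z => A z - source z).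

Hypothesis Hgrad : forall psi : E -> R, test_function Q psi -> forall i j,
  \int[mu]_z (v z ord0 i * 'D_(e_space j) psi z + Dv z i j * psi z) = 0.
Hypothesis Hweak : forall phi : E -> 'rV[R]_N, test_function Q phi ->
  \int[mu]_z (- (\sum_i v z ord0 i * dt phi z ord0 i) +
    \sum_i \sum_j G z i j * grad phi z i j) = 0.

Lemma measurable_edot m k (X Y : V -> 'M[R]_(m, k)) :
  (forall i j, measurable_fun setT (fun z => X z i j)) ->
  (forall i j, measurable_fun setT (fun z => Y z i j)) ->
  measurable_fun setT (fun z => edot (X z) (Y z)).
Proof.
move=> mX mY; apply: measurable_sum => i; apply: measurable_sum => j.
exact: measurable_funM.
Qed.

Lemma measurable_enorm m k (X : V -> 'M[R]_(m, k)) :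
  (forall i j, measurable_fun setT (fun z => X z i j)) ->
  measurable_fun setT (fun z => enorm (X z)).
Proof.
move=> mX; apply: (measurableT_comp (continuous_measurable_fun (@sqrt_continuous R))).
exact: measurable_edot.
Qed.

Let mev : measurable_fun setT ev.
Proof. by apply: measurable_enorm => i j; rewrite (ord1 i). Qed.
Let meDv : measurable_fun setT eDv. Proof. exact: measurable_enorm. Qed.
Let meF : measurable_fun setT eF. Proof. exact: measurable_enorm. Qed.

Let powF r z : 2 <= r -> eF z `^ (r - 2) * eF z = eF z `^ (r - 1).
Proof.
move=> r2; rewrite (_ : r - 2 = r - 1 - 1); last by ring.
by rewrite mulrC mulr_powRB1 ?enorm_ge0//; lra.
Qed.

Let hq : 2 <= q. Proof. have h := hp; have h' := hpq; lra. Qed.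

Lemma source_coord_le z i j : `|source z i j| <= eF z `^ (p - 1) + b z * eF z `^ (q - 1).
Proof.
rewrite /source !mxE -mulrDl normrM ger0_norm ?addr_ge0 ?mulr_ge0 ?powR_ge0//.
rewrite -(powF z hp) -(powF z hq) mulrA -mulrDl ler_wpM2l//.
  by rewrite addr_ge0 ?mulr_ge0 ?powR_ge0.
exact: coord_le_enorm.
Qed.

Lemma edot_source_le z : edot (source z) (Dv z) <=
  (N * n)%:R * (eF z `^ (p - 1) * eDv z + b z * (eF z `^ (q - 1) * eDv z)).
Proof.
apply: le_trans (ler_norm _) _.
rewrite mulrA -mulrDl; apply: double_sum_le => i j; rewrite normrM; apply: ler_pM => //.
  exact: source_coord_le.
exact: coord_le_enorm.
Qed.

Let gr z := L * (eDv z `^ (p - 1) + b z * eDv z `^ (q - 1)) +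
  (eF z `^ (p - 1) + b z * eF z `^ (q - 1)).

Let GE z i j : G z i j = A z i j - source z i j.
Proof. by rewrite /source !mxE. Qed.

Let Gle z i j : `|G z i j| <= gr z.
Proof.
rewrite GE; apply: le_trans (ler_normB _ _) _; apply: lerD.
  exact: le_trans (coord_le_enorm (A z) i j) (growthA z).
exact: source_coord_le.
Qed.

(** A single function dominating both |Dv| and |F|, so that the whole flux [G] satisfies one growth
    condition of the kind used in [core_identity]. *)
Let f z := eDv z + eF z.

Let mf : measurable_fun setT f. Proof. exact: measurable_funD. Qed.
Let f0 z : 0 <= f z. Proof. by rewrite addr_ge0 ?enorm_ge0. Qed.

Let GC z i j : `|G z i j| <= (L + 1) * (f z `^ (p - 1) + b z * f z `^ (q - 1)).
Proof.
apply: le_trans (Gle z i j) _; rewrite /gr mulrDl mul1r.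
have h := hp; have h' := hq.
have p1 : 0 <= p - 1 by lra.
have q1 : 0 <= q - 1 by lra.
have D1 : eDv z <= f z by rewrite lerDl enorm_ge0.
have D2 : eF z <= f z by rewrite lerDr enorm_ge0.
apply: lerD.
  apply: ler_wpM2l => //; apply: lerD; first by apply: le_powR => //; exact: enorm_ge0.
  by apply: ler_wpM2l => //; apply: le_powR => //; exact: enorm_ge0.
apply: lerD; first by apply: le_powR => //; exact: enorm_ge0.
by apply: ler_wpM2l => //; apply: le_powR => //; exact: enorm_ge0.
Qed.

Let i_f : (\int[mu]_z (phase p q b f z)%:E < +oo)%E.
Proof.
apply: (phase_dom hp hpq mb b0 ler01 mf meDv meF _ iDv iF) => z.
by rewrite mul1r !ger0_norm ?enorm_ge0.
Qed.

Let dom (W w : V -> R) : measurable_fun setT W -> measurable_fun setT w -> (forall z, `|W z| <= `|w z|) ->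
  (\int[mu]_z (phase p q b w z)%:E < +oo)%E -> (\int[mu]_z (phase p q b W z)%:E < +oo)%E.
Proof.
move=> mW mw Ww iw; apply: (phase_dom hp hpq mb b0 ler01 mW mw mw _ iw iw) => z.
by rewrite mul1r; apply: le_trans (Ww z) _; rewrite lerDl.
Qed.

Variables (tau delta : R) (m : nat).
Hypotheses (d0 : 0 < delta) (tau_gt : t0 - S1 <= tau) (tau_lt : tau + delta < t0 + S2).
Hypothesis hm : q <= (m.+1 + m.+1)%:R.
Local Notation eta := (cutoff x0 t0 R1 R2 S1 S2 tau delta m).
Local Notation zeta := (cut_space x0 R1 R2).
Local Notation r := (rise t0 S1 S2).
Local Notation s := (fall tau delta).

(** The coefficient of the cross term: 2 because it occurs twice in the identity, N n for the
    entries, m+1 from differentiating the power of zeta, and 4 [sstep_lip] from the gradient of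
    zeta. The factor 1/(R2 - R1) is put with v. *)
Definition cacc_k1 : R := 2 * (N * n)%:R * (m.+1%:R * (4 * sstep_lip)).
Definition cacc_M : R := 1 + 2 * ((N * n)%:R + cacc_k1 * L) / nu.
(** The first three summands are those of [absorb_phase] with D = N n; the last one bounds the
    derivative of the rising factor, up to 1/(S2 - S1). *)
Definition cacc_C : R := (N * n)%:R * cacc_M + cacc_k1 * L * cacc_M `^ q + cacc_k1 + 2 * sstep_lip.

Let k10 : 0 <= cacc_k1.
Proof. by rewrite /cacc_k1; do ?apply: mulr_ge0 => //; exact: ltW (sstep_lip_gt0). Qed.

Lemma cacc_C_ge0 : 0 <= cacc_C.
Proof.
have L0 : 0 < @sstep_lip R := sstep_lip_gt0.
have Mp : 0 <= cacc_M.
  by rewrite addr_ge0// divr_ge0 ?(ltW hnu)// mulr_ge0// addr_ge0// mulr_ge0.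
by do ?apply: addr_ge0 => //; do ?apply: mulr_ge0 => //; rewrite ?powR_ge0// ltW.
Qed.

Let teta : test_function Q eta.
Proof. by have := @test_function_cutoff R n x0 t0 R1 R2 S1 S2 tau delta m R10 R12 S12 d0 tau_lt. Qed.

(** X is what is to be bounded, Y the integrand on the right, and I the integrand of the energy
    identity. Since I has integral 0, the estimate reduces to the pointwise inequality X <= C Y -
    I. *)
Let X z : R := enorm (v z) ^+ 2 * (zeta z.1 ^+ (m.+1 + m.+1) * (- (s z.2 * 'D_1 s z.2))) +
  nu / 2 * (eta z ^+ 2 * phase p q b eDv z).
Let Y z : R := phase p q b (fun z => enorm (v z) / (R2 - R1)) z +
  enorm (v z) ^+ 2 / (S2 - S1) + phase p q b eF z.
Let I z : R := \sum_i v z ord0 i * 'D_e_time eta z * (eta z * v z ord0 i) -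
  \sum_i \sum_j (G z i j * eta z * (eta z * Dv z i j + v z ord0 i * 'D_(e_space j) eta z) +
    G z i j * 'D_(e_space j) eta z * (eta z * v z ord0 i)).

Let mG i j : measurable_fun setT (fun z => G z i j).
Proof.
have mpow x : measurable_fun setT (fun z => eF z `^ x).
  exact: (measurableT_comp (measurable_powR x) meF).
rewrite (_ : (fun z => _) = fun z => A z i j - (eF z `^ (p - 2) * F z i j + b z * eF z `^ (q - 2) * F z i j)).
  apply: measurable_funB => //; apply: measurable_funD; first exact: measurable_funM.
  by apply: measurable_funM => //; exact: measurable_funM.
by apply/funext => z; rewrite !mxE.
Qed.

Let I_int : mu.-integrable setT (EFin \o I) /\ \int[mu]_z I z = 0.
Proof.
have G0 i j z : ~ Q z -> G z i j = 0.
  by move=> nQ; rewrite /source A0// F0// !scaler0 addr0 subr0 mxE.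
have ivi i : (\int[mu]_z (phase p q b (fun z => v z ord0 i) z)%:E < +oo)%E.
  by apply: (dom _ mev _ iv) => // z; rewrite [X in _ <= X]ger0_norm ?enorm_ge0// coord_le_enorm.
have iDvi i j : (\int[mu]_z (phase p q b (fun z => Dv z i j) z)%:E < +oo)%E.
  by apply: (dom _ meDv _ iDv) => // z; rewrite [X in _ <= X]ger0_norm ?enorm_ge0// coord_le_enorm.
have L10 : 0 <= L + 1 by rewrite addr_ge0.
have vi0 i z : ~ Q z -> v z ord0 i = 0 by move=> nQ; rewrite v0// mxE.
have Dvi0 i j z : ~ Q z -> Dv z i j = 0 by move=> nQ; rewrite Dv0// mxE.
have [C1 C2 C3 C4] := core_identity hp hpq ha hpqa M0 mQ QM mb b0 Kc0 bK bM mv mDv mG mf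
  vi0 Dvi0 G0 ivi iDvi i_f f0 L10 (fun i j z => GC z i j) Hgrad Hweak teta.
have C23 i j : mu.-integrable setT (EFin \o (fun z =>
    G z i j * eta z * (eta z * Dv z i j + v z ord0 i * 'D_(e_space j) eta z) +
    G z i j * 'D_(e_space j) eta z * (eta z * v z ord0 i))).
  exact: (integrableD measurableT (C2 i j) (C3 i j)).
have J1 := integrable_fsum measurableT C1.
have J2 i := integrable_fsum measurableT (C23 i).
have J3 := integrable_fsum measurableT J2.
split; first exact: (integrableB measurableT J1 J3).
rewrite /I RintegralB// Rintegral_fsum// Rintegral_fsum// C4; apply/eqP; rewrite subr_eq0; apply/eqP.
apply: eq_bigr => i _; rewrite Rintegral_fsum//; apply: eq_bigr => j _.
by rewrite (RintegralD measurableT (C2 i j) (C3 i j)).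
Qed.

Let zeta_r_s z : 0 <= zeta z.1 <= 1 /\ 0 <= (r z.2 * s z.2) ^+ 2 <= 1.
Proof.
split; first by rewrite cut_space_ge0 cut_space_le1.
have rs0 : 0 <= r z.2 * s z.2 by exact: mulr_ge0 (rise_ge0 _ _ _ _) (fall_ge0 _ _ _).
have rs1 : r z.2 * s z.2 <= 1.
  exact: mulr_ile1 (rise_ge0 _ _ _ _) (fall_ge0 _ _ _) (rise_le1 _ _ _ _) (fall_le1 _ _ _).
by apply/andP; split; [exact: exprn_ge0|exact: exprn_ile1].
Qed.

(** The derivative of [rise] is positive and bounded by a multiple of 1/(S2 - S1), so it goes to the
    right-hand side. The derivative of [fall] is negative and unbounded as delta shrinks; it is
    kept, as the term of X that controls slices. *)
Let time_le z : enorm (v z) ^+ 2 * ('D_e_time eta z * eta z) <=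
  2 * sstep_lip * (enorm (v z) ^+ 2 / (S2 - S1)) -
  enorm (v z) ^+ 2 * (zeta z.1 ^+ (m.+1 + m.+1) * (- (s z.2 * 'D_1 s z.2))).
Proof.
have [/andP[z0 z1] _] := zeta_r_s z.
have [r0 r1] := (rise_ge0 t0 S1 S2 z.2, rise_le1 t0 S1 S2 z.2).
have [s0 s1] := (fall_ge0 tau delta z.2, fall_le1 tau delta z.2).
have dr0 := drise_ge0 t0 S12 z.2; have drl := drise_le t0 S12 z.2.
have rs : r z.2 ^+ 2 * (s z.2 * 'D_1 s z.2) = s z.2 * 'D_1 s z.2.
  have [tt|tt] := leP (t0 - S1) z.2; first by rewrite rise1// expr1n mul1r.
  have s'0 : 'D_1 s z.2 = 0.
    have : \forall t \near z.2, s t = cst 1 t.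
      near=> t; apply: fall1 => //; apply: ltW; apply: lt_le_trans tau_gt.
      near: t; exact: lt_nbhsl.
    by move=> H; rewrite (near_eq_derive _ H) derive_cst.
  by rewrite s'0 !mulr0.
have e2 : 0 <= enorm (v z) ^+ 2 by rewrite exprn_ge0// enorm_ge0.
have E1 : 'D_e_time eta z * eta z = zeta z.1 ^+ (m.+1 + m.+1) *
   (r z.2 * s z.2 ^+ 2 * 'D_1 r z.2 + s z.2 * 'D_1 s z.2).
  rewrite cutoff_derive_time /cutoff exprD -rs; ring.
rewrite E1 mulrDr mulrDr !mulrN opprK lerD2r [X in _ <= X]mulrCA.
apply: ler_wpM2l => //.
apply: (@le_trans _ _ ('D_1 r z.2)); last by rewrite mulrC mulrA mulrAC [_ * 2]mulrC in drl *.
rewrite mulrA; apply: ler_piMl => //.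
have s20 : 0 <= s z.2 ^+ 2 by exact: exprn_ge0.
have s21 : s z.2 ^+ 2 <= 1 by exact: exprn_ile1.
have zk0 : 0 <= zeta z.1 ^+ (m.+1 + m.+1) by exact: exprn_ge0.
have zk1 : zeta z.1 ^+ (m.+1 + m.+1) <= 1 by exact: exprn_ile1.
exact: mulr_ile1 zk0 (mulr_ge0 r0 s20) zk1 (mulr_ile1 r0 s20 r1 s21).
Unshelve. all: by end_near. Qed.

Let XY z : X z <= cacc_C * Y z - I z.
Proof.
have [/andP[z0 z1] /andP[c0 c1]] := zeta_r_s z.
have L0 : 0 < @sstep_lip R := sstep_lip_gt0.
have R0 : 0 < R2 - R1 by rewrite subr_gt0.
have S0 : 0 < S2 - S1 by rewrite subr_gt0.
pose c := (r z.2 * s z.2) ^+ 2; pose y := enorm (v z) / (R2 - R1).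
have y0 : 0 <= y by rewrite divr_ge0 ?enorm_ge0// ltW.
have eta2 : eta z ^+ 2 = zeta z.1 ^+ (m.+1 + m.+1) * c.
  by rewrite /cutoff exprMn -exprM addnn -muln2.
(* The product of eta and its spatial derivative carries zeta^(2m+1), one power less than eta^2;
   this is the weight with exponent k in [absorb_phase]. *)
have cross : - (\sum_i \sum_j 2 * (G z i j * ('D_(e_space j) eta z * eta z) * v z ord0 i)) <=
    cacc_k1 * (zeta z.1 ^+ (m.+1 + m) * c * (gr z * y)).
  apply: le_trans (ler_norm _) _; rewrite normrN.
  rewrite (_ : cacc_k1 * _ = (N * n)%:R * (2 * (gr z *
     ((m.+1%:R * (zeta z.1 ^+ (m.+1 + m)) * (4 * sstep_lip / (R2 - R1)) * c)) * enorm (v z)))); last first.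
    by rewrite /cacc_k1 /y; ring.
  apply: double_sum_le => i j; rewrite normrM (ger0_norm (ler0n _ 2)) ler_wpM2l//.
  rewrite normrM normrM; apply: ler_pM; rewrite ?mulr_ge0//; last exact: coord_le_enorm.
  apply: ler_pM (normr_ge0 _) (normr_ge0 _) (Gle z i j) _.
  rewrite cutoff_derive_space /cutoff.
  have -> : m.+1%:R * zeta z.1 ^+ m * 'D_(delta_mx ord0 j) zeta z.1 * (r z.2 * s z.2) *
      (zeta z.1 ^+ m.+1 * (r z.2 * s z.2)) =
      m.+1%:R * zeta z.1 ^+ (m.+1 + m) * c * 'D_(delta_mx ord0 j) zeta z.1.
    by rewrite exprD /c; ring.
  have w0 : 0 <= m.+1%:R * zeta z.1 ^+ (m.+1 + m) * c.
    exact: (mulr_ge0 (mulr_ge0 (ler0n _ _) (exprn_ge0 _ z0)) c0).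
  rewrite normrM (ger0_norm w0) [X in _ <= X]mulrAC; apply: ler_wpM2l => //.
  exact: (dcut_space_le x0 R10 R12 z.1 j).
(* The spatial derivative of eta comes once from the gradient of eta v and once from the outer eta
   of the test function, which gives the factor 2. *)
have IE : I z = enorm (v z) ^+ 2 * ('D_e_time eta z * eta z) - eta z ^+ 2 * edot (A z) (Dv z) +
    eta z ^+ 2 * edot (source z) (Dv z) -
    \sum_i \sum_j 2 * (G z i j * ('D_(e_space j) eta z * eta z) * v z ord0 i).
  have E3 : \sum_i \sum_j (G z i j * eta z * (eta z * Dv z i j + v z ord0 i * 'D_(e_space j) eta z) +
      G z i j * 'D_(e_space j) eta z * (eta z * v z ord0 i)) =
      (eta z ^+ 2 * edot (A z) (Dv z) - eta z ^+ 2 * edot (source z) (Dv z)) +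
      \sum_i \sum_j 2 * (G z i j * ('D_(e_space j) eta z * eta z) * v z ord0 i).
    rewrite /edot !mulr_sumr -sumrB -big_split.
    apply: eq_bigr => i _ /=; rewrite !mulr_sumr -sumrB -big_split; apply: eq_bigr => j _ /=.
    have -> : (A z - source z) i j = A z i j - source z i j by exact: GE.
    ring.
  rewrite /I E3 enorm_sqr edot_rV mulr_suml.
  have -> : \sum_i v z ord0 i * 'D_e_time eta z * (eta z * v z ord0 i) =
      \sum_j v z ord0 j ^+ 2 * ('D_e_time eta z * eta z) by apply: eq_bigr => i _; ring.
  ring.
have src := ler_wpM2l (sqr_ge0 (eta z)) (edot_source_le z).
have coer := ler_wpM2l (sqr_ge0 (eta z)) (coercive z).
have hmk : q <= (m.+1 + m).+1%:R by rewrite -addnS.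
have CE : (N * n)%:R * cacc_M + cacc_k1 * L * cacc_M `^ q + cacc_k1 <= cacc_C - 2 * sstep_lip.
  by rewrite /cacc_C addrK.
have abs := absorb_phase hp hpq hmk hnu hL (ler0n _ (N * n)) k10 (erefl cacc_M) CE (b0 z) z0 z1 c0 c1
   (enorm_ge0 (Dv z)) (enorm_ge0 (F z)) y0.
rewrite -/c -addnS -eta2 -/(gr z) in abs.
have tl := time_le z.
have e2 : 0 <= enorm (v z) ^+ 2 / (S2 - S1) by rewrite divr_ge0 ?exprn_ge0 ?enorm_ge0// ltW.
have ph1 : phase p q b eDv z = eDv z `^ p + b z * eDv z `^ q by rewrite /phase ger0_norm ?enorm_ge0.
have ph2 : phase p q b eF z = eF z `^ p + b z * eF z `^ q by rewrite /phase ger0_norm ?enorm_ge0.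
have ph3 : phase p q b (fun z => enorm (v z) / (R2 - R1)) z = y `^ p + b z * y `^ q.
  by rewrite /phase -/y ger0_norm.
have CC : 2 * sstep_lip * (enorm (v z) ^+ 2 / (S2 - S1)) <= cacc_C * (enorm (v z) ^+ 2 / (S2 - S1)).
  rewrite ler_wpM2r// /cacc_C lerDr.
  have Mp : 0 <= cacc_M.
    by rewrite addr_ge0// divr_ge0 ?(ltW hnu)// mulr_ge0// addr_ge0// mulr_ge0.
  by do ?apply: addr_ge0 => //; do ?apply: mulr_ge0 => //; rewrite ?powR_ge0.
have H0 : 0 <= y `^ p + b z * y `^ q + (eF z `^ p + b z * eF z `^ q).
  by do ?apply: addr_ge0; do ?apply: mulr_ge0; rewrite ?powR_ge0.
have LH := mulr_ge0 (ltW L0) H0.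
rewrite ph1 in coer.
rewrite /X /Y IE ph1 ph2 ph3.
set P1 := eDv z `^ p + _ in coer abs *; set P2 := eF z `^ p + b z * eF z `^ q in abs LH *.
set P3 := y `^ p + _ in abs LH *.
set T := enorm (v z) ^+ 2 / _ in tl CC *; set sm := \sum_i _ in cross *.
set a1 := edot (A z) _ in coer *; set a2 := edot (source z) _ in src *.
set e := eta z ^+ 2 in src coer abs *.
set k1 := cacc_k1 * _ in cross abs; set XX := enorm (v z) ^+ 2 * _ in tl *.
set X2 := enorm (v z) ^+ 2 * _ in tl *.
set C := cacc_C in abs CC *; set S := sstep_lip in tl CC abs LH.
set FF := _ `^ _ * _ + _ in abs src.
lra.
Qed.

Lemma caccioppoli_cutoff :
  (\int[mu]_z (enorm (v z) ^+ 2 * (zeta z.1 ^+ (m.+1 + m.+1) * (- (s z.2 * 'D_1 s z.2))) +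
     nu / 2 * (eta z ^+ 2 * phase p q b eDv z))%R%:E <=
   cacc_C%:E * \int[mu]_z (phase p q b (fun z => enorm (v z) / (R2 - R1)) z +
      enorm (v z) ^+ 2 / (S2 - S1) + phase p q b eF z)%R%:E)%E.
Proof.
have [iI I0] := I_int.
have R0 : 0 < R2 - R1 by rewrite subr_gt0.
have S0 : 0 < S2 - S1 by rewrite subr_gt0.
have mY1 : measurable_fun setT (phase p q b (fun z => enorm (v z) / (R2 - R1))).
  by apply: measurable_phase => //; exact: measurable_funM.
have mY : measurable_fun setT Y.
  apply: measurable_funD; last exact: measurable_phase.
  by apply: measurable_funD => //; apply: measurable_funM => //; exact: measurable_funX.
have Y0 z : 0 <= Y z.
  apply: addr_ge0; last exact: phase_ge0.
  apply: addr_ge0; first exact: phase_ge0.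
  apply: divr_ge0; [by rewrite exprn_ge0// enorm_ge0|exact: ltW].
have cs w : measurable_fun setT ('D_w s : R -> R).
  exact: (continuous_measurable_fun (@smooth_continuous R R R _ (@smooth_D R R R _ w (smooth_fall tau delta)))).
have mX : measurable_fun setT X.
  apply: measurable_funD.
    apply: measurable_funM; first exact: measurable_funX.
    apply: measurable_funM.
      apply: measurable_funX.
      apply: (measurableT_comp (continuous_measurable_rV (smooth_continuous (smooth_cut_space x0 R1 R2))) measurable_fst).
    apply: continuous_measurable_st => // z; apply: cvgN; apply: cvgM.
      exact: (@smooth_continuous R E R _ (smooth_snd (smooth_fall tau delta)) z).
    exact: (@smooth_continuous R E R _ (smooth_snd (@smooth_D R R R _ 1 (smooth_fall tau delta))) z).
  apply: measurable_funM; first exact: measurable_cst.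
  apply: measurable_funM; last exact: measurable_phase.
  by apply: measurable_funX; apply: continuous_measurable_st => //; case: teta => + _ _; exact: smooth_continuous.
have X0 z : 0 <= X z.
  apply: addr_ge0; apply: mulr_ge0; rewrite ?exprn_ge0 ?enorm_ge0 ?divr_ge0 ?(ltW hnu)//.
    rewrite mulr_ge0 ?exprn_ge0 ?cut_space_ge0// -mulrN mulr_ge0 ?fall_ge0// oppr_ge0.
    exact: dfall_le0.
  by rewrite mulr_ge0 ?exprn_even_ge0// phase_ge0.
have iv' : (\int[mu]_z (phase p q b (fun z => enorm (v z) / (R2 - R1)) z)%:E < +oo)%E.
  have C1 : 0 <= (R2 - R1)^-1 by rewrite invr_ge0 ltW.
  apply: (phase_dom hp hpq mb b0 C1 _ mev mev _ iv iv); first exact: measurable_funM.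
  move=> z; rewrite normrM [X in _ * X]ger0_norm// mulrC ler_wpM2l// lerDl.
  exact: normr_ge0.
(* On Q the square |v|^2 is at most 1 or at most |v|^p, since p >= 2; so the phases of the indicator
   of Q and of v dominate it. *)
have iv2 : (\int[mu]_z (enorm (v z) ^+ 2 / (S2 - S1))%R%:E < +oo)%E.
  have mI : measurable_fun setT (\1_Q : V -> R) by exact: measurable_indic.
  have mpI := measurable_phase p q mb mI.
  have mpv := measurable_phase p q mb mev.
  apply: (@le_lt_trans _ _ (\int[mu]_z ((S2 - S1)^-1 * (phase p q b \1_Q z + phase p q b ev z))%R%:E)%E).
    apply: ge0_le_integralR => //.
    - by apply: measurable_funM => //; exact: measurable_funX.
    - by apply: measurable_funM; [exact: measurable_cst|exact: measurable_funD].
    move=> z _; rewrite divr_ge0 ?exprn_ge0 ?enorm_ge0 ?(ltW S0)//= mulrC ler_wpM2l ?invr_ge0 ?(ltW S0)//.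
    have [Qz|nQ] := pselect (Q z); last first.
      rewrite v0// /enorm /edot big1 => [|i _]; last by rewrite big1// => j _; rewrite mxE mul0r.
      by rewrite sqrtr0 expr0n/= addr_ge0// phase_ge0.
    have ph1 : 1 <= phase p q b \1_Q z.
      by rewrite /phase indicE mem_set//= normr1 !powR1 mulr1 lerDl.
    have ph0 := phase_ge0 p q b0 ev z.
    have [le1|gt1] := leP (enorm (v z)) 1.
      have : enorm (v z) ^+ 2 <= 1 by rewrite exprn_ile1// enorm_ge0.
      by lra.
    apply: (@le_trans _ _ (phase p q b ev z)); last by lra.
    rewrite /phase ger0_norm ?enorm_ge0// -powR_mulrn ?enorm_ge0//.
    rewrite ler_wpDr ?mulr_ge0 ?powR_ge0// ler_powR// ltW//.
  rewrite ge0_integralZlR//; [|exact: measurable_funD|by move=> z _; rewrite addr_ge0// phase_ge0|by rewrite invr_ge0 ltW].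
  apply: lte_mul_pinfty; [by rewrite lee_fin invr_ge0 ltW|by []|].
  rewrite ge0_integralDR//; try by move=> z _; rewrite phase_ge0.
  exact: (lte_add_pinfty (phase_indic hp hpq M0 mQ QM mb b0 bM) iv).
have mev2 : measurable_fun setT (fun z => enorm (v z) ^+ 2 / (S2 - S1)).
  by apply: measurable_funM => //; exact: measurable_funX.
have e20 z : 0 <= enorm (v z) ^+ 2 / (S2 - S1).
  by rewrite divr_ge0 ?exprn_ge0 ?enorm_ge0// ltW.
have Yoo : (\int[mu]_z (Y z)%:E < +oo)%E.
  rewrite ge0_integralDR//; [|exact: measurable_funD|exact: measurable_phase|by move=> z _; rewrite addr_ge0// phase_ge0|by move=> z _; rewrite phase_ge0].
  rewrite ge0_integralDR//; last by move=> z _; rewrite phase_ge0.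
  exact: (lte_add_pinfty (lte_add_pinfty iv' iv2) iF).
have iY : mu.-integrable setT (EFin \o Y).
  by apply: (integrableR measurableT mY mY) => // z _; rewrite ger0_norm.
have mI := measurable_int _ iI; have {}mI : measurable_fun setT I by exact/measurable_EFinP.
have iCY : mu.-integrable setT (EFin \o (fun z => cacc_C * Y z)) by exact: (integrableZl measurableT cacc_C iY).
apply: (@le_trans _ _ (\int[mu]_z (cacc_C * Y z - I z)%:E)%E).
  apply: ge0_le_integralR => //.
    by apply: measurable_funB => //; exact: measurable_funM.
  by move=> z _; rewrite X0 XY.
have iCYI : mu.-integrable setT (EFin \o (fun z => cacc_C * Y z - I z)).
  exact: (integrableB measurableT iCY iI).
rewrite -[X in (X <= _)%E]fineK; last exact: (integrable_fin_num measurableT iCYI).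
rewrite -[fine _]/(\int[mu]_z (cacc_C * Y z - I z)) (RintegralB measurableT iCY iI) I0 subr0.
rewrite (RintegralZl cacc_C measurableT iY) EFinM fineK//; exact: (integrable_fin_num measurableT iY).
Qed.

End caccioppoli.

(** * Reduction to Borel data *)

Import HBNNSimple.

Section off_null.
Context d (T : measurableType d) (R : realType) (mu : {measure set T -> \bar R}).
Local Open Scope ereal_scope.

(** The integral is a supremum over simple functions, so f and g may be nonmeasurable: a simple
    function below f, set to 0 on A, lies below g and has the same integral. This is needed because
    u, Du and F are not assumed Borel. *)
Lemma ge0_le_integral_off_null (A : set T) (f g : T -> \bar R) : measurable A -> mu A = 0 ->
  (forall x, 0 <= f x) -> (forall x, 0 <= g x) -> (forall x, ~ A x -> f x <= g x) ->
  \int[mu]_x f x <= \int[mu]_x g x.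
Proof.
move=> mA A0 f0 g0 fg; rewrite !ge0_integralTE//; apply: ge_ereal_sup => _ [h hf <-].
pose h' := mul_nnsfun h (indic_nnsfun R (measurableC mA)).
have -> : sintegral mu h = sintegral mu h'.
  rewrite -!integralT_nnsfun; apply: ae_eq_integral => //.
  - exact/measurable_EFinP.
  - exact/measurable_EFinP.
  - exists A; split => // x /= hx; apply: contrapT => nA; apply: hx => _.
    by rewrite -[RHS]/((h x * \1_(~` A) x)%R%:E) indicE mem_set//= mulr1.
apply: ereal_sup_ubound; exists h' => // x /=.
rewrite -[X in X%:E]/(h x * \1_(~` A) x)%R indicE; have [Ax|nAx] := pselect (A x).
  by rewrite memNset ?mulr0//= => /(_ Ax).
by rewrite mem_set//= mulr1; exact: le_trans (hf x) (fg x nAx).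
Qed.

Lemma eq_integral_off_null (A : set T) (f g : T -> \bar R) : measurable A -> mu A = 0 ->
  (forall x, ~ A x -> f x = g x) -> \int[mu]_x f x = \int[mu]_x g x.
Proof.
move=> mA A0 fg; rewrite integralE [RHS]integralE; congr (_ - _); apply/eqP; rewrite eq_le;
  apply/andP; split; apply: (ge0_le_integral_off_null mA A0) => //;
  by move=> x /fg E; rewrite ?funeposE ?funenegE E.
Qed.

(** Converts agreement almost everywhere with a Borel function into genuine measurability on every
    measurable set that avoids a null set. In this form several exceptional sets can be merged. *)
Lemma lebesgue_measurable_off_null m k (D : set T) (f : T -> 'M[R]_(m, k)) : measurable D ->
  lebesgue_measurable mu D f -> exists A, [/\ measurable A, mu A = 0 &
    forall E i j, measurable E -> E `<=` D `\` A -> measurable_fun E (fun z => f z i j)].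
Proof.
move=> mD [g mg [A [mA A0 fgA]]]; exists A; split => // E i j mE ED.
apply: (@eq_measurable_fun _ _ _ _ _ (fun z => g z i j)).
  move=> z; rewrite inE => /ED[Dz nAz]; have : ~ ~ (D z -> f z = g z) by move=> /fgA.
  by move=> /contrapT/(_ Dz) ->.
have mgE : measurable_fun E g by apply: measurable_funS mg => // z /ED[].
exact: (measurableT_comp (measurable_coord i j) mgE).
Qed.

(* A Caratheodory field composed with [X] is the limit of its compositions with
   the roundings of [X] to the grids of mesh 1/(l+1), which take countably many values. *)
Lemma caratheodory_off_null m k m' k' (D G : set T) (A : T -> 'M[R]_(m, k) -> 'M[R]_(m', k'))
    (X : T -> 'M[R]_(m, k)) : measurable D -> measurable G -> G `<=` D ->
  (forall xi, lebesgue_measurable mu D (A ^~ xi)) -> (forall z, G z -> continuous (A z)) ->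
  (forall i j, measurable_fun G (fun z => X z i j)) ->
  exists Z, [/\ measurable Z, mu Z = 0 &
    forall E i j, measurable E -> E `<=` G `\` Z -> measurable_fun E (fun z => A z (X z) i j)].
Proof.
move=> mD mG GD mA cA mX.
pose H xi := cid (lebesgue_measurable_off_null mD (mA xi)).
pose xi (c : 'M[int]_(m, k) * nat) : 'M[R]_(m, k) :=
  (\matrix_(i, j) ((c.1 i j)%:~R / c.2.+1%:R))%R.
pose Z l := if (unpickle l : option ('M[int]_(m, k) * nat)) is Some c then sval (H (xi c)) else set0.
have mZ l : measurable (Z l) by rewrite /Z; case: unpickle => // c; case: (svalP (H (xi c))).
have Z0 l : mu (Z l) = 0 by rewrite /Z; case: unpickle => // c; case: (svalP (H (xi c))).
exists (\bigcup_l Z l); split.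
- exact: bigcupT_measurable.
- apply: measure_negligible; first exact: bigcupT_measurable.
  by apply: negligible_bigcup => l; exists (Z l); split.
move=> E i j mE EGZ.
have EX i' j' : measurable_fun E (fun z => X z i' j').
  by apply: measurable_funS (mX i' j') => // z /EGZ[].
have EA c : measurable_fun E (fun z => A z (xi c) i j).
  case: (svalP (H (xi c))) => _ _; apply => // z /EGZ[Gz nZ]; split; first exact: GD.
  by move=> Hz; apply: nZ; exists (pickle c) => //; rewrite /Z pickleK.
pose fl l z : 'M[int]_(m, k) := (\matrix_(i, j) Num.floor (X z i j * l.+1%:R))%R.
apply: (@measurable_fun_cvg _ _ _ E (fun l z => A z (xi (fl l z, l)) i j)).
  move=> l _ Y mY.
  (* The rounded field is measurable because on the set where the rounding equals c, a box in the
     values of X, it is the field at a constant argument; there are countably many integer matrices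
     c. *)
  rewrite (_ : _ `&` _ = \bigcup_(c : 'M[int]_(m, k))
     (\bigcap_(a in [set: 'I_m * 'I_k]) (E `&` (fun z => X z a.1 a.2) @^-1`
        `[((c a.1 a.2)%:~R / l.+1%:R)%R, ((c a.1 a.2 + 1)%:~R / l.+1%:R)%R[%classic) `&`
     (E `&` (fun z => A z (xi (c, l)) i j) @^-1` Y))).
    apply: countable_bigcupT_measurable; first exact: countableP.
    move=> c; apply: measurableI; last exact: EA.
    apply: fin_bigcap_measurable; first exact: finite_finset.
    by move=> a _; apply: EX.
  apply/seteqP; split => [z [Ez Yz]|z [c _ [Hc [Ez Yz]]]].
    exists (fl l z) => //; split => // a _; split => //=.
    rewrite in_itv/= mxE ler_pdivrMr// ltr_pdivlMr// floor_itv//.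
  split => //=; suff -> : fl l z = c by [].
  apply/matrixP => a b; rewrite mxE; apply: floor_def.
  have [_] := Hc (a, b) I; rewrite /= in_itv/= => /andP[].
  by rewrite ler_pdivrMr// ltr_pdivlMr// => -> ->.
move=> z /EGZ[Gz _].
(* Rounding down to mesh 1/(l+1) moves each entry by less than the mesh. *)
have xc : (fun l => xi (fl l z, l)) @ \oo --> X z.
  apply/cvg_ballP => e e0; near=> l; split => // a b.
  rewrite /ball /= !mxE.
  have l0 : (0 < l.+1%:R :> R)%R by rewrite ltr0n.
  have := floor_itv (X z a b * l.+1%:R)%R; set fx := Num.floor _ => /andP[f1 f2].
  rewrite -(ltr_pM2r l0) -{2}(gtr0_norm l0) -normrM mulrBl divfK ?gt_eqF//.
  rewrite ger0_norm ?subr_ge0//; apply: (@le_lt_trans _ _ 1%R); first by rewrite intrD in f2; lra.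
  have : (e^-1 < l.+1%:R)%R.
    apply: (@lt_trans _ _ (l%:R)%R); last by rewrite ltr_nat.
    by near: l; exact: nbhs_infty_gtr.
  by rewrite invf_plt ?posrE// => h; rewrite -ltr_pdivrMr// div1r.
have := cvg_comp _ _ xc (cA z Gz (X z)) => h.
have cc := @coord_continuous R m' k' i j (A z (X z)).
exact: (cvg_comp _ _ h cc).
Unshelve. all: by end_near. Qed.

End off_null.

Section sections.
Context {R : realType} {n : nat}.
Local Notation V := ('rV[R]_n * measurableTypeR R)%type.
Local Notation mu := (@st_lebesgue R n).

(** Tonelli's theorem for the indicator. It lets the exceptional set of space-time be ignored on
    almost every time slice. *)
Lemma ae_null_ysection (X : set V) : measurable X -> mu X = 0%E ->
  {ae @lebesgue_measure R, forall t : measurableTypeR R, rV_lebesgue n (ysection X t) = 0%E}.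
Proof.
move=> mX X0.
have mY : measurable_fun setT (fun t : measurableTypeR R => rV_lebesgue n (ysection X t)).
  exact: measurable_fun_ysection.
have mI : measurable_fun setT (\1_X : V -> R) by exact: measurable_indic.
have I0 : (\int[@lebesgue_measure R]_(t in setT) `|rV_lebesgue n (ysection X t)| = 0)%E.
  rewrite -X0 -[X in mu X]setIT -integral_indic//.
  have f0 (z : V) : (0 <= (\1_X z)%:E :> \bar R)%E by rewrite lee_fin indicE.
  have mf : measurable_fun setT (EFin \o (\1_X : V -> R)) by exact/measurable_EFinP.
  rewrite [RHS](@fubini_tonelli2 _ _ _ _ R (rV_lebesgue n) (@lebesgue_measure R) _ mf f0).
  apply: eq_integral => t _; rewrite gee0_abs// /fubini_G.
  rewrite (_ : (fun x => _) = (fun x => (\1_(ysection X t) x)%:E)); last first.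
    by apply/funext => x; rewrite !indicE /= mem_ysection.
  by rewrite integral_indic ?setIT//; exact: measurable_ysection.
have := (ae_eq_integral_abs _ measurableT mY).1 I0.
by apply: filterS => t; exact.
Qed.

End sections.

(** * From weak solutions to Borel data on a cylinder *)

Section weak_solution_cylinder.
Context {R : realType} {n N : nat}.
Local Notation V := ('rV[R]_n * measurableTypeR R)%type.
Local Notation E := ('rV[R]_n * R)%type.
Local Notation mu := (@st_lebesgue R n).
Variables (p q nu L alpha T : R) (Omega : set 'rV[R]_n) (a : E -> R)
  (A : E -> 'M[R]_(N, n) -> 'M[R]_(N, n)) (F : E -> 'M[R]_(N, n))
  (u : E -> 'rV[R]_N) (Du : E -> 'M[R]_(N, n)).
Local Notation D := (st_domain Omega T).
Hypotheses (hp : 2 <= p) (hpq : p < q) (hnu : 0 < nu) (hL : 0 <= L) (ha : 0 < alpha <= 1).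
Hypotheses (oO : open Omega) (Ha : holder_coefficient alpha Omega T a)
  (HA : double_phase_field p q nu L Omega T a A) (HF : double_phase_source p q Omega T a F)
  (HU : weak_solution p q Omega T a A F u Du).
Variables (x0 : 'rV[R]_n) (t0 R2 S2 : R).
Local Notation Q := (cylinder x0 t0 R2 S2).
Hypotheses (R20 : 0 < R2) (S20 : 0 < S2) (QD : Q `<=` D).

Lemma measurable_cylinder (r s : R) : measurable (cylinder x0 t0 r s).
Proof. by apply: measurableX; [exact: eball_measurable|exact: measurable_itv]. Qed.

Lemma open_st_domain : open (D : set E).
Proof.
have -> : D = [set z : E | Omega z.1] `&` [set z : E | `]0, T[%classic z.2].
  by apply/seteqP; split.
apply: openI; first by apply: open_comp => // z _; exact: cvg_fst.
by apply: open_comp; [move=> z _; exact: cvg_snd|exact: interval_open].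
Qed.

Let mD : measurable D. Proof. exact: (open_measurable_st open_st_domain). Qed.
Let mQ : measurable Q. Proof. exact: measurable_cylinder. Qed.

(** All exceptional sets are merged into a single Borel null set: three for measurability of u, Du
    and F, one for continuity of A in the gradient variable, one for the structure conditions and
    one for measurability of A(z, Du). *)
Lemma good_set : exists Z : set V, [/\ measurable Z, mu Z = 0%E,
  (forall i, measurable_fun (Q `\` Z) (fun z => u z ord0 i)) /\
  (forall i j, measurable_fun (Q `\` Z) (fun z => Du z i j)) /\
  (forall i j, measurable_fun (Q `\` Z) (fun z => F z i j)),
  forall i j, measurable_fun (Q `\` Z) (fun z => A z (Du z) i j) &
  forall z, (Q `\` Z) z ->
    nu * (enorm (Du z) `^ p + a z * enorm (Du z) `^ q) <= edot (A z (Du z)) (Du z) /\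
    enorm (A z (Du z)) <= L * (enorm (Du z) `^ (p - 1) + a z * enorm (Du z) `^ (q - 1))].
Proof.
case: HU => _ [[mu_u _] [mu_Du _] _] _ _; case: HF => mF _.
case: HA => mA [Z4 [mZ4 Z40 H4]] [Z5 [mZ5 Z50 H5]].
have [Z1 [mZ1 Z10 H1]] := lebesgue_measurable_off_null mD mu_u.
have [Z2 [mZ2 Z20 H2]] := lebesgue_measurable_off_null mD mu_Du.
have [Z3 [mZ3 Z30 H3]] := lebesgue_measurable_off_null mD mF.
(* Off Z2 the gradient is Borel and off Z4 the field is continuous in its second argument, as the
   composition requires; Z6 is produced afterwards. *)
pose G0 := Q `\` (Z2 `|` Z4).
have mG0 : measurable G0 by apply: measurableD => //; exact: measurableU.
have G0D : G0 `<=` D by move=> z [/QD].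
have cA z : G0 z -> continuous (A z).
  move=> [/QD Dz nZ]; have : ~ ~ (D z -> continuous (A z)) by move=> /H4 Hz; apply: nZ; right.
  by move=> /contrapT; apply.
have mDu i j : measurable_fun G0 (fun z => Du z i j).
  by apply: H2 => // z [/QD Dz nZ]; split => // h; apply: nZ; left.
have [Z6 [mZ6 Z60 H6]] := caratheodory_off_null mD mG0 G0D mA cA mDu.
pose Z := Z1 `|` Z2 `|` Z3 `|` Z4 `|` Z5 `|` Z6.
have mZ : measurable Z by do !apply: measurableU => //.
have Z0 : mu Z = 0%E.
  have ng W : measurable W -> mu W = 0%E -> mu.-negligible W by move=> mW W0; exists W; split.
  by apply: measure_negligible => //; do !apply: negligibleU; exact: ng.
have mQZ : measurable (Q `\` Z) by exact: measurableD.
exists Z; split => //.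
- split => [i|]; first by apply: H1 => // z [/QD Dz nZ]; split => // h; apply: nZ; do 5!left.
  split => i j; first by apply: H2 => // z [/QD Dz nZ]; split => // h; apply: nZ; do 4!left; right.
  by apply: H3 => // z [/QD Dz nZ]; split => // h; apply: nZ; do 3!left; right.
- move=> i j; apply: H6 => // z [Qz nZ]; split; last by move=> h; apply: nZ; right.
  by split => // -[h|h]; apply: nZ; [do 4!left; right|do 2!left; right].
- move=> z [/QD Dz nZ]; have : ~ ~ (D z -> forall xi,
    nu * (enorm xi `^ p + a z * enorm xi `^ q) <= edot (A z xi) xi /\
    enorm (A z xi) <= L * (enorm xi `^ (p - 1) + a z * enorm xi `^ (q - 1))).
    by move=> /H5 Hz; apply: nZ; left; right.
  by move=> /contrapT /(_ Dz (Du z)).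
Qed.

Variable Z : set V.
Hypotheses (mZ : measurable Z) (Z0 : mu Z = 0%E).
Local Notation G := (Q `\` Z).
Hypotheses (mu' : forall i, measurable_fun G (fun z => u z ord0 i))
  (mDu : forall i j, measurable_fun G (fun z => Du z i j))
  (mF : forall i j, measurable_fun G (fun z => F z i j))
  (mA : forall i j, measurable_fun G (fun z => A z (Du z) i j)).
Hypothesis structure : forall z, G z ->
    nu * (enorm (Du z) `^ p + a z * enorm (Du z) `^ q) <= edot (A z (Du z)) (Du z) /\
    enorm (A z (Du z)) <= L * (enorm (Du z) `^ (p - 1) + a z * enorm (Du z) `^ (q - 1)).

Let mG : measurable G. Proof. exact: measurableD. Qed.

(** Multiplication by the indicator of the good part of the cylinder yields Borel functions on the
    whole space that vanish off Q, the form in which the energy estimate takes its data. *)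
Definition cut m k (X : E -> 'M[R]_(m, k)) (z : V) : 'M[R]_(m, k) := (\1_G z : R) *: X z.

Lemma cutE m k (X : E -> 'M[R]_(m, k)) z : G z -> cut X z = X z.
Proof. by move=> Gz; rewrite /cut indicE mem_set// scale1r. Qed.

Lemma cut0 m k (X : E -> 'M[R]_(m, k)) z : ~ G z -> cut X z = 0.
Proof. by move=> Gz; rewrite /cut indicE memNset// scale0r. Qed.

Lemma measurable_cut m k (X : E -> 'M[R]_(m, k)) i j :
  measurable_fun G (fun z : V => X z i j) -> measurable_fun setT (fun z => cut X z i j).
Proof.
move=> /(measurable_restrictT _ mG); apply: eq_measurable_fun => z _.
by rewrite /cut mxE indicE patchE; case: ifP; rewrite ?mul1r ?mul0r.
Qed.

Lemma enorm0 m k : enorm (0 : 'M[R]_(m, k)) = 0.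
Proof. by rewrite /enorm /edot big1 ?sqrtr0// => i _; rewrite big1// => j _; rewrite mxE mul0r. Qed.

Lemma edot0l m k (X : 'M[R]_(m, k)) : edot 0 X = 0.
Proof. by rewrite /edot big1// => i _; rewrite big1// => j _; rewrite mxE mul0r. Qed.

(** A rough triangle inequality, from |X - Y|^2 <= 2 (|X|^2 + |Y|^2); constants are immaterial where
    it is used. *)
Lemma enormB_le m k (X Y : 'M[R]_(m, k)) : enorm (X - Y) <= 2 * (enorm X + enorm Y).
Proof.
have s0 : 0 <= 2 * (enorm X + enorm Y) by rewrite mulr_ge0// addr_ge0 ?enorm_ge0.
rewrite -(@ler_pXn2r _ 2)// ?nnegrE ?enorm_ge0// enorm_sqr.
apply: (@le_trans _ _ (2 * (edot X X + edot Y Y))).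
  rewrite mulrDr /edot !mulr_sumr -big_split; apply: ler_sum => i _ /=.
  rewrite !mulr_sumr -big_split; apply: ler_sum => j _ /=; rewrite !mxE -subr_ge0.
  by rewrite (_ : _ - _ = (X i j + Y i j) ^+ 2) ?sqr_ge0//; ring.
rewrite -!enorm_sqr exprMn; have h1 := enorm_ge0 X; have h2 := enorm_ge0 Y.
have h3 := mulr_ge0 h1 h2; rewrite -subr_ge0.
rewrite (_ : _ - _ = 2 * (enorm X ^+ 2 + enorm Y ^+ 2) + 8 * (enorm X * enorm Y)); last ring.
by rewrite addr_ge0// mulr_ge0// addr_ge0// exprn_ge0.
Qed.

Lemma integral_cylinder_cut (f g : E -> R) : (forall z, G z -> f z = g z) ->
  (forall z, ~ Q z -> g z = 0) -> (\int[mu]_(z in Q) (f z)%:E = \int[mu]_z (g z)%:E)%E.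
Proof.
move=> fg g0; rewrite integral_mkcond; apply: (eq_integral_off_null mZ Z0) => z nZ.
rewrite patchE; case: ifPn => [|nQ]; first by rewrite inE => Qz; rewrite fg.
by rewrite g0// => Qz; move: nQ; rewrite mem_set.
Qed.

Lemma Rintegral_domain_cut (f g : E -> R) : (forall z, G z -> f z = g z) ->
  (forall z, ~ Q z -> f z = 0) -> (forall z, ~ Q z -> g z = 0) ->
  \int[mu]_(z in D) f z = \int[mu]_z g z.
Proof.
move=> fg f0 g0; rewrite /Rintegral; congr fine.
rewrite integral_mkcond; apply: (eq_integral_off_null mZ Z0) => z nZ.
have [Qz|nQ] := pselect (Q z).
  by rewrite patchE mem_set; [rewrite fg|exact: QD].
by rewrite g0// patchE f0//; case: ifP.
Qed.

Lemma ge0_integral_domain_cut (f g : E -> R) : (forall z, D z -> 0 <= f z) ->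
  (forall z, 0 <= g z) -> (forall z, G z -> g z <= f z) -> (forall z, ~ G z -> g z = 0) ->
  (\int[mu]_(z in D) (f z)%:E < +oo)%E -> (\int[mu]_z (g z)%:E < +oo)%E.
Proof.
move=> f0 g0 gf gG; apply: le_lt_trans; rewrite [X in (_ <= X)%E]integral_mkcond.
apply: (ge0_le_integral_off_null mZ Z0) => z.
- by rewrite lee_fin.
- by rewrite patchE; case: ifPn => //; rewrite inE => /f0; rewrite lee_fin.
move=> nZ; rewrite patchE; case: ifPn => [|nD].
  rewrite inE => Dz; rewrite lee_fin; have [Gz|nG] := pselect (G z); first exact: gf.
  by rewrite gG// f0.
by rewrite gG// => -[/QD Dz _]; move: nD; rewrite mem_set.
Qed.

(** Restricted to Q but not to the good set: a is continuous in the domain, hence Borel there, and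
    its Hoelder estimate must hold at all pairs of points of Q. *)
Definition coeff (z : V) : R := \1_Q z * a z.

Lemma coeffE z : Q z -> coeff z = a z.
Proof. by move=> Qz; rewrite /coeff indicE mem_set// mul1r. Qed.

Lemma coeff_ge0 z : 0 <= coeff z.
Proof.
case: Ha => a0 _ _; rewrite /coeff indicE; have [Qz|nQ] := pselect (Q z).
  by rewrite mem_set// mul1r a0//; exact: QD.
by rewrite memNset// mul0r.
Qed.

Lemma coeff_le : exists M, forall z, coeff z <= M.
Proof.
case: Ha => _ [M aM] _; exists `|M| => z; rewrite /coeff indicE.
have [Qz|nQ] := pselect (Q z); last by rewrite memNset// mul0r.
by rewrite mem_set// mul1r; apply: le_trans (aM _ (QD Qz)) _; exact: ler_norm.
Qed.

Let holder_sub : exists2 K, 0 < K & forall z z' : E, D z -> D z' ->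
  `|a z - a z'| <= K * (enorm (z.1 - z'.1) `^ alpha + `|z.2 - z'.2| `^ (alpha / 2)).
Proof.
case: Ha => _ _ [K K0 [H1 H2]]; exists K => // -[x t] [y s] /= [Ox Tt] [Oy Ts].
rewrite (_ : a (x, t) - a (y, s) = (a (x, t) - a (y, t)) + (a (y, t) - a (y, s))); last ring.
by apply: le_trans (ler_normD _ _) _; rewrite mulrDr; apply: lerD; [exact: H1|exact: H2].
Qed.

Lemma coeff_holder : exists2 K, 0 <= K & forall z z' : V, Q z -> Q z' ->
  coeff z - coeff z' <= K * (enorm (z.1 - z'.1) `^ alpha + `|(z.2 : R) - z'.2| `^ (alpha / 2)).
Proof.
have [K K0 H] := holder_sub; exists K; first exact: ltW.
move=> z z' Qz Qz'; rewrite !coeffE//; apply: le_trans (ler_norm _) _.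
exact: H (QD Qz) (QD Qz').
Qed.

Lemma measurable_coeff : measurable_fun setT coeff.
Proof.
have [K K0 H] := holder_sub.
have ca (z : E) : D z -> {for z, continuous a}.
  move=> Dz; apply/cvgrPdist_lt => e e0.
  have [/andP[al0 _]] := (ha, I).
  have a20 : 0 < alpha / 2 by rewrite divr_gt0.
  (* Radii d^(1/alpha) in space and d^(2/alpha) in time make each of the two Hoelder terms smaller
     than d, and 2 K d = e. *)
  pose d := e / (K * 2).
  have d0 : 0 < d by rewrite divr_gt0// mulr_gt0.
  have D1 : nbhs (z : E) (D : set E) by apply: open_nbhs_nbhs; split => //; exact: open_st_domain.
  have c1 : continuous (fun y : E => edot (y.1 - z.1) (y.1 - z.1)).
    exact: (@smooth_continuous R E R _ (@smooth_fst R n R _ (@smooth_sqdist R n z.1))).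
  have c2 : continuous (fun y : E => enorm (y.1 - z.1)).
    move=> y; apply: (@continuous_comp _ _ _ (fun y : E => edot (y.1 - z.1) (y.1 - z.1))); first exact: c1.
    exact: sqrt_continuous.
  have D2 : nbhs (z : E) [set y : E | enorm (y.1 - z.1) < d `^ alpha^-1].
    have l2 : (fun y : E => enorm (y.1 - z.1)) @ z --> (0 : R).
      by have := c2 z; rewrite /continuous_at subrr enorm0.
    by apply: (@cvgr_lt _ _ _ _ _ _ l2); rewrite powR_gt0.
  have D3 : nbhs (z : E) [set y : E | `|y.2 - z.2| < d `^ (alpha / 2)^-1].
    have c3 : continuous (fun y : E => `|y.2 - z.2|).
      move=> y; apply: cvg_norm; apply: cvgB; [exact: cvg_snd|exact: cvg_cst].
    have l3 : (fun y : E => `|y.2 - z.2|) @ z --> (0 : R).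
      by have := c3 z; rewrite /continuous_at subrr normr0.
    by apply: (@cvgr_lt _ _ _ _ _ _ l3); rewrite powR_gt0.
  suff : nbhs (z : E) [set t : E | `|a z - a t| < e] by [].
  have := @filterI _ _ (nbhs_filter (z : E)) _ _ (@filterI _ _ (nbhs_filter (z : E)) _ _ D1 D2) D3.
  apply: (@filterS _ _ (nbhs_filter (z : E))) => y [[Dy y1] y2] /=.
  rewrite distrC; apply: le_lt_trans (H _ _ Dy Dz) _.
  have P x r : 0 <= x -> 0 < r -> x < d `^ r^-1 -> x `^ r < d.
    move=> x0' r0 xd; have -> : d = (d `^ r^-1) `^ r by rewrite -powRrM mulVf ?gt_eqF// powRr1// ltW.
    by apply: gt0_ltr_powR; rewrite ?nnegrE ?powR_ge0.
  have := P _ _ (enorm_ge0 _) al0 y1; have := P _ _ (normr_ge0 _) a20 y2 => h1 h2.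
  rewrite -ltr_pdivlMl//; apply: lt_le_trans (ltrD h2 h1) _.
  by rewrite /d -mulr2n -mulr_natr invfM; rewrite le_eqVlt; apply/orP; left; apply/eqP; field; rewrite gt_eqF.
have ma : measurable_fun Q (a : V -> R).
  by apply: measurable_funS mD QD _; apply: continuous_at_measurable_st; [exact: open_st_domain|exact: ca].
move/(measurable_restrictT _ mQ) : ma; apply: eq_measurable_fun => z _.
by rewrite /coeff indicE patchE; case: ifP; rewrite ?mul1r ?mul0r.
Qed.

Let M : R := enorm x0 + R2 + `|t0| + S2.

Let M0 : 0 <= M.
Proof. by rewrite !addr_ge0 ?enorm_ge0 ?(ltW R20) ?(ltW S20). Qed.

Let QM : Q `<=` st_cube M M.
Proof.
move=> z [/= z1]; rewrite in_itv/= => /andP[t1 t2].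
have e0 := enorm_ge0 x0; have n0 := normr_ge0 t0; have R0 := R20; have S0 := S20; split => [i|].
  apply: (@le_lt_trans _ _ (enorm (z.1 - x0) + enorm x0)).
    rewrite -[z.1 in leLHS](subrK x0) mxE; apply: le_trans (ler_normD _ _) _.
    by apply: lerD; exact: coord_le_enorm.
  rewrite /M; move: z1; rewrite /eball /=; set ez := enorm (z.1 - x0) => z1; lra.
have n1 := ler_norm t0; have n2 := ler_norm (- t0); rewrite normrN in n2.
by rewrite ltr_norml /M; apply/andP; split; lra.
Qed.

Let hq : 2 <= q. Proof. by have h := hp; have h' := hpq; lra. Qed.
Let b0 := coeff_ge0.
Let mb := measurable_coeff.

Let cutQ0 m k (X : E -> 'M[R]_(m, k)) z : ~ Q z -> cut X z = 0.
Proof. by move=> nQ; apply: cut0 => -[]. Qed.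

Lemma phase_cut m k (X : E -> 'M[R]_(m, k)) z : G z ->
  phase p q coeff (fun z => enorm (cut X z)) z = Hfun p q a z (enorm (X z)).
Proof. by move=> Gz; rewrite /phase cutE// ger0_norm ?enorm_ge0// coeffE//; case: Gz. Qed.

Let phase_cut0 m k (X : E -> 'M[R]_(m, k)) z : ~ G z ->
  phase p q coeff (fun z => enorm (cut X z)) z = 0.
Proof.
move=> nG; have h := hp; have h' := hq.
by rewrite /phase cut0// enorm0 normr0 !powR0 ?mulr0 ?addr0// gt_eqF//; lra.
Qed.

Let Hfun_ge0 z s : D z -> 0 <= Hfun p q a z s.
Proof. by case: Ha => a0 _ _ Dz; rewrite addr_ge0 ?mulr_ge0 ?powR_ge0// a0. Qed.

Lemma phase_cut_u : (\int[mu]_z (phase p q coeff (fun z => enorm (cut u z)) z)%:E < +oo)%E.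
Proof.
case: HU => _ _ i_u _; apply: ge0_integral_domain_cut i_u.
- by move=> z Dz; rewrite addr_ge0// Hfun_ge0.
- by move=> z; exact: phase_ge0.
- by move=> z Gz; rewrite phase_cut// lerDl Hfun_ge0//; apply: QD; case: Gz.
- exact: phase_cut0.
Qed.

Lemma phase_cut_Du : (\int[mu]_z (phase p q coeff (fun z => enorm (cut Du z)) z)%:E < +oo)%E.
Proof.
case: HU => _ _ i_u _; apply: ge0_integral_domain_cut i_u.
- by move=> z Dz; rewrite addr_ge0// Hfun_ge0.
- by move=> z; exact: phase_ge0.
- by move=> z Gz; rewrite phase_cut// lerDr Hfun_ge0//; apply: QD; case: Gz.
- exact: phase_cut0.
Qed.

Lemma phase_cut_F : (\int[mu]_z (phase p q coeff (fun z => enorm (cut F z)) z)%:E < +oo)%E.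
Proof.
case: HF => _ i_F; apply: ge0_integral_domain_cut i_F.
- by move=> z Dz; exact: Hfun_ge0.
- by move=> z; exact: phase_ge0.
- by move=> z Gz; rewrite phase_cut.
- exact: phase_cut0.
Qed.

Let muc i : measurable_fun setT (fun z => cut u z ord0 i). Proof. exact: measurable_cut. Qed.
Let mDuc i j : measurable_fun setT (fun z => cut Du z i j). Proof. exact: measurable_cut. Qed.
Let mFc i j : measurable_fun setT (fun z => cut F z i j). Proof. exact: measurable_cut. Qed.
Let AD z := A z (Du z).
Let mAc i j : measurable_fun setT (fun z => cut AD z i j). Proof. exact: measurable_cut. Qed.

Variable k0 : 'rV[R]_N.
Let uk z := u z - k0.

Let mukc i : measurable_fun setT (fun z => cut uk z ord0 i).
Proof.
apply: measurable_cut; rewrite (_ : (fun z => _) = fun z => u z ord0 i - k0 ord0 i).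
  exact: measurable_funB.
by apply/funext => z; rewrite !mxE.
Qed.

Let meu : measurable_fun setT (fun z => enorm (cut u z)).
Proof. by apply: measurable_enorm => i j; rewrite (ord1 i). Qed.
Let meuk : measurable_fun setT (fun z => enorm (cut uk z)).
Proof. by apply: measurable_enorm => i j; rewrite (ord1 i). Qed.
Let meDu : measurable_fun setT (fun z => enorm (cut Du z)).
Proof. exact: measurable_enorm. Qed.
Let meF : measurable_fun setT (fun z => enorm (cut F z)).
Proof. exact: measurable_enorm. Qed.

Let indicQ_phase : (\int[mu]_z (phase p q coeff (\1_Q : V -> R) z)%:E < +oo)%E.
Proof. by have [Mb bM] := coeff_le; exact: (phase_indic hp hpq M0 mQ QM mb b0 bM). Qed.

Lemma phase_cut_uk : (\int[mu]_z (phase p q coeff (fun z => enorm (cut uk z)) z)%:E < +oo)%E.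
Proof.
have mI : measurable_fun setT (\1_Q : V -> R) by exact: measurable_indic.
have mkI : measurable_fun setT (fun z : V => enorm k0 * \1_Q z) by exact: measurable_funM.
have ik : (\int[mu]_z (phase p q coeff (fun z => enorm k0 * \1_Q z) z)%:E < +oo)%E.
  apply: (phase_dom hp hpq mb b0 (enorm_ge0 k0) mkI mI mI _ indicQ_phase indicQ_phase) => z.
  by rewrite normrM (ger0_norm (enorm_ge0 _)) ler_wpM2l ?enorm_ge0// lerDl.
apply: (phase_dom hp hpq mb b0 (ler0n R 2) meuk meu mkI _ phase_cut_u ik) => z.
have wk : 0 <= enorm k0 * \1_Q z by rewrite indicE; apply: mulr_ge0; rewrite ?enorm_ge0.
rewrite (ger0_norm wk) !(ger0_norm (enorm_ge0 _)).
have [Gz|nG] := pselect (G z); last first.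
  by rewrite !cut0// !enorm0 add0r mulr_ge0.
rewrite !cutE// indicE mem_set; last by case: Gz.
by rewrite mulr1; exact: enormB_le.
Qed.

Let cut_L1 m k (X : E -> 'M[R]_(m, k)) i j : (forall i j, measurable_fun setT (fun z => cut X z i j)) ->
  (\int[mu]_z (phase p q coeff (fun z => enorm (cut X z)) z)%:E < +oo)%E ->
  (\int[mu]_z `|cut X z i j|%:E < +oo)%E.
Proof.
move=> mX iX; have me := measurable_enorm mX.
apply: (phase_L1 hp M0 mQ QM mb b0 (mX i j)).
  by move=> z nQ; rewrite cutQ0// mxE.
apply: (phase_dom hp hpq mb b0 ler01 (mX i j) me me _ iX iX) => z.
rewrite mul1r [in leRHS]ger0_norm ?enorm_ge0//.
by apply: le_trans (coord_le_enorm _ i j) _; rewrite lerDl enorm_ge0.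
Qed.

(** On the bounded cylinder the powers p - 1 and q - 1 are dominated by the phase plus the phase of
    the indicator, by Young's inequality against the constant 1. So both fluxes are integrable. *)
Let pow_L1 (f : V -> R) : measurable_fun setT f -> (forall z, 0 <= f z) ->
  (forall z, ~ Q z -> f z = 0) -> (\int[mu]_z (phase p q coeff f z)%:E < +oo)%E ->
  (\int[mu]_z (f z `^ (p - 1) + coeff z * f z `^ (q - 1))%:E < +oo)%E.
Proof.
move=> mf f0 fQ i_f; have h := hp; have h' := hq.
have mI : measurable_fun setT (\1_Q : V -> R) by exact: measurable_indic.
have mpI := measurable_phase p q mb mI; have mpf := measurable_phase p q mb mf.
have mpow x : measurable_fun setT (fun z => f z `^ x).
  exact: (measurableT_comp (measurable_powR x) mf).
apply: (@le_lt_trans _ _ (\int[mu]_z (phase p q coeff f z + phase p q coeff \1_Q z)%:E)%E); last first.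
  rewrite ge0_integralDR//; try by move=> z _; exact: phase_ge0.
  exact: lte_add_pinfty i_f indicQ_phase.
apply: ge0_le_integralR => //.
- by apply: measurable_funD => //; exact: measurable_funM.
- exact: measurable_funD.
move=> z _; have bz := b0 z; apply/andP; split.
  by apply: addr_ge0; [exact: powR_ge0|apply: mulr_ge0 => //; exact: powR_ge0].
have [Qz|nQ] := pselect (Q z); last first.
  rewrite fQ// !powR0; [|rewrite gt_eqF//; lra|rewrite gt_eqF//; lra].
  by rewrite mulr0 addr0 addr_ge0//; exact: phase_ge0.
rewrite /phase indicE mem_set//= normr1 !powR1 mulr1 (ger0_norm (f0 z)).
have p1 : 1 <= p by lra.
have q1 : 1 <= q by lra.
have := young1 p1 (f0 z) ler01; have := ler_wpM2l bz (young1 q1 (f0 z) ler01).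
rewrite !powR1 !mulr1 mulrDr mulr1 => h1 h2.
by rewrite addrACA; exact: lerD.
Qed.

Let int_test (X : V -> R) (psi : E -> R) M' : measurable_fun setT X ->
  (\int[mu]_z `|X z|%:E < +oo)%E -> continuous psi -> supp_in M' psi ->
  mu.-integrable setT (EFin \o (fun z => X z * psi z)).
Proof.
move=> mX iX cp sp; have [C C0 HC] := supp_in_bounded cp sp.
have mp : measurable_fun setT (psi : V -> R) by exact: continuous_measurable_st.
have maX : measurable_fun setT (fun z => `|X z|) by exact: measurableT_comp.
apply: (@integrableR _ _ _ _ _ (fun z => X z * psi z) (fun z => C * `|X z|)) => //.
- exact: measurable_funM.
- exact: measurable_funM.
- by move=> z _; rewrite normrM mulrC ler_wpM2r.
rewrite ge0_integralZlR//; apply: lte_mul_pinfty; [by rewrite lee_fin|by []|exact: iX].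
Qed.

(** Derivatives of test functions integrate to 0, so subtracting the constant k0 from u changes
    neither the gradient relation nor the equation. The indicator appears because the truncation of
    u - k0 subtracts k0 only on the good set. *)
Let int_cst_derive (psi : E -> R) (w : E) (c : R) : test_function Q psi ->
  mu.-integrable setT (EFin \o (fun z : V => \1_G z * c * 'D_w psi z)) /\
  \int[mu]_z (\1_G z * c * 'D_w psi z) = 0.
Proof.
move=> tp; have [sp _ _] := tp; have spM := test_function_supp_in QM tp.
have cD : continuous ('D_w psi) by exact/smooth_continuous/smooth_D.
have sD : supp_in (M + 1) ('D_w psi) by exact: supp_in_derive.
have mI : measurable_fun setT (fun z : V => \1_G z * c).
  by apply: measurable_funM => //; exact: measurable_indic.
have iI : (\int[mu]_z `|\1_G z * c|%:E < +oo)%E.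
  apply: (@le_lt_trans _ _ (\int[mu]_z (`|c| * \1_Q z)%:E)%E).
    apply: ge0_le_integralR => //.
    - exact: measurableT_comp.
    - by apply: measurable_funM => //; exact: measurable_indic.
    move=> z _; rewrite normr_ge0 /= normrM mulrC ler_wpM2l// !indicE.
    have [Gz|nG] := pselect (G z); last by rewrite memNset// normr0.
    by rewrite mem_set// mem_set ?normr1//; case: Gz.
  rewrite ge0_integralZlR//.
  rewrite integral_indic// setIT; apply: lte_mul_pinfty; [by rewrite lee_fin|by []|].
  apply: (@le_lt_trans _ _ (mu (st_cube M M))).
    by apply: le_measure; rewrite ?inE//; exact: measurable_st_cube.
  by rewrite st_lebesgue_cube// ltry.
split; first exact: int_test cD sD.
transitivity (\int[mu]_z (c * 'D_w psi z)).
  rewrite /Rintegral; congr fine; apply: (eq_integral_off_null mZ Z0) => z nZ.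
  have [Qz|nQ] := pselect (Q z); first by rewrite indicE mem_set// mul1r.
  by rewrite (test_function_derive0 _ tp nQ) !mulr0.
have iD : mu.-integrable setT (EFin \o ('D_w psi : V -> R)) by exact: integrable_supp_in cD sD.
by rewrite (RintegralZl c measurableT iD) (zero_int_derive _ sp spM) mulr0.
Qed.

(** The support of the slice is closed and contained in the projection of a compact set, hence
    compact; the inclusion in Omega comes from Q lying in the domain. *)
Let slice_test (psi : E -> R) (t : R) : test_function Q psi ->
  test_function Omega (fun x => psi (x, t)) /\
  forall j x, 'D_(delta_mx ord0 j) (fun x => psi (x, t)) x = 'D_(e_space j) psi (x, t).
Proof.
move=> tp; have [sp cp pQ] := tp.
pose l (x : 'rV[R]_n) : E := (x, 0).
have ll : linear l by move=> c x y; rewrite /l; congr pair; rewrite /= scaler0 addr0.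
have cpair (s : R) : continuous (fun x : 'rV[R]_n => (x, s) : E).
  move=> x U [[U1 U2] /= [n1 n2] sU].
  apply: (@filterS _ _ (nbhs_filter x) _ _ _ n1) => y U1y.
  by apply: (sU (y, s)); split => //=; exact: nbhs_singleton n2.
have cl : continuous l by exact: cpair.
have lE : (fun x => psi (x, t)) = fun x => psi (l x + (0, t)).
  by apply/funext => x; congr psi; rewrite /l; congr pair; rewrite /= ?addr0 ?add0r.
split; last first.
  move=> j x; have D1 := @is_derive_comp_affine R 'rV[R]_n E R l (0, t) psi x (delta_mx ord0 j) ll
    (@smooth_derivable R _ _ _ _ _ sp).
  rewrite lE; case: D1 => _ ->; rewrite /e_space; congr ('D_ _ psi _).
  by rewrite /l; congr pair; rewrite /= ?addr0 ?add0r.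
have ct : continuous (fun x : 'rV[R]_n => (x, t) : E).
  exact: cpair.
pose K := closure [set z | psi z != 0].
have cK : closed ((fun x : 'rV[R]_n => (x, t) : E) @^-1` K).
  by apply: closed_comp => [x _|]; [exact: ct|exact: closed_closure].
have sK : closure [set x | psi (x, t) != 0] `<=` (fun x : 'rV[R]_n => (x, t) : E) @^-1` K.
  rewrite [X in _ `<=` X]((closure_id _).1 cK); apply: closure_subset => x /= px.
  exact: subset_closure.
split.
- by rewrite lE; exact: (@smooth_comp_affine R 'rV[R]_n E R l (0, t) psi ll cl sp).
- have cKx : compact (fst @` K).
    apply: continuous_compact => //; apply: continuous_subspaceT => z; exact: cvg_fst.
  apply: (subclosed_compact _ cKx); first exact: closed_closure.
  by move=> x /sK Kx; exists (x, t).
- by move=> x /sK /= /pQ /QD [].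
Qed.

(** The weak gradient is given slice by slice, for almost every time; integrating in time by
    Fubini's theorem produces the relation tested on space-time functions. *)
Lemma cut_grad (psi : E -> R) : test_function Q psi -> forall i j,
  \int[mu]_z (cut uk z ord0 i * 'D_(e_space j) psi z + cut Du z i j * psi z) = 0.
Proof.
move=> tp i j; have [sp _ _] := tp; have spM := test_function_supp_in QM tp.
have cp := smooth_continuous sp.
have cD : continuous ('D_(e_space j) psi) by exact/smooth_continuous/smooth_D.
have sD : supp_in (M + 1) ('D_(e_space j) psi) by exact: supp_in_derive.
have iu := cut_L1 ord0 i (fun i j => eq_ind_r (fun i => measurable_fun setT (fun z => cut u z i j)) (muc j) (ord1 i)) phase_cut_u.
have iDu := cut_L1 i j mDuc phase_cut_Du.
have i1 := int_test (muc i) iu cD sD; have i2 := int_test (mDuc i j) iDu cp spM.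
have [i3 z3] := int_cst_derive (e_space j) (k0 ord0 i) tp.
pose f (z : V) := cut u z ord0 i * 'D_(e_space j) psi z + cut Du z i j * psi z.
have i12 : mu.-integrable setT (EFin \o f) := integrableD measurableT i1 i2.
have -> : \int[mu]_z (cut uk z ord0 i * 'D_(e_space j) psi z + cut Du z i j * psi z) =
    \int[mu]_z (f z - \1_G z * k0 ord0 i * 'D_(e_space j) psi z).
  by apply: eq_Rintegral => z _; rewrite /f /cut /uk !mxE; ring.
rewrite (RintegralB measurableT i12 i3) z3 subr0 /Rintegral.
rewrite -[X in fine X](@integral21_prod_meas1 _ _ _ _ R (rV_lebesgue n) (@lebesgue_measure R) (EFin \o f) i12).
(* It is enough that almost every slice integrates to 0. Four null sets of times are avoided: two
   where a term is not integrable on the slice, one where the slice of Z is not null, one where the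
   slice of u is not in W^{1,1}. *)
have [Zt [mZt Zt0 HZt]] : {ae @lebesgue_measure R, forall t : measurableTypeR R,
    fubini_G (rV_lebesgue n) (EFin \o f) t = 0%E}; last first.
  rewrite (_ : (\int[_]_x _)%E = 0%E)//.
  rewrite -[RHS](integral0 (@lebesgue_measure R) setT).
  apply: (eq_integral_off_null mZt Zt0) => t nt; apply: contrapT => h; exact/nt/HZt.
case: HU => _ [_ _ slices] _ _.
have a1 := @ae_integrable2 _ _ _ _ R (rV_lebesgue n) (@lebesgue_measure R) _ i1.
have a2 := @ae_integrable2 _ _ _ _ R (rV_lebesgue n) (@lebesgue_measure R) _ i2.
have a3 := ae_null_ysection mZ Z0.
move: a1 a2 a3 slices => [Y1 [mY1 Y10 H1]] [Y2 [mY2 Y20 H2]] [Y3 [mY3 Y30 H3]] [Y4 [mY4 Y40 H4]].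
have mY : measurable (Y1 `|` Y2 `|` (Y3 `|` Y4)) by do !apply: measurableU.
exists (Y1 `|` Y2 `|` (Y3 `|` Y4)); split => //.
  have ng W : measurable W -> @lebesgue_measure R W = 0%E -> (@lebesgue_measure R).-negligible W.
    by move=> mW W0; exists W; split.
  by apply: measure_negligible => //; do !apply: negligibleU; exact: ng.
move=> t /= nt; apply: contrapT => nY; apply: nt.
have j1 := contrapT (fun h => nY (or_introl (or_introl (H1 t h)))).
have j2 := contrapT (fun h => nY (or_introl (or_intror (H2 t h)))).
have zt := contrapT (fun h => nY (or_intror (or_introl (H3 t h)))).
have st := contrapT (fun h => nY (or_intror (or_intror (H4 t h)))).
rewrite /fubini_G.
have -> : (\int[rV_lebesgue n]_x (EFin \o f) (x, t) =
   (\int[rV_lebesgue n]_x (cut u (x, t) ord0 i * 'D_(e_space j) psi (x, t)) +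
    \int[rV_lebesgue n]_x (cut Du (x, t) i j * psi (x, t)))%:E)%E.
  rewrite -(RintegralD measurableT j1 j2) /Rintegral fineK//.
  exact: (integrable_fin_num measurableT (integrableD measurableT j1 j2)).
(* For a time outside ]0, T[ the slice does not meet Q, so the test function and its derivative
   vanish on it. *)
have [tT|tT] := boolP ((t : R) \in `]0, T[); last first.
  have nQ x : ~ Q (x, t) by move=> /QD [_ /= h]; move: tT; rewrite h.
  rewrite /Rintegral !integral0_eq ?addr0// => x _.
    by rewrite (test_function0 tp (nQ x)) mulr0.
  by rewrite (test_function_derive0 _ tp (nQ x)) mulr0.
have [_ _ /(_ _ (slice_test t tp).1 i j) W] := st tT.
have mzt : measurable (ysection Z t) by exact: measurable_ysection.
have tr (X : E -> R) (c : E -> R) (Y : E -> R) : (forall z, G z -> Y z = X z) -> (forall z, ~ Q z -> c z = 0) ->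
    \int[rV_lebesgue n]_x (Y (x, t) * c (x, t)) = \int[rV_lebesgue n]_(x in Omega) (X (x, t) * c (x, t)).
  move=> YX c0; rewrite /Rintegral; congr fine; rewrite [RHS]integral_mkcond.
  apply: (eq_integral_off_null mzt zt) => x nx.
  have nZ : ~ Z (x, t) by move=> h; apply: nx; rewrite /ysection /= inE.
  have [Qx|nQ] := pselect (Q (x, t)).
    by rewrite patchE mem_set; [rewrite YX|case: (QD Qx)].
  by rewrite c0// mulr0 patchE c0// mulr0; case: ifP.
have c1 z : ~ Q z -> 'D_(e_space j) psi z = 0 by move=> nQ; exact: test_function_derive0 tp nQ.
have c2 z : ~ Q z -> psi z = 0 by move=> nQ; exact: test_function0 tp nQ.
have u1 z : G z -> cut u z ord0 i = u z ord0 i by move=> Gz; rewrite cutE.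
have u2 z : G z -> cut Du z i j = Du z i j by move=> Gz; rewrite cutE.
have E1 := tr (fun z => u z ord0 i) ('D_(e_space j) psi) (fun z => cut u z ord0 i) u1 c1.
have E2 := tr (fun z => Du z i j) psi (fun z => cut Du z i j) u2 c2.
rewrite [X in (X + _)%R]E1 [X in (_ + X)%R]E2.
move: W; under eq_Rintegral do rewrite (slice_test t tp).2.
by move=> ->; rewrite addNr.
Qed.

Lemma is_derive_coord k (phi : E -> 'rV[R]_k) (z w : E) i : derivable phi z w ->
  is_derive z w (fun z => phi z ord0 i) ('D_w phi z ord0 i).
Proof.
move=> d; have c : (fun h : R => (h^-1 *: (phi (h *: w + z) - phi z)) ord0 i) @ 0^' --> 'D_w phi z ord0 i.
  exact: (cvg_comp _ _ d (@coord_continuous R 1 k ord0 i ('D_w phi z))).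
have c' : (fun h : R => h^-1 *: (phi (h *: w + z) ord0 i - phi z ord0 i)) @ 0^' --> 'D_w phi z ord0 i.
  apply: cvg_trans c; apply: near_eq_cvg; near=> h; by rewrite !mxE.
apply: DeriveDef; first by apply/cvg_ex; exists ('D_w phi z ord0 i); exact: c'.
by apply/cvg_lim => //; exact: c'.
Unshelve. all: by end_near. Qed.

Lemma smooth_coord_comp k (phi : E -> 'rV[R]_k) i : smooth phi -> smooth (fun z => phi z ord0 i).
Proof.
have cc (f : E -> 'rV[R]_k) : smooth f -> continuous (fun z => f z ord0 i).
  move=> sf z; apply: (@continuous_comp E _ _ f (fun X : 'rV[R]_k => X ord0 i) z).
    exact: smooth_continuous.
  exact: coord_continuous.
move=> sf l; elim: l phi sf => [|l IH] phi sf; first by split => //; exact: cc.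
split; first exact: cc.
move=> w; split.
  by move=> z; have [] := @is_derive_coord k phi z w i (@smooth_derivable R _ _ _ _ _ sf).
rewrite (_ : 'D_w _ = fun z => 'D_w phi z ord0 i); first exact: IH (smooth_D w sf).
apply/funext => z.
by have [_ ->] := @is_derive_coord k phi z w i (@smooth_derivable R _ _ _ _ _ sf).
Qed.

Let edot_row (x y : 'rV[R]_N) : edot x y = \sum_i x ord0 i * y ord0 i.
Proof. by rewrite /edot big_ord1. Qed.

Local Notation Sc := (source p q coeff (cut F)).

Let mSc i j : measurable_fun setT (fun z => Sc z i j).
Proof.
have mpow x : measurable_fun setT (fun z => enorm (cut F z) `^ x).
  exact: (measurableT_comp (measurable_powR x) meF).
rewrite (_ : (fun z => _) = fun z => enorm (cut F z) `^ (p - 2) * cut F z i j +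
   coeff z * enorm (cut F z) `^ (q - 2) * cut F z i j).
  apply: measurable_funD; first exact: measurable_funM.
  by apply: measurable_funM => //; exact: measurable_funM.
by apply/funext => z; rewrite /source !mxE.
Qed.

Let enorm_cut_Q m k (X : E -> 'M[R]_(m, k)) z : ~ Q z -> enorm (cut X z) = 0.
Proof. by move=> nQ; rewrite cutQ0// enorm0. Qed.

Let iSc i j : (\int[mu]_z `|Sc z i j|%:E < +oo)%E.
Proof.
have i1 := pow_L1 meF (fun z => enorm_ge0 _) (@enorm_cut_Q _ _ F) phase_cut_F.
apply: le_lt_trans i1; apply: ge0_le_integralR => //.
- exact: measurableT_comp.
- have mpow x : measurable_fun setT (fun z => enorm (cut F z) `^ x).
    exact: (measurableT_comp (measurable_powR x) meF).
  by apply: measurable_funD => //; exact: measurable_funM.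
by move=> z _; rewrite normr_ge0 /=; exact: source_coord_le.
Qed.

Let growthA z : enorm (cut AD z) <=
  L * (enorm (cut Du z) `^ (p - 1) + coeff z * enorm (cut Du z) `^ (q - 1)).
Proof.
have [Gz|nG] := pselect (G z).
  by rewrite !cutE// coeffE; [case: (structure Gz)|case: Gz].
rewrite [in leLHS]cut0// enorm0 mulr_ge0//.
by apply: addr_ge0; [exact: powR_ge0|apply: mulr_ge0; [exact: b0|exact: powR_ge0]].
Qed.

Let iAc i j : (\int[mu]_z `|cut AD z i j|%:E < +oo)%E.
Proof.
have i1 := pow_L1 meDu (fun z => enorm_ge0 _) (@enorm_cut_Q _ _ Du) phase_cut_Du.
have mpow x : measurable_fun setT (fun z => enorm (cut Du z) `^ x).
  exact: (measurableT_comp (measurable_powR x) meDu).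
have mp : measurable_fun setT (fun z => enorm (cut Du z) `^ (p - 1) + coeff z * enorm (cut Du z) `^ (q - 1)).
  by apply: measurable_funD => //; exact: measurable_funM.
apply: (@le_lt_trans _ _ (\int[mu]_z (L * (enorm (cut Du z) `^ (p - 1) + coeff z * enorm (cut Du z) `^ (q - 1)))%:E)%E).
  apply: ge0_le_integralR => //.
  - exact: measurableT_comp.
  - exact: measurable_funM.
  move=> z _; rewrite normr_ge0 /=; exact: le_trans (coord_le_enorm _ i j) (growthA z).
rewrite ge0_integralZlR//.
  by apply: lte_mul_pinfty; [by rewrite lee_fin|by []|exact: i1].
move=> z _; apply: addr_ge0; [exact: powR_ge0|apply: mulr_ge0; [exact: b0|exact: powR_ge0]].
Qed.

(** A test function for the cylinder is one for the domain, and both sides of the equation only see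
    the cylinder. There the data may be replaced by their truncations, and then all terms may be
    collected since each is integrable. *)
Lemma cut_weak (phi : E -> 'rV[R]_N) : test_function Q phi ->
  \int[mu]_z (- (\sum_i cut uk z ord0 i * dt phi z ord0 i) +
    \sum_i \sum_j (cut AD z - Sc z) i j * grad phi z i j) = 0.
Proof.
move=> tphi; have [sphi _ _] := tphi.
have s_i i := smooth_coord_comp i sphi.
have t_i i : test_function Q (fun z => phi z ord0 i).
  by apply: (test_functionS tphi (s_i i)) => z; apply: contra_neq => ->; rewrite mxE.
have D_i w z i : 'D_w phi z ord0 i = 'D_w (fun z => phi z ord0 i) z.
  by have [_ ->] := @is_derive_coord N phi z w i (@smooth_derivable R _ _ _ _ _ sphi).
have cD w i : continuous ('D_w (fun z => phi z ord0 i)) by exact/smooth_continuous/smooth_D.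
have sD w i : supp_in (M + 1) ('D_w (fun z => phi z ord0 i)).
  exact: supp_in_derive (test_function_supp_in QM (t_i i)).
have dtE z i : dt phi z ord0 i = 'D_e_time (fun z => phi z ord0 i) z by exact: D_i.
have gradE z i j : grad phi z i j = 'D_(e_space j) (fun z => phi z ord0 i) z by rewrite mxE; exact: D_i.
have dt0 z : ~ Q z -> dt phi z = 0 by move=> nQ; exact: test_function_derive0 tphi nQ.
have grad0 z : ~ Q z -> grad phi z = 0.
  by move=> nQ; apply/matrixP => i j; rewrite gradE mxE; exact: test_function_derive0 (t_i i) nQ.
have iu i := cut_L1 ord0 i (fun i j => eq_ind_r (fun i => measurable_fun setT (fun z => cut u z i j)) (muc j) (ord1 i)) phase_cut_u.
have i1 i : mu.-integrable setT (EFin \o (fun z => cut u z ord0 i * dt phi z ord0 i)).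
  under [X in EFin \o X]eq_fun do rewrite dtE; exact: int_test (muc i) (iu i) (cD _ _) (sD _ _).
have i2 i j : mu.-integrable setT (EFin \o (fun z => cut AD z i j * grad phi z i j)).
  under [X in EFin \o X]eq_fun do rewrite gradE; exact: int_test (mAc i j) (iAc i j) (cD _ _) (sD _ _).
have i3 i j : mu.-integrable setT (EFin \o (fun z => Sc z i j * grad phi z i j)).
  under [X in EFin \o X]eq_fun do rewrite gradE; exact: int_test (mSc i j) (iSc i j) (cD _ _) (sD _ _).
have i4 i : mu.-integrable setT (EFin \o (fun z : V => \1_G z * k0 ord0 i * dt phi z ord0 i)).
  under [X in EFin \o X]eq_fun do rewrite dtE; exact: (int_cst_derive _ _ (t_i i)).1.
have z4 i : \int[mu]_z (\1_G z * k0 ord0 i * dt phi z ord0 i) = 0.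
  under eq_Rintegral do rewrite dtE; exact: (int_cst_derive _ _ (t_i i)).2.
have I1 := integrable_fsum measurableT i1.
have I2 := integrable_fsum measurableT (fun i => integrable_fsum measurableT (i2 i)).
have I3 := integrable_fsum measurableT (fun i => integrable_fsum measurableT (i3 i)).
have I4 := integrable_fsum measurableT i4.
have Z4 : \int[mu]_z (\sum_i \1_G z * k0 ord0 i * dt phi z ord0 i) = 0.
  by rewrite Rintegral_fsum// big1.
pose g1 (z : V) := \sum_i \sum_j cut AD z i j * grad phi z i j - \sum_i cut u z ord0 i * dt phi z ord0 i.
pose g2 (z : V) := \sum_i \sum_j Sc z i j * grad phi z i j.
have J1 : mu.-integrable setT (EFin \o g1) := integrableB measurableT I2 I1.
have J2 : mu.-integrable setT (EFin \o (fun z => g1 z - g2 z)) := integrableB measurableT J1 I3.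
have tD : test_function D phi.
  by case: tphi => h1 h2 h3; split => //; exact: subset_trans h3 QD.
have W : \int[mu]_z g1 z = \int[mu]_z g2 z.
  case: HU => _ _ _ /(_ _ tD); rewrite (@Rintegral_domain_cut _ g1).
  - rewrite (@Rintegral_domain_cut _ g2) => [->//|z Gz|z nQ|z nQ].
    + have Qz : Q z by case: Gz.
      rewrite /g2 /edot mulr_sumr -big_split; apply: eq_bigr => i _ /=.
      rewrite mulr_sumr -big_split; apply: eq_bigr => j _ /=.
      by rewrite /source !(cutE _ Gz) coeffE// !mxE; ring.
    + by rewrite grad0// /edot !big1 ?mulr0 ?addr0// => i _; rewrite big1// => j _; rewrite [X in _ * X]mxE mulr0.
    + by rewrite /g2 big1// => i _; rewrite big1// => j _; rewrite grad0// [X in _ * X]mxE mulr0.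
  - by move=> z Gz; rewrite /g1 !cutE// addrC edot_row.
  - move=> z nQ; rewrite grad0// dt0// edot_row big1 => [|i _]; last by rewrite [X in _ * X]mxE mulr0.
    by rewrite oppr0 add0r /edot big1// => i _; rewrite big1// => j _; rewrite [X in _ * X]mxE mulr0.
  - move=> z nQ; rewrite /g1 dt0// grad0// big1 => [|i _].
      by rewrite big1 ?subr0// => i _; rewrite [X in _ * X]mxE mulr0.
    by rewrite big1// => j _; rewrite [X in _ * X]mxE mulr0.
rewrite (@eq_Rintegral _ _ _ mu setT (fun z => (g1 z - g2 z) + \sum_i \1_G z * k0 ord0 i * dt phi z ord0 i)).
  rewrite (RintegralD measurableT J2 I4) Z4 addr0 (RintegralB measurableT J1 I3) W.
  by rewrite subrr.
move=> z _; rewrite /g1 /g2.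
have -> : \sum_i \sum_j (cut AD z - Sc z) i j * grad phi z i j =
    \sum_i \sum_j cut AD z i j * grad phi z i j - \sum_i \sum_j Sc z i j * grad phi z i j.
  rewrite -sumrB; apply: eq_bigr => i _; rewrite -sumrB; apply: eq_bigr => j _.
  by rewrite -mulrBl; congr (_ * _); rewrite /source !mxE.
have -> : \sum_i cut uk z ord0 i * dt phi z ord0 i =
    \sum_i cut u z ord0 i * dt phi z ord0 i - \sum_i \1_G z * k0 ord0 i * dt phi z ord0 i.
  by rewrite -sumrB; apply: eq_bigr => i _; rewrite /cut /uk !mxE; ring.
by ring.
Qed.

Lemma weak_caccioppoli (R1 S1 tau delta : R) (m : nat) : (n%:R + 2) * (q - p) <= alpha * p ->
  0 < R1 -> R1 < R2 -> S1 < S2 -> 0 < delta -> t0 - S1 <= tau -> tau + delta < t0 + S2 ->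
  q <= (m.+1 + m.+1)%:R ->
  (\int[mu]_z (enorm (cut uk z) ^+ 2 *
      (cut_space x0 R1 R2 z.1 ^+ (m.+1 + m.+1) * (- (fall tau delta z.2 * 'D_(1%R : R) (fall tau delta) z.2))) +
     nu / 2 * (cutoff x0 t0 R1 R2 S1 S2 tau delta m z ^+ 2 * phase p q coeff (fun z => enorm (cut Du z)) z))%R%:E <=
   (@cacc_C R n N q nu L m)%:E * \int[mu]_(z in Q) (Hfun p q a z (enorm (u z - k0) / (R2 - R1)) +
      enorm (u z - k0) ^+ 2 / (S2 - S1) + Hfun p q a z (enorm (F z)))%R%:E)%E.
Proof.
move=> hpqa R10 R12 S12 d0 tau_gt tau_lt hm.
have [Kc Kc0 bK] := coeff_holder; have [Mb bM] := coeff_le.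
have coer z : nu * phase p q coeff (fun z => enorm (cut Du z)) z <= edot (cut AD z) (cut Du z).
  have [Gz|nG] := pselect (G z); last by rewrite phase_cut0// mulr0 cut0// edot0l.
  by rewrite phase_cut// !cutE//; case: (structure Gz).
have := caccioppoli_cutoff hp hpq ha hnu hL hpqa R10 R12 S12 M0 mQ QM mb b0 Kc0 bK bM
  mukc mDuc mAc mFc (@cutQ0 _ _ uk) (@cutQ0 _ _ Du) (@cutQ0 _ _ AD) (@cutQ0 _ _ F)
  phase_cut_uk phase_cut_Du phase_cut_F coer growthA cut_grad cut_weak d0 tau_gt tau_lt hm.
move=> H; apply: le_trans H _; rewrite le_eqVlt; apply/orP; left; apply/eqP; congr (_ * _)%E.
apply/esym; apply: integral_cylinder_cut => z.
  move=> Gz; have Qz : Q z by case: Gz.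
  have R0 : 0 < R2 - R1 by rewrite subr_gt0.
  rewrite [in RHS]phase_cut// cutE//; congr (_ + _ + _).
  by rewrite /phase /Hfun cutE// coeffE// ger0_norm// divr_ge0 ?enorm_ge0// ltW.
move=> nQ; have nG : ~ G z by case.
rewrite phase_cut0// cut0// enorm0 expr0n/= mul0r !addr0 /phase cut0// enorm0 mul0r normr0.
by have h := hp; have h' := hq; rewrite !powR0 ?mulr0 ?addr0// gt_eqF//; lra.
Qed.

End weak_solution_cylinder.

(** * Slices and means *)

Section volumes.
Context {R : realType} {n : nat}.

Lemma rV_lebesgue_cube_at (x0 : 'rV[R]_n) r : 0 <= r ->
  rV_lebesgue n [set x : 'rV[R]_n | forall i, x ord0 i \in `]x0 ord0 i - r, x0 ord0 i + r[] =
  ((2 * r) ^+ n)%:E.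
Proof.
move=> r0; rewrite (@rV_lebesgue_box R n (fun i => x0 ord0 i - r) (fun i => x0 ord0 i + r)); last by move=> i; lra.
congr EFin; rewrite -[RHS](_ : \prod_(i < n) (2 * r) = _); last by rewrite prodr_const card_ord.
by apply: eq_bigr => i _; ring.
Qed.

Lemma measurable_cube_at (x0 : 'rV[R]_n) r :
  measurable [set x : 'rV[R]_n | forall i, x ord0 i \in `]x0 ord0 i - r, x0 ord0 i + r[].
Proof.
rewrite (_ : mkset _ = \bigcap_(i in [set: 'I_n])
  ((fun x : 'rV[R]_n => x ord0 i) @^-1` `]x0 ord0 i - r, x0 ord0 i + r[%classic)).
  apply: fin_bigcap_measurable => // i _.
  by rewrite -[X in measurable X]setTI; apply: measurable_coord.
by apply/seteqP; split => x /= H i; [move=> _|]; exact: H.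
Qed.

Lemma eball_volume_le (x0 : 'rV[R]_n) r : 0 <= r ->
  (rV_lebesgue n (eball x0 r) <= ((2 * r) ^+ n)%:E)%E.
Proof.
move=> r0; rewrite -(rV_lebesgue_cube_at x0 r0).
apply: le_measure; rewrite ?inE; [exact: eball_measurable|exact: measurable_cube_at|].
move=> x xr i /=; rewrite in_itv/= -ltr_distl.
by apply: le_lt_trans xr; have := coord_le_enorm (x - x0) ord0 i; rewrite !mxE.
Qed.

(** The cube of half-side r/(n+1) is inscribed in the ball because n/(n+1)^2 < 1. *)
Lemma eball_volume_ge (x0 : 'rV[R]_n) r : 0 < r ->
  (((2 * (r / n.+1%:R)) ^+ n)%:E <= rV_lebesgue n (eball x0 r))%E.
Proof.
move=> r0; have rn : 0 < r / n.+1%:R by rewrite divr_gt0.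
rewrite -(rV_lebesgue_cube_at x0 (ltW rn)).
apply: le_measure; rewrite ?inE; [exact: measurable_cube_at|exact: eball_measurable|].
move=> x xr; rewrite /eball /= -(@ltr_pXn2r _ 2)// ?nnegrE ?enorm_ge0 ?(ltW r0)//.
rewrite enorm_sqr edot_rV; apply: (@le_lt_trans _ _ (\sum_(i < n) (r / n.+1%:R) ^+ 2)).
  apply: ler_sum => i _; have := xr i; rewrite /= in_itv/= -ltr_distl => h.
  rewrite -real_normK ?num_real// lerXn2r// ?nnegrE ?(ltW rn)//.
  by rewrite !mxE ltW.
rewrite sumr_const card_ord -[X in X < _]mulr_natl expr_div_n mulrCA.
rewrite -[X in _ < X]mulr1 ltr_pM2l ?exprn_gt0// ltr_pdivrMr ?exprn_gt0// mul1r -natrX ltr_nat.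
by apply: (@leq_trans n.+1) => //; rewrite -mulnn leq_pmulr.
Qed.

(** The larger ball is enclosed in a cube and a cube is inscribed in the smaller one; with R2 <= 2
    R1 the ratio of the two cubes is at most (2(n+1))^n. *)
Lemma eball_volumes (x0 : 'rV[R]_n) R1 R2 : 0 < R2 -> R2 / 2 <= R1 -> R1 < R2 ->
  exists b1 b2 : R, [/\ rV_lebesgue n (eball x0 R1) = b1%:E,
    rV_lebesgue n (eball x0 R2) = b2%:E, 0 < b1, 0 < b2 & b2 <= (2 * n.+1%:R) ^+ n * b1].
Proof.
move=> R20 R12 R1R2; have R10 : 0 < R1 by lra.
pose b r := fine (rV_lebesgue n (eball x0 r)).
have bE r : 0 < r -> rV_lebesgue n (eball x0 r) = (b r)%:E.
  move=> r0; rewrite fineK// ge0_fin_numE//.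
  by apply: le_lt_trans (eball_volume_le x0 (ltW r0)) _; rewrite ltry.
have b_ge r : 0 < r -> (2 * (r / n.+1%:R)) ^+ n <= b r.
  by move=> r0; rewrite -lee_fin -bE//; exact: eball_volume_ge.
have b_le r : 0 < r -> b r <= (2 * r) ^+ n.
  by move=> r0; rewrite -lee_fin -bE//; exact: eball_volume_le (ltW r0).
have b_gt0 r : 0 < r -> 0 < b r.
  by move=> r0; apply: lt_le_trans (b_ge r r0); rewrite exprn_gt0// mulr_gt0// divr_gt0.
exists (b R1), (b R2); split; rewrite ?bE ?b_gt0//.
apply: le_trans (b_le _ R20) _; apply: (@le_trans _ _ ((2 * n.+1%:R) ^+ n * (2 * (R1 / n.+1%:R)) ^+ n)).
  rewrite -exprMn lerXn2r// ?nnegrE; try by rewrite ?mulr_ge0// ?divr_ge0// ltW.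
  set k := n.+1%:R; have -> : 2 * k * (2 * (R1 / k)) = 4 * R1 * (k / k) by ring.
  by rewrite divff ?pnatr_eq0// mulr1; lra.
by rewrite ler_wpM2l ?exprn_ge0 ?mulr_ge0// b_ge.
Qed.

Lemma cylinder_volume (x0 : 'rV[R]_n) t0 r s b : 0 <= s -> rV_lebesgue n (eball x0 r) = b%:E ->
  st_lebesgue n (cylinder x0 t0 r s) = (b * (2 * s))%:E.
Proof.
move=> s0 bE; rewrite [LHS]product_measure1E; [|exact: eball_measurable|exact: measurable_itv].
rewrite EFinM; congr (_ * _)%E; first exact: bE.
rewrite [LHS]lebesgue_itv_oo; last lra.
by congr EFin; ring.
Qed.

End volumes.

Section squares.
Context {R : realType}.

Lemma enormD_sqr_le m k (X Y : 'M[R]_(m, k)) :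
  enorm (X + Y) ^+ 2 <= 2 * (enorm X ^+ 2 + enorm Y ^+ 2).
Proof.
rewrite !enorm_sqr mulrDr /edot !mulr_sumr -big_split; apply: ler_sum => i _ /=.
rewrite !mulr_sumr -big_split; apply: ler_sum => j _ /=; rewrite !mxE -subr_ge0.
by rewrite (_ : _ - _ = (X i j - Y i j) ^+ 2) ?sqr_ge0//; ring.
Qed.

Context d (T : measurableType d) (mu : {measure set T -> \bar R}) (N : nat).

Lemma measurable_sqr_dist (S : set T) (f g : T -> 'rV[R]_N) : measurable S ->
  (forall i, measurable_fun S (fun x => f x ord0 i)) ->
  (forall i, measurable_fun S (fun x => g x ord0 i)) ->
  measurable_fun S (fun x => enorm (f x - g x) ^+ 2).
Proof.
move=> mS mf mg; rewrite (_ : (fun x => _) = fun x => \sum_i (f x ord0 i - g x ord0 i) ^+ 2).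
  by apply: measurable_sum => i; apply: measurable_funX; exact: measurable_funB.
by apply/funext => x; rewrite enorm_sqr edot_rV; apply: eq_bigr => i _; rewrite !mxE.
Qed.

Lemma integral_off_null (S A : set T) (f : T -> \bar R) : measurable A -> mu A = 0%E ->
  (\int[mu]_(x in S) f x = \int[mu]_(x in S `\` A) f x)%E.
Proof.
move=> mA A0; rewrite integral_mkcond [RHS]integral_mkcond; apply: (eq_integral_off_null mA A0) => x nA.
rewrite !patchE; case: ifPn; rewrite ?inE => Sx.
  by rewrite mem_set.
by rewrite memNset// => -[Sx' _]; move: Sx; rewrite mem_set.
Qed.

Lemma integral_sqr_dist_le (S A : set T) (f g h : T -> 'rV[R]_N) : measurable S ->
  measurable A -> mu A = 0%E ->
  (forall i, measurable_fun (S `\` A) (fun x => f x ord0 i)) ->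
  (forall i, measurable_fun (S `\` A) (fun x => g x ord0 i)) ->
  (forall i, measurable_fun (S `\` A) (fun x => h x ord0 i)) ->
  (\int[mu]_(x in S) (enorm (f x - h x) ^+ 2)%:E <=
   2%:E * (\int[mu]_(x in S) (enorm (f x - g x) ^+ 2)%:E + \int[mu]_(x in S) (enorm (g x - h x) ^+ 2)%:E))%E.
Proof.
move=> mS mA A0 mf mg mh; rewrite !(@integral_off_null S A)//.
have mSA : measurable (S `\` A) by exact: measurableD.
have m1 := measurable_sqr_dist mSA mf mg; have m2 := measurable_sqr_dist mSA mg mh.
have sq k (X : 'rV[R]_k) : 0 <= enorm X ^+ 2 by rewrite exprn_ge0// enorm_ge0.
rewrite -ge0_integralDR// -ge0_integralZlR//; last by move=> x _; exact: addr_ge0.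
  apply: ge0_le_integralR => //.
  - exact: measurable_sqr_dist.
  - by apply: measurable_funM => //; exact: measurable_funD.
  move=> x _; rewrite sq /= (_ : f x - h x = (f x - g x) + (g x - h x)) ?enormD_sqr_le//.
  by rewrite addrA subrK.
exact: measurable_funD.
Qed.

Lemma sqr_integrable (S : set T) (g : T -> R) (c : R) : measurable S -> mu S = c%:E ->
  measurable_fun S g -> (\int[mu]_(x in S) (g x ^+ 2)%:E < +oo)%E ->
  mu.-integrable S (EFin \o g).
Proof.
move=> mS Sc mg ig2; have mg2 : measurable_fun S (fun x => g x ^+ 2) by exact: measurable_funX.
apply: (@integrableR _ _ _ _ _ g (fun x => 1 + g x ^+ 2)) => //.
- exact: measurable_funD.
- move=> x _; rewrite -subr_ge0; have := sqr_ge0 (`|g x| - 2^-1).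
  rewrite sqrrB real_normK ?num_real// => h.
  have -> : 1 + g x ^+ 2 - `|g x| = (g x ^+ 2 - `|g x| * 2^-1 *+ 2 + 2^-1 ^+ 2) + 3 / 4 by field.
  by rewrite addr_ge0// divr_ge0.
rewrite ge0_integralDR//; last by move=> x _; exact: sqr_ge0.
by apply: lte_add_pinfty ig2; rewrite integral_cst// mul1e Sc ltry.
Qed.

(** Jensen's inequality for the square. With h = g - k and l its mean, (h - l)^2 >= 0 gives h^2 >= 2
    l h - l^2, whose right side integrates to c l^2. *)
Lemma mean_sqr_dist_le (S : set T) (g : T -> R) (c k : R) : measurable S -> 0 < c -> mu S = c%:E ->
  measurable_fun S g -> (\int[mu]_(x in S) ((g x - k) ^+ 2)%:E < +oo)%E ->
  ((c * (c^-1 * (\int[mu]_(x in S) g x) - k) ^+ 2)%:E <= \int[mu]_(x in S) ((g x - k) ^+ 2)%:E)%E.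
Proof.
move=> mS c0 Sc mg ig2; pose h x := g x - k; pose l := c^-1 * (\int[mu]_(x in S) h x).
have mh : measurable_fun S h by exact: measurable_funB.
have mh2 : measurable_fun S (fun x => h x ^+ 2) by exact: measurable_funX.
have i2 : mu.-integrable S (EFin \o (fun x => h x ^+ 2)).
  by apply: (integrableR mS mh2 mh2) => // x _; rewrite ger0_norm// sqr_ge0.
have i1 : mu.-integrable S (EFin \o (fun _ : T => 1 : R)).
  apply: (@integrableR _ _ _ _ _ _ (fun _ => 1 : R)) => //; first by move=> x _; rewrite normr1.
  by rewrite integral_cst// mul1e Sc ltry.
have ih : mu.-integrable S (EFin \o h) := sqr_integrable mS Sc mh ig2.
have I1 : \int[mu]_(x in S) (1 : R) = c by rewrite /Rintegral integral_cst// mul1e Sc.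
have Ih : \int[mu]_(x in S) h x = c * l by rewrite /l mulrA divff ?mul1r// gt_eqF.
have Ig : c^-1 * (\int[mu]_(x in S) g x) - k = l.
  have -> : \int[mu]_(x in S) g x = \int[mu]_(x in S) (h x + k * 1).
    by apply: eq_Rintegral => x _; rewrite /h mulr1 subrK.
  rewrite (RintegralD mS ih (integrableZl mS k i1)) (RintegralZl k mS i1) I1 Ih.
  by field; rewrite gt_eqF.
rewrite Ig.
have R2 : \int[mu]_(x in S) (2 * l * h x - l ^+ 2 * 1) <= \int[mu]_(x in S) h x ^+ 2.
  apply: le_Rintegral => //.
    exact: (integrableB mS (integrableZl mS (2 * l) ih) (integrableZl mS (l ^+ 2) i1)).
  move=> x _; rewrite mulr1 -subr_ge0 (_ : _ - _ = (h x - l) ^+ 2) ?sqr_ge0//; ring.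
rewrite -[X in (_ <= X)%E]fineK; last exact: (integrable_fin_num mS i2).
rewrite lee_fin; apply: le_trans R2.
rewrite (RintegralB mS (integrableZl mS (2 * l) ih) (integrableZl mS (l ^+ 2) i1)).
rewrite (RintegralZl (2 * l) mS ih) (RintegralZl (l ^+ 2) mS i1) I1 Ih.
by rewrite le_eqVlt; apply/orP; left; apply/eqP; ring.
Qed.

End squares.

(** * Selection of time slices and transfer to a given time *)

Section slices.
Context {R : realType} {n N : nat}.
Local Notation V := ('rV[R]_n * measurableTypeR R)%type.
Local Notation E := ('rV[R]_n * R)%type.
Local Notation mu := (@st_lebesgue R n).

(** If every admissible slice exceeded 2 K + eps, integrating against a weight of mass 1/2 would
    give at least K + eps/2, contradicting the bound K. *)
Lemma exists_slice (w : V -> R) (tau delta K eps : R) (Z : set (measurableTypeR R)) :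
  measurable_fun setT w -> (forall z, 0 <= w z) -> 0 < delta -> 0 < eps ->
  measurable Z -> @lebesgue_measure R Z = 0%E ->
  (\int[mu]_z (w z * (- (fall tau delta z.2 * 'D_(1%R : R) (fall tau delta) z.2)))%:E <= K%:E)%E ->
  exists t : R, [/\ tau < t, t < tau + delta, ~ Z t &
    (\int[rV_lebesgue n]_x (w (x, t))%:E <= (2 * K + eps)%:E)%E].
Proof.
move=> mw w0 d0 e0 mZ Z0 HK; apply: contrapT => nex.
pose k (t : R) := - (fall tau delta t * 'D_(1%R : R) (fall tau delta) t).
have k0 t : 0 <= k t by rewrite /k -mulrN mulr_ge0 ?fall_ge0// oppr_ge0; exact: dfall_le0.
have mk : measurable_fun setT (fun z : V => k z.2).
  apply: (@continuous_measurable_st R n (fun z : E => k z.2)) => // z; apply: cvgN; apply: cvgM.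
    exact: (@smooth_continuous R E R _ (@smooth_snd R n R _ (smooth_fall tau delta)) z).
  exact: (@smooth_continuous R E R _ (@smooth_snd R n R _ (@smooth_D R R R _ 1 (smooth_fall tau delta))) z).
have mwk : measurable_fun setT (EFin \o (fun z : V => w z * k z.2)).
  by apply/measurable_EFinP; exact: measurable_funM.
have wk0 (z : V) : (0 <= (w z * k z.2)%:E)%E by rewrite lee_fin mulr_ge0.
have F2 := @fubini_tonelli2 _ _ _ _ R (rV_lebesgue n) (@lebesgue_measure R) _ mwk wk0.
have mk1 : measurable_fun `[tau, tau + delta]%classic k.
  apply: measurable_funTS; apply: continuous_measurable_fun => t; apply: cvgN; apply: cvgM.
    exact: (@smooth_continuous R R R _ (smooth_fall tau delta) t).
  exact: (@smooth_continuous R R R _ (@smooth_D R R R _ 1 (smooth_fall tau delta)) t).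
pose c' := 2 * K + eps.
have K0 : 0 <= K.
  by rewrite -lee_fin; apply: le_trans HK; apply: integral_ge0 => z _; exact: wk0.
have c0 : 0 <= c' by rewrite addr_ge0 ?mulr_ge0// ltW.
(* The two endpoints join the null set, so that the slice found lies strictly between tau and tau +
   delta. *)
pose Z' : set (measurableTypeR R) := Z `|` ([set tau] `|` [set tau + delta]).
have mZ' : measurable Z' by do !apply: measurableU => //; exact: measurable_set1.
have Z'0 : @lebesgue_measure R Z' = 0%E.
  have ng W : measurable W -> @lebesgue_measure R W = 0%E -> (@lebesgue_measure R).-negligible W.
    by move=> mW W0; exists W; split.
  apply: measure_negligible => //; do !apply: negligibleU; apply: ng => //; exact: lebesgue_measure_set1.
suff : ((c' / 2)%:E <= K%:E)%E by rewrite lee_fin /c'; lra.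
apply: le_trans HK; rewrite [leRHS]F2.
have -> : ((c' / 2)%:E = \int[@lebesgue_measure R]_(t in `[tau, (tau + delta)%R]%classic) (c' * k t)%:E)%E.
  have mI : measurable (`[tau, tau + delta]%classic : set (measurableTypeR R)) by exact: measurable_itv.
  rewrite (ge0_integralZlR _ mI mk1 (fun t _ => k0 t) c0).
  by rewrite [X in (_ * X)%E](integral_fall tau d0).
rewrite integral_mkcond; apply: (ge0_le_integral_off_null mZ' Z'0).
- by move=> t; rewrite patchE; case: ifP => // _; rewrite lee_fin mulr_ge0.
- by move=> t; apply: integral_ge0 => x _; exact: wk0.
move=> t nZ; rewrite /fubini_G patchE; case: ifPn => [|_]; last first.
  by apply: integral_ge0 => x _; exact: wk0.
rewrite inE /= in_itv/= => /andP[t1 t2].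
have t1' : tau < t.
  by rewrite lt_neqAle t1 andbT; apply/eqP => h; apply: nZ; right; left.
have t2' : t < tau + delta.
  by rewrite lt_neqAle t2 andbT; apply/eqP => h; apply: nZ; right; right.
have nZt : ~ Z t by move=> h; apply: nZ; left.
have mwt : measurable_fun setT (fun x : 'rV[R]_n => w (x, t)).
  exact: (measurableT_comp mw (measurable_pair2 t)).
have : ((2 * K + eps)%:E <= \int[rV_lebesgue n]_x (w (x, t))%:E)%E.
  by rewrite leNgt; apply/negP => /ltW h; apply: nex; exists t.
move=> h; rewrite (_ : (fun x => _) = fun x => (k t * w (x, t))%:E); last first.
  by apply/funext => x; rewrite /= mulrC.
rewrite ge0_integralZlR// [(c' * k t)]mulrC EFinM.
by apply: lee_wpmul2l; rewrite ?lee_fin.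
Qed.

Lemma L2_norm_lt (Omega : set 'rV[R]_n) (w : 'rV[R]_n -> 'rV[R]_N) (e : R) : 0 < e ->
  (L2_norm Omega w < e%:E)%E ->
  (\int[rV_lebesgue n]_(x in Omega) (enorm (w x) ^+ 2)%:E <= (e ^+ 2)%:E)%E.
Proof.
move=> e0; rewrite /L2_norm unlock; set I := (\int[_]_x _)%E => H.
have I0 : (0 <= I)%E by apply: integral_ge0 => x _; exact: poweR_ge0.
have -> : (\int[rV_lebesgue n]_(x in Omega) (enorm (w x) ^+ 2)%:E = I)%E.
  rewrite integral_mkcond; apply: eq_integral => x _; rewrite !patchE; case: ifP => _.
    by rewrite abse_EFin poweR_EFin ger0_norm ?enorm_ge0// powR_mulrn ?enorm_ge0.
  by rewrite abse0 poweR0r// pnatr_eq0.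
move: I0 H; case: I => [r||] //; rewrite ?lee_fin; last by rewrite poweRyr ?invr_eq0 ?pnatr_eq0// ltNge leey.
move=> r0; rewrite poweR_EFin lte_fin => H.
have <- : (r `^ 2^-1) ^+ 2 = r.
  by rewrite -powR_mulrn ?powR_ge0// -powRrM mulVf ?pnatr_eq0// powRr1.
by rewrite lerXn2r// ?nnegrE ?powR_ge0 ?(ltW e0)// ltW.
Qed.

(** The selected times t tend to tau, and L^2 continuity makes u(., t) close to u(., tau). The
    factor 2 is that of (x + y)^2 <= 2 x^2 + 2 y^2. *)
Lemma slice_limit (Omega B : set 'rV[R]_n) (T tau K : R) (u : E -> 'rV[R]_N) (k : 'rV[R]_N) :
  open Omega -> measurable B -> B `<=` Omega -> C_L2_fun Omega T u -> tau \in `]0, T[ -> 0 <= K ->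
  (forall delta eps, 0 < delta -> 0 < eps -> exists t, [/\ tau < t, t < tau + delta,
     t \in `]0, T[ & (\int[rV_lebesgue n]_(x in B) (enorm (u (x, t) - k) ^+ 2)%:E <= (K + eps)%:E)%E]) ->
  (\int[rV_lebesgue n]_(x in B) (enorm (u (x, tau) - k) ^+ 2)%:E <= (2 * K)%:E)%E.
Proof.
move=> oO mB BO cL tauT K0 H; have mO : measurable Omega by exact: open_measurable_rV.
apply/lee_addgt0Pr => e e0.
(* At most 1 so that e1^2 <= e1, and at most e/4 so that 2 (e1^2 + K + e1) <= 2 K + e. *)
pose e1 := Num.min 1 (e / 4).
have e10 : 0 < e1 by rewrite lt_min ltr01 divr_gt0.
have [mtau _ ctau] := cL _ tauT.
have : \forall s \near tau, (L2_norm Omega (fun x => (u (x, s) - u (x, tau))%R) < e1%:E)%E.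
  by apply: (ctau [set y | (y < e1%:E)%E]); apply: open_ereal_lt'; rewrite lte_fin.
move=> /nbhs_ballP[delta /= d0 Hd].
have [t [t1 t2 tT Ht]] := H _ _ d0 e10.
have := Hd t; rewrite /ball/= => /(_ _) Ht'.
have {}Ht' : (L2_norm Omega (fun x => (u (x, t) - u (x, tau))%R) < e1%:E)%E.
  by apply: Ht'; rewrite distrC ger0_norm; lra.
have J2 := L2_norm_lt e10 Ht'.
have [A1 [mA1 A10 HA1]] := lebesgue_measurable_off_null mO mtau.
have [mt _ _] := cL _ tT.
have [A2 [mA2 A20 HA2]] := lebesgue_measurable_off_null mO mt.
have mA : measurable (A1 `|` A2) by exact: measurableU.
have A0 : rV_lebesgue n (A1 `|` A2) = 0%E by rewrite measureU0.
have mBA : measurable (B `\` (A1 `|` A2)) by exact: measurableD.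
have s1 : B `\` (A1 `|` A2) `<=` Omega `\` A1.
  by move=> x [Bx nA]; split; [exact: BO|move=> h; apply: nA; left].
have s2 : B `\` (A1 `|` A2) `<=` Omega `\` A2.
  by move=> x [Bx nA]; split; [exact: BO|move=> h; apply: nA; right].
have HH := @integral_sqr_dist_le R _ _ (rV_lebesgue n) N B (A1 `|` A2) (fun x => u (x, tau)) (fun x => u (x, t)) (fun _ => k)
  mB mA A0 (fun i => HA1 _ ord0 i mBA s1) (fun i => HA2 _ ord0 i mBA s2) (fun i => measurable_cst _).
apply: le_trans HH _.
have J3 : (\int[rV_lebesgue n]_(x in B) (enorm (u (x, tau) - u (x, t)) ^+ 2)%:E <= (e1 ^+ 2)%:E)%E.
  apply: le_trans J2.
  rewrite integral_mkcond [leRHS]integral_mkcond; apply: (@ge0_le_integral_off_null _ _ R (rV_lebesgue n) set0 _ _ measurable0 (measure0 _)).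
  - by move=> x; rewrite patchE; case: ifP => // _; rewrite lee_fin sqr_ge0.
  - by move=> x; rewrite patchE; case: ifP => // _; rewrite lee_fin sqr_ge0.
  move=> x _; rewrite !patchE; case: ifPn; rewrite ?inE => Bx.
    rewrite mem_set; last exact: BO.
    rewrite -[X in (X <= _)%E]/((enorm (u (x, tau) - u (x, t)) ^+ 2)%:E) -[X in (_ <= X)%E]/((enorm (u (x, t) - u (x, tau)) ^+ 2)%:E).
    by rewrite !enorm_sqr -edotN opprB.
  by case: ifP => // _; rewrite lee_fin sqr_ge0.
apply: (@le_trans _ _ (2%:E * ((e1 ^+ 2)%:E + (K + e1)%:E))%E).
  by rewrite lee_pmul2l//; exact: leeD.
rewrite -EFinD -EFinM lee_fin.
have e11 : e1 <= 1 by rewrite ge_min lexx.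
have e14 : e1 <= e / 4 by rewrite ge_min lexx orbT.
have : e1 ^+ 2 <= e1 by rewrite expr2 ler_piMl// ltW.
by lra.
Qed.

End slices.

(** * Assembly of the estimate *)

Lemma fall_weight_ge0 (R : realType) (tau delta t : R) : 0 < delta ->
  0 <= - (fall tau delta t * 'D_(1 : R) (fall tau delta) t).
Proof. by move=> d0; rewrite -mulrN mulr_ge0 ?fall_ge0// oppr_ge0; exact: dfall_le0. Qed.

Theorem theorem2p4 (R : realType) (n N : nat) (hn : (1 <= n)%N) (hN : (1 <= N)%N)
    (p q nu L : R) (hp : 2 <= p) (hpq : p < q) (hnu : 0 < nu) (hnuL : nu <= L) :
  exists c : R, 0 < c /\
  forall (alpha T : R) (Omega : set 'rV[R]_n)
         (a : 'rV[R]_n * R -> R)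
         (A : 'rV[R]_n * R -> 'M[R]_(N, n) -> 'M[R]_(N, n))
         (F : 'rV[R]_n * R -> 'M[R]_(N, n))
         (u : 'rV[R]_n * R -> 'rV[R]_N)
         (Du : 'rV[R]_n * R -> 'M[R]_(N, n)),
    0 < alpha <= 1 ->
    q <= p + 2 * alpha / (n%:R + 2) ->
    open Omega -> bounded_set Omega -> 0 < T ->
    holder_coefficient alpha Omega T a ->
    double_phase_field p q nu L Omega T a A ->
    double_phase_source p q Omega T a F ->
    weak_solution p q Omega T a A F u Du ->
  forall (x0 : 'rV[R]_n) (t0 R1 R2 S1 S2 : R),
    0 < R2 -> 0 < S2 ->
    cylinder x0 t0 R2 S2 `<=` st_domain Omega T ->
    R2 / 2 <= R1 < R2 ->
    S2 / 2 ^+ 2 <= S1 < S2 ->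
    let u1 := vmean (st_lebesgue n) (cylinder x0 t0 R1 S1) u in
    let u2 := vmean (st_lebesgue n) (cylinder x0 t0 R2 S2) u in
    let excess t := mean (rV_lebesgue n) (eball x0 R1)
          (fun x => enorm (u (x, t) - u1) ^+ 2 / S1) in
    let energy := mean (st_lebesgue n) (cylinder x0 t0 R1 S1)
          (fun z => Hfun p q a z (enorm (Du z))) in
    let bound := mean (st_lebesgue n) (cylinder x0 t0 R2 S2)
          (fun z => Hfun p q a z (enorm (u z - u2) / (R2 - R1))
                    + enorm (u z - u2) ^+ 2 / (S2 - S1)
                    + Hfun p q a z (enorm (F z))) in
    let I1 := `]t0 - S1, t0 + S1[%classic in
    (ereal_sup [set excess t | t in I1] + energy <= c%:E * bound)%E.
Proof.
(* Any m with q <= 2 (m+1) would serve; this one depends on q alone, so it may enter the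
   constant. *)
pose m := Num.bound q.
have L0 : 0 < L by lra.
pose C := @cacc_C R n N q nu L m.
have C0 : 0 <= C by apply: cacc_C_ge0 => //; exact: ltW.
(* The ratio of the volumes of the two balls. *)
pose cn : R := (2 * n.+1%:R) ^+ n.
have cn0 : 0 < cn by rewrite exprn_gt0// mulr_gt0.
(* The summand 8 C comes from the slices, 4 N from the difference of the two means, and C / nu from
   the energy. *)
pose K0 := 8 * C + 4 * N%:R + C / nu.
have N0 : 0 < N%:R :> R by rewrite ltr0n.
have K00 : 0 < K0.
  have : 0 <= C / nu by rewrite divr_ge0// ltW.
  by rewrite /K0; lra.
exists (K0 * (8 * cn)); split; first by rewrite !mulr_gt0.
move=> alpha T Omega a A F u Du ha hqa oO _ T0 Ha HA HF HU x0 t0 R1 R2 S1 S2 R20 S20 QD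
  /andP[R21 R12] /andP[S21 S12].
pose u1 := vmean (st_lebesgue n) (cylinder x0 t0 R1 S1) u.
pose u2 := vmean (st_lebesgue n) (cylinder x0 t0 R2 S2) u.
pose excess t := mean (rV_lebesgue n) (eball x0 R1)
  (fun x => enorm (u (x, t) - u1) ^+ 2 / S1).
pose energy := mean (st_lebesgue n) (cylinder x0 t0 R1 S1)
  (fun z => Hfun p q a z (enorm (Du z))).
pose bound := mean (st_lebesgue n) (cylinder x0 t0 R2 S2)
  (fun z => Hfun p q a z (enorm (u z - u2) / (R2 - R1)) +
    enorm (u z - u2) ^+ 2 / (S2 - S1) + Hfun p q a z (enorm (F z))).
pose I1 := `]t0 - S1, t0 + S1[%classic.
suff : (ereal_sup [set excess t | t in I1] + energy <= (K0 * (8 * cn))%:E * bound)%E by [].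
have hm : q <= (m.+1 + m.+1)%:R.
  have q0 : 0 <= q by lra.
  have := archi_boundP q0; rewrite -/m natrD -natr1 => h.
  have m0 : 0 <= m%:R :> R by []; lra.
have [al0 al1] := andP ha.
have n20 : 0 < n%:R + 2 :> R by rewrite ltr_wpDl.
have hpqa : (n%:R + 2) * (q - p) <= alpha * p.
  have : (n%:R + 2) * (q - p) <= (n%:R + 2) * (2 * alpha / (n%:R + 2)) by rewrite ler_pM2l//; lra.
  rewrite [leRHS]mulrC divfK ?gt_eqF// => h; apply: le_trans h _.
  by rewrite mulrC ler_pM2l.
have R10 : 0 < R1 by lra.
have S10 : 0 < S1 by apply: lt_le_trans S21; rewrite divr_gt0// exprn_gt0.
have S41 : S2 <= 4 * S1 by move: S21; rewrite ler_pdivrMr ?exprn_gt0// => h; lra.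
have [Z [mZ Z0 [mu' [mDu mF]] mA st]] := good_set oO HA HF HU QD.
pose Q1 := cylinder x0 t0 R1 S1; pose Q2 := cylinder x0 t0 R2 S2.
have Q12 : Q1 `<=` Q2.
  move=> z [z1]; rewrite /= in_itv/= => /andP[t1 t2]; split; first exact: lt_trans z1 _.
  by rewrite /= in_itv/=; apply/andP; split; lra.
have mQ1 : measurable Q1 by exact: measurable_cylinder.
have [b1 [b2 [b1E b2E b10 b20 b12]]] := eball_volumes x0 R20 R21 R12.
pose V1 := b1 * (2 * S1); pose V2 := b2 * (2 * S2).
have V10 : 0 < V1 by rewrite !mulr_gt0.
have V20 : 0 < V2 by rewrite !mulr_gt0.
have Q1E : st_lebesgue n Q1 = V1%:E := cylinder_volume t0 (ltW S10) b1E.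
have Q2E : st_lebesgue n Q2 = V2%:E := cylinder_volume t0 (ltW S20) b2E.
pose rhs z := Hfun p q a z (enorm (u z - u2) / (R2 - R1)) + enorm (u z - u2) ^+ 2 / (S2 - S1) +
  Hfun p q a z (enorm (F z)).
have R210 : 0 < R2 - R1 by lra.
have S210 : 0 < S2 - S1 by lra.
have H0 z s : Q2 z -> 0 <= Hfun p q a z s.
  by case: Ha => a0 _ _ Qz; rewrite addr_ge0 ?mulr_ge0 ?powR_ge0// a0//; exact: QD.
have sq k (X : 'rV[R]_k) : 0 <= enorm X ^+ 2 by rewrite exprn_ge0// enorm_ge0.
have sq1 z : 0 <= enorm (u z - u2) ^+ 2 / (S2 - S1) by rewrite divr_ge0// ltW.
have rhs0 z : Q2 z -> 0 <= rhs z by move=> Qz; apply: addr_ge0 (H0 _ _ Qz); exact: addr_ge0 (H0 _ _ Qz) (sq1 z).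
have W := weak_caccioppoli hp hpq hnu (ltW L0) ha oO Ha HF HU R20 S20 QD mZ Z0 mu' mDu mF mA st u2.
have boundE : bound = ((V2^-1)%:E * \int[st_lebesgue n]_(z in Q2) (rhs z)%:E)%E.
  by rewrite /bound /mean [X in fine X]Q2E.
have BB0 : (0 <= \int[st_lebesgue n]_(z in Q2) (rhs z)%:E)%E.
  by apply: integral_ge0 => z Qz; rewrite lee_fin; exact: rhs0.
rewrite boundE.
(* If the right-hand integral is infinite, the positive factors in front keep it so and nothing
   remains to be shown. *)
case BBE : (\int[st_lebesgue n]_(z in Q2) (rhs z)%:E)%E => [B| |]; last 2 first.
- rewrite gt0_muley ?lte_fin ?invr_gt0// gt0_muley ?leey// lte_fin.
  by rewrite !mulr_gt0.
- by move: BB0; rewrite BBE.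
have B0 : 0 <= B by rewrite -lee_fin -BBE.
have CB0 : 0 <= C * B by exact: mulr_ge0.
(* With tau = t0 + S1 and delta half of S2 - S1 the cut-off is 1 on the whole small cylinder. The
   slice term is nonnegative and dropped; dividing by nu / 2 gives the constant. *)
have EN : (\int[st_lebesgue n]_(z in Q1) (Hfun p q a z (enorm (Du z)))%:E <= (2 * C / nu * B)%:E)%E.
  have d0 : 0 < (S2 - S1) / 2 by rewrite divr_gt0.
  have := W R1 S1 (t0 + S1) ((S2 - S1) / 2) m hpqa R10 R12 S12 d0 _ _ hm.
  rewrite -/rhs -/Q2 BBE -EFinM -/C => /(_ _ _)W1.
  have c1 : t0 - S1 <= t0 + S1 by clear -S10; lra.
  have c2 : t0 + S1 + (S2 - S1) / 2 < t0 + S2 by clear -S12; lra.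
  have {}W1 := W1 c1 c2.
  pose ph := phase p q (coeff a x0 t0 R2 S2) (fun z => enorm (cut x0 t0 R2 S2 Z Du z)).
  have ph0 z : 0 <= ph z by apply: phase_ge0 => z'; exact: (coeff_ge0 Ha QD).
  have mph : measurable_fun setT ph.
    apply: measurable_phase; first exact: (measurable_coeff ha oO Ha QD).
    by apply: measurable_enorm => i j; exact: (measurable_cut mZ).
  have -> : (\int[st_lebesgue n]_(z in Q1) (Hfun p q a z (enorm (Du z)))%:E =
      \int[st_lebesgue n]_z (\1_Q1 z * ph z)%:E)%E.
    rewrite integral_mkcond; apply: (eq_integral_off_null mZ Z0) => z nZ.
    rewrite patchE indicE; case: ifPn => zQ; last by rewrite mul0r.
    rewrite mul1r /ph phase_cut//; split => //; apply: Q12; by rewrite inE in zQ.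
  have mI : measurable_fun setT (fun z => \1_Q1 z * ph z) by apply: measurable_funM.
  have I0 z : 0 <= \1_Q1 z * ph z by rewrite mulr_ge0// indicE.
  have nu20 : 0 < nu / 2 by rewrite divr_gt0.
  have first0 (z : 'rV[R]_n * measurableTypeR R) :
      0 <= enorm (cut x0 t0 R2 S2 Z (fun z => u z - u2) z) ^+ 2 * (cut_space x0 R1 R2 z.1 ^+ (m.+1 + m.+1) *
        (- (fall (t0 + S1) ((S2 - S1) / 2) z.2 * 'D_(1 : R) (fall (t0 + S1) ((S2 - S1) / 2)) z.2))).
    apply: mulr_ge0 (sq _ _) (mulr_ge0 (exprn_ge0 _ (cut_space_ge0 _ _ _ _)) _).
    exact: fall_weight_ge0.
  have : ((nu / 2)%:E * \int[st_lebesgue n]_z (\1_Q1 z * ph z)%:E <= (C * B)%:E)%E.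
    apply: le_trans W1; rewrite -ge0_integralZlR ?(ltW nu20)//.
    apply: (@ge0_le_integral_off_null _ _ R (st_lebesgue n) set0 _ _ measurable0 (measure0 _)) => z.
    - by rewrite lee_fin mulr_ge0// ltW.
    - rewrite lee_fin; apply: addr_ge0 (first0 z) _.
      by apply: mulr_ge0 (ltW nu20) (mulr_ge0 (sqr_ge0 _) (ph0 z)).
    move=> _; rewrite lee_fin; apply: ler_wpDl (first0 z) _.
    rewrite ler_wpM2l ?(ltW nu20)//; have [Qz|nQ] := pselect (Q1 z); last first.
      by rewrite indicE memNset// mul0r mulr_ge0// sqr_ge0.
    rewrite indicE mem_set// mul1r; case: Qz => z1; rewrite /= in_itv/= => /andP[t1 t2].
    have -> : cutoff x0 t0 R1 R2 S1 S2 (t0 + S1) ((S2 - S1) / 2) m z = 1.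
      by rewrite /cutoff cut_space1// rise1 ?fall1 ?expr1n ?mul1r//; exact: ltW.
    by rewrite expr1n mul1r.
  rewrite muleC -lee_pdivlMr// => h; apply: le_trans h _.
  by rewrite -EFinM lee_fin invf_div le_eqVlt; apply/orP; left; apply/eqP; ring.
have x0B r : 0 < r -> eball x0 r x0 by move=> r0; rewrite /eball /= subrr enorm0.
have inT t : t0 - S2 < t -> t < t0 + S2 -> t \in `]0, T[.
  move=> h1 h2; have /QD[] // : Q2 (x0, t).
  by split; [exact: x0B|rewrite /= in_itv/= h1 h2].
have B1O : eball x0 R1 `<=` Omega.
  move=> x xB; have /QD[] // : Q2 (x, t0).
  by split; [exact: lt_trans xB R12|rewrite /= in_itv/=; apply/andP; split; clear -S20; lra].
have mB1 : measurable (eball x0 R1) by exact: eball_measurable.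
have cL : C_L2_fun Omega T u by case: HU.
have [Zt [mZt Zt0 HZt]] := ae_null_ysection mZ Z0.
(* One factor 2 is due to the mass 1/2 of the weight, the other to the transfer from nearby times to
   tau. *)
have slice tau : t0 - S1 < tau -> tau < t0 + S1 ->
  (\int[rV_lebesgue n]_(x in eball x0 R1) (enorm (u (x, tau) - u2) ^+ 2)%:E <= (2 * (2 * (C * B)))%:E)%E.
  move=> tau1 tau2; apply: (slice_limit oO mB1 B1O cL); [|by rewrite mulr_ge0|].
    by apply: inT; [clear -tau1 S12|clear -tau2 S12]; lra.
  (* Besides delta, the width of the falling edge is limited so that the cut-off ends before t0 +
     S2. *)
  move=> delta eps d0 e0; pose d := Num.min delta ((t0 + S2 - tau) / 2).
  have d'0 : 0 < d by rewrite lt_min d0 divr_gt0//; clear -tau2 S12; lra.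
  have dl : d <= delta by rewrite ge_min lexx.
  have dr : d <= (t0 + S2 - tau) / 2 by rewrite ge_min lexx orbT.
  have := W R1 S1 tau d m hpqa R10 R12 S12 d'0 (ltW tau1) _ hm.
  rewrite -/rhs -/Q2 BBE -EFinM -/C => /(_ _) W1.
  have c1 : tau + d < t0 + S2 by clear -dr tau2 S12; lra.
  have {}W1 := W1 c1.
  pose w z : R := enorm (cut x0 t0 R2 S2 Z (fun z => u z - u2) z) ^+ 2 * cut_space x0 R1 R2 z.1 ^+ (m.+1 + m.+1).
  have w0 z : 0 <= w z by rewrite mulr_ge0// exprn_ge0// cut_space_ge0.
  have mw : measurable_fun setT w.
    apply: measurable_funM.
      apply: measurable_funX; apply: measurable_enorm => i j; rewrite (ord1 i).
      apply: (measurable_cut mZ).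
      rewrite (_ : (fun z => _) = fun z => u z ord0 j - u2 ord0 j); first exact: measurable_funB.
      by apply/funext => z; rewrite !mxE.
    apply: measurable_funX.
    exact: (measurableT_comp (continuous_measurable_rV (smooth_continuous (smooth_cut_space x0 R1 R2))) measurable_fst).
  have ph0 z : 0 <= phase p q (coeff a x0 t0 R2 S2) (fun z => enorm (cut x0 t0 R2 S2 Z Du z)) z.
    by apply: phase_ge0 => z'; exact: (coeff_ge0 Ha QD).
  have second0 (z : 'rV[R]_n * measurableTypeR R) : 0 <= nu / 2 * (cutoff x0 t0 R1 R2 S1 S2 tau d m z ^+ 2 *
      phase p q (coeff a x0 t0 R2 S2) (fun z => enorm (cut x0 t0 R2 S2 Z Du z)) z).
    by apply: mulr_ge0; [rewrite divr_ge0// ltW|exact: mulr_ge0 (sqr_ge0 _) (ph0 z)].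
  have first0 (z : 'rV[R]_n * measurableTypeR R) :
      0 <= w z * (- (fall tau d z.2 * 'D_(1 : R) (fall tau d) z.2)).
    by apply: mulr_ge0 (w0 z) _; exact: fall_weight_ge0.
  have HW : (\int[st_lebesgue n]_z (w z * (- (fall tau d z.2 * 'D_(1%R : R) (fall tau d) z.2)))%:E <= (C * B)%:E)%E.
    apply: le_trans W1.
    apply: (@ge0_le_integral_off_null _ _ R (st_lebesgue n) set0 _ _ measurable0 (measure0 _)) => z.
    - by rewrite lee_fin; exact: first0.
    - by rewrite lee_fin; apply: addr_ge0 _ (second0 z); rewrite mulrA; exact: first0.
    by move=> _; rewrite lee_fin [X in _ <= X + _]mulrA lerDl; exact: second0.
  have [t [t1 t2 nt Ht]] := exists_slice mw w0 d'0 e0 mZt Zt0 HW.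
  have tl : t0 - S2 < t by clear -t1 tau1 S12; lra.
  have tr : t < t0 + S2 by clear -t2 dr tau2 S12; lra.
  exists t; split; [exact: t1|by clear -t2 dl; lra|exact: inT|].
  apply: le_trans Ht; rewrite integral_mkcond.
  have zt : rV_lebesgue n (ysection Z t) = 0%E by apply: contrapT => h; apply: nt; exact: HZt.
  apply: (ge0_le_integral_off_null (measurable_ysection t mZ) zt) => x.
  - by rewrite patchE; case: ifP => // _; rewrite lee_fin.
  - by rewrite lee_fin.
  move=> nx; rewrite patchE; case: ifPn; rewrite ?inE ?lee_fin// => xB.
  have Gx : (Q2 `\` Z) (x, t).
    split; last by move=> h; apply: nx; rewrite /ysection /= inE.
    by split; [exact: lt_trans xB R12|rewrite /= in_itv/= tl tr].
  by rewrite /w cutE// cut_space1// expr1n mulr1.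
(* By the second term of the right-hand side, (u - u2)^2 integrates over the small cylinder to at
   most (S2 - S1) B <= 4 S1 B. Jensen's inequality and the volume 2 S1 b1 give 2 B / b1 for each of
   the N components. *)
have means : enorm (u2 - u1) ^+ 2 <= 2 * N%:R * B / b1.
  have mG1 : measurable (Q1 `\` Z) by exact: measurableD.
  have G1E : st_lebesgue n (Q1 `\` Z) = V1%:E.
    rewrite -Q1E -[X in _ = _ X](setUIDK Q1 Z) setUC measureU0//; first exact: measurableI.
    by apply: measure_negligible; [exact: measurableI|exists Z; split => // z []].
  have ui i : measurable_fun (Q1 `\` Z) (fun z => u z ord0 i).
    by apply: measurable_funS (mu' i); [exact: measurableD (measurable_cylinder _ _ _ _) mZ|move=> z [/Q12 ? ?]].
  have J i : (\int[st_lebesgue n]_(z in Q1 `\` Z) ((u z ord0 i - u2 ord0 i) ^+ 2)%:E <= (4 * S1 * B)%:E)%E.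
    have mg : measurable_fun (Q1 `\` Z) (fun z => (u z ord0 i - u2 ord0 i) ^+ 2).
      by apply: measurable_funX; exact: measurable_funB.
    have : (((S2 - S1)^-1)%:E * \int[st_lebesgue n]_(z in Q1 `\` Z) ((u z ord0 i - u2 ord0 i) ^+ 2)%:E <= B%:E)%E.
      rewrite -ge0_integralZlR ?invr_ge0 ?(ltW S210)//; last by move=> z _; exact: sqr_ge0.
      rewrite -BBE integral_mkcond [leRHS]integral_mkcond.
      apply: (@ge0_le_integral_off_null _ _ R (st_lebesgue n) set0 _ _ measurable0 (measure0 _)) => z.
      - by rewrite patchE; case: ifP => // _; rewrite lee_fin mulr_ge0 ?sqr_ge0// invr_ge0 ltW.
      - by rewrite patchE; case: ifPn => //; rewrite inE => Qz; rewrite lee_fin; exact: rhs0.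
      move=> _; rewrite !patchE; case: ifPn => [|_]; last first.
        by case: ifPn => //; rewrite inE => Qz; rewrite lee_fin; exact: rhs0.
      rewrite inE => -[/Q12 Qz _]; rewrite mem_set// lee_fin.
      apply: (@le_trans _ _ (enorm (u z - u2) ^+ 2 / (S2 - S1))).
        rewrite mulrC ler_wpM2r ?invr_ge0 ?(ltW S210)// enorm_sqr.
        by have := coord_sqr_le (u z - u2) ord0 i; rewrite !mxE.
      by rewrite /rhs; have h1 := H0 z (enorm (u z - u2) / (R2 - R1)) Qz; have h2 := H0 z (enorm (F z)) Qz; clear -h1 h2; lra.
    rewrite muleC -lee_pdivlMr ?invr_gt0// => h; apply: le_trans h _.
    rewrite -EFinM lee_fin invrK mulrC ler_wpM2r//; clear -S41 S10; lra.
  have coord i : (u2 - u1) ord0 i ^+ 2 <= 2 * B / b1.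
    have fin : (\int[st_lebesgue n]_(z in Q1 `\` Z) ((u z ord0 i - u2 ord0 i) ^+ 2)%:E < +oo)%E.
      by apply: le_lt_trans (J i) _; rewrite ltry.
    have := le_trans (mean_sqr_dist_le mG1 V10 G1E (ui i) fin) (J i).
    have -> : V1^-1 * (\int[st_lebesgue n]_(z in Q1 `\` Z) u z ord0 i) = u1 ord0 i.
      rewrite /u1 mxE [X in fine X]Q1E; congr (_ * _); rewrite /Rintegral; congr fine.
      by rewrite -integral_off_null.
    have -> : (u2 - u1) ord0 i ^+ 2 = (u1 ord0 i - u2 ord0 i) ^+ 2.
      by rewrite mxE [X in _ + X]mxE; ring.
    rewrite lee_fin => h; rewrite ler_pdivlMr//.
    have S20' : 0 < 2 * S1 by rewrite mulr_gt0.
    rewrite -(ler_pM2l S20'); apply: le_trans (_ : V1 * (u1 ord0 i - u2 ord0 i) ^+ 2 <= _).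
      by rewrite /V1 le_eqVlt; apply/orP; left; apply/eqP; ring.
    by apply: le_trans h _; rewrite le_eqVlt; apply/orP; left; apply/eqP; ring.
  rewrite enorm_sqr edot_rV; apply: (@le_trans _ _ (\sum_(i < N) (2 * B / b1))); first exact: ler_sum.
  by rewrite sumr_const card_ord -[leLHS]mulr_natl le_eqVlt; apply/orP; left; apply/eqP; ring.
(* The distance to [u1] is split at [u2]: twice the slice bound 4 C B plus twice the bound 2 N B for
   the constant difference of the means. *)
have EX tau : t0 - S1 < tau -> tau < t0 + S1 ->
    (excess tau <= ((S1 * b1)^-1 * ((8 * C + 4 * N%:R) * B))%:E)%E.
  move=> tau1 tau2; have mO : measurable Omega by exact: open_measurable_rV.
  have tauT : tau \in `]0, T[ by apply: inT; [clear -tau1 S12|clear -tau2 S12]; lra.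
  have [mtau _ _] := cL _ tauT.
  have [A1 [mA1 A10 HA1]] := lebesgue_measurable_off_null mO mtau.
  have mBA : measurable (eball x0 R1 `\` A1) by exact: measurableD.
  have BA : eball x0 R1 `\` A1 `<=` Omega `\` A1 by move=> x [/B1O ? ?].
  have mui i : measurable_fun (eball x0 R1 `\` A1) (fun x => u (x, tau) ord0 i).
    exact: (HA1 _ ord0 i mBA BA).
  have X1 := @integral_sqr_dist_le R _ _ (rV_lebesgue n) N (eball x0 R1) A1 (fun x => u (x, tau)) (fun _ => u2)
    (fun _ => u1) mB1 mA1 A10 mui (fun i => measurable_cst _) (fun i => measurable_cst _).
  have X2 : (\int[rV_lebesgue n]_(x in eball x0 R1) (enorm (u2 - u1) ^+ 2)%:E <= (2 * N%:R * B)%:E)%E.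
    rewrite integral_cst// [X in (_ * X)%E]b1E -EFinM lee_fin.
    apply: le_trans (ler_wpM2r (ltW b10) means) _.
    by rewrite divfK ?gt_eqF.
  have X3 := slice _ tau1 tau2.
  have X4 : (\int[rV_lebesgue n]_(x in eball x0 R1) (enorm (u (x, tau) - u1) ^+ 2)%:E <=
      ((8 * C + 4 * N%:R) * B)%:E)%E.
    apply: (le_trans X1); apply: (@le_trans _ _ (2%:E * ((2 * (2 * (C * B)))%:E + (2 * N%:R * B)%:E))%E).
      by rewrite lee_pmul2l//; exact: leeD.
    by rewrite -EFinD -EFinM lee_fin le_eqVlt; apply/orP; left; apply/eqP; ring.
  have X5 : (\int[rV_lebesgue n]_(x in eball x0 R1) (enorm (u (x, tau) - u1) ^+ 2 / S1)%:E =
      (S1^-1)%:E * \int[rV_lebesgue n]_(x in eball x0 R1) (enorm (u (x, tau) - u1) ^+ 2)%:E)%E.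
    rewrite !(@integral_off_null _ _ _ (rV_lebesgue n) (eball x0 R1) A1)// -ge0_integralZlR//.
    - by apply: eq_integral => x _; rewrite mulrC.
    - exact: measurable_sqr_dist.
    - by rewrite invr_ge0 ltW.
  rewrite /excess /mean X5 [X in fine X]b1E muleA -EFinM.
  apply: (@le_trans _ _ ((b1^-1 * S1^-1)%:E * ((8 * C + 4 * N%:R) * B)%:E)%E).
    by rewrite lee_pmul2l// ?lte_fin mulr_gt0 ?invr_gt0.
  by rewrite -EFinM lee_fin invfM mulrC [_^-1 * _]mulrC mulrC.
have EN' : (energy <= ((S1 * b1)^-1 * (C / nu * B))%:E)%E.
  rewrite /energy /mean [X in fine X]Q1E.
  apply: (@le_trans _ _ ((V1^-1)%:E * (2 * C / nu * B)%:E)%E).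
    by rewrite lee_pmul2l// lte_fin invr_gt0.
  rewrite -EFinM lee_fin le_eqVlt; apply/orP; left; apply/eqP; rewrite /V1.
  by field; rewrite !gt_eqF.
apply: (@le_trans _ _ (((S1 * b1)^-1 * ((8 * C + 4 * N%:R) * B))%:E + ((S1 * b1)^-1 * (C / nu * B))%:E)%E).
  apply: leeD => //; apply: ge_ereal_sup => _ [t It <-].
  by move: It; rewrite /I1 /= in_itv/= => /andP[t1 t2]; exact: EX.
have Sb : 0 < S1 * b1 by rewrite mulr_gt0.
(* Here the restrictions on both radii and times meet: b2 <= cn b1 and S2 <= 4 S1 give V2 = 2 b2 S2
   <= 8 cn S1 b1. *)
have key : (S1 * b1)^-1 <= 8 * cn / V2.
  rewrite ler_pdivlMr// mulrC ler_pdivrMr// /V2.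
  have h1 := ler_pM (ltW b20) (ltW S20) b12 S41.
  have -> : b2 * (2 * S2) = 2 * (b2 * S2) by ring.
  have -> : 8 * cn * (S1 * b1) = 2 * (cn * b1 * (4 * S1)) by ring.
  by rewrite ler_wpM2l.
have KB : 0 <= K0 * B by rewrite mulr_ge0// ltW.
rewrite -EFinD -!EFinM lee_fin.
have -> : (S1 * b1)^-1 * ((8 * C + 4 * N%:R) * B) + (S1 * b1)^-1 * (C / nu * B) = (S1 * b1)^-1 * (K0 * B).
  by rewrite /K0; ring.
have -> : K0 * (8 * cn) * (V2^-1 * B) = 8 * cn / V2 * (K0 * B) by ring.
exact: ler_wpM2r KB _ _ key.
Qed.
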